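(* Let $(A,B)$ be a Weyl pair of dimension $d$ on a UMD Banach lattice $X$ with a bounded Weyl calculus of type $0$. Then $L:=\frac12(A^2+B^2)-\frac12 d$ has a bounded $H^\infty(\Sigma_\theta)$-calculus for all $\theta\in(0,\pi)$.
   Context: Weyl pair: a pair $(A,B)$ of $d$-tuples $A=(A_1,\dots,A_d)$, $B=(B_1,\dots,B_d)$ of closed densely defined operators on a complex Banach space $X$ such that each $iA_j$ and $iB_j$ generates a uniformly bounded $C_0$-group, denoted $(e^{itA_j})_{t\in\mathbb{R}}$, $(e^{itB_j})_{t\in\mathbb{R}}$, and for all $s,t\in\mathbb{R}$, $1\le j,k\le d$: $e^{isA_j}e^{itA_k}=e^{itA_k}e^{isA_j}$, $e^{isB_j}e^{itB_k}=e^{itB_k}e^{isB_j}$, $e^{isA_j}e^{itB_k}=e^{-ist\delta_{jk}}e^{itB_k}e^{isA_j}$. For $u,v\in\mathbb{R}^d$: $uv=\sum_j u_jv_j$, $e^{i(uA+vB)}:=e^{\frac12 iuv}\prod_j e^{iu_jA_j}\prod_j e^{iv_jB_j}$. Weyl calculus: for $a\in\mathscr{S}(\mathbb{R}^{2d})$, $a(A,B)f=\frac{1}{(2\pi)^d}\int_{\mathbb{R}^{2d}}\widehat a(u,v)e^{i(uA+vB)}f\,du\,dv$ for $f\in X$, where $\widehat a(u,v)=\frac1{(2\pi)^d}\int_{\mathbb{R}^{2d}}a(x,\xi)e^{-i(xu+\xi v)}\,dx\,d\xi$. Bounded Weyl calculus of type $0$: there exist $m\in\mathbb{N}$ and a constant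 $C$ such that for all $a\in\mathscr{S}(\mathbb{R}^{2d})$, $\|a(A,B)\|\le C\max_{|\alpha|,|\beta|\le m}\sup_{(x,\xi)\in\mathbb{R}^{2d}}\langle\xi\rangle^{|\alpha|}|\partial_\xi^\alpha\partial_x^\beta a(x,\xi)|$, where $\langle\xi\rangle=(1+|\xi|^2)^{1/2}$. $A^2=\sum_jA_j^2$ on $\mathsf{D}(A^2)=\bigcap_j\mathsf{D}(A_j^2)$ and $B^2=\sum_jB_j^2$ on $\mathsf{D}(B^2)=\bigcap_j\mathsf{D}(B_j^2)$. The operator $\frac12(A^2+B^2)-\frac12 d$ with domain $\mathsf{D}(A^2)\cap\mathsf{D}(B^2)$ is closable; $L$ denotes its closure, and $-L$ generates a $C_0$-semigroup that extends to an analytic semigroup of angle $\frac12\pi$, bounded on smaller sectors. For $\theta\in(0,\pi)$ let $\Sigma_\theta=\{z\in\mathbb{C}\setminus\{0\}:|\arg z|<\theta\}$. A closed operator $L$ is $\sigma$-sectorial if its spectrum lies in $\overline{\Sigma_\sigma}$ and $\sup_{z\notin\overline{\Sigma_\sigma}}\|z(z-L)^{-1}\|<\infty$; $\omega(L)$ is the infimum of such $\sigma\in(0,\pi)$. $H^\infty(\Sigma_\theta)$ is the space of bounded holomorphic functions on $\Sigma_\theta$ with the supremum norm; $H^1(\Sigma_\theta)$ is the space of holomorphic $\phi$ on $\Sigma_\theta$ with $\sup_{0<\nu<\theta}\frac1{2\pi}\int_{\partial\Sigma_\nu}|\phi(z)|\frac{|dz|}{|z|}<\infty$. For $\phi\in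 H^1(\Sigma_\theta)$ with $\theta>\omega(L)$, $\phi(L):=\frac1{2\pi i}\int_{\partial\Sigma_\nu}\phi(z)(z-L)^{-1}\,dz$ with $\omega(L)<\nu<\theta$, $\partial\Sigma_\nu$ downwards oriented. $L$ has a bounded $H^\infty(\Sigma_\theta)$-calculus ($\omega(L)<\theta<\pi$) if there is $K$ with $\|\phi(L)\|\le K\|\phi\|_{H^\infty(\Sigma_\theta)}$ for all $\phi\in H^1(\Sigma_\theta)\cap H^\infty(\Sigma_\theta)$. UMD Banach lattice: a (complex) Banach lattice that is a UMD space. *)

(* Defs.v *)
From HB Require Import structures.
From mathcomp Require Import all_boot all_order all_algebra complex.
From mathcomp Require Import all_classical all_reals all_analysis.
Set Implicit Arguments.
Unset Strict Implicit.
Unset Printing Implicit Defensive.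
Import Order.TTheory GRing.Theory Num.Theory.
Import numFieldNormedType.Exports.
Local Open Scope classical_set_scope.
Local Open Scope ring_scope.
Local Open Scope complex_scope.

(* The scalar field is R[i]; a complex Banach space is a
   [completeNormedModType R[i]], whose norm `|x| is a nonnegative real element
   of R[i].  [nrm] is the same norm with values in R; on R[i] it is the
   modulus.  R[i]^o is R[i] with its norm topology. *)
Definition nrm (R : realType) (V : normedZmodType R[i]) (x : V) : R := complex.Re `|x|.

(* e^{it} *)
Definition expi (R : realType) (t : R) : R[i] := cos t +i* sin t.

Section LebesgueTuple.
Variable R : realType.

Definition tcons n (p : n.-tuple R * R) : n.+1.-tuple R :=
  [tuple of p.2 :: p.1].

Lemma measurable_tcons n : measurable_fun [set: n.-tuple R * R] (@tcons n).
Proof. exact: measurable_cons. Qed.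

Section Step.
Variables (n : nat) (m : {measure set (n.-tuple R) -> \bar R}).

Definition lebesgue_step : set (n.+1.-tuple R) -> \bar R :=
  pushforward (m \x (@lebesgue_measure R))%E (@tcons n).

Let step0 : lebesgue_step set0 = 0%E.
Proof. by apply: measure0; exact: measurable_tcons. Qed.

Let step_ge0 A : (0 <= lebesgue_step A)%E.
Proof. by apply: measure_ge0; exact: measurable_tcons. Qed.

Let step_sigma_additive : semi_sigma_additive lebesgue_step.
Proof. by apply: measure_semi_sigma_additive; exact: measurable_tcons. Qed.

HB.instance Definition _ :=
  isMeasure.Build _ _ _ lebesgue_step step0 step_ge0 step_sigma_additive.

End Step.

(* Lebesgue measure on R^n, as the n-fold product measure on the Borel sets of
   n.-tuple R (only the second factor of a binary product has to be
   sigma-finite, hence the order of the factors in [lebesgue_step]). *)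
Fixpoint lebesgue_tuple n : {measure set (n.-tuple R) -> \bar R} :=
  match n with
  | 0 => \d_([tuple])
  | m.+1 => lebesgue_step (lebesgue_tuple m)
  end.

Definition vec n (t : n.-tuple R) : 'rV[R]_n := \row_i tnth t i.

End LebesgueTuple.

Section Bochner.
Context (R : realType) (X : completeNormedModType R[i]).
Context (disp : measure_display) (T : measurableType disp).
Variable mu : {measure set T -> \bar R}.

(* mu-simple functions that are measurable with respect to G, a
   sub-sigma-algebra of [measurable] *)
Definition simple (G : set (set T)) (s : T -> X) :=
  finite_set (range s) /\
  forall x, x != 0 ->
    G (s @^-1` [set x]) /\ (mu (s @^-1` [set x]) < +oo)%E.

Definition simple_integral (s : T -> X) : X :=
  \sum_(x \in range s) (fine (mu (s @^-1` [set x])))%:C *: x.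

Definition strongly_measurable (G : set (set T)) (f : T -> X) :=
  exists s : nat -> T -> X, (forall n, simple G (s n)) /\
    {ae mu, forall t, s n t @[n --> \oo] --> f t}.

Definition is_bochner_integral (f : T -> X) (y : X) :=
  strongly_measurable measurable f /\
  exists s : nat -> T -> X, (forall n, simple measurable (s n)) /\
    (\int[mu]_t (nrm (f t - s n t))%:E)%E @[n --> \oo] --> 0%E /\
    simple_integral (s n) @[n --> \oo] --> y.

(* [patch (fun=> 0) D f] rather than [f \_ D], which extends f by [point]. *)
Definition bochner_integrable (D : set T) (f : T -> X) :=
  exists y, is_bochner_integral (patch (fun=> 0) D f) y.

Definition bochner (D : set T) (f : T -> X) : X :=
  xget 0 [set y | is_bochner_integral (patch (fun=> 0) D f) y].

Definition LpNorm (p : R) (f : T -> X) : \bar R :=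
  Lnorm mu p%:E (fun t => (nrm (f t))%:E).

End Bochner.

Section UMD.
Context (R : realType) (X : completeNormedModType R[i]).

(* E[f (n+1) | F n] = f n is expressed by equality of the integrals over the
   members of F n. *)
Definition Lp_martingale (disp : measure_display) (T : measurableType disp)
    (P : probability T R) (p : R) (F : nat -> set (set T))
    (f : nat -> T -> X) :=
  (forall n, sigma_algebra setT (F n) /\ F n `<=` measurable /\
             F n `<=` F n.+1) /\
  (forall n, strongly_measurable P (F n) (f n) /\
             (LpNorm P p (f n) < +oo)%E) /\
  (forall n E, F n E -> bochner P E (f n.+1) = bochner P E (f n)).

Definition UMD :=
  forall p : R, 1 < p ->
  exists beta : R, 0 <= beta /\
    forall (disp : measure_display) (T : measurableType disp)
      (P : probability T R) (F : nat -> set (set T)) (f : nat -> T -> X),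
    Lp_martingale P p F f ->
    forall (N : nat) (eps : nat -> R[i]), (forall n, nrm (eps n) = 1) ->
    (LpNorm P p (fun t => (\sum_(n < N) eps n *: (f n.+1 t - f n t))%R) <=
     beta%:E * LpNorm P p (fun t => (\sum_(n < N) (f n.+1 t - f n t))%R))%E.

End UMD.

Section ComplexBanachLattice.
Context (R : realType) (X : completeNormedModType R[i]).

Section Cone.
Variable P : set X.

(* the real part of X and its order, when P is the positive cone *)
Definition real_part : set X :=
  [set x | exists y z, P y /\ P z /\ x = y - z].
Definition cone_le (x y : X) := P (y - x).
Definition cone_lub (S : set X) (m : X) :=
  (forall x, S x -> cone_le x m) /\
  (forall b, (forall x, S x -> cone_le x b) -> cone_le m b).

(* X is the complexification of the real Banach lattice [real_part]: the
   modulus of z = x + iy is the supremum over t of (cos t) x + (sin t) y, and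
   z has the norm of its modulus. *)
Record lattice_cone : Prop := {
  cone0 : P 0;
  coneD : forall x y, P x -> P y -> P (x + y);
  coneZ : forall (r : R) x, 0 <= r -> P x -> P (r%:C *: x);
  cone_proper : forall x, P x -> P (- x) -> x = 0;
  cone_complexification : forall z, exists x y,
    real_part x /\ real_part y /\ z = x + (0 +i* 1) *: y;
  cone_totally_real : forall x,
    real_part x -> real_part ((0 +i* 1) *: x) -> x = 0;
  cone_lattice : forall x y, real_part x -> real_part y ->
    exists m, cone_lub [set x; y] m;
  cone_modulus : forall x y, real_part x -> real_part y ->
    exists m,
      cone_lub (range (fun t : R => (cos t)%:C *: x + (sin t)%:C *: y)) m /\
      nrm m = nrm (x + (0 +i* 1) *: y);
  cone_norm : forall x y, P x -> cone_le x y -> nrm x <= nrm y }.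

End Cone.

Definition complex_Banach_lattice := exists P : set X, lattice_cone P.

End ComplexBanachLattice.

(* An operator in X is identified with its graph. *)
Section Operators.
Context (R : realType) (X : completeNormedModType R[i]).

Definition is_operator (A : set (X * X)) :=
  A (0, 0) /\
  (forall (c : R[i]) f g f' g', A (f, g) -> A (f', g') ->
     A (c *: f + f', c *: g + g')) /\
  (forall g, A (0, g) -> g = 0).

Definition dom (A : set (X * X)) : set X := [set f | exists g, A (f, g)].

Definition closed_densely_defined (A : set (X * X)) :=
  is_operator A /\ closed A /\ closure (dom A) = setT.

Definition bounded_C0_group (U : R -> {linear X -> X}) :=
  (forall f, U 0 f = f) /\
  (forall s t f, U (s + t) f = U s (U t f)) /\
  (forall f, continuous (fun t => U t f : X)) /\
  (exists M : R, forall t f, nrm (U t f) <= M * nrm f).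

Definition generator (U : R -> {linear X -> X}) : set (X * X) :=
  [set fg | (t^-1)%:C *: (U t fg.1 - fg.1) @[t --> (0 : R)^'] --> fg.2].

(* the operator iA *)
Definition imul (A : set (X * X)) : set (X * X) :=
  [set fg | exists g, A (fg.1, g) /\ fg.2 = (0 +i* 1) *: g].

(* U j t = e^{itA_j} and V j t = e^{itB_j}; the groups are determined by their
   generators. *)
Record weyl_pair (d : nat) (A B : 'I_d -> set (X * X))
    (U V : 'I_d -> R -> {linear X -> X}) : Prop := {
  weyl_A : forall j, closed_densely_defined (A j);
  weyl_B : forall j, closed_densely_defined (B j);
  weyl_U : forall j, bounded_C0_group (U j);
  weyl_V : forall j, bounded_C0_group (V j);
  weyl_UA : forall j, generator (U j) = imul (A j);
  weyl_VB : forall j, generator (V j) = imul (B j);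
  weyl_UU : forall j k s t f, U j s (U k t f) = U k t (U j s f);
  weyl_VV : forall j k s t f, V j s (V k t f) = V k t (V j s f);
  weyl_UV : forall j k s t f,
    U j s (V k t f) = expi (- (s * t * (j == k)%:R)) *: V k t (U j s f) }.

Definition square (A : set (X * X)) : set (X * X) :=
  [set fh | exists g, A (fh.1, g) /\ A (g, fh.2)].

Definition sum_squares (d : nat) (A : 'I_d -> set (X * X)) : set (X * X) :=
  [set fh | exists h : 'I_d -> X,
     (forall j, square (A j) (fh.1, h j)) /\ fh.2 = \sum_j h j].

(* (A^2 + B^2)/2 - d/2 on D(A^2) `&` D(B^2) *)
Definition oscillator0 (d : nat) (A B : 'I_d -> set (X * X)) : set (X * X) :=
  [set fg | exists h k,
     sum_squares A (fg.1, h) /\ sum_squares B (fg.1, k) /\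
     fg.2 = 2^-1 *: (h + k) - (2^-1 * d%:R) *: fg.1].

(* The graph of the closure of an operator is the closure of its graph. *)
Definition oscillator (d : nat) (A B : 'I_d -> set (X * X)) : set (X * X) :=
  closure (oscillator0 A B).

End Operators.

Section WeylCalculus.
Context (R : realType).

Definition dot n (x y : 'rV[R]_n) : R := \sum_j x ord0 j * y ord0 j.

Definition partial n (i : 'I_n) (f : 'rV[R]_n -> R[i]) (x : 'rV[R]_n) : R[i] :=
  ('D_(delta_mx ord0 i) (fun y : 'rV[R]_n => complex.Re (f y)) x) +i*
  ('D_(delta_mx ord0 i) (fun y : 'rV[R]_n => complex.Im (f y)) x).

(* the product over j < k of the (alpha j)-th powers of the partial
   derivatives in the coordinates [e j] *)
Definition multi_partial n k (e : 'I_k -> 'I_n) (alpha : 'I_k -> nat)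
    (f : 'rV[R]_n -> R[i]) : 'rV[R]_n -> R[i] :=
  foldr (fun j => iter (alpha j) (partial (e j))) f (enum 'I_k).

(* C^oo: every iterated partial derivative is differentiable *)
Definition smooth n (f : 'rV[R]_n -> R[i]) :=
  forall (s : seq 'I_n) (x : 'rV[R]_n),
    let g := foldr (@partial n) f s in
    differentiable (fun y : 'rV[R]_n => complex.Re (g y)) x /\
    differentiable (fun y : 'rV[R]_n => complex.Im (g y)) x.

Definition schwartz n (f : 'rV[R]_n -> R[i]) :=
  smooth f /\
  forall alpha beta : 'I_n -> nat, exists M : R, forall x : 'rV[R]_n,
    `|\prod_i x ord0 i ^+ alpha i| * nrm (multi_partial id beta f x) <= M.

Definition complex_integral disp (T : measurableType disp)
    (mu : {measure set T -> \bar R}) (f : T -> R[i]) : R[i] :=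
  (\int[mu]_t complex.Re (f t)) +i* (\int[mu]_t complex.Im (f t)).

(* A point of R^2d is row_mx x xi, so that the exponent of the Fourier
   transform at row_mx u v is -i(xu + xi v). *)
Definition fourier d (a : 'rV[R]_(d + d) -> R[i]) (w : 'rV[R]_(d + d)) : R[i] :=
  (((2 * pi) ^+ d)^-1)%:C *
  complex_integral (lebesgue_tuple R (d + d))
    (fun t => a (vec t) * expi (- dot (vec t) w)).

Section Calculus.
Context (X : completeNormedModType R[i]) (d : nat).
Variables U V : 'I_d -> R -> {linear X -> X}.

(* e^{i(uA+vB)} *)
Definition weyl_exp (u v : 'rV[R]_d) (f : X) : X :=
  expi (2^-1 * dot u v) *:
  (\big[@comp X X X/id]_(j < d) (U j (u ord0 j) : X -> X))
    ((\big[@comp X X X/id]_(j < d) (V j (v ord0 j) : X -> X)) f).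

Definition weyl_calculus (a : 'rV[R]_(d + d) -> R[i]) (f : X) : X :=
  (((2 * pi) ^+ d)^-1)%:C *:
  bochner (lebesgue_tuple R (d + d)) setT
    (fun t => fourier a (vec t) *:
              weyl_exp (lsubmx (vec t)) (rsubmx (vec t)) f).

Definition bracket (xi : 'rV[R]_d) : R := Num.sqrt (1 + dot xi xi).

Definition seminorm0 (m : nat) (a : 'rV[R]_(d + d) -> R[i]) : R :=
  \big[Num.max/0]_(alpha : {ffun 'I_d -> 'I_m.+1} | (\sum_j alpha j <= m)%N)
  \big[Num.max/0]_(beta : {ffun 'I_d -> 'I_m.+1} | (\sum_j beta j <= m)%N)
    sup (range (fun z : 'rV[R]_(d + d) =>
      bracket (rsubmx z) ^+ (\sum_j alpha j)%N *
      nrm (multi_partial (@rshift d d) (fun j => alpha j : nat)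
             (multi_partial (@lshift d d) (fun j => beta j : nat) a) z))).

Definition bounded_weyl_calculus_type0 :=
  exists (m : nat) (C : R), forall a, schwartz a ->
    forall f, nrm (weyl_calculus a f) <= C * seminorm0 m a * nrm f.

End Calculus.
End WeylCalculus.

Section HooCalculus.
Context (R : realType).

(* z != 0 and |arg z| < theta, for theta <= pi *)
Definition sector (theta : R) : set (R[i]^o) :=
  [set z | exists r t : R, 0 < r /\ `|t| < theta /\ z = r%:C * expi t].

Definition holomorphic_on (theta : R) (phi : R[i]^o -> R[i]^o) :=
  forall z, sector theta z -> derivable phi z 1.

Definition bounded_on (theta : R) (phi : R[i]^o -> R[i]^o) :=
  exists M : R, forall z, sector theta z -> nrm (phi z) <= M.

Definition Hoo_norm (theta : R) (phi : R[i]^o -> R[i]^o) : R :=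
  sup [set nrm (phi z) | z in sector theta].

Definition Hoo (theta : R) (phi : R[i]^o -> R[i]^o) :=
  holomorphic_on theta phi /\ bounded_on theta phi.

(* On the two rays of the boundary of the sector of angle nu, z = r e^{+-i nu}
   and |dz| / |z| = dr / r. *)
Definition H1 (theta : R) (phi : R[i]^o -> R[i]^o) :=
  holomorphic_on theta phi /\
  exists M : R, forall nu, 0 < nu -> nu < theta ->
    (((2 * pi)^-1)%:E *
     \int[lebesgue_measure]_(r in [set r : R | (0 < r)%R])
       ((nrm (phi (r%:C * expi nu)) + nrm (phi (r%:C * expi (- nu)))) / r)%:E
     <= M%:E)%E.

Context (X : completeNormedModType R[i]).
Variable L : set (X * X).

Definition resolvent_set : set (R[i]^o) :=
  [set z |
    (forall g, exists! f, exists h, L (f, h) /\ z *: f - h = g) /\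
    (exists M : R, forall f h, L (f, h) -> nrm f <= M * nrm (z *: f - h))].

Definition spectrum : set (R[i]^o) := ~` resolvent_set.

(* (z - L)^{-1} *)
Definition resolvent (z : R[i]) (g : X) : X :=
  xget 0 [set f | exists h, L (f, h) /\ z *: f - h = g].

Definition sectorial (sigma : R) :=
  is_operator L /\ closed L /\ spectrum `<=` closure (sector sigma) /\
  exists M : R, forall z, ~ closure (sector sigma) z ->
    forall g, nrm (z *: resolvent z g) <= M * nrm g.

Definition sectoriality_angles : set R :=
  [set sigma | 0 < sigma /\ sigma < pi /\ sectorial sigma].

(* meaningful when [sectoriality_angles] is nonempty *)
Definition omega : R := inf sectoriality_angles.

(* With the boundary oriented downwards, z = r e^{i nu} is traversed from
   infinity to 0 and z = r e^{-i nu} from 0 to infinity. *)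
Definition contour_integrand (nu : R) (phi : R[i]^o -> R[i]^o) (f : X)
    (r : R) : X :=
  let zp := r%:C * expi nu in
  let zm := r%:C * expi (- nu) in
  (phi zm * expi (- nu)) *: resolvent zm f -
  (phi zp * expi nu) *: resolvent zp f.

Definition functional_calculus (nu : R) (phi : R[i]^o -> R[i]^o) (f : X) : X :=
  (2 * pi%:C * (0 +i* 1))^-1 *:
  bochner lebesgue_measure [set r : R | 0 < r] (contour_integrand nu phi f).

(* phi(L) does not depend on nu in (omega, theta). *)
Definition bounded_Hoo_calculus (theta : R) :=
  sectoriality_angles !=set0 /\ omega < theta /\ theta < pi /\
  exists K : R, forall phi, H1 theta phi -> Hoo theta phi ->
    forall nu, omega < nu -> nu < theta -> forall f,
      bochner_integrable lebesgue_measure [set r : R | 0 < r]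
        (contour_integrand nu phi f) /\
      nrm (functional_calculus nu phi f) <= K * Hoo_norm theta phi * nrm f.

End HooCalculus.

(* Main.v *)
(** For Re t > 0 the operator e^{-tL} is [a_t(A, B)], where a_t is a multiple of the
    Gaussian exp(- lam (|x|^2 + |xi|^2)) with lam = tanh (t/2).  The operators
    S(q^j e^{-q}), q = |w|^2/4, which integrate such kernels against e^{i(uA+vB)}, map
    into the span of the eigenvectors of L, with eigenvalues 0, 1, 2, ..., and this span
    is dense.  On it, writing (z - L)^{-1} for z on the two boundary rays of a sector as
    a Laplace transform of e^{-tL} along a ray of the right half-plane and discretising,
    phi(L) becomes a limit of sums of c_j^+ e^{-t_j w_+ L} - c_j^- e^{-t_j w_- L}.  Here
    |c_j^+| and |c_j^-| are at most C |phi|/j, and by Cauchy's theorem the partial sums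
    of c_j^+ - c_j^- are at most C |phi|.  Comparing each Gaussian symbol with a step
    function of t, this bounds the type 0 seminorms of the total symbol by C |phi|. *)

From HB Require Import structures.
Require Import Defs.
From mathcomp Require Import all_boot all_order all_algebra complex.
From mathcomp Require Import all_classical all_reals all_analysis.
From mathcomp Require Import measurable_realfun ring lra.
Set Implicit Arguments.
Unset Strict Implicit.
Unset Printing Implicit Defensive.
Import Order.TTheory GRing.Theory Num.Theory.
Import numFieldNormedType.Exports.
Local Open Scope classical_set_scope.
Local Open Scope ring_scope.
Local Open Scope complex_scope.

(** The hypothesis on A and B speaks of Schwartz symbols only; this is why Laplace transforms are
    replaced by finite sums of Gaussians. The obstacle is their scale invariance: with coefficients
    of size 1/j, the triangle inequality loses a logarithm. It is regained because the step function
    is the same for both directions, so that it meets only the differences of the coefficients,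
    while the errors are bounded by a / (1 + a)^2 at a = t and a = t (1 + |x|^2 + |xi|^2), whose
    sums against 1/j are bounded uniformly in the mesh. The coefficients are increments of H(t), the
    integral of phi(r z) e^{t r w z} dr / r: partial sums telescope, and H(t) is up to O(|phi|) the
    integral of phi(r z) / r over r < 1/t. That L is single-valued, has resolvents and is sectorial
    is proved on the way, from the triangular action of L on the operators S(q^j e^{-q}) and from
    the same multiplier estimate. To make the constants depend on theta alone, phi is damped by z /
    ((z + e)(1 + e z)) and the contour is moved to the angle theta/2. *)

Lemma le_of_eq (disp : Order.disp_t) (T : porderType disp) (x y : T) : x = y -> (x <= y)%O.
Proof. by move=> ->. Qed.

Lemma complex_ext (R : realType) (z w : R[i]) :
  complex.Re z = complex.Re w -> complex.Im z = complex.Im w -> z = w.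
Proof. by case: z w => [a b] [c e] /= -> ->. Qed.

(** * Real-valued norms, complex moduli, and sequential criteria for limits and closures *)

Section Norm.
Variable R : realType.

Section Zmod.
Variable V : normedZmodType R[i].
Implicit Types x y : V.

Lemma nrmE x : `|x| = (nrm x)%:C.
Proof.
rewrite /nrm; have := normr_ge0 x; case: (`|x|) => a b; rewrite lecE /=.
by case/andP=> /eqP -> _.
Qed.

Lemma nrm_ge0 x : 0 <= nrm x.
Proof. by have := normr_ge0 x; rewrite nrmE lecR. Qed.

Lemma nrmD x y : nrm (x + y) <= nrm x + nrm y.
Proof. by have := ler_normD x y; rewrite !nrmE -rmorphD lecR. Qed.

Lemma nrmN x : nrm (- x) = nrm x.
Proof. by rewrite /nrm normrN. Qed.

Lemma nrm0 : nrm (0 : V) = 0.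
Proof. by rewrite /nrm normr0. Qed.

Lemma nrm_eq0 x : nrm x = 0 -> x = 0.
Proof. by move=> h; apply/eqP; rewrite -normr_eq0 nrmE h. Qed.

Lemma nrm_gt0 x : x != 0 -> 0 < nrm x.
Proof.
move=> x0; rewrite lt_def nrm_ge0 andbT; apply: contra x0 => /eqP h.
by apply/eqP; exact: nrm_eq0.
Qed.

Lemma nrmC x y : nrm (x - y) = nrm (y - x).
Proof. by rewrite /nrm distrC. Qed.

Lemma nrmB x y : nrm (x - y) <= nrm x + nrm y.
Proof. by apply: le_trans (nrmD _ _) _; rewrite nrmN. Qed.

Lemma nrm_tri x y z : nrm (x - y) <= nrm (x - z) + nrm (z - y).
Proof. by rewrite -[x - y](subrKA z); exact: nrmD. Qed.

Lemma nrm_dist x y : `|nrm x - nrm y| <= nrm (x - y).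
Proof.
rewrite ler_norml; apply/andP; split.
  by have := nrmD (y - x) x; rewrite subrK nrmC; lra.
by have := nrmD (x - y) y; rewrite subrK; lra.
Qed.

Lemma nrm_le0 x : (forall e : R, 0 < e -> nrm x <= e) -> x = 0.
Proof.
move=> h; apply: nrm_eq0; apply/eqP; rewrite eq_le nrm_ge0 andbT.
by apply/ler_addgt0Pl => e e0; rewrite addr0; exact: h.
Qed.

Lemma nrm_sum I (r : seq I) (P : pred I) (F : I -> V) :
  nrm (\sum_(i <- r | P i) F i) <= \sum_(i <- r | P i) nrm (F i).
Proof.
elim/big_ind2 : _ => //; first by rewrite nrm0.
by move=> a b c d h1 h2; apply: le_trans (nrmD _ _) _; exact: lerD.
Qed.

End Zmod.

Lemma nrm_def (z : R[i]) : nrm z = Num.sqrt (complex.Re z ^+ 2 + complex.Im z ^+ 2).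
Proof. by rewrite /nrm normc_def. Qed.

Lemma nrm_sqr (z : R[i]) : nrm z ^+ 2 = complex.Re z ^+ 2 + complex.Im z ^+ 2.
Proof. by rewrite nrm_def sqr_sqrtr // addr_ge0 // sqr_ge0. Qed.

Lemma nrmM (x y : R[i]) : nrm (x * y) = nrm x * nrm y.
Proof. by rewrite {1}/nrm normrM !nrmE -rmorphM. Qed.

Lemma nrm_real (r : R) : nrm (r%:C : R[i]) = `|r|.
Proof. by rewrite nrm_def /= expr0n addr0 sqrtr_sqr. Qed.

Lemma nrm1 : nrm (1 : R[i]) = 1.
Proof. by rewrite -[1]/(1%:C) nrm_real normr1. Qed.

Lemma nrm_nat n : nrm (n%:R : R[i]) = n%:R.
Proof. by rewrite /nrm normr_nat -[n%:R](rmorph_nat (real_complex R)). Qed.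

Lemma nrmX (x : R[i]) n : nrm (x ^+ n) = nrm x ^+ n.
Proof. by elim: n => [|n ih]; rewrite ?expr0 ?nrm1 // !exprS nrmM ih. Qed.

Lemma nrmV (x : R[i]) : nrm x^-1 = (nrm x)^-1.
Proof.
have [->|x0] := eqVneq x 0; first by rewrite invr0 nrm0 invr0.
apply: (mulfI (lt0r_neq0 (nrm_gt0 x0))).
by rewrite -nrmM !divff ?nrm1 // lt0r_neq0 // nrm_gt0.
Qed.

Lemma nrm_i : nrm (0 +i* 1 : R[i]) = 1.
Proof. by rewrite nrm_def /= expr0n add0r expr1n sqrtr1. Qed.

Lemma nrm_expi (t : R) : nrm (expi t) = 1.
Proof. by rewrite nrm_def /= cos2Dsin2 sqrtr1. Qed.

Lemma nrm_ReIm (z : R[i]) : nrm z <= `|complex.Re z| + `|complex.Im z|.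
Proof.
rewrite -[X in _ <= X]ger0_norm ?addr_ge0 // -sqrtr_sqr nrm_def ler_wsqrtr //.
rewrite sqrrD !real_normK ?num_real // addrAC lerDl mulrn_wge0 // mulr_ge0 //.
Qed.

Lemma Re_nrm (z : R[i]) : `|complex.Re z| <= nrm z.
Proof. by rewrite nrm_def -sqrtr_sqr ler_wsqrtr // lerDl sqr_ge0. Qed.

Lemma Im_nrm (z : R[i]) : `|complex.Im z| <= nrm z.
Proof. by rewrite nrm_def -sqrtr_sqr ler_wsqrtr // lerDr sqr_ge0. Qed.

Lemma Re_le_nrm (z : R[i]) : complex.Re z <= nrm z.
Proof. exact: le_trans (ler_norm _) (Re_nrm z). Qed.

Lemma nrmZ (V : normedModType R[i]) (c : R[i]) (x : V) :
  nrm (c *: x) = nrm c * nrm x.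
Proof. by rewrite {1}/nrm normrZ !nrmE -rmorphM. Qed.

Lemma expiD (s t : R) : expi (s + t) = expi s * expi t.
Proof. by rewrite /expi cosD sinD; apply/eqP; rewrite eq_complex /= eqxx /= addrC eqxx. Qed.

Lemma expi0 : expi (0 : R) = 1.
Proof. by rewrite /expi cos0 sin0. Qed.

Lemma complex_le (e : R[i]) : 0 < e -> exists2 r : R, 0 < r & r%:C = e.
Proof.
by case: e => a b; rewrite ltcE /= => /andP [/eqP -> a0]; exists a.
Qed.

Section Topology.
Variable V : normedModType R[i].

Lemma cvg_nrmP (u : nat -> V) (l : V) :
  u n @[n --> \oo] --> l <->
  forall e : R, 0 < e -> exists N, forall n, (N <= n)%N -> nrm (u n - l) <= e.
Proof.
split=> [/cvgrPdist_le h e e0|h].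
  have e0' : 0 < e%:C :> R[i] by rewrite ltcR.
  have [N _ hN] := h _ e0'; exists N => n Nn.
  by have := hN n Nn; rewrite nrmE lecR nrmC.
apply/cvgrPdist_le => _ /complex_le [r r0 <-].
have [N hN] := h r r0; exists N => // n /= Nn.
by rewrite nrmE lecR nrmC hN.
Qed.

Lemma cvg_nrm0 (u : nat -> V) (l : V) :
  u n @[n --> \oo] --> l <-> nrm (u n - l) @[n --> \oo] --> (0 : R).
Proof.
rewrite cvg_nrmP; split=> [h|/cvgrPdist_le h e e0].
  apply/cvgrPdist_le => e e0; have [N hN] := h e e0; exists N => // n /= Nn.
  by rewrite sub0r normrN ger0_norm ?nrm_ge0 ?hN.
have [N _ hN] := h e e0; exists N => n Nn.
by have := hN n Nn; rewrite sub0r normrN ger0_norm ?nrm_ge0.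
Qed.

Lemma cvg_uniq (u : nat -> V) (l l' : V) :
  u n @[n --> \oo] --> l -> u n @[n --> \oo] --> l' -> l = l'.
Proof. exact: cvg_unique. Qed.

Lemma cvg_nrm (u : nat -> V) (l : V) :
  u n @[n --> \oo] --> l -> nrm (u n) @[n --> \oo] --> nrm l.
Proof.
move=> /cvg_nrmP h; apply/cvgrPdist_le => e e0; have [N hN] := h e e0.
exists N => // n /= Nn; apply: le_trans (nrm_dist _ _) _.
by rewrite nrmC hN.
Qed.

Lemma nrm_lim_le (u : nat -> V) (l : V) (c : R) :
  u n @[n --> \oo] --> l -> (forall n, nrm (u n) <= c) -> nrm l <= c.
Proof.
move=> /cvg_nrmP h hc; apply/ler_addgt0Pl => e e0.
have [N hN] := h e e0; have := hN N (leqnn _); have := hc N.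
by have := nrmB (u N) (u N - l); rewrite opprB addrC subrK; lra.
Qed.

Lemma cvg_dnbhsP (F : R -> V) (l : V) :
  F t @[t --> (0 : R)^'] --> l <->
  forall e : R, 0 < e -> exists2 d : R, 0 < d &
    forall t, t != 0 -> `|t| <= d -> nrm (F t - l) <= e.
Proof.
split=> [/cvgrPdist_le h e e0|h].
  have e0' : 0 < e%:C :> R[i] by rewrite ltcR.
  have /= [d d0 hd] := h _ e0'; exists (d / 2) => [|t t0 td]; first by rewrite divr_gt0.
  have := hd t; rewrite /ball_ /= sub0r normrN => /(_ (le_lt_trans td _) t0).
  by rewrite nrmE lecR nrmC; apply; move: d0 => /= ?; lra.
apply/cvgrPdist_le => _ /complex_le [r r0 <-].
have [d d0 hd] := h r r0; exists d => // t /=.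
rewrite sub0r normrN => td t0.
by rewrite nrmE lecR nrmC hd // ltW.
Qed.

Lemma closureP (A : set V) (x : V) :
  closure A x <-> forall e : R, 0 < e -> exists2 y, A y & nrm (y - x) <= e.
Proof.
split=> [h e e0|h B /nbhs_ballP /= [e' /= /complex_le [e e0 <-] hB]].
  have e0' : 0 < e%:C :> R[i] by rewrite ltcR.
  have [y [Ay]] := h _ (nbhsx_ballx x _ e0').
  by rewrite -ball_normE /= nrmE ltcR => /ltW hy; exists y; rewrite // nrmC.
have [|y Ay hy] := h (e / 2); first by rewrite divr_gt0.
exists y; split=> //; apply: hB; rewrite -ball_normE /= nrmE ltcR nrmC.
by apply: le_lt_trans hy _; lra.
Qed.

Lemma closure_pairP (A : set (V * V)) (x y : V) :
  closure A (x, y) <-> forall e : R, 0 < e ->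
    exists a b, A (a, b) /\ nrm (a - x) <= e /\ nrm (b - y) <= e.
Proof.
split=> [h e e0|h B /nbhs_ballP /= [e' /= /complex_le [e e0 <-] hB]].
  have e0' : 0 < e%:C :> R[i] by rewrite ltcR.
  have [[a b] [Ay []]] := h _ (nbhsx_ballx (x, y) _ e0').
  rewrite -!ball_normE /= !nrmE !ltcR => /ltW h1 /ltW h2.
  by exists a, b; rewrite nrmC [nrm (b - _)]nrmC.
have [|a [b [Ay [h1 h2]]]] := h (e / 2); first by rewrite divr_gt0.
exists (a, b); split=> //; apply: hB.
by split; rewrite -ball_normE /= nrmE ltcR nrmC; [apply: le_lt_trans h1 _|apply: le_lt_trans h2 _]; lra.
Qed.

End Topology.

Lemma cauchy_nrm (V : completeNormedModType R[i]) (u : nat -> V) :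
  (forall e : R, 0 < e -> exists N, forall m n, (N <= m)%N -> (N <= n)%N ->
     nrm (u m - u n) <= e) ->
  exists l : V, u n @[n --> \oo] --> l.
Proof.
move=> h; exists (lim (u n @[n --> \oo])).
apply: cauchy_cvg; apply/cauchy_ballP => _ /complex_le [e e0 <-].
have [|N hN] := h (e / 2); first by rewrite divr_gt0.
pose B : set V := [set x | exists2 n, (N <= n)%N & x = u n].
have FB : \forall n \near \oo, B (u n) by exists N => // n /= Nn; exists n.
exists (B, B) => // -[_ _] [/= [m Nm ->] [n Nn ->]]; rewrite -ball_normE /= nrmE ltcR.
by apply: le_lt_trans (hN _ _ Nm Nn) _; lra.
Qed.

Lemma cvg_complex (u : nat -> R[i]^o) (l : R[i]) :
  complex.Re (u n) @[n --> \oo] --> complex.Re l ->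
  complex.Im (u n) @[n --> \oo] --> complex.Im l ->
  u n @[n --> \oo] --> (l : R[i]^o).
Proof.
move=> /cvgrPdist_le h1 /cvgrPdist_le h2; apply/cvg_nrmP => e e0.
have e2 : 0 < e / 2 by rewrite divr_gt0.
have [N1 _ H1] := h1 _ e2; have [N2 _ H2] := h2 _ e2.
exists (maxn N1 N2) => n; rewrite geq_max => /andP [n1 n2].
apply: le_trans (nrm_ReIm _) _; rewrite [e]splitr.
have := H1 n n1; have := H2 n n2 => /=; rewrite !raddfB /= distrC => b1.
by rewrite distrC => b2; apply: lerD.
Qed.

(** A Cauchy filter contains a ball of radius 1/(n+1) for every n. The centres form a Cauchy
    sequence, whose real and imaginary parts converge by completeness of R. *)
Lemma complex_cauchy_cvg (F : set_system R[i]^o) :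
  ProperFilter F -> cauchy F -> cvg F.
Proof.
move=> FF /cauchy_ballP h.
have pick n : {x : R[i]^o | F (ball x (n.+1%:R^-1)%:C)}.
  apply: cid; have e0 : 0 < (n.+1%:R^-1)%:C :> R[i] by rewrite ltcR invr_gt0 ltr0n.
  have [[A B] /= [FA FB] hAB] := h _ e0.
  have [x Ax] := filter_ex FA; exists x; apply: filterS FB => y By.
  exact: (hAB (x, y)).
pose u n := sval (pick n).
have hu n : F (ball (u n) (n.+1%:R^-1)%:C) by exact: svalP (pick n).
have ucau m n : nrm (u m - u n) <= m.+1%:R^-1 + n.+1%:R^-1.
  have [x [/= ]] := filter_ex (filterI (hu m) (hu n)).
  rewrite -!ball_normE /= !nrmE !ltcR => /ltW b1 /ltW b2.
  by apply: le_trans (nrm_tri _ _ x) _; rewrite [nrm (x - _)]nrmC lerD.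
have small e : 0 < e -> exists N, forall n, (N <= n)%N -> n.+1%:R^-1 <= e :> R.
  move=> e0; exists (Num.truncn e^-1) => n Nn.
  rewrite -[e]invrK lef_pV2 ?posrE ?invr_gt0 ?ltr0n //.
  apply: le_trans (ltW (truncnS_gt _)) _.
  by rewrite ler_nat ltnS.
have cau (p : R[i] -> R) : (forall x y, p x - p y = p (x - y)) -> (forall x, `|p x| <= nrm x) ->
    cvg (p (u n) @[n --> \oo]).
  move=> pB pn; apply: cauchy_cvg; apply/cauchy_ballP => e e0.
  have [|N hN] := small (e / 4); first by rewrite divr_gt0.
  pose B : set R := [set x | exists2 n, (N <= n)%N & x = p (u n)].
  have FB : \forall n \near \oo, B (p (u n)) by exists N => // n /= Nn; exists n.
  exists (B, B) => // -[_ _] [/= [m Nm ->] [n Nn ->]]; rewrite /ball /= pB.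
  apply: le_lt_trans (pn _) _; apply: le_lt_trans (ucau _ _) _.
  by apply: le_lt_trans (lerD (hN _ Nm) (hN _ Nn)) _; move: (e0 : (0 : R) < e); lra.
have c1 := cau (@complex.Re R) (fun x y => esym (raddfB _ x y)) Re_nrm.
have c2 := cau (@complex.Im R) (fun x y => esym (raddfB _ x y)) Im_nrm.
pose l : R[i]^o := lim (complex.Re (u n) @[n --> \oo]) +i* lim (complex.Im (u n) @[n --> \oo]).
have ul : u n @[n --> \oo] --> l by apply: cvg_complex.
apply/cvg_ex; exists l; apply/cvg_ballP => _ /complex_le [e e0 <-].
have e2 : 0 < e / 2 by rewrite divr_gt0.
have [N1 hN1] := small _ e2; have /cvg_nrmP/(_ (e / 4)) [|N2 hN2] := ul.
  by rewrite divr_gt0.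
pose n := maxn N1 N2; apply: filterS (hu n) => x.
rewrite -!ball_normE /= !nrmE !ltcR => b1; apply: le_lt_trans (nrm_tri _ _ (u n)) _.
have := hN1 n (leq_maxl _ _); have := hN2 n (leq_maxr _ _).
move=> h2 h1; rewrite [nrm (l - _)]nrmC; apply: le_lt_trans (lerD h2 (ltW b1)) _.
by apply: le_lt_trans (lerD (lexx _) h1) _; lra.
Qed.

End Norm.

(** An alias of [R[i]^o] that carries the completeness just proved, so that scalar functions have
    Bochner integrals and share the theory of vector-valued ones. *)
Definition cplx (R : realType) : Type := R[i]^o.

HB.instance Definition _ (R : realType) := NormedModule.copy (cplx R) (R[i]^o).
HB.instance Definition _ (R : realType) :=
  Uniform_isComplete.Build (cplx R) (@complex_cauchy_cvg R).

(** * Finitely valued measurable maps and the integral of simple functions *)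

Section SimpleMaps.
Context (R : realType) (disp : measure_display) (T : measurableType disp).

(** In contrast to [simple], the zero fibre is measurable too, and fibres may have infinite measure.
    Values in any type are allowed, which makes the notion stable under pairing and under all
    compositions. *)
Definition smap (Z : Type) (s : T -> Z) :=
  finite_set (range s) /\ forall z, measurable (s @^-1` [set z]).

Lemma smap_pre (Z : Type) (s : T -> Z) (A : set Z) : smap s -> measurable (s @^-1` A).
Proof.
move=> [fs ms]; have -> : s @^-1` A = \bigcup_(z in range s `&` A) (s @^-1` [set z]).
  apply/seteqP; split=> [t At|t [z [_ Az] /= ->]] //.
  by exists (s t) => //; split=> //; exists t.
by apply: fin_bigcup_measurable => //; exact: finite_setIl.
Qed.

Lemma smap_comp (Z Y : Type) (g : Z -> Y) (s : T -> Z) : smap s -> smap (g \o s).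
Proof.
move=> h; split; last by move=> y; rewrite comp_preimage; exact: smap_pre.
apply: (@sub_finite_set _ _ (g @` range s)); last exact: finite_image h.1.
by move=> _ [t _ <-]; exists (s t) => //; exists t.
Qed.

Lemma smap_pair (Z Y : Type) (s : T -> Z) (u : T -> Y) :
  smap s -> smap u -> smap (fun t => (s t, u t)).
Proof.
move=> [fs ms] [fu mu]; split.
  apply: (@sub_finite_set _ _ (range s `*` range u)); last exact: finite_setX.
  by move=> _ [t _ <-]; split; exists t.
move=> [a b]; have -> : (fun t => (s t, u t)) @^-1` [set (a, b)] = s @^-1` [set a] `&` u @^-1` [set b].
  by apply/seteqP; split=> t /= [-> ->].
exact: measurableI.
Qed.

Lemma smap2 (Z Y W : Type) (F : Z -> Y -> W) (s : T -> Z) (u : T -> Y) :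
  smap s -> smap u -> smap (fun t => F (s t) (u t)).
Proof. by move=> h1 h2; exact: (smap_comp (fun p => F p.1 p.2) (smap_pair h1 h2)). Qed.

Variable mu : {measure set T -> \bar R}.

Section Int.
Variable X : completeNormedModType R[i].

Lemma simple_smap (s : T -> X) : simple mu measurable s -> smap s.
Proof.
move=> [fs hs]; split=> // z; have [->|z0] := eqVneq z 0; last by case: (hs z z0).
have -> : s @^-1` [set 0] = ~` \bigcup_(z in range s `&` [set~ 0]) (s @^-1` [set z]).
  apply/seteqP; split=> [t /= st [w /= [_ w0] sw]|t /= h].
    by apply: w0; rewrite -sw.
  by apply: contrapT => h'; apply: h; exists (s t) => //; split=> //; exists t.
apply: measurableC; apply: fin_bigcup_measurable; first exact: finite_setIl.
by move=> w [_ /eqP w0]; case: (hs w w0).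
Qed.


(** A level set of [g \o u] is a finite disjoint union of level sets of [u], of finite measure where
    [g] does not vanish; the sum may therefore be taken over the finer partition. *)
Lemma SI_comp (Z : choiceType) (u : T -> Z) (g : Z -> X) : smap u ->
  (forall z, g z != 0 -> (mu (u @^-1` [set z]) < +oo)%E) ->
  simple_integral mu (g \o u) =
  \sum_(z \in range u) (fine (mu (u @^-1` [set z])))%:C *: g z.
Proof.
move=> su hg; have fu : finite_set (range u) by case: su.
have fgu : finite_set (range (g \o u)) by case: (smap_comp g su).
rewrite /simple_integral fsbig_finite //= [RHS]fsbig_finite //=.
set D := finmap.enum_fset (fset_set (range u)).
set E := finmap.enum_fset (fset_set (range (g \o u))).
transitivity (\sum_(x <- E) \sum_(z <- D)
   (if g z == x then (fine (mu (u @^-1` [set z])))%:C *: x else 0)).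
  apply: eq_bigr => x _; have [->|x0] := eqVneq x 0.
    by rewrite scaler0 big1 // => z _; rewrite scaler0 if_same.
  have -> : (g \o u) @^-1` [set x] =
      \bigcup_(z in range u `&` [set z | g z == x]) (u @^-1` [set z]).
    apply/seteqP; split=> [t /= h|t [z [_ /= /eqP gz] /= tz]]; last by rewrite tz.
    by exists (u t) => //; split; [exists t|apply/eqP].
  rewrite measure_fin_bigcup //; last 3 first.
  - exact: finite_setIl.
  - by move=> z w _ _ [t [/= -> ->]].
  - by move=> z _; case: su => _; exact.
  rewrite fsbig_mkcondr fsbig_finite //= -sum_fine; last first.
    move=> z _; case: ifPn => //; rewrite inE /= => /eqP gz.
    by rewrite ge0_fin_numE // hg // gz.
  rewrite rmorph_sum scaler_suml; apply: eq_bigr => z _.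
  rewrite (_ : (z \in [set z | g z == x]) = (g z == x)); last first.
    by apply/idP/idP => [|h]; [rewrite inE|rewrite inE].
  by case: ifP => // _; rewrite /= scale0r.
rewrite exchange_big /=; apply: eq_big_seq => z; rewrite in_fset_set // inE => -[t _ <-].
rewrite (bigD1_seq (g (u t))) /= ?finmap.fset_uniq //; last by rewrite in_fset_set // inE; exists t.
by rewrite eqxx big1 ?addr0 // => x; rewrite eq_sym => /negbTE ->.
Qed.

Lemma simple_fin (s : T -> X) x : simple mu measurable s -> x != 0 ->
  mu (s @^-1` [set x]) \is a fin_num.
Proof. by move=> [_ h] /h [_ ?]; rewrite ge0_fin_numE. Qed.

Lemma simple_nrm (s : T -> X) : simple mu measurable s ->
  (\int[mu]_t (nrm (s t))%:E)%E =
  (\sum_(x \in range s) fine (mu (s @^-1` [set x])) * nrm x)%:E.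
Proof.
move=> ss; have sm := simple_smap ss; have [fs ms] := sm.
have e t : (nrm (s t))%:E = (\sum_(x \in range s) ((nrm x)%:E * (\1_(s @^-1` [set x]) t)%:E))%E.
  rewrite (fsbigID [set s t]) //= [X in (_ + X)%E]fsbig1 ?adde0.
    rewrite (_ : range s `&` _ = [set s t]) ?fsbig_set1 ?indicE ?mem_set ?mule1 //.
    by apply/seteqP; split=> [x [_ /=]|x /= ->] //; split=> //; exists t.
  by move=> x [_ /= h]; rewrite indicE memNset ?mule0 // => h'; apply: h.
under eq_integral do rewrite e.
rewrite ge0_integral_fsum //; last 2 first.
- move=> x; apply/measurable_EFinP; exact: measurable_funM.
- by move=> x t _; rewrite mule_ge0 // lee_fin ?nrm_ge0.
rewrite -fsumEFin //; apply: eq_fsbigr => x _.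
have mx : measurable (s @^-1` [set x]) by exact: ms.
rewrite ge0_integralZl_EFin ?nrm_ge0 //; last first.
  by apply/measurable_EFinP; exact: measurable_indic.
rewrite integral_indic // setIT; have [->|x0] := eqVneq x 0; first by rewrite nrm0 mul0e mulr0.
by rewrite EFinM fineK ?(simple_fin ss x0) // muleC.
Qed.

Lemma SI_le (s : T -> X) : simple mu measurable s ->
  ((nrm (simple_integral mu s))%:E <= \int[mu]_t (nrm (s t))%:E)%E.
Proof.
move=> ss; have [fs _] := ss; rewrite simple_nrm // lee_fin /simple_integral.
rewrite !fsbig_finite //=; apply: le_trans (nrm_sum _ _ _) _.
apply: ler_sum => x _; by rewrite nrmZ nrm_real ger0_norm.
Qed.

End Int.

(** As F 0 0 = 0, the combination vanishes off the union of the two supports, which has finite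
    measure. *)
Lemma simple_comp2 (X Y W : completeNormedModType R[i]) (F : X -> Y -> W)
    (s : T -> X) (s' : T -> Y) : F 0 0 = 0 ->
  simple mu measurable s -> simple mu measurable s' ->
  simple mu measurable (fun t => F (s t) (s' t)).
Proof.
move=> F0 h h'; have m := smap2 F (simple_smap h) (simple_smap h').
split=> [|w w0]; first by case: m.
split; first by case: m => _; exact.
have m1 := smap_pre [set~ 0] (simple_smap h); have m2 := smap_pre [set~ 0] (simple_smap h').
have fin (Z : completeNormedModType R[i]) (u : T -> Z) : simple mu measurable u ->
    (mu (u @^-1` [set~ 0%R]) < +oo)%E.
  move=> su; have [fu hu] := su.
  have -> : u @^-1` [set~ 0%R] = \bigcup_(z in range u `&` [set~ 0%R]) (u @^-1` [set z]).
    apply/seteqP; split=> [t h0|t [z [_ z0] /= ->]] //.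
    by exists (u t) => //; split=> //; exists t.
  rewrite measure_fin_bigcup //; last 3 first.
  - exact: finite_setIl.
  - by move=> z v _ _ [t [/= -> ->]].
  - by move=> z [_ /eqP z0]; case: (hu _ z0).
  rewrite fsbig_finite /=; last exact: finite_setIl.
  rewrite big_seq; apply: lte_sum_pinfty => z.
  rewrite in_fset_set; last exact: finite_setIl.
  by rewrite inE => -[_ /eqP z0]; case: (hu _ z0).
apply: (@le_lt_trans _ _ (mu (s @^-1` [set~ 0] `|` s' @^-1` [set~ 0]))).
  apply: le_measure; rewrite ?inE //; [by case: m => _; exact|exact: measurableU|].
  move=> t /= Ft; apply: contrapT => /not_orP [/contrapT h1 /contrapT h2].
  by move: w0; rewrite -Ft h1 h2 F0 eqxx.
apply: le_lt_trans (measureU2 _ _ _) _ => //.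
by apply: lte_add_pinfty; exact: fin.
Qed.

(** The values of the pair (s, s') index a common partition. With the same weights in all three
    integrals, linearity of the simple integral is checked term by term. *)
Lemma SI_comp2 (X Y W : completeNormedModType R[i]) (F : X -> Y -> W)
    (s : T -> X) (s' : T -> Y) : F 0 0 = 0 ->
  simple mu measurable s -> simple mu measurable s' ->
  exists (I : seq (X * Y)) (c : X * Y -> R),
  [/\ simple_integral mu s = \sum_(p <- I) (c p)%:C *: p.1,
      simple_integral mu s' = \sum_(p <- I) (c p)%:C *: p.2 &
      simple_integral mu (fun t => F (s t) (s' t)) = \sum_(p <- I) (c p)%:C *: F p.1 p.2].
Proof.
move=> F0 h h'; pose u t := (s t, s' t).
have su : smap u := smap_pair (simple_smap h) (simple_smap h').
have fu : finite_set (range u) by case: su.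
exists (finmap.enum_fset (fset_set (range u))), (fun z => fine (mu (u @^-1` [set z]))).
have key (Z : completeNormedModType R[i]) (g : X * Y -> Z) : g (0, 0) = 0 ->
    simple_integral mu (g \o u) = \sum_(z <- finmap.enum_fset (fset_set (range u))) (fine (mu (u @^-1` [set z])))%:C *: g z.
  move=> g0; rewrite SI_comp ?fsbig_finite // => -[a b] gz.
  have [a0|a0] := eqVneq a 0.
    have b0 : b != 0 by apply: contra gz => /eqP ->; rewrite a0 g0.
    have [mb fb] := h'.2 _ b0; apply: le_lt_trans fb.
    by apply: le_measure; rewrite ?inE //; [case: su => _; exact|move=> t [/= _ ->]].
  have [mb fb] := h.2 _ a0; apply: le_lt_trans fb.
  by apply: le_measure; rewrite ?inE //; [case: su => _; exact|move=> t [/= -> _]].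
split; first exact: (key _ fst).
  exact: (key _ snd).
exact: (key _ (fun p => F p.1 p.2)).
Qed.

Lemma SI_sub (X : completeNormedModType R[i]) (s s' : T -> X) :
  simple mu measurable s -> simple mu measurable s' ->
  simple_integral mu (fun t => s t - s' t) = simple_integral mu s - simple_integral mu s'.
Proof.
move=> h h'; have [|I [c [-> -> ->]]] := @SI_comp2 X X X (fun x y => x - y) s s' _ h h'.
  by rewrite subr0.
by rewrite -sumrB; apply: eq_bigr => p _; rewrite scalerBr.
Qed.

Lemma SI_add (X : completeNormedModType R[i]) (s s' : T -> X) :
  simple mu measurable s -> simple mu measurable s' ->
  simple_integral mu (fun t => s t + s' t) = simple_integral mu s + simple_integral mu s'.
Proof.
move=> h h'; have [|I [c [-> -> ->]]] := @SI_comp2 X X X (fun x y => x + y) s s' _ h h'.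
  by rewrite addr0.
by rewrite -big_split; apply: eq_bigr => p _; rewrite scalerDr.
Qed.

Lemma SI_lin (X Y : completeNormedModType R[i]) (F : {linear X -> Y}) (s : T -> X) :
  simple mu measurable s ->
  simple mu measurable (F \o s) /\
  simple_integral mu (F \o s) = F (simple_integral mu s).
Proof.
move=> h; split; first exact: (@simple_comp2 X X Y (fun x _ => F x) s s (linear0 F) h h).
have [I [c [-> _ ->]]] := @SI_comp2 X X Y (fun x _ => F x) s s (linear0 F) h h.
by rewrite linear_sum; apply: eq_bigr => p _; rewrite linearZ.
Qed.

End SimpleMaps.

Lemma ecvg0P (R : realType) (u : nat -> \bar R) : (forall n, 0 <= u n)%E ->
  u n @[n --> \oo] --> 0%E <->
  forall e : R, 0 < e -> exists N, forall n, (N <= n)%N -> (u n <= e%:E)%E.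
Proof.
move=> u0; split=> [/fine_cvgP [[N1 _ fu] /cvgrPdist_le h] e e0|h].
  have [N2 _ hN] := h e e0; exists (maxn N1 N2) => n; rewrite geq_max => /andP [n1 n2].
  have fn : u n \is a fin_num by exact: fu.
  rewrite -(fineK fn) lee_fin; have := hN n n2; rewrite sub0r normrN ger0_norm //.
  exact: fine_ge0.
have fin n e : (u n <= (e : R)%:E)%E -> u n \is a fin_num.
  by move=> h'; rewrite ge0_fin_numE //; apply: le_lt_trans h' _; rewrite ltry.
apply/fine_cvgP; split.
  by have [N hN] := h 1 ltr01; exists N => // n /= Nn; apply: fin (hN _ Nn).
apply/cvgrPdist_le => e e0; have [N hN] := h e e0; exists N => // n /= Nn.
rewrite sub0r normrN ger0_norm ?fine_ge0 // -lee_fin fineK ?hN //.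
exact: fin (hN _ Nn).
Qed.

(** * Strong measurability of maps into normed spaces *)

Section Bmeas.
Context (R : realType) (disp : measure_display) (T : measurableType disp).

(** Everywhere limits of finitely valued maps, with no measure involved: the supports may have
    infinite measure. Finite measure is recovered from integrability in [Bint_approx]. *)
Definition bmeas (V : normedModType R[i]) (f : T -> V) :=
  exists s : nat -> T -> V, (forall n, smap (s n)) /\
    forall t, s n t @[n --> \oo] --> f t.

Lemma smap_bmeas (V : normedModType R[i]) (f : T -> V) : smap f -> bmeas f.
Proof. by move=> h; exists (fun=> f); split=> // t; exact: cvg_cst. Qed.

Lemma bmeas_cst (V : normedModType R[i]) (c : V) : bmeas (fun=> c).
Proof.
apply: smap_bmeas; split.
  by apply: (@sub_finite_set _ _ [set c]) => // _ [t _ <-].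
move=> z; have [->|zc] := pselect (z = c).
  by rewrite (_ : _ @^-1` _ = setT) //; apply/seteqP; split.
rewrite (_ : _ @^-1` _ = set0) //; apply/seteqP; split=> // t /= h.
by apply: zc.
Qed.

Lemma bmeas2 (V W Z : normedModType R[i]) (F : V -> W -> Z) f g :
  (forall u v x y, u n @[n --> \oo] --> x -> v n @[n --> \oo] --> y ->
     F (u n) (v n) @[n --> \oo] --> F x y) ->
  bmeas f -> bmeas g -> bmeas (fun t => F (f t) (g t)).
Proof.
move=> hF [s [ms cs]] [s' [ms' cs']]; exists (fun n t => F (s n t) (s' n t)).
by split=> [n|t]; [exact: smap2|exact: hF].
Qed.

Lemma bmeasD (V : normedModType R[i]) (f g : T -> V) :
  bmeas f -> bmeas g -> bmeas (fun t => f t + g t).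
Proof. by apply: bmeas2 => u v x y hu hv; exact: cvgD. Qed.

Lemma bmeasB (V : normedModType R[i]) (f g : T -> V) :
  bmeas f -> bmeas g -> bmeas (fun t => f t - g t).
Proof. by apply: (@bmeas2 V V V (fun x y => x - y)) => u v x y hu hv; exact: cvgB. Qed.

Lemma bmeasZ (V : normedModType R[i]) (f : T -> cplx R) (g : T -> V) :
  bmeas f -> bmeas g -> bmeas (fun t => (f t : R[i]) *: g t).
Proof. by apply: bmeas2 => u v x y hu hv; exact: cvgZ. Qed.

Lemma bmeasF (V W : normedModType R[i]) (F : V -> W) (f : T -> V) :
  (forall u x, u n @[n --> \oo] --> x -> F (u n) @[n --> \oo] --> F x) ->
  bmeas f -> bmeas (F \o f).
Proof. by move=> hF hf; apply: (@bmeas2 V V W (fun x _ => F x) f f) => // u v x y hu _; exact: hF. Qed.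

Lemma smap_measurable (g : T -> R) : smap g -> measurable_fun setT g.
Proof. by move=> sg _ B mB; rewrite setTI; exact: smap_pre. Qed.

Lemma bmeas_nrm (V : normedModType R[i]) (f : T -> V) :
  bmeas f -> measurable_fun setT (fun t => nrm (f t)).
Proof.
move=> [s [ms cs]]; apply: (@measurable_fun_cvg _ _ _ _ (fun n t => nrm (s n t))).
  by move=> n; apply: smap_measurable; exact: (smap_comp (@nrm R V) (ms n)).
by move=> t _; exact: cvg_nrm.
Qed.

Lemma bmeas_nrmE (V : normedModType R[i]) (f : T -> V) :
  bmeas f -> measurable_fun setT (fun t => (nrm (f t))%:E).
Proof. by move=> h; apply/measurable_EFinP; exact: bmeas_nrm. Qed.

End Bmeas.

(** * The Bochner integral: existence, linearity, dominated convergence, comparison with the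
    Lebesgue integral *)

Section BochnerIntegral.
Context (R : realType) (disp : measure_display) (T : measurableType disp).
Variable mu : {measure set T -> \bar R}.

Definition Bint (X : completeNormedModType R[i]) (f : T -> X) :=
  bmeas f /\ (\int[mu]_t (nrm (f t))%:E < +oo)%E.

Definition BI (X : completeNormedModType R[i]) (f : T -> X) : X := bochner mu setT f.

Section OneSpace.
Variable X : completeNormedModType R[i].
Implicit Types f g s : T -> X.

Lemma simple_bmeas s : simple mu measurable s -> bmeas s.
Proof. by move=> /simple_smap; exact: smap_bmeas. Qed.

Lemma int_nrm_dist (f g h : T -> X) : bmeas f -> bmeas g -> bmeas h ->
  (\int[mu]_t (nrm (f t - g t))%:E <=
   \int[mu]_t (nrm (h t - f t))%:E + \int[mu]_t (nrm (h t - g t))%:E)%E.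
Proof.
move=> mf mg mh; have m1 := bmeas_nrmE (bmeasB mh mf); have m2 := bmeas_nrmE (bmeasB mh mg).
rewrite -ge0_integralD //=; try by move=> *; rewrite lee_fin nrm_ge0.
apply: ge0_le_integral => //=.
- by move=> *; rewrite lee_fin nrm_ge0.
- exact: bmeas_nrmE (bmeasB mf mg).
- exact: emeasurable_funD.
- move=> t _; rewrite -EFinD lee_fin; apply: le_trans (nrm_tri _ _ (h t)) _.
  by rewrite nrmC.
Qed.

Lemma SI_dist f s s' : bmeas f -> simple mu measurable s -> simple mu measurable s' ->
  ((nrm (simple_integral mu s - simple_integral mu s'))%:E <=
   \int[mu]_t (nrm (f t - s t))%:E + \int[mu]_t (nrm (f t - s' t))%:E)%E.
Proof.
move=> mf hs hs'; rewrite -SI_sub //.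
have ss : simple mu measurable (fun t => s t - s' t).
  by apply: (@simple_comp2 _ _ _ _ X X X (fun x y => x - y)); rewrite ?subr0.
apply: le_trans (SI_le ss) _; apply: int_nrm_dist => //; exact: simple_bmeas.
Qed.

Lemma L1_dominated (f_ : nat -> T -> X) f (G : T -> R) :
  (forall n, bmeas (f_ n)) -> bmeas f ->
  (forall t, f_ n t @[n --> \oo] --> f t) ->
  measurable_fun setT G -> (forall n t, nrm (f_ n t) <= G t) ->
  (\int[mu]_t (G t)%:E < +oo)%E ->
  (\int[mu]_t (nrm (f t - f_ n t))%:E)%E @[n --> \oo] --> 0%E.
Proof.
move=> mf_ mf cf mG fG iG.
have G0 t : 0 <= G t := le_trans (nrm_ge0 _) (fG 0 t).
have fG' t : nrm (f t) <= G t by apply: nrm_lim_le (cf t) _ => n.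
have iG2 : mu.-integrable setT (fun t => (2 * G t)%:E).
  apply/integrableP; split; first by apply/measurable_EFinP; exact: measurable_funM.
  under eq_integral do rewrite abse_EFin ger0_norm ?mulr_ge0 // EFinM.
  rewrite ge0_integralZl_EFin //; first by rewrite lte_mul_pinfty.
  - by move=> t _; rewrite lee_fin.
  - exact/measurable_EFinP.
have [] := @dominated_convergence _ _ _ mu setT measurableT
  (fun n t => (nrm (f t - f_ n t))%:E) (fun=> 0%E) (fun t => (2 * G t)%:E) _ _ _ iG2 _.
- by move=> n; apply: bmeas_nrmE; exact: bmeasB.
- exact: measurable_cst.
- apply: aeW => t _; apply: cvg_EFin; first by exists 0.
  have /cvg_nrm0 := cf t; under eq_fun do rewrite nrmC; exact.
- apply: aeW => t n _; rewrite abse_EFin lee_fin ger0_norm ?nrm_ge0 //.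
  by apply: le_trans (nrmB _ _) _; rewrite mulr2n mulrDl !mul1r lerD.
by move=> _ _; rewrite integral0.
Qed.

(** An approximating value is kept only where its norm is at most 2 |f t|. Where f t is nonzero this
    eventually holds, so the limit is unchanged, and the integrable majorant 2 |f| forces nonzero
    level sets to have finite measure. *)
Lemma Bint_approx f : Bint f -> exists s : nat -> T -> X,
  [/\ forall n, simple mu measurable (s n),
      forall t, s n t @[n --> \oo] --> f t &
      forall n t, nrm (s n t) <= 2 * nrm (f t)].
Proof.
move=> [mf fi]; have [a [sa ca]] := mf.
pose b n t := nrm (a n t) <= 2 * nrm (f t).
have mb n : measurable (b n @^-1` [set true]).
  have -> : b n @^-1` [set true] = setT `&` (fun t => 2 * nrm (f t) - nrm (a n t)) @^-1` `[0, +oo[.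
    apply/seteqP; split=> t /=; rewrite /b; first by move=> h; split=> //; rewrite in_itv /= andbT subr_ge0.
    by move=> [_]; rewrite in_itv /= andbT subr_ge0.
  suff m : measurable_fun setT (fun t => 2 * nrm (f t) - nrm (a n t)).
    by apply: m => //; exact: measurable_itv.
  apply: measurable_funB; first by apply: measurable_funM => //; exact: bmeas_nrm.
  by apply: smap_measurable; exact: (smap_comp (@nrm R X) (sa n)).
have sb n : smap (b n).
  split; first exact: finite_finset.
  case; first exact: mb.
  have -> : b n @^-1` [set false] = ~` (b n @^-1` [set true]).
    by apply/seteqP; split=> t /=; case: (b n t).
  exact: measurableC.
pose s n t := if b n t then a n t else 0.
have ss n : smap (s n) by exact: (smap2 (fun (b : bool) x => if b then x else 0) (sb n) (sa n)).
have bs n t : nrm (s n t) <= 2 * nrm (f t).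
  by rewrite /s; case: ifP => // _; rewrite nrm0 mulr_ge0 // nrm_ge0.
exists s; split=> //.
  move=> n; split=> [|x x0]; first by case: (ss n).
  have mx : measurable (s n @^-1` [set x]) by case: (ss n) => _; exact.
  split=> //; have x0' := nrm_gt0 x0.
  (* Markov's inequality on the level set of x, where |x| <= 2 |f|. *)
  have h1 : ((nrm x)%:E * mu (s n @^-1` [set x]) < +oo)%E.
    rewrite -integral_cst //; apply: (@le_lt_trans _ _ (\int[mu]_t (2%:E * (nrm (f t))%:E)%E)%E).
      apply: (@le_trans _ _ (\int[mu]_(t in s n @^-1` [set x]) (2%:E * (nrm (f t))%:E)%E)%E).
        apply: ge0_le_integral => //=.
        - by move=> t _; rewrite lee_fin nrm_ge0.
        - by apply: measurable_funTS; apply/measurable_EFinP; apply: measurable_funM => //; exact: bmeas_nrm.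
        - by move=> t <-; rewrite -EFinM lee_fin.
      apply: ge0_subset_integral => //=.
      - by apply/measurable_EFinP; apply: measurable_funM => //; exact: bmeas_nrm.
      - by move=> t _; rewrite -EFinM lee_fin mulr_ge0 // nrm_ge0.
    rewrite ge0_integralZl_EFin //; first by rewrite lte_mul_pinfty.
    - by move=> t _; rewrite lee_fin nrm_ge0.
    - exact: bmeas_nrmE.
  move: h1; case: (mu _) => [r| |] //; rewrite ?ltry // gt0_muley ?lte_fin //.
move=> t; have [f0|f0] := eqVneq (f t) 0.
  have e n : s n t = 0.
    by apply: nrm_eq0; apply/eqP; rewrite eq_le nrm_ge0 andbT; have := bs n t; rewrite f0 nrm0 mulr0.
  by under eq_fun do rewrite e; rewrite f0; exact: cvg_cst.
apply/cvg_nrmP => e e0; have /cvg_nrmP ct := ca t.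
have [N1 h1] := ct e e0; have [N2 h2] := ct _ (nrm_gt0 f0).
exists (maxn N1 N2) => n; rewrite geq_max => /andP [n1 n2].
rewrite /s; have -> : b n t; last exact: h1.
have := nrmD (a n t - f t) (f t); rewrite subrK /b => h.
by apply: le_trans h _; rewrite mulr2n mulrDl !mul1r lerD2r h2.
Qed.

Lemma bochner_uniq f y y' : bmeas f ->
  is_bochner_integral mu f y -> is_bochner_integral mu f y' -> y = y'.
Proof.
move=> mf [_ [s [ss [i1 c1]]]] [_ [s' [ss' [i2 c2]]]].
have i0 (u : nat -> T -> X) : forall n, (0 <= \int[mu]_t (nrm (f t - u n t))%:E)%E.
  by move=> n; apply: integral_ge0 => t _; rewrite lee_fin nrm_ge0.
move: i1 i2 => /ecvg0P - /(_ (i0 _)) h1 /ecvg0P - /(_ (i0 _)) h2.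
apply/eqP; rewrite -subr_eq0; apply/eqP; apply: nrm_le0 => e e0.
have e4 : 0 < e / 4 by rewrite divr_gt0.
have [N1 H1] := h1 _ e4; have [N2 H2] := h2 _ e4.
have [N3 H3] := (cvg_nrmP _ _).1 c1 _ e4; have [N4 H4] := (cvg_nrmP _ _).1 c2 _ e4.
pose n := maxn (maxn N1 N2) (maxn N3 N4).
have {}H1 : _ := H1 n ltac:(by rewrite /n !leq_max leqnn ?orbT).
have {}H2 : _ := H2 n ltac:(by rewrite /n !leq_max leqnn ?orbT).
have {}H3 : _ := H3 n ltac:(by rewrite /n !leq_max leqnn ?orbT).
have {}H4 : _ := H4 n ltac:(by rewrite /n !leq_max leqnn ?orbT).
have := le_trans (SI_dist mf (ss n) (ss' n)) (leeD H1 H2); rewrite -EFinD lee_fin => H5.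
apply: le_trans (nrm_tri _ _ (simple_integral mu (s n))) _.
have := nrm_tri (simple_integral mu (s n)) y' (simple_integral mu (s' n)).
move=> h6; rewrite nrmC; apply: le_trans (lerD H3 (le_trans h6 (lerD H5 H4))) _; lra.
Qed.

Lemma bochner_of_dominated f (s : nat -> T -> X) (G : T -> R) : bmeas f ->
  (forall n, simple mu measurable (s n)) -> (forall t, s n t @[n --> \oo] --> f t) ->
  measurable_fun setT G -> (forall n t, nrm (s n t) <= G t) ->
  (\int[mu]_t (G t)%:E < +oo)%E ->
  exists y, is_bochner_integral mu f y /\ simple_integral mu (s n) @[n --> \oo] --> y.
Proof.
move=> mf ss cs mG sG iG.
have i1 := L1_dominated (fun n => simple_bmeas (ss n)) mf cs mG sG iG.
have i0 n : (0 <= \int[mu]_t (nrm (f t - s n t))%:E)%E.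
  by apply: integral_ge0 => t _; rewrite lee_fin nrm_ge0.
have [|y cy] := @cauchy_nrm R X (fun n => simple_integral mu (s n)).
  move=> e e0; have e2 : 0 < e / 2 by rewrite divr_gt0.
  have [N hN] := (ecvg0P i0).1 i1 _ e2; exists N => m n Nm Nn.
  have := le_trans (SI_dist mf (ss m) (ss n)) (leeD (hN _ Nm) (hN _ Nn)).
  by rewrite -EFinD lee_fin -splitr.
exists y; split=> //; split.
  by exists s; split=> //; exact: aeW.
by exists s.
Qed.

Lemma patch_setT f : patch (fun=> 0) setT f = f.
Proof. by apply/funext => t; rewrite patchT ?inE. Qed.

(** [bochner] is a choice among the possible values; by uniqueness, the chosen one is the limit
    along any dominated approximating sequence. *)
Lemma BI_dom f (s : nat -> T -> X) (G : T -> R) : bmeas f ->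
  (forall n, simple mu measurable (s n)) -> (forall t, s n t @[n --> \oo] --> f t) ->
  measurable_fun setT G -> (forall n t, nrm (s n t) <= G t) ->
  (\int[mu]_t (G t)%:E < +oo)%E ->
  is_bochner_integral mu f (BI f) /\ simple_integral mu (s n) @[n --> \oo] --> BI f.
Proof.
move=> mf ss cs mG sG iG; have [y [hy cy]] := bochner_of_dominated mf ss cs mG sG iG.
have hy' := hy; suff -> : BI f = y by [].
apply: (bochner_uniq mf) hy; rewrite /BI /bochner patch_setT.
exact: (xgetPex 0 (ex_intro _ y hy')).
Qed.

Lemma Bint_dom2 f : Bint f ->
  measurable_fun setT (fun t => 2 * nrm (f t)) /\ (\int[mu]_t (2 * nrm (f t))%:E < +oo)%E.
Proof.
move=> [mf fi]; split; first by apply: measurable_funM => //; exact: bmeas_nrm.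
under eq_integral do rewrite EFinM.
rewrite ge0_integralZl_EFin //; first by rewrite lte_mul_pinfty.
- by move=> t _; rewrite lee_fin nrm_ge0.
- exact: bmeas_nrmE.
Qed.

Lemma BIP f : Bint f -> is_bochner_integral mu f (BI f).
Proof.
move=> fi; have [s [ss cs ds]] := Bint_approx fi; have [mG iG] := Bint_dom2 fi.
by case: (BI_dom fi.1 ss cs mG ds iG).
Qed.

Lemma BI_le f : Bint f -> ((nrm (BI f))%:E <= \int[mu]_t (nrm (f t))%:E)%E.
Proof.
move=> fi; have [mf fint] := fi; have [s [ss cs ds]] := Bint_approx fi.
have [mG iG] := Bint_dom2 fi; have [_ c] := BI_dom mf ss cs mG ds iG.
have i1 := L1_dominated (fun n => simple_bmeas (ss n)) mf cs mG ds iG.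
have i0 n : (0 <= \int[mu]_t (nrm (f t - s n t))%:E)%E.
  by apply: integral_ge0 => t _; rewrite lee_fin nrm_ge0.
have f0 : (0 <= \int[mu]_t (nrm (f t))%:E)%E.
  by apply: integral_ge0 => t _; rewrite lee_fin nrm_ge0.
have ff : (\int[mu]_t (nrm (f t))%:E)%E \is a fin_num by rewrite ge0_fin_numE.
rewrite -(fineK ff) lee_fin; apply/ler_addgt0Pl => e e0.
have e2 : 0 < e / 2 by rewrite divr_gt0.
have [N1 h1] := (ecvg0P i0).1 i1 _ e2; have [N2 h2] := (cvg_nrmP _ _).1 c _ e2.
pose n := maxn N1 N2; have := h1 n (leq_maxl _ _); have := h2 n (leq_maxr _ _) => b2 b1.
have mz : bmeas (fun _ : T => 0 : X) by exact: bmeas_cst.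
have := int_nrm_dist (simple_bmeas (ss n)) mz mf.
have -> : (fun t => (nrm (s n t - 0))%:E) = (fun t => (nrm (s n t))%:E) by apply/funext => t; rewrite subr0.
have -> : (fun t => (nrm (f t - 0))%:E) = (fun t => (nrm (f t))%:E) by apply/funext => t; rewrite subr0.
move=> /(le_trans (SI_le (ss n))) /le_trans /(_ (leeD b1 (lexx _))).
rewrite -{1}(fineK ff) -EFinD lee_fin => b3.
have := nrm_tri (BI f) 0 (simple_integral mu (s n)); rewrite !subr0 nrmC.
by lra.
Qed.

Lemma BI_bound f (c : R) : Bint f -> (\int[mu]_t (nrm (f t))%:E <= c%:E)%E -> nrm (BI f) <= c.
Proof. by move=> fi h; rewrite -lee_fin; apply: le_trans (BI_le fi) h. Qed.

Lemma le_Bint f (G : T -> R) : bmeas f -> measurable_fun setT G ->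
  (forall t, nrm (f t) <= G t) -> (\int[mu]_t (G t)%:E < +oo)%E -> Bint f.
Proof.
move=> mf mG fG iG; split=> //; apply: le_lt_trans iG.
apply: ge0_le_integral => //=.
- by move=> t _; rewrite lee_fin nrm_ge0.
- exact: bmeas_nrmE.
- exact/measurable_EFinP.
- by move=> t _; rewrite lee_fin.
Qed.

Lemma BI_leG f (G : T -> R) (c : R) : bmeas f -> measurable_fun setT G ->
  (forall t, nrm (f t) <= G t) -> (\int[mu]_t (G t)%:E <= c%:E)%E -> nrm (BI f) <= c.
Proof.
move=> mf mG fG iG; apply: BI_bound.
  by apply: (le_Bint mf mG fG); apply: le_lt_trans iG _; rewrite ltry.
apply: le_trans iG; apply: ge0_le_integral => //=.
- by move=> t _; rewrite lee_fin nrm_ge0.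
- exact: bmeas_nrmE.
- exact/measurable_EFinP.
- by move=> t _; rewrite lee_fin.
Qed.

Lemma BintD f g : Bint f -> Bint g -> Bint (fun t => f t + g t).
Proof.
move=> [mf fi] [mg gi]; apply: (@le_Bint _ (fun t => nrm (f t) + nrm (g t))).
- exact: bmeasD.
- by apply: measurable_funD; exact: bmeas_nrm.
- by move=> t; exact: nrmD.
under eq_integral do rewrite EFinD.
rewrite ge0_integralD //=; try (by move=> *; rewrite lee_fin nrm_ge0); try exact: bmeas_nrmE.
exact: lte_add_pinfty.
Qed.

Lemma BI_D f g : Bint f -> Bint g -> BI (fun t => f t + g t) = BI f + BI g.
Proof.
move=> fi gi; have [s [ss cs ds]] := Bint_approx fi; have [mG iG] := Bint_dom2 fi.
have [s' [ss' cs' ds']] := Bint_approx gi; have [mG' iG'] := Bint_dom2 gi.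
have [_ c] := BI_dom fi.1 ss cs mG ds iG; have [_ c'] := BI_dom gi.1 ss' cs' mG' ds' iG'.
have := @BI_dom (fun t => f t + g t) (fun n t => s n t + s' n t) (fun t => 2 * nrm (f t) + 2 * nrm (g t)).
case.
- by have [] := BintD fi gi.
- by move=> n; apply: (@simple_comp2 _ _ _ _ X X X (fun x y => x + y)); rewrite ?addr0.
- by move=> t; exact: cvgD.
- exact: measurable_funD.
- by move=> n t; apply: le_trans (nrmD _ _) _; exact: lerD.
- under eq_integral do rewrite EFinD.
  rewrite ge0_integralD //=; try (by move=> *; rewrite lee_fin mulr_ge0 // nrm_ge0); try exact/measurable_EFinP.
  exact: lte_add_pinfty.
move=> _; under eq_fun do rewrite SI_add //.
by move=> c1; exact: (cvg_uniq c1 (cvgD c c')).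
Qed.

Lemma BI0 : BI (fun _ => 0 : X) = 0.
Proof.
apply: nrm_eq0; apply/eqP; rewrite eq_le nrm_ge0 andbT.
apply: (@BI_leG _ (fun=> 0)) => //; first exact: bmeas_cst.
  by move=> t; rewrite nrm0.
by rewrite integral0.
Qed.

Lemma Bint0 : Bint (fun _ => 0 : X).
Proof.
split; first exact: bmeas_cst.
by under eq_integral do rewrite nrm0; rewrite integral0.
Qed.

Lemma BI_sum I (r : seq I) (f_ : I -> T -> X) : (forall i, Bint (f_ i)) ->
  Bint (fun t => \sum_(i <- r) f_ i t) /\
  BI (fun t => \sum_(i <- r) f_ i t) = \sum_(i <- r) BI (f_ i).
Proof.
move=> hf; elim: r => [|i r [ih1 ih2]].
  rewrite big_nil; under eq_fun do rewrite big_nil.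
  by rewrite BI0; split=> //; exact: Bint0.
rewrite big_cons; have e : (fun t => \sum_(j <- i :: r) f_ j t) = (fun t => f_ i t + \sum_(j <- r) f_ j t).
  by apply/funext => t; rewrite big_cons.
by rewrite e BI_D // ih2; split=> //; exact: BintD.
Qed.

End OneSpace.

Lemma Bint_lin (X Y : completeNormedModType R[i]) (F : {linear X -> Y}) (M : R) (f : T -> X) :
  (forall x, nrm (F x) <= M * nrm x) -> Bint f ->
  Bint (F \o f) /\ BI (F \o f) = F (BI f).
Proof.
move=> hF fi; have [mf fint] := fi.
have M0 : 0 <= `|M| by [].
have {}hF x : nrm (F x) <= `|M| * nrm x.
  by apply: le_trans (hF x) _; rewrite ler_wpM2r ?nrm_ge0 // ler_norm.
have cF (u : nat -> X) x : u n @[n --> \oo] --> x -> F (u n) @[n --> \oo] --> F x.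
  move=> /cvg_nrmP h; apply/cvg_nrmP => e e0.
  have [|N hN] := h (e / (`|M| + 1)); first by rewrite divr_gt0 // ltr_wpDl.
  exists N => n Nn; rewrite -linearB; apply: le_trans (hF _) _.
  have := hN _ Nn; rewrite ler_pdivlMr ?ltr_wpDl // => h2.
  by apply: le_trans h2; rewrite mulrDr mulr1 mulrC lerDl nrm_ge0.
have [s [ss cs ds]] := Bint_approx fi; have [mG iG] := Bint_dom2 fi.
have [_ c] := BI_dom mf ss cs mG ds iG.
have mFf : bmeas (F \o f) by exact: bmeasF.
have iMG : (\int[mu]_t (`|M| * (2 * nrm (f t)))%:E < +oo)%E.
  under eq_integral do rewrite EFinM.
  rewrite ge0_integralZl_EFin //; first by rewrite lte_mul_pinfty.
  - by move=> t _; rewrite lee_fin mulr_ge0 // nrm_ge0.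
  - exact/measurable_EFinP.
have mMG : measurable_fun setT (fun t => `|M| * (2 * nrm (f t))) by exact: measurable_funM.
split.
  apply: (le_Bint mFf mMG) => // t /=; apply: le_trans (hF _) _.
  by rewrite ler_wpM2l // ler_peMl ?nrm_ge0 // ler1n.
have [] := @BI_dom Y (F \o f) (fun n => F \o s n) (fun t => `|M| * (2 * nrm (f t))).
- by [].
- by move=> n; case: (SI_lin F (ss n)).
- by move=> t; exact: cF.
- by [].
- by move=> n t /=; apply: le_trans (hF _) _; exact: ler_wpM2l.
- by [].
move=> _; have e n : simple_integral mu (F \o s n) = F (simple_integral mu (s n)).
  by case: (SI_lin F (ss n)).
by under eq_fun do rewrite e; move=> c1; apply: cvg_uniq c1 _; exact: cF.
Qed.

Section More.
Variable X : completeNormedModType R[i].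
Implicit Types f g : T -> X.

Lemma BintZ (c : R[i]) f : Bint f -> Bint (fun t => c *: f t) /\ BI (fun t => c *: f t) = c *: BI f.
Proof.
move=> fi; have := @Bint_lin X X (GRing.scale c) (nrm c) f _ fi; apply.
by move=> x /=; rewrite nrmZ.
Qed.

Lemma BintB f g : Bint f -> Bint g ->
  Bint (fun t => f t - g t) /\ BI (fun t => f t - g t) = BI f - BI g.
Proof.
move=> fi gi; have [i1 e1] := BintZ (-1) gi.
have e : (fun t => f t - g t) = (fun t => f t + -1 *: g t).
  by apply/funext => t; rewrite scaleN1r.
by rewrite e BI_D // e1 scaleN1r; split=> //; exact: BintD.
Qed.

Lemma BI_cvg (f_ : nat -> T -> X) f (G : T -> R) :
  (forall n, bmeas (f_ n)) -> bmeas f ->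
  (forall t, f_ n t @[n --> \oo] --> f t) ->
  measurable_fun setT G -> (forall n t, nrm (f_ n t) <= G t) ->
  (\int[mu]_t (G t)%:E < +oo)%E ->
  BI (f_ n) @[n --> \oo] --> BI f.
Proof.
move=> mf_ mf cf mG fG iG; have := L1_dominated mf_ mf cf mG fG iG.
have fG' t : nrm (f t) <= G t by apply: nrm_lim_le (cf t) _ => n.
have i1 n : Bint (f_ n) := le_Bint (mf_ n) mG (fG n) iG.
have i2 : Bint f := le_Bint mf mG fG' iG.
move=> /ecvg0P h; apply/cvg_nrmP => e e0; have [|N hN] := h _ e e0.
  by move=> n; apply: integral_ge0 => t _; rewrite lee_fin nrm_ge0.
exists N => n Nn; have [i3 e3] := BintB i2 (i1 n).
by rewrite nrmC -e3; apply: BI_bound (hN _ Nn).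
Qed.

Lemma BI_scalar (f : T -> cplx R) (x : X) : Bint f ->
  Bint (fun t => (f t : R[i]) *: x) /\ BI (fun t => (f t : R[i]) *: x) = (BI f : R[i]) *: x.
Proof.
move=> fi.
have lin : linear (fun c : cplx R => (c : R[i]) *: x).
  by move=> a b c; rewrite scalerDl -scalerA.
pose F : {linear cplx R -> X} := HB.pack (fun c : cplx R => (c : R[i]) *: x)
   (GRing.isLinear.Build _ _ _ _ _ lin).
by apply: (@Bint_lin (cplx R) X F (nrm x) f) => // c; rewrite nrmZ mulrC.
Qed.

End More.


(** Since g is nonnegative, replacing the approximants by their moduli keeps the limit, and it turns
    their simple integrals into Lebesgue integrals through [simple_nrm]. *)
Lemma BI_pos (g : T -> R) : (forall t, 0 <= g t) ->
  Bint (fun t => (g t)%:C : cplx R) ->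
  BI (fun t => (g t)%:C : cplx R) = (fine (\int[mu]_t (g t)%:E))%:C.
Proof.
move=> g0 fi; have [mf fint] := fi; have [s [ss cs ds]] := Bint_approx fi.
pose s' n t : cplx R := (nrm (s n t))%:C.
have [mG iG] := Bint_dom2 fi.
have ss' n : simple mu measurable (s' n).
  apply: (@simple_comp2 _ _ _ _ (cplx R) (cplx R) (cplx R) (fun x _ => (nrm x)%:C) (s n) (s n)) => //.
  by rewrite nrm0.
have ng t : nrm ((g t)%:C : cplx R) = g t by rewrite nrm_real ger0_norm.
have cs' t : s' n t @[n --> \oo] --> ((g t)%:C : cplx R).
  apply/cvg_nrmP => e e0; have /cvg_nrmP/(_ e e0) [N hN] := cs t.
  exists N => n Nn; rewrite /s' -rmorphB nrm_real -[X in _ - X]ng.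
  by apply: le_trans (nrm_dist _ _) _; exact: hN.
have ds' n t : nrm (s' n t) <= 2 * nrm ((g t)%:C : cplx R).
  by rewrite /s' nrm_real ger0_norm ?nrm_ge0.
have [_ c] := BI_dom mf ss' cs' mG ds' iG.
have eSI n : simple_integral mu (s' n) = (fine (\int[mu]_t (nrm (s' n t))%:E))%:C.
  have [fs _] := ss' n.
  rewrite (simple_nrm (ss' n)) /= /simple_integral !fsbig_finite //= rmorph_sum.
  apply: eq_big_seq => x; rewrite in_fset_set // inE => -[t _ <-].
  by rewrite rmorphM /=; congr (_ * _); rewrite /s' nrm_real ger0_norm ?nrm_ge0.
have i1 := L1_dominated (fun n => simple_bmeas (ss' n)) mf cs' mG ds' iG.
apply: cvg_uniq c _.
have i0 n : (0 <= \int[mu]_t (nrm ((g t)%:C - s' n t : cplx R))%:E)%E.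
  by apply: integral_ge0 => t _; rewrite lee_fin nrm_ge0.
have fint' : (\int[mu]_t (g t)%:E < +oo)%E by under eq_integral do rewrite -ng.
have f1 : (\int[mu]_t (g t)%:E)%E \is a fin_num.
  by rewrite ge0_fin_numE // integral_ge0 // => t _; rewrite lee_fin.
have mz : bmeas (fun _ : T => 0 : cplx R) by exact: bmeas_cst.
have f2 n : (\int[mu]_t (nrm (s' n t))%:E)%E \is a fin_num.
  by rewrite (simple_nrm (ss' n)).
apply/cvg_nrmP => e e0; have [N hN] := (ecvg0P i0).1 i1 _ e0; exists N => n Nn.
rewrite eSI -rmorphB nrm_real; have b1 := hN _ Nn.
have e1 (h : T -> cplx R) : (\int[mu]_t (nrm (h t - 0))%:E = \int[mu]_t (nrm (h t))%:E)%E.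
  by under eq_integral do rewrite subr0.
have e2 (h : T -> cplx R) : (\int[mu]_t (nrm (0 - h t))%:E = \int[mu]_t (nrm (h t))%:E)%E.
  by under eq_integral do rewrite sub0r nrmN.
have e3 : (\int[mu]_t (nrm ((g t)%:C : cplx R))%:E = \int[mu]_t (g t)%:E)%E.
  by under eq_integral do rewrite ng.
have := int_nrm_dist (simple_bmeas (ss' n)) mz mf.
rewrite e1 e1 e3 => /le_trans /(_ (leeD b1 (lexx _))).
have := int_nrm_dist mf mz (simple_bmeas (ss' n)).
rewrite e1 e1 e3 => h3 h4; have : (\int[mu]_t (nrm (s' n t - (g t)%:C : cplx R))%:E <= e%:E)%E.
  by under eq_integral do rewrite nrmC.
move=> /leeD /(_ (lexx (\int[mu]_t (nrm (s' n t))%:E)%E)) /(le_trans h3).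
move: h4; rewrite -(fineK f1) -(fineK (f2 n)) -!EFinD !lee_fin /=.
by rewrite ler_norml; lra.
Qed.

Lemma int_posneg (h : T -> R) : (\int[mu]_t (h t)%:E =
  \int[mu]_t (Num.max (h t) 0)%:E - \int[mu]_t (Num.max (- h t) 0)%:E)%E.
Proof.
by rewrite integralE; congr (_ - _)%E; apply: eq_integral => t _;
  rewrite ?funeposE ?funenegE EFin_max.
Qed.

(** Positive and negative parts are 1-Lipschitz functions of h vanishing at 0, hence inherit
    measurability and integrability from h. *)
Lemma BI_real (h : T -> R) : Bint (fun t => (h t)%:C : cplx R) ->
  BI (fun t => (h t)%:C : cplx R) = (fine (\int[mu]_t (h t)%:E))%:C.
Proof.
move=> fi; have [mf fint] := fi; rewrite int_posneg.
have lip (a b : R) : `|Num.max a 0 - Num.max b 0| <= `|a - b|.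
  have := ler_norm (a - b); have := ler_norm (b - a); rewrite distrC.
  by case: (leP a 0) => h1; case: (leP b 0) => h2 h3 h4; rewrite ler_norml; apply/andP; split; lra.
have key (F : R -> R) : F 0 = 0 -> (forall a b, `|F a - F b| <= `|a - b|) ->
    Bint (fun t => (F (h t))%:C : cplx R).
  move=> F0 hF; have m1 : bmeas (fun t => (F (h t))%:C : cplx R).
    apply: (@bmeasF _ _ _ (cplx R) (cplx R) (fun z => (F (complex.Re z))%:C) (fun t => (h t)%:C)); last exact: mf.
    move=> u x /cvg_nrmP hu; apply/cvg_nrmP => e e0; have [N hN] := hu e e0.
    exists N => n Nn; rewrite -rmorphB nrm_real; apply: le_trans (hF _ _) _.
    by rewrite -raddfB; apply: le_trans (Re_nrm _) _; exact: hN.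
  apply: (@le_Bint _ _ (fun t => nrm ((h t)%:C : cplx R))).
  - exact: m1.
  - exact: bmeas_nrm mf.
  - by move=> t; rewrite !nrm_real; have := hF (h t) 0; rewrite F0 !subr0.
  - exact: fint.
have i1 : Bint (fun t => (Num.max (h t) 0)%:C : cplx R).
  by apply: (key (fun a => Num.max a 0)) => //; rewrite maxxx.
have i2 : Bint (fun t => (Num.max (- h t) 0)%:C : cplx R).
  apply: (key (fun a => Num.max (- a) 0)) => [|a b]; first by rewrite oppr0 maxxx.
  by apply: le_trans (lip _ _) _; rewrite -opprD normrN.
have p0 (a : R) : 0 <= Num.max a 0 by rewrite le_max lexx orbT.
have -> : (fun t => (h t)%:C : cplx R) =
    (fun t => ((Num.max (h t) 0)%:C : cplx R) - ((Num.max (- h t) 0)%:C : cplx R)).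
  apply/funext => t; rewrite -[RHS]/(((Num.max (h t) 0)%:C - (Num.max (- h t) 0)%:C)%R) -rmorphB; congr (_%:C).
  by case: (leP (h t) 0); case: (leP (- h t) 0); lra.
have [_ ->] := BintB i1 i2; rewrite !BI_pos //.
have fin (g : T -> R) : (forall t, 0 <= g t) -> Bint (fun t => (g t)%:C : cplx R) ->
    (\int[mu]_t (g t)%:E)%E \is a fin_num.
  move=> g0 [_]; under eq_integral do rewrite nrm_real ger0_norm //.
  by rewrite -ge0_fin_numE //; apply: integral_ge0 => t _; rewrite lee_fin.
rewrite (fineB (fin _ (fun t => p0 _) i1) (fin _ (fun t => p0 _) i2)).
set a := fine _; set b := fine _; by rewrite [RHS](raddfB (real_complex R)).
Qed.

(** Links the Bochner integral to the componentwise integral in which the Fourier transform is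
    written. *)
Lemma BI_complex (f : T -> cplx R) : Bint f -> BI f = complex_integral mu f.
Proof.
move=> fi; have [mf fint] := fi.
have key (p : R[i] -> R) : (forall x y, p x - p y = p (x - y)) -> (forall x, `|p x| <= nrm x) ->
    Bint (fun t => (p (f t))%:C : cplx R).
  move=> pB pn; apply: (@le_Bint _ _ (fun t => nrm (f t))); last 3 first.
  - exact: bmeas_nrm mf.
  - by move=> t; rewrite nrm_real; exact: pn.
  - exact: fint.
  apply: (@bmeasF _ _ _ (cplx R) (cplx R) (fun z => (p z)%:C) f); last exact: mf.
  move=> u x /cvg_nrmP hu; apply/cvg_nrmP => e e0; have [N hN] := hu e e0.
  exists N => n Nn; rewrite -rmorphB nrm_real pB; apply: le_trans (pn _) _.
  exact: hN.
have i1 := key (@complex.Re R) (fun x y => esym (raddfB _ x y)) (@Re_nrm R).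
have i2 := key (@complex.Im R) (fun x y => esym (raddfB _ x y)) (@Im_nrm R).
have [i3 e3] := BintZ ((0 +i* 1) : R[i]) i2.
have -> : f = (fun t => ((complex.Re (f t))%:C : cplx R) + (0 +i* 1 : R[i]) *: ((complex.Im (f t))%:C : cplx R)).
  apply/funext => t; rewrite {1}[f t]complexE /=; congr (_ + _).
rewrite BI_D // e3 !BI_real // /complex_integral /Rintegral.
set a := fine _; set b := fine _.
have -> : (a%:C + (0 +i* 1 : R[i]) *: (b%:C : cplx R) : cplx R) = a +i* b.
  by rewrite -[LHS]/((a%:C + (0 +i* 1 : R[i]) * b%:C)%R); simpc.
congr (_ +i* _); congr fine; apply: eq_integral => t _.
  by rewrite -[X in _ = (complex.Re X)%:E]/(((complex.Re (f t))%:C + (0 +i* 1 : R[i]) * (complex.Im (f t))%:C)%R); simpc.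
by rewrite -[X in _ = (complex.Im X)%:E]/(((complex.Re (f t))%:C + (0 +i* 1 : R[i]) * (complex.Im (f t))%:C)%R); simpc.
Qed.

End BochnerIntegral.

Lemma smap_preimage d1 d2 (T1 : measurableType d1) (T2 : measurableType d2) (Z : Type)
    (s : T2 -> Z) (phi : T1 -> T2) : measurable_fun setT phi -> smap s -> smap (s \o phi).
Proof.
move=> mphi ss; split.
  by apply: (@sub_finite_set _ _ (range s)) => [_ [t _ <-]|]; [exists (phi t)|case: ss].
by move=> z; rewrite comp_preimage -[X in measurable X]setTI; apply: mphi => //; case: ss => _; exact.
Qed.

(** * Invariance of integrals under measure-preserving maps *)

Section MeasurePreserving.
Context (R : realType) (disp : measure_display) (T : measurableType disp).
Variable mu : {measure set T -> \bar R}.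
Variables phi psi : T -> T.
Hypothesis mphi : measurable_fun setT phi.
Hypothesis phiK : cancel psi phi.
Hypothesis mu_phi : forall A, measurable A -> mu (phi @^-1` A) = mu A.

Lemma int_preserving (g : T -> R) : measurable_fun setT g -> (forall t, 0 <= g t) ->
  (\int[mu]_t (g (phi t))%:E = \int[mu]_t (g t)%:E)%E.
Proof.
move=> mg g0.
have -> : (\int[mu]_t (g t)%:E = \int[pushforward mu phi]_t (g t)%:E)%E.
  by apply: eq_measure_integral => A mA _; rewrite -mu_phi.
rewrite ge0_integral_pushforward //; first exact/measurable_EFinP.
by move=> t _; rewrite lee_fin.
Qed.

Variable X : completeNormedModType R[i].

Lemma simple_preserving (s : T -> X) : simple mu measurable s ->
  simple mu measurable (s \o phi) /\ simple_integral mu (s \o phi) = simple_integral mu s.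
Proof.
move=> ss; have sm := simple_smap ss; have sm' := smap_preimage mphi sm.
have e x : mu ((s \o phi) @^-1` [set x]) = mu (s @^-1` [set x]).
  by rewrite comp_preimage mu_phi //; case: sm => _; exact.
split; last first.
  rewrite /simple_integral; have -> : range (s \o phi) = range s.
    apply/seteqP; split=> _ [t _ <-]; first by exists (phi t).
    by exists (psi t) => //=; rewrite phiK.
  by apply: eq_fsbigr => x _; rewrite e.
split=> [|x x0]; first by case: sm'.
by split; [case: sm' => _; exact|rewrite e; case: ss => _ /(_ x x0) []].
Qed.

Lemma BI_preserving (f : T -> X) : Bint mu f ->
  Bint mu (f \o phi) /\ BI mu (f \o phi) = BI mu f.
Proof.
move=> fi; have [mf fint] := fi; have [s [ss cs ds]] := Bint_approx fi.
have [mG iG] := Bint_dom2 fi; have [_ c] := BI_dom mf ss cs mG ds iG.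
have mf' : bmeas (f \o phi).
  by have [a [sa ca]] := mf; exists (fun n => a n \o phi); split=> [n|t]; [exact: smap_preimage|exact: ca].
split.
  split=> //; rewrite /= (int_preserving (g := fun t => nrm (f t))) //; first exact: bmeas_nrm.
  by move=> t; exact: nrm_ge0.
have [] := @BI_dom _ _ _ mu X (f \o phi) (fun n => s n \o phi) (fun t => 2 * nrm (f (phi t))) mf'.
- by move=> n; case: (simple_preserving (ss n)).
- by move=> t; exact: cs.
- by apply: measurable_funM => //; exact: bmeas_nrm.
- by move=> n t; exact: ds.
- rewrite (int_preserving (g := fun t => 2 * nrm (f t))) //.
  by move=> t; rewrite mulr_ge0 // nrm_ge0.
move=> _; have e n : simple_integral mu (s n \o phi) = simple_integral mu (s n).
  by case: (simple_preserving (ss n)).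
by move=> c1; apply: (cvg_uniq c1); move: c; apply: cvg_trans; apply: near_eq_cvg; near=> n; rewrite e.
Unshelve. all: by end_near. Qed.

End MeasurePreserving.

(** * Approximation by grids on R^n and translation invariance of Lebesgue measure *)

Section Tuples.
Context (R : realType).

Definition clip (k : nat) (x : R) : R := Num.max (- k%:R) (Num.min x k%:R).

(** Rounding down to multiples of 1/(k+1), after clipping to [-k, k]. These finitely valued maps
    tend to the identity, so [f \o grid k] tends to f whenever f is sequentially continuous. *)
Definition grid (k : nat) (x : R) : R := (Num.floor (clip k x * k.+1%:R))%:~R / k.+1%:R.

Lemma smap_grid k : smap (grid k).
Proof.
have mg : measurable_fun setT (grid k).
  apply: nondecreasing_measurable => // x y xy; rewrite /grid ler_pM2r ?invr_gt0 ?ltr0n //.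
  rewrite ler_int; apply: le_floor; rewrite ler_wpM2r // /clip.
  by rewrite ge_max le_max lexx /= le_max le_min !ge_min xy lexx !orbT.
split; last by move=> z; rewrite -[X in measurable X]setTI; apply: mg => //; exact: measurable_set1.
pose M := (k * k.+1)%N.
apply: (@sub_finite_set _ _ ((fun i : nat => (i%:R - M%:R) / k.+1%:R : R) @` `I_(M + M).+1)).
  move=> _ [x _ <-]; pose z := clip k x * k.+1%:R.
  have z1 : - M%:R <= z.
    by rewrite /M natrM -mulNr ler_wpM2r // /clip le_max lexx.
  have z2 : z <= M%:R.
    by rewrite /M natrM ler_wpM2r // /clip ge_max ge_min lexx orbT andbT; apply: le_trans (_ : 0 <= _); rewrite ?oppr_le0.
  have f1 : - M%:Z <= Num.floor z by rewrite floor_ge_int mulrNz.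
  have f2 : Num.floor z <= M%:Z.
    by rewrite -(ler_int R); apply: le_trans (floor_le _) z2.
  exists (absz (Num.floor z + M%:Z)).
    rewrite /= ltnS -lez_nat gez0_abs; last by rewrite -lerBlDr sub0r.
    by rewrite PoszD lerD2r.
  rewrite /grid -/z; congr (_ / _).
  rewrite pmulrn gez0_abs; last by rewrite -lerBlDr sub0r.
  by rewrite intrD addrK.
by apply: finite_image; exact: finite_II.
Qed.

Lemma grid_cvg (u : nat -> R) (x : R) : u n @[n --> \oo] --> x ->
  grid n (u n) @[n --> \oo] --> x.
Proof.
move=> /cvgrPdist_le h; apply/cvgrPdist_le => e e0.
have e2 : 0 < e / 2 by rewrite divr_gt0.
have [N1 _ h1] := h _ e2; have [N2 _ h2] := h _ ltr01.
near=> n; have un : `|x - u n| <= e / 2 by apply: h1; near: n; exists N1.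
have un1 : `|x - u n| <= 1 by apply: h2; near: n; exists N2.
have nx : `|x| + 1 <= n%:R by near: n; exact: nbhs_infty_ger.
have ne : 2 / e <= n%:R by near: n; exact: nbhs_infty_ger.
have [a1 a2] : - n%:R <= u n /\ u n <= n%:R.
  move: nx un1; rewrite ler_norml; have := ler_norm x; have := ler_norm (- x); rewrite normrN.
  by move=> ? ? ? /andP [? ?]; split; lra.
have -> : grid n (u n) = (Num.floor (u n * n.+1%:R))%:~R / n.+1%:R.
  by rewrite /grid /clip (min_idPl a2) (max_idPr a1).
have n0 : 0 < n.+1%:R :> R by rewrite ltr0n.
have b1 : (Num.floor (u n * n.+1%:R))%:~R / n.+1%:R <= u n by rewrite ler_pdivrMr // floor_le.
have b2 : u n - n.+1%:R^-1 <= (Num.floor (u n * n.+1%:R))%:~R / n.+1%:R.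
  rewrite ler_pdivlMr // mulrBl mulVf ?gt_eqF // lerBlDr.
  by have := floorD1_gt (u n * n.+1%:R); rewrite intrD => /ltW.
have b3 : n.+1%:R^-1 <= e / 2.
  rewrite -[e / 2]invrK lef_pV2 ?posrE ?invr_gt0 //; rewrite invf_div.
  by apply: le_trans ne _; rewrite ler_nat.
move: b1 b2 b3; set q := _ / _; set w := _^-1 => b1 b2 b3.
by move: un; rewrite !ler_norml => /andP [? ?]; apply/andP; split; lra.
Unshelve. all: by end_near. Qed.

Lemma smap_seq d (T : measurableType d) (Z : Type) (I : Type) (r : seq I) (g : I -> T -> Z) :
  (forall i, smap (g i)) -> smap (fun t => [seq g i t | i <- r]).
Proof.
move=> hg; elim: r => [|i r ih] /=; last exact: (smap2 cons (hg i) ih).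
split; first by apply: (@sub_finite_set _ _ [set [::]]) => // _ [t _ <-].
move=> z; have [->|zc] := pselect (z = [::]).
  by rewrite (_ : _ @^-1` _ = setT) //; apply/seteqP; split.
by rewrite (_ : _ @^-1` _ = set0) //; apply/seteqP; split=> // t /= h; apply: zc.
Qed.

Definition tgrid n k (t : n.-tuple R) : n.-tuple R := map_tuple (grid k) t.

Lemma smap_tgrid n k : smap (@tgrid n k).
Proof.
have -> : @tgrid n k = insubd (nseq_tuple n 0) \o (fun t => [seq grid k (tnth t i) | i <- enum 'I_n]).
  apply/funext => t; apply: val_inj; rewrite /= val_insubd size_map size_enum_ord eqxx.
  by rewrite (map_comp (grid k) (tnth t)) -[in LHS](map_tnth_enum t).
apply: smap_comp; apply: (smap_seq (enum 'I_n) (g := fun i t => grid k (tnth t i))) => i.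
apply: (smap_preimage (phi := fun t : n.-tuple R => tnth t i)); last exact: smap_grid.
exact: measurable_tnth.
Qed.

Definition tcvg n (u : nat -> n.-tuple R) (t : n.-tuple R) :=
  forall i, tnth (u k) i @[k --> \oo] --> tnth t i.

Definition seqcont n (V : normedModType R[i]) (f : n.-tuple R -> V) :=
  forall u t, tcvg u t -> f (u k) @[k --> \oo] --> f t.

Lemma seqcont_bmeas n (V : normedModType R[i]) (f : n.-tuple R -> V) :
  seqcont f -> bmeas f.
Proof.
move=> hf; exists (fun k => f \o @tgrid n k); split=> [k|t].
  exact: (smap_comp f (@smap_tgrid n k)).
apply: (hf (fun k => tgrid k t)) => i.
rewrite (_ : (fun k => _) = (fun k => grid k (tnth t i))); last first.
  by apply/funext => k; rewrite tnth_map.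
by apply: (@grid_cvg (fun=> tnth t i)); exact: cvg_cst.
Qed.

Lemma bmeas_seqcontR (V : normedModType R[i]) (f : R -> V) :
  (forall (u : nat -> R) x, u n @[n --> \oo] --> x -> f (u n) @[n --> \oo] --> f x) ->
  bmeas f.
Proof.
move=> hf; exists (fun k => f \o grid k); split=> [k|t].
  exact: (smap_comp f (smap_grid k)).
by apply: hf; apply: (@grid_cvg (fun=> t)); exact: cvg_cst.
Qed.

Definition shiftc n (i : 'I_n) (s : R) (t : n.-tuple R) : n.-tuple R :=
  [tuple tnth t j + (if j == i then s else 0) | j < n].

Lemma tnth_shiftc n (i : 'I_n) s t j : tnth (shiftc i s t) j = tnth t j + (if j == i then s else 0).
Proof. by rewrite tnth_mktuple. Qed.

Lemma shiftcK n (i : 'I_n) s : cancel (@shiftc n i (- s)) (@shiftc n i s).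
Proof.
move=> t; apply: eq_from_tnth => j; rewrite !tnth_shiftc.
by case: ifP; rewrite ?addr0 // subrK.
Qed.

Lemma shiftcD n (i : 'I_n) s s' t : shiftc i s (shiftc i s' t) = shiftc i (s + s') t.
Proof.
apply: eq_from_tnth => j; rewrite !tnth_shiftc.
by case: ifP; rewrite ?addr0 // -addrA [s' + s]addrC.
Qed.

Lemma measurable_shiftc n (i : 'I_n) s : measurable_fun setT (@shiftc n i s).
Proof.
apply/measurable_fun_tnthP => j.
rewrite (_ : _ \o _ = (fun t => tnth t j + (if j == i then s else 0))); last first.
  by apply/funext => t /=; rewrite tnth_shiftc.
by apply: measurable_funD => //; exact: measurable_tnth.
Qed.

Lemma lebesgue_shift s (A : set R) : measurable A ->
  lebesgue_measure ((fun x => x + s) @^-1` A) = @lebesgue_measure R A.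
Proof.
move=> mA.
rewrite -[LHS]/(pushforward lebesgue_measure ((fun x => x + s) : _ -> measurableTypeR R) A).
apply/esym/lebesgue_measure_unique => //= [|ms _ [[a b]] _ <-]; first exact: measurable_funD.
rewrite /= /pushforward.
rewrite (_ : _ @^-1` _ = `]a - s, b - s]%classic); last first.
  by apply/seteqP; split=> x /=; rewrite !in_itv /= ltrBlDr lerBrDr.
rewrite !lebesgue_measure_itv /= !lte_fin ltrD2r; case: ifP => // _.
by rewrite -!EFinD opprB addrA subrK.
Qed.

(** By induction on n. Coordinate 0 is the factor [lebesgue_measure] of the last product, so its
    shift acts on sections; a shift of another coordinate acts on the other factor, where the
    induction hypothesis is used through a pushforward. *)
Lemma lebesgue_tuple_shift n (i : 'I_n) s (A : set (n.-tuple R)) : measurable A ->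
  lebesgue_tuple R n (shiftc i s @^-1` A) = lebesgue_tuple R n A.
Proof.
elim: n i A => [[]//|n ih] i A mA; rewrite /= /lebesgue_step /pushforward.
have mA' : measurable (@tcons R n @^-1` A).
  by rewrite -[X in measurable X]setTI; apply: measurable_tcons.
rewrite /product_measure1 /=.
have [-> {i}|[j ->]] : i = ord0 \/ exists j : 'I_n, i = lift ord0 j.
- by case: (unliftP ord0 i) => [j ->|->]; [right; exists j|left].
- apply: eq_integral => x _ /=.
  rewrite (_ : xsection _ x = (fun y => y + s) @^-1` (xsection (@tcons R n @^-1` A) x)).
    by rewrite lebesgue_shift //; exact: measurable_xsection.
  apply/seteqP; split=> y /=; rewrite /xsection /= !inE /=;
  rewrite (_ : shiftc ord0 s (tcons (x, y)) = tcons (x, y + s)) //;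
  by apply: eq_from_tnth => k; rewrite tnth_shiftc; case: (unliftP ord0 k) => [k' ->|->];
    rewrite ?tnth0 ?tnthS //= addr0.
have mh := measurable_fun_xsection (@lebesgue_measure R) mA'.
transitivity (\int[lebesgue_tuple R n]_x (@lebesgue_measure R \o xsection (@tcons R n @^-1` A)) (shiftc j s x))%E.
  apply: eq_integral => x _ /=; congr (lebesgue_measure _).
  apply/seteqP; split=> y /=; rewrite /xsection /= !inE /=;
  rewrite (_ : shiftc (lift ord0 j) s (tcons (x, y)) = tcons (shiftc j s x, y)) //;
  by apply: eq_from_tnth => k; rewrite tnth_shiftc; case: (unliftP ord0 k) => [k' ->|->];
    rewrite ?tnth0 ?tnthS //= ?addr0 // tnth_shiftc (inj_eq lift_inj).
have -> : (\int[lebesgue_tuple R n]_x (@lebesgue_measure R \o xsection (@tcons R n @^-1` A)) x =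
   \int[pushforward (lebesgue_tuple R n) (shiftc j s)]_x (@lebesgue_measure R \o xsection (@tcons R n @^-1` A)) x)%E.
  apply: eq_measure_integral => [|mf B mB _]; first exact: measurable_shiftc.
  by rewrite -[RHS]/(lebesgue_tuple R n (shiftc j s @^-1` B)) (ih j B mB).
by rewrite [RHS](ge0_integral_pushforward (measurable_shiftc j s)).
Qed.

Lemma BI_shift (X : completeNormedModType R[i]) n (i : 'I_n) s (f : n.-tuple R -> X) :
  Bint (lebesgue_tuple R n) f ->
  Bint (lebesgue_tuple R n) (f \o shiftc i s) /\
  BI (lebesgue_tuple R n) (f \o shiftc i s) = BI (lebesgue_tuple R n) f.
Proof.
move=> fi; apply: BI_preserving (fi); first exact: measurable_shiftc.
  exact: shiftcK.
exact: lebesgue_tuple_shift.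
Qed.

End Tuples.

(** * The complex exponential and its Taylor remainders *)

Section Cexp.
Variable R : realType.
Implicit Types x t : R.

Lemma sin_le x : `|sin x| <= `|x|.
Proof.
wlog x0 : x / 0 <= x => [h|].
  by have [/h //|/ltW x0] := leP 0 x; rewrite -(normrN (sin x)) -sinN -(normrN x); apply: h; rewrite oppr_ge0.
have [] := @MVT_segment R sin cos 0 x x0.
- by apply: continuous_subspaceT => y; exact: continuous_sin.
move=> c _; rewrite sin0 !subr0 => ->; rewrite normrM ler_piMl //.
exact: cos_max.
Qed.

Lemma cos_half x : 1 - cos x = 2 * sin (x / 2) ^+ 2.
Proof.
rewrite {1}(splitr x) cosD -!expr2.
by have := cos2Dsin2 (x / 2); lra.
Qed.

Lemma cos_le2 x : `|cos x - 1| <= x ^+ 2.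
Proof.
rewrite distrC cos_half ger0_norm; last by rewrite mulr_ge0 // sqr_ge0.
have h : sin (x / 2) ^+ 2 <= (x / 2) ^+ 2.
  by rewrite -[X in X <= _]real_normK ?num_real // -[X in _ <= X]real_normK ?num_real // lerXn2r ?nnegrE // sin_le.
by apply: le_trans (_ : 2 * (x / 2) ^+ 2 <= _); [rewrite ler_wpM2l|have := sqr_ge0 x; lra].
Qed.

Lemma cos_le1d x : `|cos x - 1| <= `|x|.
Proof.
rewrite distrC cos_half ger0_norm; last by rewrite mulr_ge0 // sqr_ge0.
rewrite -[sin _ ^+ 2]real_normK ?num_real //.
have h1 := sin_le (x / 2); have h2 := sin_max (x / 2).
rewrite normrM [`|2^-1|]ger0_norm ?invr_ge0 // in h1.
have : `|sin (x / 2)| ^+ 2 <= `|sin (x / 2)| by rewrite expr2 ler_piMl.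
lra.
Qed.

Lemma sin_le2 x : `|sin x - x| <= x ^+ 2.
Proof.
wlog x0 : x / 0 <= x => [h|].
  have [/h //|/ltW x0] := leP 0 x.
  by rewrite -normrN opprB -[x in x - _]opprK addrC -sinN -sqrrN; apply: h; rewrite oppr_ge0.
have [] := @MVT_segment R (fun y => sin y - y) (fun y => cos y - 1) 0 x x0.
- apply: continuous_subspaceT => y; apply: continuousB; first exact: continuous_sin.
  exact: cvg_id.
move=> c; rewrite in_itv /= => /andP [c0 cx]; rewrite sin0 !subr0 => ->.
rewrite normrM expr2 (ger0_norm x0) ler_wpM2r //; apply: le_trans (cos_le1d c) _.
by rewrite ger0_norm.
Qed.

Lemma expi_le t : nrm (expi t - 1) <= `|t|.
Proof.
rewrite nrm_def /= subr0 -[X in _ <= X]sqrtr_sqr ler_wsqrtr //.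
have := cos_half t; have h1 := sin_le (t / 2); have := cos2Dsin2 t.
have : sin (t / 2) ^+ 2 <= (t / 2) ^+ 2.
  by rewrite -[X in X <= _]real_normK ?num_real // -[X in _ <= X]real_normK ?num_real // lerXn2r ?nnegrE.
by rewrite sqrrB1; lra.
Qed.

Lemma expi_le2 t : nrm (expi t - 1 - (0 +i* t)) <= 2 * t ^+ 2.
Proof.
apply: le_trans (nrm_ReIm _) _; rewrite /= !subr0.
by have := cos_le2 t; have := sin_le2 t; lra.
Qed.

Lemma expR_sub1_le x : `|expR x - 1| <= `|x| * expR `|x|.
Proof.
have h1 := expR_ge1Dx x; have h2 := expR_ge1Dx (- x).
have [x0|x0] := leP 0 x.
  rewrite (ger0_norm x0) ger0_norm; last by rewrite subr_ge0; lra.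
  have e1 := expRxMexpNx_1 x; have : expR x * (1 - x) <= expR x * expR (- x) by rewrite ler_wpM2l ?expR_ge0.
  lra.
have e1 : expR x <= 1 by rewrite -[X in _ <= X]expR0 ler_expR ltW.
rewrite ler0_norm ?subr_le0 // (ltr0_norm x0).
have : - x * 1 <= - x * expR (- x) by rewrite ler_wpM2l ?oppr_ge0 ?(ltW x0) // -[X in X <= _]expR0 ler_expR oppr_ge0 ltW.
lra.
Qed.

Lemma expR_le2 x : `|expR x - 1 - x| <= x ^+ 2 * expR `|x|.
Proof.
have h1 := expR_ge1Dx x; have h2 := expR_ge1Dx (- x).
rewrite ger0_norm; last lra.
have e1 := expRxMexpNx_1 x; have h3 : expR x * (1 - x) <= expR x * expR (- x) by rewrite ler_wpM2l ?expR_ge0.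
apply: le_trans (_ : x * (expR x - 1) <= _); first lra.
apply: le_trans (ler_norm _) _; rewrite normrM -(real_normK (num_real x)) expr2 -mulrA ler_wpM2l //.
exact: expR_sub1_le.
Qed.

Lemma expR_le0 x : x <= 0 -> `|expR x - 1| <= `|x|.
Proof.
move=> x0; have h1 := expR_ge1Dx x.
have e1 : expR x <= 1 by rewrite -[X in _ <= X]expR0 ler_expR.
by rewrite ler0_norm ?subr_le0 // (ler0_norm x0); lra.
Qed.

Definition cexp (z : R[i]) : R[i] := (expR (complex.Re z))%:C * expi (complex.Im z).

Lemma cexpD (z w : R[i]) : cexp (z + w) = cexp z * cexp w.
Proof. by rewrite /cexp !raddfD /= expRD expiD rmorphM mulrACA. Qed.

Lemma cexp0 : cexp 0 = 1.
Proof. by rewrite /cexp /= expR0 expi0 mulr1. Qed.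

Lemma nrm_cexp z : nrm (cexp z) = expR (complex.Re z).
Proof. by rewrite /cexp nrmM nrm_expi mulr1 nrm_real ger0_norm ?expR_ge0. Qed.

Lemma cexp_natr z n : cexp (z * n%:R) = cexp z ^+ n.
Proof.
elim: n => [|n ih]; first by rewrite mulr0 cexp0 expr0.
by rewrite -addn1 natrD mulrDr mulr1 cexpD ih addn1 exprSr.
Qed.

Lemma cexp_real x : cexp x%:C = (expR x)%:C.
Proof. by rewrite /cexp /= expi0 mulr1. Qed.

Lemma cexp_im t : cexp (0 +i* t) = expi t.
Proof. by rewrite /cexp /= expR0 mul1r. Qed.

Lemma expR_nrm_ge1 (z : R[i]) : 1 <= expR (nrm z).
Proof. by rewrite -[X in X <= _]expR0 ler_expR nrm_ge0. Qed.

Lemma cexp_sub1E z : cexp z - 1 = (expR (complex.Re z) - 1)%:C * expi (complex.Im z) + (expi (complex.Im z) - 1).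
Proof. by rewrite /cexp rmorphB /= mulrBl mul1r addrA subrK. Qed.

Lemma cexp_le1 z : nrm (cexp z - 1) <= 2 * nrm z * expR (nrm z).
Proof.
rewrite cexp_sub1E; apply: le_trans (nrmD _ _) _.
rewrite nrmM nrm_expi mulr1 nrm_real.
have h1 := expR_sub1_le (complex.Re z); have h2 := expi_le (complex.Im z).
have h3 := Re_nrm z; have h4 := Im_nrm z; have h5 := expR_nrm_ge1 z.
have h6 : `|complex.Re z| * expR `|complex.Re z| <= nrm z * expR (nrm z).
  by rewrite ler_pM ?expR_ge0 ?ler_expR.
have h7 : `|complex.Im z| * 1 <= nrm z * expR (nrm z) by rewrite ler_pM.
lra.
Qed.

Lemma cexp_le0 z : complex.Re z <= 0 -> nrm (cexp z - 1) <= 2 * nrm z.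
Proof.
move=> z0; rewrite cexp_sub1E; apply: le_trans (nrmD _ _) _.
rewrite nrmM nrm_expi mulr1 nrm_real.
have h1 := expR_le0 z0; have h2 := expi_le (complex.Im z).
by have h3 := Re_nrm z; have h4 := Im_nrm z; lra.
Qed.

Lemma cexp_le2 z : nrm (cexp z - 1 - z) <= 4 * nrm z ^+ 2 * expR (nrm z).
Proof.
set a := complex.Re z; set b := complex.Im z.
have -> : cexp z - 1 - z = (expR a - 1 - a)%:C * expi b + a%:C * (expi b - 1) + (expi b - 1 - (0 +i* b)).
  have ez : z = a%:C + 'i%C * b%:C := complexE z.
  rewrite [X in _ - X]ez /cexp -/a -/b.
  have -> : 0 +i* b = 'i%C * b%:C by simpc.
  by rewrite !rmorphB /=; ring.
have h1 := expR_le2 a; have h2 := expi_le b; have h3 := expi_le2 b.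
have h4 : `|a| <= nrm z := Re_nrm z; have h5 : `|b| <= nrm z := Im_nrm z; have h6 := expR_nrm_ge1 z.
apply: le_trans (nrmD _ _) _; apply: le_trans (lerD (nrmD _ _) (lexx _)) _.
rewrite !nrmM nrm_expi mulr1 !nrm_real.
have g1 : a ^+ 2 * expR `|a| <= nrm z ^+ 2 * expR (nrm z).
  by rewrite -(real_normK (num_real a)) ler_pM ?exprn_ge0 ?expR_ge0 ?ler_expR // lerXn2r ?nnegrE ?nrm_ge0.
have z2 : 0 <= nrm z ^+ 2 by rewrite exprn_ge0 ?nrm_ge0.
have g0 : nrm z ^+ 2 <= nrm z ^+ 2 * expR (nrm z) by rewrite ler_peMr.
have g2 : `|a| * nrm (expi b - 1) <= nrm z ^+ 2.
  by rewrite expr2 ler_pM ?nrm_ge0 //; apply: le_trans h2 h5.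
have g3 : b ^+ 2 <= nrm z ^+ 2.
  by rewrite -(real_normK (num_real b)) lerXn2r ?nnegrE ?nrm_ge0.
move: h1 h3 g1 g0 g2 g3; set E := expR (nrm z); set E' := expR `|a|; set N := nrm z ^+ 2; nra.
Qed.

Lemma cexp_dist z w : nrm (cexp z - cexp w) <= expR (complex.Re w) * (2 * nrm (z - w) * expR (nrm (z - w))).
Proof.
rewrite -{1}(subrK w z) cexpD -{2}[cexp w]mul1r -mulrBl nrmM mulrC nrm_cexp.
by rewrite ler_wpM2l ?expR_ge0 // cexp_le1.
Qed.

Lemma cexp_cvg (u : nat -> cplx R) (z : cplx R) :
  u n @[n --> \oo] --> z -> (cexp (u n) : cplx R) @[n --> \oo] --> (cexp z : cplx R).
Proof.
move=> /cvg_nrmP h; apply/cvg_nrmP => e e0.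
pose c := expR (complex.Re z) * (2 * expR 1).
have c0 : 0 < c by rewrite !mulr_gt0 // expR_gt0.
have [|N hN] := h (Num.min 1 (e / c)); first by rewrite lt_min ltr01 divr_gt0.
exists N => n Nn; have := hN n Nn; rewrite le_min => /andP [h1 h2].
apply: le_trans (cexp_dist (u n) z) _.
have h3 : expR (nrm (u n - z)) <= expR 1 by rewrite ler_expR.
rewrite ler_pdivlMr // in h2; apply: le_trans h2; rewrite /c [X in _ <= X]mulrC -[X in _ <= X]mulrA.
rewrite ler_wpM2l ?expR_ge0 // [X in _ <= X]mulrAC ler_wpM2l // mulr_ge0 ?nrm_ge0 //.
Qed.

End Cexp.

(** * Real Gaussian integrals on R^n *)

Section Gauss.
Variable R : realType.

Definition sqn n (t : n.-tuple R) : R := \sum_(i < n) tnth t i ^+ 2.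

Lemma sqn_ge0 n (t : n.-tuple R) : 0 <= sqn t.
Proof. by apply: sumr_ge0 => i _; exact: sqr_ge0. Qed.

Lemma measurable_sqn n : measurable_fun setT (@sqn n).
Proof.
apply: measurable_sum => i; apply: measurable_funX; exact: measurable_tnth.
Qed.

Lemma measurable_gauss n (c : R) : measurable_fun setT (fun t : n.-tuple R => expR (- c * sqn t)).
Proof.
apply: measurableT_comp; first exact: measurable_expR.
by apply: measurable_funM => //; exact: measurable_sqn.
Qed.

(** Read off from the normalisation of the normal density of variance 1/(2c). *)
Lemma gauss1 (c : R) : 0 < c ->
  (\int[lebesgue_measure]_x (expR (- c * x ^+ 2))%:E)%E = (Num.sqrt (pi / c))%:E.
Proof.
move=> c0; pose s := Num.sqrt (2 * c)^-1.
have c2 : 0 < 2 * c by rewrite mulr_gt0.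
have s0 : 0 < s by rewrite sqrtr_gt0 invr_gt0.
have s2 : s ^+ 2 = (2 * c)^-1 by rewrite sqr_sqrtr // invr_ge0 ltW.
have p0 : 0 < Num.sqrt (pi / c) by rewrite sqrtr_gt0 divr_gt0 // pi_gt0.
have e x : expR (- c * x ^+ 2) = Num.sqrt (pi / c) * normal_pdf 0 s x.
  rewrite normal_pdfE ?gt_eqF // /normal_peak /normal_fun s2 subr0.
  have -> : (2 * c)^-1 * pi *+ 2 = pi / c by field; rewrite gt_eqF.
  rewrite mulVKf ?gt_eqF //; congr expR.
  by field; rewrite gt_eqF.
under eq_integral do rewrite e EFinM.
rewrite ge0_integralZl_EFin ?integral_normal_pdf ?mule1 //.
- by move=> x _; rewrite lee_fin normal_pdf_ge0.
- by apply/measurable_EFinP; exact: measurable_normal_pdf.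
Qed.

Definition cube n (k : nat) : set (n.-tuple R) := [set t | forall i, `|tnth t i| <= k%:R].

Lemma measurable_cube n k : measurable (@cube n k).
Proof.
have -> : @cube n k = \bigcap_(i in [set: 'I_n]) ((fun t => tnth t i) @^-1` `[- k%:R, k%:R]).
  apply/seteqP; split=> t /=; first by move=> h i _ /=; rewrite in_itv /= -ler_norml.
  by move=> h i; have := h i Logic.I; rewrite /= in_itv /= -ler_norml.
apply: fin_bigcap_measurable => // i _.
by rewrite -[X in measurable X]setTI; apply: measurable_tnth => //; exact: measurable_itv.
Qed.

Lemma cube_fin n k : (lebesgue_tuple R n (@cube n k) < +oo)%E.
Proof.
elim: n => [|n ih]; first by rewrite /= diracE; case: (_ \in _); rewrite ltry.
rewrite /= /lebesgue_step /pushforward.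
rewrite (_ : _ @^-1` _ = @cube n k `*` `[- k%:R, k%:R]); last first.
  apply/seteqP; split=> -[x y] /= h.
    split; last by have := h ord0; rewrite tnth0 in_itv /= ler_norml.
    by move=> i; have := h (lift ord0 i); rewrite tnthS.
  move=> i; case: (unliftP ord0 i) => [j ->|->]; first by rewrite tnthS; exact: h.1.
  by rewrite tnth0; have := h.2; rewrite in_itv /= ler_norml.
rewrite product_measure1E //; last exact: measurable_cube.
apply: lte_mul_pinfty => //; first by rewrite ge0_fin_numE.
rewrite [X in (X < _)%E](_ : _ = lebesgue_measure `[- k%:R, k%:R]%classic) // lebesgue_measure_itv /=.
by case: ifP => // _; rewrite ltry.
Qed.

Lemma sigma_finite_tuple n : sigma_finite setT (lebesgue_tuple R n).
Proof.
exists (@cube n); last by move=> k; split; [exact: measurable_cube|exact: cube_fin].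
apply/seteqP; split=> // t _; have [k hk] : exists k : nat, forall i, `|tnth t i| <= k%:R.
  exists (\max_(i < n) (Num.truncn `|tnth t i|).+1)%N => i.
  apply: ltW; apply: lt_le_trans (truncnS_gt _) _; rewrite ler_nat.
  exact: (leq_bigmax_cond (F := fun i => (Num.truncn `|tnth t i|).+1)).
by exists k.
Qed.

(** An alias of [lebesgue_tuple] that carries the sigma-finiteness used in Tonelli's theorem. *)
Definition ltuple n : set (n.-tuple R) -> \bar R := lebesgue_tuple R n.

HB.instance Definition _ n := isMeasure.Build _ _ _ (@ltuple n)
  (measure0 (lebesgue_tuple R n)) (measure_ge0 (lebesgue_tuple R n))
  (@measure_semi_sigma_additive _ _ _ (lebesgue_tuple R n)).

HB.instance Definition _ n := Measure_isSigmaFinite.Build _ _ _ (@ltuple n)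
  (@sigma_finite_tuple n).

Lemma gauss_tuple n (c : R) : 0 < c ->
  (\int[lebesgue_tuple R n]_t (expR (- c * sqn t))%:E)%E = (Num.sqrt (pi / c) ^+ n)%:E.
Proof.
move=> c0; elim: n => [|n ih].
  rewrite integral_dirac //=; last by apply/measurable_EFinP; exact: measurable_gauss.
  by rewrite diracE mem_set // mul1e /sqn big_ord0 mulr0 expR0 expr0.
pose m : {sigma_finite_measure set (n.-tuple R) -> \bar R} := @ltuple n.
have -> : (\int[lebesgue_tuple R n.+1]_t (expR (- c * sqn t))%:E =
   \int[(m \x @lebesgue_measure R)%E]_p (expR (- c * sqn (tcons p)))%:E)%E.
  rewrite /= /lebesgue_step ge0_integral_pushforward //=; first exact: measurable_tcons.
  by apply/measurable_EFinP; exact: measurable_gauss.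
rewrite fubini_tonelli1; last 2 first.
- apply/measurable_EFinP; apply: (measurableT_comp (@measurable_gauss n.+1 c)).
  exact: measurable_tcons.
- by move=> p; rewrite lee_fin expR_ge0.
have e (x : n.-tuple R) y : expR (- c * sqn (tcons (x, y))) = expR (- c * sqn x) * expR (- c * y ^+ 2).
  rewrite -expRD -mulrDr; congr (expR (_ * _)); rewrite /sqn big_ord_recl addrC tnth0; congr (_ + _).
  by apply: eq_bigr => i _; rewrite tnthS.
rewrite /fubini_F; transitivity (\int[m]_x ((Num.sqrt (pi / c))%:E * (expR (- c * sqn x))%:E))%E.
  apply: eq_integral => x _ /=; under eq_integral do rewrite e EFinM.
  rewrite ge0_integralZl_EFin ?expR_ge0 //; first by rewrite gauss1 // muleC.
  apply/measurable_EFinP; apply: measurableT_comp; first exact: measurable_expR.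
  by apply: measurable_funM => //; exact: measurable_funX.
rewrite ge0_integralZl_EFin //.
- by rewrite [X in (_ * X)%E]ih -EFinM exprS.
- by apply/measurable_EFinP; exact: measurable_gauss.
Qed.

End Gauss.

(** * Products of commuting groups of operators *)

Section GroupProducts.
Context (R : realType) (X : completeNormedModType R[i]) (d : nat).
Variable U : 'I_d -> R -> {linear X -> X}.
Hypothesis hU : forall j, bounded_C0_group (U j).
Hypothesis UU : forall j k s t f, U j s (U k t f) = U k t (U j s f).

Definition gprod (r : seq 'I_d) (u : 'I_d -> R) (f : X) : X :=
  foldr (fun j x => U j (u j) x) f r.

Lemma gprodE (r : seq 'I_d) u f :
  (\big[@comp X X X/id]_(j <- r) (U j (u j) : X -> X)) f = gprod r u f.
Proof. by elim: r => [|j r ih]; rewrite ?big_nil ?big_cons //= ih. Qed.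

Lemma gprod_linear r u : linear (gprod r u).
Proof. by move=> c x y; elim: r => [|j r ih] //=; rewrite ih linearP. Qed.

HB.instance Definition _ r u := GRing.isLinear.Build _ _ _ _ (gprod r u) (gprod_linear r u).

Lemma eq_gprod r u u' f : (forall j, j \in r -> u j = u' j) -> gprod r u f = gprod r u' f.
Proof.
elim: r => [|j r ih] //= h; rewrite ih; first by rewrite h ?mem_head.
by move=> k kr; apply: h; rewrite in_cons kr orbT.
Qed.

Lemma gprod_ins r u k s f : uniq r -> k \in r ->
  U k s (gprod r u f) = gprod r (fun j => u j + (if j == k then s else 0)) f.
Proof.
elim: r => [|j r ih] //= /andP [jr ur]; rewrite in_cons; have [->|kj] := eqVneq k j => /= kr.
  rewrite (eq_gprod (u := u) (u' := fun i => u i + (if i == j then s else 0))).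
    by have [_ [h _]] := hU j; rewrite addrC h.
  move=> i ir; case: eqP => [ij|_]; last by rewrite addr0.
  by move: jr; rewrite -ij ir.
by rewrite UU ih // addr0.
Qed.

(** Moves an operator of the other family across a product, each factor contributing its commutation
    phase. *)
Lemma gprod_phase r u (T : {linear X -> X}) (c : 'I_d -> R) f :
  (forall j t x, T (U j t x) = expi (c j * t) *: U j t (T x)) ->
  T (gprod r u f) = expi (\sum_(j <- r) c j * u j) *: gprod r u (T f).
Proof.
move=> h; elim: r => [|j r ih] /=; first by rewrite big_nil expi0 scale1r.
by rewrite h ih linearZ /= scalerA -expiD big_cons.
Qed.

Lemma gprod_bound r : exists2 M : R, 0 <= M & forall u f, nrm (gprod r u f) <= M * nrm f.
Proof.
elim: r => [|j r [M M0 hM]] /=; first by exists 1 => // u f; rewrite mul1r.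
have [_ [_ [_ [C hC]]]] := hU j; exists (`|C| * M); first by rewrite mulr_ge0.
move=> u f; apply: le_trans (hC _ _) _; apply: le_trans (ler_wpM2r (nrm_ge0 _) (ler_norm C)) _.
by rewrite -mulrA ler_wpM2l.
Qed.

(** Joint continuity: strong continuity at the limit vector, and the uniform bound of the group for
    the rest. *)
Lemma group_cvg j (t : nat -> R) (x : nat -> X) (t0 : R) (x0 : X) :
  t n @[n --> \oo] --> t0 -> x n @[n --> \oo] --> x0 ->
  U j (t n) (x n) @[n --> \oo] --> U j t0 x0.
Proof.
move=> ht /cvg_nrmP hx; have [_ [_ [hc [M hM]]]] := hU j.
have /cvg_nrmP h1 : U j (t n) x0 @[n --> \oo] --> U j t0 x0.
  exact: (cvg_comp _ _ ht (hc x0 t0)).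
apply/cvg_nrmP => e e0; have e2 : 0 < e / 2 by rewrite divr_gt0.
have [N1 H1] := h1 _ e2; have M0 : 0 < `|M| + 1 by rewrite ltr_wpDl.
have [|N2 H2] := hx (e / 2 / (`|M| + 1)); first by rewrite divr_gt0.
exists (maxn N1 N2) => n; rewrite geq_max => /andP [n1 n2].
apply: le_trans (nrm_tri _ _ (U j (t n) x0)) _; rewrite [e]splitr lerD ?H1 //.
rewrite -linearB; apply: le_trans (hM _ _) _.
have := H2 n n2; rewrite ler_pdivlMr // mulrC; apply: le_trans.
by rewrite ler_wpM2r ?nrm_ge0 //; have := ler_norm M; lra.
Qed.

Lemma gprod_cvg r (u : nat -> 'I_d -> R) (u0 : 'I_d -> R) (x : nat -> X) (x0 : X) :
  (forall j, u n j @[n --> \oo] --> u0 j) -> x n @[n --> \oo] --> x0 ->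
  gprod r (u n) (x n) @[n --> \oo] --> gprod r u0 x0.
Proof. by move=> h hx; elim: r => [|j r ih] //=; exact: group_cvg. Qed.

Lemma gprod0 r u f : (forall j, u j = 0) -> gprod r u f = f.
Proof. by move=> u0; elim: r => [|j r ih] //=; rewrite ih u0 (hU j).1. Qed.

End GroupProducts.

(** * The Weyl operators e^{i(uA+vB)} and their composition with the groups *)

Section WeylOperators.
Context (R : realType) (X : completeNormedModType R[i]) (d : nat).
Variables (A B : 'I_d -> set (X * X)) (U V : 'I_d -> R -> {linear X -> X}).
Hypothesis HW : weyl_pair A B U V.
Implicit Types (t : (d + d).-tuple R) (i : 'I_(d + d)).

Definition tu t (j : 'I_d) : R := tnth t (lshift d j).
Definition tv t (j : 'I_d) : R := tnth t (rshift d j).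

Definition W t (f : X) : X :=
  expi (2^-1 * \sum_j tu t j * tv t j) *:
  gprod U (index_enum 'I_d) (tu t) (gprod V (index_enum 'I_d) (tv t) f).

Lemma W_weyl_exp t f : weyl_exp U V (lsubmx (vec t)) (rsubmx (vec t)) f = W t f.
Proof.
rewrite /weyl_exp /W /dot; congr (expi (_ * _) *: _).
  by apply: eq_bigr => j _; rewrite !mxE.
rewrite (gprodE U _ (fun j => lsubmx (vec t) ord0 j)) (gprodE V _ (fun j => rsubmx (vec t) ord0 j)).
have e1 : (fun j => lsubmx (vec t) ord0 j) = tu t by apply/funext => j; rewrite !mxE.
have e2 : (fun j => rsubmx (vec t) ord0 j) = tv t by apply/funext => j; rewrite !mxE.
by rewrite e1 e2.
Qed.

Lemma W_linear t : linear (W t).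
Proof.
move=> c x y; rewrite /W !gprod_linear !scalerDr !scalerA; congr (_ + _).
by rewrite mulrC.
Qed.

HB.instance Definition _ t := GRing.isLinear.Build _ _ _ _ (W t) (W_linear t).

Lemma W_bound : exists2 M : R, 0 <= M & forall t f, nrm (W t f) <= M * nrm f.
Proof.
have [M1 p1 h1] := gprod_bound (weyl_U HW) (index_enum 'I_d).
have [M2 p2 h2] := gprod_bound (weyl_V HW) (index_enum 'I_d).
exists (M1 * M2); first by rewrite mulr_ge0.
move=> t f; rewrite /W nrmZ nrm_expi mul1r; apply: le_trans (h1 _ _) _.
by rewrite -mulrA ler_wpM2l.
Qed.

Lemma expi_cvg (u : nat -> R) (x : R) : u n @[n --> \oo] --> x ->
  (expi (u n) : cplx R) @[n --> \oo] --> (expi x : cplx R).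
Proof.
move=> h; rewrite -cexp_im; under eq_fun do rewrite -cexp_im.
apply: cexp_cvg; apply: cvg_complex => //=; exact: cvg_cst.
Qed.

Lemma W_seqcont f : seqcont (fun t => W t f).
Proof.
move=> u t h; have hu j : tu (u k) j @[k --> \oo] --> tu t j := h _.
have hv j : tv (u k) j @[k --> \oo] --> tv t j := h _.
apply: (@cvgZ _ X); last first.
  apply: (gprod_cvg (weyl_U HW)); first exact: hu.
  by apply: (gprod_cvg (weyl_V HW)); [exact: hv|exact: cvg_cst].
apply: expi_cvg; apply: cvgM; first exact: cvg_cst.
elim: (index_enum 'I_d) => [|j r ih].
  by rewrite big_nil; under eq_fun do rewrite big_nil; exact: cvg_cst.
rewrite big_cons; under eq_fun do rewrite big_cons.
by apply: cvgD => //; exact: cvgM.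
Qed.

Lemma W0 t f : (forall i, tnth t i = 0) -> W t f = f.
Proof.
move=> t0; rewrite /W !(gprod0 (weyl_V HW), gprod0 (weyl_U HW)); try by move=> j; exact: t0.
by rewrite big1 ?mulr0 ?expi0 ?scale1r // => j _; rewrite /tu t0 mul0r.
Qed.

(** The 2d groups indexed like the coordinates of (u, v), so that A and B are treated alike. *)
Definition Zg i (s : R) : {linear X -> X} :=
  match fintype.split i with inl j => U j s | inr j => V j s end.

(** The coordinates of J (u, v) = (-v, u), which are the commutation phases of the Weyl
    operators. *)
Definition jw i t : R := match fintype.split i with inl j => - tv t j | inr j => tu t j end.

Lemma tu_shift_l j s t : tu (shiftc (lshift d j) s t) = (fun k => tu t k + (if k == j then s else 0)).
Proof. by apply/funext => k; rewrite /tu tnth_shiftc eq_lshift. Qed.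

Lemma tv_shift_l j s t : tv (shiftc (lshift d j) s t) = tv t.
Proof. by apply/funext => k; rewrite /tv tnth_shiftc eq_rlshift addr0. Qed.

Lemma tu_shift_r j s t : tu (shiftc (rshift d j) s t) = tu t.
Proof. by apply/funext => k; rewrite /tu tnth_shiftc eq_lrshift addr0. Qed.

Lemma tv_shift_r j s t : tv (shiftc (rshift d j) s t) = (fun k => tv t k + (if k == j then s else 0)).
Proof. by apply/funext => k; rewrite /tv tnth_shiftc eq_rshift. Qed.

Lemma sum_ins (a b : 'I_d -> R) j s :
  \sum_k (a k + (if k == j then s else 0)) * b k = \sum_k a k * b k + s * b j.
Proof.
under eq_bigr do rewrite mulrDl; rewrite big_split /=; congr (_ + _).
by rewrite (bigD1 j) //= eqxx big1 ?addr0 // => k /negbTE ->; rewrite mul0r.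
Qed.

Lemma sum_ins' (a b : 'I_d -> R) j s :
  \sum_k a k * (b k + (if k == j then s else 0)) = \sum_k a k * b k + s * a j.
Proof.
by under eq_bigr do rewrite mulrC; rewrite sum_ins; under eq_bigr do rewrite mulrC.
Qed.

Lemma VU j k s r f : V k r (U j s f) = expi (s * r * (j == k)%:R) *: U j s (V k r f).
Proof. by rewrite (weyl_UV HW) scalerA -expiD subrr expi0 scale1r. Qed.

(** The group of index i adds s to the coordinate i. In the first half, the factor e^{iuv/2} of the
    shifted operator gains the phase s v_j / 2, which has to be compensated; in the second half the
    commutation phase s u_j exceeds the gain s u_j / 2 by one half. *)
Lemma Z_W i s t f : Zg i s (W t f) = expi (s * jw i t / 2) *: W (shiftc i s t) f.
Proof.
rewrite /Zg /jw; case: (split_ordP i) => j ->.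
  rewrite /W linearZ /= (gprod_ins (weyl_U HW) (weyl_UU HW)) ?index_enum_uniq ?mem_index_enum //.
  rewrite tu_shift_l tv_shift_l scalerA -expiD; congr (expi _ *: _).
  by rewrite sum_ins; field.
rewrite /W linearZ /= (@gprod_phase _ _ _ U (index_enum 'I_d) (tu t) (V j s) (fun k => s * (k == j)%:R)); last first.
  by move=> k t' x; rewrite VU; congr (expi _ *: _); ring.
rewrite (gprod_ins (weyl_V HW) (weyl_VV HW)) ?index_enum_uniq ?mem_index_enum //.
rewrite tu_shift_r tv_shift_r !scalerA -!expiD; congr (expi _ *: _).
have -> : \sum_(k < d) s * (k == j)%:R * tu t k = s * tu t j.
  rewrite (bigD1 j) //= eqxx mulr1 big1 ?addr0 // => k kj.
  by rewrite (negbTE kj) mulr0 mul0r.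
rewrite sum_ins'.
by field.
Qed.

Lemma gprod_ins_r (T : 'I_d -> R -> {linear X -> X}) (r : seq 'I_d) u k s f :
  (forall j, bounded_C0_group (T j)) ->
  (forall j k s r f, T j s (T k r f) = T k r (T j s f)) -> uniq r -> k \in r ->
  gprod T r u (T k s f) = gprod T r (fun j => u j + (if j == k then s else 0)) f.
Proof.
move=> hT TT ur kr; rewrite -(gprod_ins hT TT) //; elim: r {ur kr} => [|j r ih] //=.
by rewrite ih TT.
Qed.

Lemma W_Z i s t f : W t (Zg i s f) = expi (- (s * jw i t / 2)) *: W (shiftc i s t) f.
Proof.
rewrite /Zg /jw; case: (split_ordP i) => j ->.
  rewrite /W.
  have -> : gprod V (index_enum 'I_d) (tv t) (U j s f) =
      expi (s * tv t j) *: U j s (gprod V (index_enum 'I_d) (tv t) f).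
    have := @gprod_phase _ _ _ V (index_enum 'I_d) (tv t) (U j s) (fun k => - (s * (j == k)%:R)) f.
    move=> ->; last by move=> k t' x; rewrite (weyl_UV HW); congr (expi _ *: _); ring.
    rewrite scalerA -expiD (bigD1 j) //= eqxx big1 ?addr0; last first.
      by move=> k; rewrite eq_sym => /negbTE ->; rewrite mulr0 oppr0 mul0r.
    by rewrite mulr1 mulNr subrr expi0 scale1r.
  rewrite linearZ /= (gprod_ins_r _ _ _ (weyl_U HW) (weyl_UU HW)) ?index_enum_uniq ?mem_index_enum //.
  rewrite tu_shift_l tv_shift_l !scalerA -!expiD; congr (expi _ *: _).
  by rewrite sum_ins; field.
rewrite /W (gprod_ins_r _ _ _ (weyl_V HW) (weyl_VV HW)) ?index_enum_uniq ?mem_index_enum //.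
rewrite tu_shift_r tv_shift_r scalerA -expiD; congr (expi _ *: _).
by rewrite sum_ins'; field.
Qed.

End WeylOperators.

(** * Kernels with Gaussian bounds and their partial derivatives *)

Section Kernels.
Context (R : realType) (n : nat).
Local Notation T := (n.-tuple R).
Local Notation mu := (lebesgue_tuple R n).
Implicit Types (t : T) (i : 'I_n).

Definition abs1 t : R := \sum_(i < n) `|tnth t i|.

(** The exponential of the 1-norm absorbs polynomial factors and unit translations, at the cost of a
    larger a but with the Gaussian rate c unchanged. *)
Definition wgt (a c : R) t : R := expR (a * abs1 t - c * sqn t).

Lemma abs1_ge0 t : 0 <= abs1 t.
Proof. exact: sumr_ge0. Qed.

Lemma tnth_le_abs1 t i : `|tnth t i| <= abs1 t.
Proof. by rewrite /abs1 (bigD1 i) //= lerDl sumr_ge0. Qed.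

Lemma wgt_ge0 a c t : 0 <= wgt a c t.
Proof. exact: expR_ge0. Qed.

Lemma wgtM a c a' c' t : wgt a c t * wgt a' c' t = wgt (a + a') (c + c') t.
Proof. by rewrite -expRD; congr expR; ring. Qed.

Lemma wgt_mono a a' c t : a <= a' -> wgt a c t <= wgt a' c t.
Proof. by move=> h; rewrite ler_expR lerD2r ler_wpM2r ?abs1_ge0. Qed.

Lemma wgt1_ge1 a t : 0 <= a -> 1 <= wgt a 0 t.
Proof.
move=> a0; rewrite -[X in X <= _]expR0 ler_expR mul0r subr0.
by rewrite mulr_ge0 ?abs1_ge0.
Qed.

Lemma measurable_wgt a c : measurable_fun setT (wgt a c).
Proof.
apply: measurableT_comp; first exact: measurable_expR.
apply: measurable_funB; apply: measurable_funM => //; last exact: measurable_sqn.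
apply: measurable_sum => i; apply: measurableT_comp; last exact: measurable_tnth.
exact: normr_measurable.
Qed.

(** Completing the square, a |x| - c x^2 <= a^2 / (2c) - (c/2) x^2 in each coordinate; what remains
    is a Gaussian integral of rate c/2. *)
Definition Kw (a c : R) : R := expR (n%:R * (a ^+ 2 / (2 * c))) * Num.sqrt (pi / (c / 2)) ^+ n.

Lemma Kw_ge0 a c : 0 <= Kw a c.
Proof. by rewrite mulr_ge0 ?expR_ge0 // exprn_ge0 // sqrtr_ge0. Qed.

Lemma int_wgt a c : 0 < c -> (\int[mu]_t (wgt a c t)%:E <= (Kw a c)%:E)%E.
Proof.
move=> c0; have c2 : 0 < c / 2 by rewrite divr_gt0.
apply: (@le_trans _ _ (\int[mu]_t ((expR (n%:R * (a ^+ 2 / (2 * c))))%:E * (expR (- (c / 2) * sqn t))%:E))%E).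
  apply: ge0_le_integral => //=.
  - by move=> t _; rewrite lee_fin wgt_ge0.
  - by apply/measurable_EFinP; exact: measurable_wgt.
  - by apply/measurable_EFinP; apply: measurable_funM => //; exact: measurable_gauss.
  move=> t _; rewrite -EFinM -expRD lee_fin ler_expR /abs1 /sqn.
  rewrite !mulr_sumr -sumrB -[n%:R]mulr1 mulr_natl -[X in _ *+ X]card_ord -sumr_const mulr_suml -big_split /=.
  apply: ler_sum => i _; rewrite mul1r -(real_normK (num_real (tnth t i))); set x := `|_|.
  have : 0 <= (c / 2) * (x - a / c) ^+ 2 by rewrite mulr_ge0 ?sqr_ge0 // ltW.
  have -> : (c / 2) * (x - a / c) ^+ 2 = a ^+ 2 / (2 * c) + - (c / 2) * x ^+ 2 - (a * x - c * x ^+ 2).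
    by field; rewrite gt_eqF.
  by rewrite subr_ge0.
rewrite ge0_integralZl_EFin ?expR_ge0 //; first by rewrite gauss_tuple.
by apply/measurable_EFinP; exact: measurable_gauss.
Qed.

Lemma Bint_wgt (X : completeNormedModType R[i]) (F : T -> X) (C a c : R) :
  0 < c -> bmeas F -> (forall t, nrm (F t) <= C * wgt a c t) ->
  Bint mu F /\ nrm (BI mu F) <= C * Kw a c.
Proof.
move=> c0 mF hF.
have C0 : 0 <= C.
  have t0 : T by exact: (nseq_tuple n 0).
  by have := le_trans (nrm_ge0 _) (hF t0); rewrite pmulr_lge0 // expR_gt0.
have mG : measurable_fun setT (fun t => C * wgt a c t).
  by apply: measurable_funM => //; exact: measurable_wgt.
have iG : (\int[mu]_t (C * wgt a c t)%:E <= (C * Kw a c)%:E)%E.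
  under eq_integral do rewrite EFinM.
  rewrite ge0_integralZl_EFin //; last 2 first.
  - by move=> t _; rewrite lee_fin wgt_ge0.
  - by apply/measurable_EFinP; exact: measurable_wgt.
  by rewrite EFinM lee_wpmul2l ?lee_fin // int_wgt.
split; first by apply: (le_Bint mF mG hF); apply: le_lt_trans iG _; rewrite ltry.
exact: BI_leG mF mG hF iG.
Qed.

Definition gb (c : R) (g : T -> R[i]) :=
  seqcont (g : T -> cplx R) /\
  exists C a : R, [/\ 0 <= C, 0 <= a & forall t, nrm (g t) <= C * wgt a c t].

Definition cdiff (c : R) i (g g' : T -> R[i]) :=
  exists C a : R, [/\ 0 <= C, 0 <= a & forall s t, `|s| <= 1 ->
    nrm (g (shiftc i s t) - g t - s%:C * g' t) <= s ^+ 2 * (C * wgt a c t)].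

(** The remainder of the i-th partial derivative is quadratic in the step, uniformly against a
    Gaussian weight. Difference quotients can thus be integrated against the Weyl operators with an
    explicit rate. *)
Definition kd (c : R) i (g g' : T -> R[i]) := [/\ gb c g, gb c g' & cdiff c i g g'].

Lemma seqcontD (V : normedModType R[i]) (g h : T -> V) :
  seqcont g -> seqcont h -> seqcont (fun t => g t + h t).
Proof. by move=> hg hh u t ut; apply: cvgD; [exact: hg|exact: hh]. Qed.

Lemma seqcontZ (V : normedModType R[i]) (g : T -> R[i]) (h : T -> V) :
  seqcont (g : T -> cplx R) -> seqcont h -> seqcont (fun t => g t *: h t).
Proof.
by move=> hg hh u t ut; apply: (@cvgZ _ V); [exact: hg|exact: hh].
Qed.

Lemma seqcont_cst (V : normedModType R[i]) (c : V) : seqcont (fun _ : T => c).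
Proof. by move=> u t _; exact: cvg_cst. Qed.

Lemma seqcont_real (g : T -> R) : (forall u t, tcvg u t -> g (u k) @[k --> \oo] --> g t) ->
  seqcont ((fun t => (g t)%:C) : T -> cplx R).
Proof.
move=> h u t ut; apply: cvg_complex => /=; first exact: h.
exact: cvg_cst.
Qed.

Lemma gb_mono c g C a a' : 0 <= C -> a <= a' ->
  (forall t, nrm (g t : R[i]) <= C * wgt a c t) -> forall t, nrm (g t) <= C * wgt a' c t.
Proof. by move=> C0 aa h t; apply: le_trans (h t) _; rewrite ler_wpM2l // wgt_mono. Qed.

Lemma gbD c g h : gb c g -> gb c h -> gb c (fun t => g t + h t).
Proof.
move=> [sg [C [a [C0 a0 hg]]]] [sh [C' [a' [C0' a0' hh]]]].
split; first exact: (@seqcontD (cplx R) g h sg sh).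
exists (C + C'), (Num.max a a'); split; rewrite ?addr_ge0 // ?le_max ?a0 // => t.
apply: le_trans (nrmD _ _) _; rewrite mulrDl lerD //.
  by apply: gb_mono hg t; rewrite // le_max lexx.
by apply: gb_mono hh t; rewrite // le_max lexx orbT.
Qed.

Lemma gbM c c' g h : gb c g -> gb c' h -> gb (c + c') (fun t => g t * h t).
Proof.
move=> [sg [C [a [C0 a0 hg]]]] [sh [C' [a' [C0' a0' hh]]]].
split; first exact: (@seqcontZ (cplx R) g h sg sh).
exists (C * C'), (a + a'); split; rewrite ?addr_ge0 ?mulr_ge0 // => t.
by rewrite nrmM -wgtM mulrACA ler_pM ?nrm_ge0.
Qed.

Lemma gb_cst (z : R[i]) : gb 0 (fun _ => z).
Proof.
split; first exact: (@seqcont_cst (cplx R)).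
exists (nrm z), 0; split=> //; first exact: nrm_ge0.
by move=> t; rewrite ler_peMr ?nrm_ge0 // wgt1_ge1.
Qed.

Lemma gb_coord k : gb 0 (fun t => (tnth t k)%:C).
Proof.
split; first by apply: seqcont_real => u t; exact.
exists 1, 1; split=> // t; rewrite nrm_real mul1r /wgt mul0r subr0 mul1r.
apply: le_trans (tnth_le_abs1 t k) _; apply: le_trans (expR_ge1Dx _).
by rewrite lerDr.
Qed.

Lemma wgt_shift a c i s t : 0 <= a -> 0 <= c -> `|s| <= 1 ->
  wgt a c (shiftc i s t) <= expR a * wgt (a + 2 * c) c t.
Proof.
move=> a0 c0 s1; rewrite -expRD ler_expR.
have h1 : abs1 (shiftc i s t) <= 1 + abs1 t.
  rewrite /abs1 (bigD1 i) //= [X in _ <= _ + X](bigD1 i) //= tnth_shiftc eqxx addrA.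
  rewrite lerD //; last by apply: ler_sum => j ji; rewrite tnth_shiftc (negbTE ji) addr0.
  by apply: le_trans (ler_normD _ _) _; lra.
have h2 : sqn t - 2 * abs1 t <= sqn (shiftc i s t).
  rewrite /sqn (bigD1 i) //= [X in _ <= X](bigD1 i) //= tnth_shiftc eqxx.
  rewrite [X in _ <= _ + X](eq_bigr (fun j => tnth t j ^+ 2)); last first.
    by move=> j ji; rewrite tnth_shiftc (negbTE ji) addr0.
  rewrite addrAC lerD2r; have := tnth_le_abs1 t i; set x := tnth t i => hx.
  have hxs : - (`|x| * `|s|) <= x * s by rewrite lerNl -normrM -normrN ler_norm.
  have : `|x| * `|s| <= `|x| by rewrite ler_piMr.
  have := sqr_ge0 s; rewrite sqrrD mulr2n; lra.
have := ler_wpM2l a0 h1; have := ler_wpM2l c0 h2.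
lra.
Qed.

Lemma kd_eq c i g g' h h' : kd c i g g' -> g =1 h -> g' =1 h' -> kd c i h h'.
Proof. by move=> hk /funext <- /funext <-. Qed.

Lemma kdM c c' i g g' h h' : 0 <= c -> 0 <= c' -> kd c i g g' -> kd c' i h h' ->
  kd (c + c') i (fun t => g t * h t) (fun t => g' t * h t + g t * h' t).
Proof.
move=> c0 c0' [bg bg' dg] [bh bh' dh]; split; first exact: gbM.
  by apply: gbD; exact: gbM.
have [_ [C1 [a1 [C10 a10 h1]]]] := bg; have [_ [C2 [a2 [C20 a20 h2]]]] := bg'.
have [_ [C3 [a3 [C30 a30 h3]]]] := bh; have [_ [C4 [a4 [C40 a40 h4]]]] := bh'.
have [C5 [a5 [C50 a50 h5]]] := dg; have [C6 [a6 [C60 a60 h6]]] := dh.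
pose a := a1 + a2 + a3 + a4 + a5 + a6 + 2 * c'.
have aP : [/\ a1 <= a, a2 <= a, a5 <= a, a4 <= a & a6 <= a] /\ a3 + 2 * c' <= a.
  by rewrite /a; split; first split; lra.
have {aP} [[A1 A2 A5 A4 A6] A3] := aP.
exists (C5 * (C3 * expR a3) + (C1 + C2) * C6 + C2 * C4), (a + a); split.
- by rewrite !addr_ge0 ?mulr_ge0 ?addr_ge0 ?expR_ge0.
- by rewrite /a !addr_ge0 ?mulr_ge0.
move=> s t s1; set gs := g (shiftc _ _ _); set hs := h (shiftc _ _ _).
(* The two remainders, each with a bounded cofactor, and the second-order term s^2 g' h'. *)
have -> : gs * hs - g t * h t - s%:C * (g' t * h t + g t * h' t) =
  (gs - g t - s%:C * g' t) * hs + (g t + s%:C * g' t) * (hs - h t - s%:C * h' t)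
  + (s ^+ 2)%:C * (g' t * h' t).
  by rewrite rmorphXn /=; ring.
have W0 := @wgt_ge0.
have b1 : nrm hs <= C3 * expR a3 * wgt a c' t.
  apply: le_trans (h3 _) _; rewrite -mulrA ler_wpM2l //.
  apply: le_trans (wgt_shift i t a30 c0' s1) _.
  by rewrite ler_wpM2l ?expR_ge0 // wgt_mono.
have b2 : nrm (gs - g t - s%:C * g' t) <= s ^+ 2 * (C5 * wgt a c t).
  apply: le_trans (h5 _ _ s1) _; rewrite ler_wpM2l ?sqr_ge0 // ler_wpM2l //.
  exact: wgt_mono.
have b3 : nrm (g t + s%:C * g' t) <= (C1 + C2) * wgt a c t.
  apply: le_trans (nrmD _ _) _; rewrite nrmM nrm_real mulrDl lerD //.
    exact: gb_mono C10 A1 h1 t.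
  by apply: le_trans (ler_piMl (nrm_ge0 _) s1) _; exact: gb_mono C20 A2 h2 t.
have b4 : nrm (hs - h t - s%:C * h' t) <= s ^+ 2 * (C6 * wgt a c' t).
  apply: le_trans (h6 _ _ s1) _; rewrite ler_wpM2l ?sqr_ge0 // ler_wpM2l //.
  exact: wgt_mono.
have b5 : nrm (g' t) <= C2 * wgt a c t by exact: gb_mono C20 A2 h2 t.
have b6 : nrm (h' t) <= C4 * wgt a c' t by exact: gb_mono C40 A4 h4 t.
apply: le_trans (nrmD _ _) _; apply: le_trans (lerD (nrmD _ _) (lexx _)) _.
rewrite !nrmM nrm_real ger0_norm ?sqr_ge0 // -wgtM.
have := ler_pM (nrm_ge0 _) (nrm_ge0 _) b2 b1.
have := ler_pM (nrm_ge0 _) (nrm_ge0 _) b3 b4.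
have := ler_wpM2l (sqr_ge0 s) (ler_pM (nrm_ge0 _) (nrm_ge0 _) b5 b6).
set x1 := nrm _ * nrm _; set x2 := nrm _ * nrm _; set x3 := _ * (nrm _ * nrm _).
move=> y3 y2 y1; apply: le_trans (lerD (lerD y1 y2) y3) _.
by apply: le_of_eq; ring.
Qed.

Lemma kdD c i g g' h h' : kd c i g g' -> kd c i h h' ->
  kd c i (fun t => g t + h t) (fun t => g' t + h' t).
Proof.
move=> [bg bg' [C [a [C0 a0 h1]]]] [bh bh' [C' [a' [C0' a0' h2]]]]; split; try exact: gbD.
exists (C + C'), (Num.max a a'); split; rewrite ?addr_ge0 // ?le_max ?a0 // => s t s1.
have -> : g (shiftc i s t) + h (shiftc i s t) - (g t + h t) - s%:C * (g' t + h' t) =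
  (g (shiftc i s t) - g t - s%:C * g' t) + (h (shiftc i s t) - h t - s%:C * h' t) by ring.
apply: le_trans (nrmD _ _) _; rewrite mulrDl mulrDr lerD //.
  apply: le_trans (h1 _ _ s1) _; rewrite ler_wpM2l ?sqr_ge0 // ler_wpM2l //.
  by apply: wgt_mono; rewrite le_max lexx.
apply: le_trans (h2 _ _ s1) _; rewrite ler_wpM2l ?sqr_ge0 // ler_wpM2l //.
by apply: wgt_mono; rewrite le_max lexx orbT.
Qed.

Lemma kd_cst i (z : R[i]) : kd 0 i (fun _ => z) (fun _ => 0).
Proof.
split; try exact: gb_cst.
exists 0, 0; split=> // s t _; rewrite subrr mulr0 subr0 nrm0 mul0r mulr0.
exact: lexx.
Qed.

Lemma kdZ c i (z : R[i]) g g' : 0 <= c -> kd c i g g' ->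
  kd c i (fun t => z * g t) (fun t => z * g' t).
Proof.
move=> c0 h; have := kdM (lexx 0) c0 (kd_cst i z) h; rewrite add0r.
by move=> h'; apply: (kd_eq h') => t //; rewrite mul0r add0r.
Qed.

Lemma kd_coord i k : kd 0 i (fun t => (tnth t k)%:C) (fun _ => (k == i)%:R).
Proof.
split; first exact: gb_coord.
  exact: gb_cst.
exists 0, 0; split=> // s t _; rewrite tnth_shiftc rmorphD /=.
rewrite (_ : _ - _ = 0) ?nrm0 ?mul0r ?mulr0 //.
by case: ifP => _; rewrite ?mulr1 ?mulr0 ?addr0; ring.
Qed.

Definition qf t : R[i] := (sqn t / 4)%:C.

Lemma kd_sum c i I (r : seq I) (g g' : I -> T -> R[i]) : 0 <= c -> (forall k, kd c i (g k) (g' k)) ->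
  kd c i (fun t => \sum_(k <- r) g k t) (fun t => \sum_(k <- r) g' k t) \/ r = [::].
Proof.
move=> c0 h; elim: r => [|k r [ih|->]]; first by right.
  left; apply: (kd_eq (kdD (h k) ih)) => t; by rewrite big_cons.
by left; apply: (kd_eq (h k)) => t; rewrite big_seq1.
Qed.

Lemma kd_qf i : kd 0 i qf (fun t => (tnth t i / 2)%:C).
Proof.
have h k : kd 0 i (fun t => (4^-1)%:C * ((tnth t k)%:C * (tnth t k)%:C))
    (fun t => (4^-1)%:C * ((k == i)%:R * (tnth t k)%:C + (tnth t k)%:C * (k == i)%:R)).
  apply: kdZ => //; have := kdM (lexx 0) (lexx 0) (kd_coord i k) (kd_coord i k).
  by rewrite addr0.
have [|h0] := kd_sum (index_enum 'I_n) (lexx 0) h; last first.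
  by have := mem_index_enum i; rewrite h0.
move=> hk; apply: (kd_eq hk) => t.
  rewrite /qf /sqn mulr_suml rmorph_sum; apply: eq_bigr => k _.
  by rewrite -!rmorphM /=; congr (_%:C); rewrite mulrC expr2.
rewrite (bigD1 i) //= eqxx mul1r mulr1 big1 ?addr0; last first.
  by move=> k /negbTE ->; rewrite mul0r mulr0 addr0 mulr0.
by rewrite -rmorphD -rmorphM /=; congr (_%:C); field.
Qed.

Lemma kd_qfX i j : kd 0 i (fun t => qf t ^+ j) (fun t => j%:R * qf t ^+ j.-1 * (tnth t i / 2)%:C).
Proof.
elim: j => [|j ih].
  by apply: (kd_eq (kd_cst i 1)) => t; rewrite ?expr0 // !mul0r.
have := kdM (lexx 0) (lexx 0) (kd_qf i) ih; rewrite addr0 => h.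
apply: (kd_eq h) => t; first by rewrite exprS.
case: j {ih h} => [|j] /=; first by rewrite !expr0; ring.
by rewrite exprS -[j.+2%:R]natr1; ring.
Qed.

Definition Eb (b : R[i]) t : R[i] := cexp (- b * qf t).

Lemma seqcont_qf : seqcont (qf : T -> cplx R).
Proof.
apply: seqcont_real => u t ut; apply: cvgM; last exact: cvg_cst.
rewrite /sqn; elim: (index_enum 'I_n) => [|j r ih].
  by rewrite big_nil; under eq_fun do rewrite big_nil; exact: cvg_cst.
rewrite big_cons; under eq_fun do rewrite big_cons.
by apply: cvgD => //; apply: cvgM; exact: ut.
Qed.

Lemma seqcont_Eb b : seqcont (Eb b : T -> cplx R).
Proof.
move=> u t ut; apply: (@cexp_cvg R (fun k => - b * qf (u k)) (- b * qf t)).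
apply: (@cvgZ _ (cplx R)); first exact: cvg_cst.
exact: seqcont_qf.
Qed.

Lemma nrm_Eb b t : nrm (Eb b t) = wgt 0 (complex.Re b / 4) t.
Proof.
rewrite nrm_cexp /wgt mul0r sub0r; congr expR.
by rewrite /qf; case: b => x y /=; ring.
Qed.

Lemma qf_shift i s t : qf (shiftc i s t) = qf t + (s * tnth t i / 2 + s ^+ 2 / 4)%:C.
Proof.
rewrite /qf -rmorphD; congr (_%:C); rewrite /sqn (bigD1 i) //= [X in _ = X / _ + _](bigD1 i) //=.
rewrite tnth_shiftc eqxx [X in (_ + X) / _](eq_bigr (fun j => tnth t j ^+ 2)); last first.
  by move=> j ji; rewrite tnth_shiftc (negbTE ji) addr0.
by field.
Qed.

Lemma kd_Eb b i : 0 < complex.Re b ->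
  kd (complex.Re b / 4) i (Eb b) (fun t => - b * (tnth t i / 2)%:C * Eb b t).
Proof.
move=> b0; have b4 : 0 <= complex.Re b / 4 by rewrite divr_ge0 // ltW.
have bE : gb (complex.Re b / 4) (Eb b).
  split; first exact: seqcont_Eb.
  by exists 1, 0; split=> // t; rewrite nrm_Eb mul1r.
split=> //.
  have h1 : gb 0 (fun t => - b * (tnth t i / 2)%:C).
    have := gbM (gb_cst (- b * (2^-1)%:C)) (gb_coord i); rewrite addr0.
    by congr gb; apply/funext => t; rewrite rmorphM /=; ring.
  by have := gbM h1 bE; rewrite add0r.
set nb := nrm b; have nb0 : 0 <= nb := nrm_ge0 b.
(* With z the increment of the exponent, |z| <= |s| nb (1 + |x|/2) where x is the i-th coordinate;
   |z|^2 costs e^{|x|} and e^{|z|} costs e^{nb (1 + |x|)}, whence the linear rate 1 + nb. *)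
exists (4 * nb ^+ 2 * expR nb + nb), (1 + nb); split.
- by rewrite addr_ge0 ?mulr_ge0 ?exprn_ge0 ?expR_ge0.
- by rewrite addr_ge0.
move=> s t s1; rewrite /Eb qf_shift mulrDr cexpD -/(Eb b t).
set x := tnth t i; set z := - b * _%:C.
have -> : Eb b t * cexp z - Eb b t - s%:C * (- b * (x / 2)%:C * Eb b t) =
   Eb b t * ((cexp z - 1 - z) + (- b) * (s ^+ 2 / 4)%:C).
  by rewrite /z !rmorphD /= !rmorphM /=; ring.
have x0 := normr_ge0 x; have s0 := normr_ge0 s.
have nz : nrm z <= `|s| * (nb * (1 + `|x| / 2)).
  rewrite /z nrmM nrmN nrm_real -/nb mulrCA ler_wpM2l //.
  apply: le_trans (ler_normD _ _) _; rewrite !normrM [ `|2^-1| ]ger0_norm ?invr_ge0 //.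
  rewrite [ `|4^-1| ]ger0_norm ?invr_ge0 //.
  by have := ler_wpM2l s0 s1; lra.
have ex : 1 + `|x| / 2 <= expR (`|x| / 2) := expR_ge1Dx _.
have ex2 : (1 + `|x| / 2) ^+ 2 <= expR `|x|.
  rewrite [X in expR X]splitr expRD -expr2 lerXn2r ?nnegrE ?expR_ge0 //; lra.
have nz1 : nrm z <= nb * (1 + `|x|).
  apply: le_trans nz _; apply: le_trans (ler_piMl _ s1) _; last by rewrite ler_wpM2l //; lra.
  by rewrite mulr_ge0 //; lra.
have nz2 : nrm z ^+ 2 <= s ^+ 2 * (nb ^+ 2 * expR `|x|).
  apply: (@le_trans _ _ ((`|s| * (nb * (1 + `|x| / 2))) ^+ 2)).
    rewrite lerXn2r ?nnegrE ?nrm_ge0 // !mulr_ge0 //; lra.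
  by rewrite !exprMn real_normK ?num_real // ler_wpM2l ?sqr_ge0 // ler_wpM2l ?sqr_ge0.
have xa : `|x| <= abs1 t := tnth_le_abs1 t i.
have main : 4 * nrm z ^+ 2 * expR (nrm z) <= s ^+ 2 * (4 * nb ^+ 2 * expR nb * wgt (1 + nb) 0 t).
  have e1 : expR (nrm z) <= expR (nb * (1 + `|x|)) by rewrite ler_expR.
  have := ler_pM (sqr_ge0 (nrm z)) (expR_ge0 _) nz2 e1.
  have -> : s ^+ 2 * (nb ^+ 2 * expR `|x|) * expR (nb * (1 + `|x|)) =
     s ^+ 2 * (nb ^+ 2 * expR nb * expR ((1 + nb) * `|x|)).
    have ee : expR `|x| * expR (nb * (1 + `|x|)) = expR nb * expR ((1 + nb) * `|x|).
      by rewrite -!expRD; congr expR; ring.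
    transitivity (s ^+ 2 * nb ^+ 2 * (expR `|x| * expR (nb * (1 + `|x|)))); first ring.
    by rewrite ee; ring.
  have : expR ((1 + nb) * `|x|) <= wgt (1 + nb) 0 t.
    by rewrite ler_expR mul0r subr0 ler_wpM2l // addr_ge0.
  move=> g1 g2.
  have g3 : 0 <= s ^+ 2 * (nb ^+ 2 * expR nb).
    by apply: mulr_ge0; [exact: sqr_ge0|apply: mulr_ge0; [exact: sqr_ge0|exact: expR_ge0]].
 
  have := ler_wpM2l g3 g1; lra.
rewrite nrmM nrm_Eb; apply: (@le_trans _ _ (wgt 0 (complex.Re b / 4) t * (s ^+ 2 * ((4 * nb ^+ 2 * expR nb + nb) * wgt (1 + nb) 0 t)))).
  rewrite ler_wpM2l ?wgt_ge0 //; apply: le_trans (nrmD _ _) _.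
  rewrite mulrDl mulrDr lerD //; first exact: le_trans (cexp_le2 z) main.
  rewrite nrmM nrmN nrm_real -/nb ger0_norm; last by rewrite divr_ge0 // sqr_ge0.
  have w1 : 1 <= wgt (1 + nb) 0 t by rewrite wgt1_ge1 // addr_ge0.
  have := ler_wpM2l (mulr_ge0 nb0 (sqr_ge0 s)) w1; have := mulr_ge0 nb0 (sqr_ge0 s); lra.
have -> : wgt (1 + nb) (complex.Re b / 4) t = wgt 0 (complex.Re b / 4) t * wgt (1 + nb) 0 t.
  by rewrite wgtM add0r addr0.
by apply: le_of_eq; ring.
Qed.

Definition rk (b : R[i]) (j : nat) t : R[i] := qf t ^+ j * Eb b t.

Lemma kd_rk b j i : 0 < complex.Re b ->
  kd (complex.Re b / 4) i (rk b j)
    (fun t => (tnth t i / 2)%:C * (j%:R * rk b j.-1 t - b * rk b j t)).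
Proof.
move=> b0; have b4 : 0 <= complex.Re b / 4 by rewrite divr_ge0 // ltW.
have := kdM (lexx 0) b4 (kd_qfX i j) (kd_Eb i b0); rewrite add0r => h.
by apply: (kd_eq h) => t //; rewrite /rk; ring.
Qed.

Lemma gb_rk b j : 0 < complex.Re b -> gb (complex.Re b / 4) (rk b j).
Proof.
move=> b0; have h1 : gb 0 (fun t => qf t ^+ j).
  elim: j => [|j ih]; first by rewrite (_ : (fun t => _) = (fun=> 1)); [exact: gb_cst|apply/funext => t; rewrite expr0].
  have hq : gb 0 qf.
    split; first exact: seqcont_qf.
    exists 1, 2; split=> // t; rewrite nrm_real mul1r /wgt mul0r subr0 ger0_norm ?divr_ge0 ?sqn_ge0 //.
    have h2 : sqn t <= abs1 t ^+ 2.
      rewrite /sqn /abs1 expr2 mulr_suml; apply: ler_sum => i _.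
      rewrite -(real_normK (num_real (tnth t i))) expr2 ler_wpM2l //; exact: tnth_le_abs1.
    have e1 : abs1 t <= expR (abs1 t) by apply: le_trans (expR_ge1Dx _); rewrite lerDr.
    have e2 : abs1 t ^+ 2 <= expR (2 * abs1 t).
      by rewrite mulr2n mulrDl mul1r expRD -expr2 lerXn2r ?nnegrE ?expR_ge0 ?abs1_ge0.
    have := expR_ge0 (2 * abs1 t); lra.
  have := gbM hq ih; rewrite addr0; congr gb; apply/funext => t; by rewrite exprS.
have bE : gb (complex.Re b / 4) (Eb b).
  split; first exact: seqcont_Eb.
  by exists 1, 0; split=> // t; rewrite nrm_Eb mul1r.
by have := gbM h1 bE; rewrite add0r.
Qed.

End Kernels.

(** * Integrated Weyl operators and the action of the generators on their kernels *)

Section WeylIntegrals.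
Context (R : realType) (X : completeNormedModType R[i]) (d : nat).
Variables (A B : 'I_d -> set (X * X)) (U V : 'I_d -> R -> {linear X -> X}).
Hypothesis HW : weyl_pair A B U V.
Local Notation N := (d + d)%N.
Local Notation T := (N.-tuple R).
Local Notation mu := (lebesgue_tuple R N).
Local Notation W := (W U V).
Local Notation Zg := (Zg U V).
Implicit Types (t : T) (i : 'I_N) (f : X).

Definition S (g : T -> R[i]) (f : X) : X := BI mu (fun t => g t *: W t f).

Lemma bmeas_gW c g f : gb c g -> bmeas (fun t => g t *: W t f).
Proof.
move=> [sg _]; apply: seqcont_bmeas; apply: (@seqcontZ _ _ X) => //.
exact: (W_seqcont HW).
Qed.

(** One constant M serves for all kernels, so that a factor s^2 in the bound of a remainder survives
    integration. *)
Lemma S_ex : exists2 M : R, 0 <= M & forall c a C g f, 0 < c -> gb c g ->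
  (forall t, nrm (g t) <= C * wgt a c t) ->
  Bint mu (fun t => g t *: W t f) /\ nrm (S g f) <= C * (M * Kw N a c * nrm f).
Proof.
have [M M0 hM] := W_bound HW; exists M => // c a C g f c0 bg hg.
have h t : nrm (g t *: W t f) <= C * M * nrm f * wgt a c t.
  rewrite nrmZ; apply: le_trans (ler_pM (nrm_ge0 _) (nrm_ge0 _) (hg t) (hM t f)) _.
  by apply: le_of_eq; ring.
have [h1 h2] := Bint_wgt c0 (bmeas_gW f bg) h; split=> //.
by apply: le_trans h2 _; apply: le_of_eq; ring.
Qed.

Lemma S_Bint c g f : 0 < c -> gb c g -> Bint mu (fun t => g t *: W t f).
Proof.
move=> c0 bg; have [M _ hM] := S_ex; have [sg [C [a [C0 a0 hg]]]] := bg.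
by case: (hM c a C g f c0 bg hg).
Qed.

Lemma S_bnd c g : 0 < c -> gb c g -> exists2 M : R, 0 <= M & forall f, nrm (S g f) <= M * nrm f.
Proof.
move=> c0 bg; have [M M0 hM] := S_ex; have [sg [C [a [C0 a0 hg]]]] := bg.
exists (C * (M * Kw N a c)); first by rewrite !mulr_ge0 ?Kw_ge0.
by move=> f; have [_] := hM c a C g f c0 bg hg; rewrite !mulrA.
Qed.

Lemma S_D c g h f : 0 < c -> gb c g -> gb c h ->
  S (fun t => g t + h t) f = S g f + S h f.
Proof.
move=> c0 bg bh; rewrite /S -(BI_D (S_Bint f c0 bg) (S_Bint f c0 bh)); congr BI.
by apply/funext => t; rewrite scalerDl.
Qed.

Lemma S_Z c (z : R[i]) g f : 0 < c -> gb c g -> S (fun t => z * g t) f = z *: S g f.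
Proof.
move=> c0 bg; have [_ <-] := BintZ z (S_Bint f c0 bg); congr BI.
by apply/funext => t; rewrite scalerA.
Qed.

Lemma gbZ c (z : R[i]) (g : T -> R[i]) : gb c g -> gb c (fun t => z * g t).
Proof. by move=> h; have := gbM (gb_cst N z) h; rewrite add0r. Qed.

Lemma gbN c (g : T -> R[i]) : gb c g -> gb c (fun t => - g t).
Proof.
by move=> /(gbZ (-1)); congr gb; apply/funext => t; rewrite mulN1r.
Qed.

Lemma S_B c g h f : 0 < c -> gb c g -> gb c h ->
  S (fun t => g t - h t) f = S g f - S h f.
Proof.
move=> c0 bg bh; rewrite (S_D f c0 bg (gbN bh)); congr (_ + _).
rewrite -scaleN1r -(S_Z (-1) f c0 bh); congr S.
by apply/funext => t; rewrite mulN1r.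
Qed.

Lemma gb_sum c I (r : seq I) (g : I -> T -> R[i]) : 0 <= c -> (forall k, gb c (g k)) ->
  gb c (fun t => \sum_(k <- r) g k t).
Proof.
move=> c0 h; elim: r => [|k r ih].
  rewrite (_ : (fun t => _) = (fun=> 0)); last by apply/funext => t; rewrite big_nil.
  split; first exact: (@seqcont_cst _ _ (cplx R)).
  by exists 0, 0; split=> // t; rewrite nrm0 mul0r.
rewrite (_ : (fun t => _) = (fun t => g k t + \sum_(k <- r) g k t)); first exact: gbD.
by apply/funext => t; rewrite big_cons.
Qed.

Lemma S_sum c I (r : seq I) (g : I -> T -> R[i]) f : 0 < c -> (forall k, gb c (g k)) ->
  S (fun t => \sum_(k <- r) g k t) f = \sum_(k <- r) S (g k) f.
Proof.
move=> c0 h; elim: r => [|k r ih].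
  rewrite big_nil /S (_ : (fun t => _) = (fun=> 0)) ?BI0 //.
  by apply/funext => t; rewrite big_nil scale0r.
rewrite big_cons -ih -(S_D f c0 (h k) (gb_sum r (ltW c0) h)); congr S.
by apply/funext => t; rewrite big_cons.
Qed.

Lemma S_linear c g : 0 < c -> gb c g -> linear (S g).
Proof.
move=> c0 bg z x y; rewrite /S; have [h1 h2] := BintZ z (S_Bint x c0 bg).
rewrite -h2 -(BI_D h1 (S_Bint y c0 bg)); congr BI; apply/funext => t.
by rewrite linearP scalerDr !scalerA [g t * z]mulrC.
Qed.

Lemma S_0 c g : 0 < c -> gb c g -> S g 0 = 0.
Proof.
by move=> c0 bg; have := S_linear c0 bg (-1) 0 0; rewrite scaler0 addr0 scaleN1r addNr.
Qed.

Lemma jw_shift i s t : jw i (shiftc i s t) = jw i t.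
Proof.
rewrite /jw; case: (split_ordP i) => j ->.
  by rewrite tv_shift_l.
by rewrite tu_shift_r.
Qed.

(** The derivative at s = 0 of the kernels [Ks]: it is the kernel of the generator of [Zg i]
    composed with [S g], on the left for sg = 1 and on the right for sg = -1. *)
Definition Dk (sg : R) i (g g' : T -> R[i]) t : R[i] :=
  - g' t + (0 +i* (sg / 2 * jw i t)) * g t.

Lemma kd_jw i : kd 0 i (fun t : T => (jw i t)%:C) (fun _ => 0).
Proof.
rewrite /jw; case: (split_ordP i) => j ->.
  have := kdZ (-1) (lexx 0) (kd_coord R (lshift d j) (rshift d j)).
  rewrite eq_rlshift mulr0 => h; apply: (kd_eq h) => t //.
  by rewrite rmorphN mulN1r.
have := kd_coord R (rshift d j) (lshift d j); rewrite eq_lrshift => h.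
by apply: (kd_eq h).
Qed.

Lemma kd_Dk sg c i g g' g'' : 0 <= c -> kd c i g g' -> kd c i g' g'' ->
  kd c i (Dk sg i g g') (fun t => - g'' t + (0 +i* (sg / 2 * jw i t)) * g' t).
Proof.
move=> c0 h1 h2; have a1 := kdZ (-1) c0 h2.
have k1 := kdM (lexx 0) c0 (kd_jw i) h1; rewrite add0r in k1.
have a2 := kdZ (0 +i* (sg / 2)) c0 k1; apply: (kd_eq (kdD a1 a2)) => t.
  rewrite /Dk mulN1r mulrA; congr (_ + _ * _).
  by simpc.
rewrite mulN1r mul0r add0r mulrA; congr (_ + _ * _).
by simpc.
Qed.

(* The kernel of [S g], after the change of variable that absorbs the action of
   [Zg i s] on either side (sg = 1 on the left, sg = -1 on the right). *)
Definition Ks (sg : R) i (g : T -> R[i]) s t : R[i] :=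
  g (shiftc i (- s) t) * expi (sg * (s * jw i t / 2)).

Lemma Ks_diff sg c i g g' : 0 <= c -> kd c i g g' ->
  exists C a : R, [/\ 0 <= C, 0 <= a & forall s t, `|s| <= 1 ->
    nrm (Ks sg i g s t - g t - s%:C * Dk sg i g g' t) <= s ^+ 2 * C * wgt a c t].
Proof.
move=> c0 [bg bg' dg].
have [_ [C1 [a1 [C10 a10 h1]]]] := bg; have [_ [C2 [a2 [C20 a20 h2]]]] := bg'.
have [C3 [a3 [C30 a30 h3]]] := dg.
have bj : gb 0 (fun t : T => (sg / 2)%:C * (jw i t)%:C) by case: (kdZ (sg / 2)%:C (lexx 0) (kd_jw i)).
have [_ [C4 [a4 [C40 a40 h4]]]] := bj.
pose a := a1 + a2 + a3 + a4.
have A1 : a1 <= a by rewrite /a; lra.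
have A2 : a2 <= a by rewrite /a; lra.
have A3 : a3 <= a by rewrite /a; lra.
have A4 : a4 <= a by rewrite /a; lra.
have a0 : 0 <= a by rewrite /a !addr_ge0.
exists (C3 + C2 * C4 + 2 * C1 * C4 ^+ 2), (a + a + a); split.
- by rewrite !addr_ge0 ?mulr_ge0 ?sqr_ge0.
- by rewrite !addr_ge0.
move=> s t s1; rewrite /Ks; set gs := g _; set y := sg / 2 * jw i t.
have -> : sg * (s * jw i t / 2) = s * y by rewrite /y; field.
have ny : `|y| <= C4 * wgt a 0 t.
  by have := gb_mono C40 A4 h4 t; rewrite -rmorphM nrm_real.
(* The remainder of the translation, the product of the two first-order terms, and the remainder of
   the phase. *)
have -> : gs * expi (s * y) - g t - s%:C * Dk sg i g g' t =
  (gs - g t - (- s)%:C * g' t) * expi (s * y) - s%:C * g' t * (expi (s * y) - 1)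
  + g t * (expi (s * y) - 1 - (0 +i* (s * y))).
  rewrite /Dk -/y; have -> : 0 +i* (s * y) = s%:C * (0 +i* y) by simpc.
  by rewrite rmorphN /=; ring.
have wa := @wgt_ge0 R N.
have b1 : nrm (gs - g t - (- s)%:C * g' t) <= s ^+ 2 * (C3 * wgt a c t).
  have := h3 (- s) t; rewrite normrN sqrrN => /(_ s1) h; apply: le_trans h _.
  by rewrite ler_wpM2l ?sqr_ge0 // ler_wpM2l // wgt_mono.
have b2 : nrm (g' t) <= C2 * wgt a c t := gb_mono C20 A2 h2 t.
have b3 : nrm (g t) <= C1 * wgt a c t := gb_mono C10 A1 h1 t.
have b4 : nrm (expi (s * y) - 1) <= `|s| * (C4 * wgt a 0 t).
  by apply: le_trans (expi_le _) _; rewrite normrM ler_wpM2l.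
have b5 : nrm (expi (s * y) - 1 - (0 +i* (s * y))) <= 2 * (s ^+ 2 * (C4 * wgt a 0 t) ^+ 2).
  apply: le_trans (expi_le2 _) _; rewrite ler_wpM2l // exprMn ler_wpM2l ?sqr_ge0 //.
  rewrite -(real_normK (num_real y)) lerXn2r ?nnegrE //; exact: le_trans ny.
apply: le_trans (nrmD _ _) _; apply: le_trans (lerD (nrmB _ _) (lexx _)) _.
rewrite !nrmM nrm_expi mulr1 nrm_real.
have w1 : 1 <= wgt a 0 t by rewrite wgt1_ge1.
have g2 := ler_pM (nrm_ge0 _) (nrm_ge0 _) b2 b4.
have g3 := ler_pM (nrm_ge0 _) (nrm_ge0 _) b3 b5.
have -> : wgt (a + a + a) c t = wgt a 0 t * wgt a 0 t * wgt a c t.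
  by rewrite !wgtM addr0 add0r.
set w := wgt a 0 t in w1 g2 g3 b4 b5 *; set v := wgt a c t in b1 b2 b3 g2 g3 *.
have w2 : w <= w * w by rewrite ler_peMr // (le_trans ler01).
have ww1 : 1 <= w * w by apply: le_trans w1 w2.
have v0 : 0 <= v := wgt_ge0 _ _ _.
have s20 := sqr_ge0 s.
have e1 : s ^+ 2 * (C3 * v) <= s ^+ 2 * (C3 * v) * (w * w).
  by rewrite ler_peMr //; apply: mulr_ge0 => //; exact: mulr_ge0.
have e2 : `|s| * (nrm (g' t) * nrm (expi (s * y) - 1)) <= s ^+ 2 * (C2 * C4) * v * (w * w).
  apply: le_trans (ler_wpM2l (normr_ge0 s) g2) _.
  have -> : `|s| * (C2 * v * (`|s| * (C4 * w))) = `|s| ^+ 2 * (C2 * C4) * v * w by ring.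
  rewrite real_normK ?num_real // ler_wpM2l //; apply: mulr_ge0 => //.
  by apply: mulr_ge0 => //; exact: mulr_ge0.
rewrite -mulrA; apply: le_trans (lerD (lerD (le_trans b1 e1) e2) g3) _.
by apply: le_of_eq; ring.
Qed.

Lemma gb_Ks sg c i g g' s : 0 <= c -> kd c i g g' -> `|s| <= 1 -> gb c (Ks sg i g s).
Proof.
move=> c0 hk s1; have [bg bg' dg] := hk; split.
  have [sg1 _] := bg; apply: (@seqcontZ _ _ (cplx R) _ (fun t => expi (sg * (s * jw i t / 2)))).
    move=> u t ut; apply: (sg1 (fun k => shiftc i (- s) (u k))) => j.
    by under eq_fun do rewrite tnth_shiftc; rewrite tnth_shiftc; apply: cvgD; [exact: ut|exact: cvg_cst].
  move=> u t ut; apply: expi_cvg; apply: cvgM; first exact: cvg_cst.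
  apply: cvgM; last exact: cvg_cst.
  apply: cvgM; first exact: cvg_cst.
  rewrite /jw; case: fintype.split => j; first by apply: cvgN; exact: ut.
  exact: ut.
have [_ [C [a [C0 a0 h]]]] := bg; exists (C * expR a), (a + 2 * c); split.
- by rewrite mulr_ge0 ?expR_ge0.
- by rewrite addr_ge0 // mulr_ge0.
move=> t; rewrite /Ks nrmM nrm_expi mulr1; apply: le_trans (h _) _.
by rewrite -mulrA ler_wpM2l // wgt_shift // normrN.
Qed.

(** The shift produced by [Z_W] is absorbed by a translation of the integration variable; the phase
    survives it unchanged because [jw i] does not involve the coordinate i. *)
Lemma Z_S c i g g' s f : 0 < c -> kd c i g g' -> `|s| <= 1 ->
  Zg i s (S g f) = S (Ks 1 i g s) f.
Proof.
move=> c0 hk s1; have [bg _ _] := hk.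
have [Mz hMz] : exists M, forall x, nrm (Zg i s x) <= M * nrm x.
  rewrite /Zg; case: fintype.split => j.
    by have [_ [_ [_ [M hM]]]] := weyl_U HW j; exists M.
  by have [_ [_ [_ [M hM]]]] := weyl_V HW j; exists M.
have [h1 <-] := Bint_lin hMz (S_Bint f c0 bg).
have h2 := S_Bint f c0 (gb_Ks 1 (ltW c0) hk s1).
rewrite [RHS]/S; have [_ <-] := BI_shift i s h2; congr BI; apply/funext => t /=.
rewrite linearZ /= (Z_W HW) scalerA /Ks jw_shift mul1r; congr (_ * _ *: _).
by rewrite shiftcD addrC subrr; congr g; apply: eq_from_tnth => k; rewrite tnth_shiftc; case: ifP; rewrite addr0.
Qed.

Lemma S_Z_right c i g g' s f : 0 < c -> kd c i g g' -> `|s| <= 1 ->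
  S g (Zg i s f) = S (Ks (-1) i g s) f.
Proof.
move=> c0 hk s1; have h2 := S_Bint f c0 (gb_Ks (-1) (ltW c0) hk s1).
rewrite /S; have [_ <-] := BI_shift i s h2; congr BI; apply/funext => t /=.
rewrite (W_Z HW) scalerA /Ks jw_shift mulN1r; congr (_ * _ *: _).
by rewrite shiftcD addrC subrr; congr g; apply: eq_from_tnth => k; rewrite tnth_shiftc; case: ifP; rewrite addr0.
Qed.

Lemma gb_Dk sg c i g g' : 0 <= c -> kd c i g g' -> gb c (Dk sg i g g').
Proof.
move=> c0 [bg bg' _]; apply: gbD; first exact: gbN.
have [bj _ _] := kd_jw i; have := gbM (gbZ (0 +i* (sg / 2)) bj) bg; rewrite add0r.
by congr gb; apply/funext => t; congr (_ * _); simpc.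
Qed.

Lemma Ks_S_diff sg c i g g' : 0 < c -> kd c i g g' ->
  exists2 M : R, 0 <= M & forall s f, `|s| <= 1 ->
    nrm (S (Ks sg i g s) f - S g f - s%:C *: S (Dk sg i g g') f) <= s ^+ 2 * (M * nrm f).
Proof.
move=> c0 hk; have [C [a [C0 a0 h]]] := Ks_diff sg (ltW c0) hk.
have [M M0 hM] := S_ex; exists (C * (M * Kw N a c)); first by rewrite !mulr_ge0 ?Kw_ge0.
move=> s f s1; have [bg bg' _] := hk; have bK := gb_Ks sg (ltW c0) hk s1.
have bD := gb_Dk sg (ltW c0) hk; have bKg := gbD bK (gbN bg).
rewrite -(S_Z s%:C f c0 bD) -(S_B f c0 bK bg) -(S_B f c0 bKg (gbZ s%:C bD)).
have [_ h2] := hM c a (s ^+ 2 * C) _ f c0 (gbD bKg (gbN (gbZ s%:C bD))) (fun t => h s t s1).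
by apply: le_trans h2 _; rewrite !mulrA.
Qed.

(** The derivative falls on the kernel, hence the range of [S g] lies in the domain of every
    generator. *)
Lemma gen_left c i g g' f : 0 < c -> kd c i g g' ->
  generator (Zg i) (S g f, S (Dk 1 i g g') f).
Proof.
move=> c0 hk; have [M M0 hM] := Ks_S_diff 1 c0 hk.
apply/cvg_dnbhsP => e e0 /=; pose K := M * nrm f + 1.
have K0 : 0 < K by rewrite ltr_wpDl // mulr_ge0 ?nrm_ge0.
exists (Num.min 1 (e / K)); first by rewrite lt_min ltr01 divr_gt0.
move=> s s0; rewrite le_min => /andP [s1 sK]; rewrite (Z_S f c0 hk s1).
have -> : (s^-1)%:C *: (S (Ks 1 i g s) f - S g f) - S (Dk 1 i g g') f =
   (s^-1)%:C *: (S (Ks 1 i g s) f - S g f - s%:C *: S (Dk 1 i g g') f).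
  by rewrite [RHS]scalerBr scalerA -rmorphM /= mulVf // scale1r.
rewrite nrmZ nrm_real normfV mulrC ler_pdivrMr ?normr_gt0 //.
apply: le_trans (hM s f s1) _; rewrite -(real_normK (num_real s)) expr2 -mulrA mulrC ler_wpM2r //.
rewrite ler_pdivlMr // in sK; apply: le_trans sK; rewrite ler_wpM2l // /K; lra.
Qed.

(** For f in the domain, the difference quotient of [S g (Zg i s f)] is computed twice: through the
    boundedness of [S g] and through the kernel. *)
Lemma gen_right c i g g' f h : 0 < c -> kd c i g g' -> generator (Zg i) (f, h) ->
  S g h = S (Dk (-1) i g g') f.
Proof.
move=> c0 hk /cvg_dnbhsP /= hgen; have [bg _ _] := hk.
have [M1 M10 hM1] := S_bnd c0 bg; have [M M0 hM] := Ks_S_diff (-1) c0 hk.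
apply/eqP; rewrite -subr_eq0; apply/eqP; apply: nrm_le0 => e e0.
pose K := M * nrm f + M1 + 1.
have K0 : 0 < K by rewrite /K ltr_wpDl // addr_ge0 // mulr_ge0 ?nrm_ge0.
have eK : 0 < e / K by rewrite divr_gt0.
have [dl dl0 hd] := hgen _ eK; pose s := Num.min dl (Num.min 1 (e / K)).
have s0 : 0 < s by rewrite !lt_min dl0 ltr01 eK.
have ns : `|s| = s by rewrite ger0_norm // ltW.
have s1 : `|s| <= 1 by rewrite ns !ge_min lexx !orbT.
have sd : `|s| <= dl by rewrite ns ge_min lexx.
have sK : s <= e / K by rewrite /s !ge_min lexx !orbT.
have h1 := hd s (lt0r_neq0 s0) sd; have h2 := hM s f s1.
have lin := S_linear c0 bg.
have SB x y : S g (x - y) = S g x - S g y.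
  by have := lin (-1) y x; rewrite !scaleN1r => h3; rewrite addrC h3 addrC.
have SZ z x : S g (z *: x) = z *: S g x.
  by have := lin z x 0; rewrite addr0 (S_0 c0 bg) addr0.
rewrite -(S_Z_right f c0 hk s1) -SB in h2.
have -> : S g h - S (Dk (-1) i g g') f =
  (s^-1)%:C *: (S g (Zg i s f - f) - s%:C *: S (Dk (-1) i g g') f) - S g ((s^-1)%:C *: (Zg i s f - f) - h).
  rewrite [S g (_ *: _ - h)]SB SZ scalerBr scalerA -rmorphM /= mulVf ?lt0r_neq0 // scale1r.
  by rewrite opprB [RHS]addrC [RHS]addrA subrK.
apply: le_trans (nrmB _ _) _; rewrite nrmZ nrm_real normfV ns.
have b1 : s^-1 * nrm (S g (Zg i s f - f) - s%:C *: S (Dk (-1) i g g') f) <= e / K * (M * nrm f).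
  rewrite ler_pdivrMl //; apply: le_trans h2 _; rewrite expr2 -mulrA ler_wpM2l ?(ltW s0) //.
  by rewrite ler_wpM2r // mulr_ge0 ?nrm_ge0.
have b2 : nrm (S g ((s^-1)%:C *: (Zg i s f - f) - h)) <= M1 * (e / K).
  by apply: le_trans (hM1 _) _; rewrite ler_wpM2l.
apply: le_trans (lerD b1 b2) _; rewrite [M1 * _]mulrC -mulrDr -mulrA ler_piMr ?(ltW e0) //.
by rewrite ler_pdivrMl // mulr1 /K; lra.
Qed.

End WeylIntegrals.

(** * The oscillator acting on the kernels q^j e^{-bq} *)

Section OscillatorKernels.
Context (R : realType) (X : completeNormedModType R[i]) (d : nat).
Variables (A B : 'I_d -> set (X * X)) (U V : 'I_d -> R -> {linear X -> X}).
Hypothesis HW : weyl_pair A B U V.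
Local Notation N := (d + d)%N.
Local Notation T := (N.-tuple R).
Local Notation Zg := (Zg U V).
Local Notation S := (S U V).
Implicit Types (t : T) (i : 'I_N) (f : X).

Lemma ii_N1 : (0 +i* 1 : R[i]) * (0 +i* 1) = -1.
Proof. by apply: complex_ext => /=; ring. Qed.

Lemma operatorZ (A0 : set (X * X)) (c : R[i]) x y : is_operator A0 -> A0 (x, y) -> A0 (c *: x, c *: y).
Proof. by move=> [h0 [h1 _]] h; have := h1 c _ _ _ _ h h0; rewrite !addr0. Qed.

Lemma square_gen (A0 : set (X * X)) U0 f p q : is_operator A0 -> generator U0 = imul A0 ->
  generator U0 (f, p) -> generator U0 (p, q) -> square A0 (f, - q).
Proof.
move=> hA ->; move=> [a [/= h1 ->]] [b [/= h2 ->]]; exists a; split=> //=.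
have := operatorZ (- (0 +i* 1)) hA h2.
by rewrite scalerA mulNr ii_N1 opprK scale1r scaleNr.
Qed.

Lemma gen_square (A0 : set (X * X)) U0 f h : is_operator A0 -> generator U0 = imul A0 ->
  square A0 (f, h) -> exists p, generator U0 (f, p) /\ generator U0 (p, - h).
Proof.
move=> hA ->; move=> [a [/= h1 h2]]; exists ((0 +i* 1 : R[i]) *: a); split; first by exists a.
exists ((0 +i* 1 : R[i]) *: h); split=> /=; first exact: operatorZ.
by rewrite scalerA ii_N1 scaleN1r.
Qed.

Lemma Zg_l j : Zg (lshift d j) = U j.
Proof.
apply/funext => s; rewrite /Zg; case: split_ordP => k /eqP.
  by rewrite eq_lshift => /eqP ->.
by rewrite eq_lrshift.
Qed.

Lemma Zg_r j : Zg (rshift d j) = V j.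
Proof.
apply/funext => s; rewrite /Zg; case: split_ordP => k /eqP.
  by rewrite eq_rlshift.
by rewrite eq_rshift => /eqP ->.
Qed.

Definition gen2 i f q := exists p, generator (Zg i) (f, p) /\ generator (Zg i) (p, q).

(** The generators are iA_j and iB_j, so the sum of their squares is -(A^2 + B^2). *)
Lemma oscillator0_gen2 f (q : 'I_N -> X) : (forall i, gen2 i f (q i)) ->
  oscillator0 A B (f, - (2^-1 *: \sum_i q i) - (2^-1 * d%:R) *: f).
Proof.
move=> hq; exists (\sum_j - q (lshift d j)), (\sum_j - q (rshift d j)); split; last split.
- exists (fun j => - q (lshift d j)); split=> // j.
  have [p []] := hq (lshift d j); rewrite Zg_l; apply: square_gen.
    by have [] := weyl_A HW j.
  exact: weyl_UA HW j.
- exists (fun j => - q (rshift d j)); split=> // j.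
  have [p []] := hq (rshift d j); rewrite Zg_r; apply: square_gen.
    by have [] := weyl_B HW j.
  exact: weyl_VB HW j.
- have e (x y : X) : 2^-1 *: (- x + - y) = - (2^-1 *: (x + y)) by rewrite -opprD scalerN.
  by rewrite /= big_split_ord /= !sumrN e.
Qed.

Lemma gen2_oscillator0 f h : oscillator0 A B (f, h) ->
  exists2 q : 'I_N -> X, forall i, gen2 i f (q i) & h = - (2^-1 *: \sum_i q i) - (2^-1 * d%:R) *: f.
Proof.
move=> [_ [_ [[h1 [/= hA ->]] [[h2 [/= hB ->]] /= ->]]]].
exists (fun i => match fintype.split i with inl j => - h1 j | inr j => - h2 j end).
  move=> i; case: (split_ordP i) => j ->.
    rewrite /gen2 Zg_l; apply: gen_square (hA j); first by have [] := weyl_A HW j.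
    exact: weyl_UA HW j.
  rewrite /gen2 Zg_r; apply: gen_square (hB j); first by have [] := weyl_B HW j.
  exact: weyl_VB HW j.
rewrite big_split_ord /=; congr (_ - _); rewrite -scalerN opprD -!sumrN; congr (_ *: (_ + _)).
  apply: eq_bigr => j _; case: split_ordP => k /eqP; last by rewrite eq_lrshift.
  by rewrite eq_lshift => /eqP ->; rewrite opprK.
apply: eq_bigr => j _; case: split_ordP => k /eqP; first by rewrite eq_rlshift.
by rewrite eq_rshift => /eqP ->; rewrite opprK.
Qed.

Variable b : R[i].
Hypothesis b0 : 0 < complex.Re b.
Let c := complex.Re b / 4.
Let c0 : 0 < c. Proof. by rewrite divr_gt0. Qed.

(** [phi1] and [phi2] are the first and second derivatives of q^j e^{-bq} in q. The predecessor of 0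
    is harmless, since its coefficient is 0. *)
Definition phi1 j t : R[i] := j%:R * rk b j.-1 t - b * rk b j t.
Definition phi2 j t : R[i] := j%:R * phi1 j.-1 t - b * phi1 j t.

Lemma kd_lin i g g' h h' (z w : R[i]) : kd c i g g' -> kd c i h h' ->
  kd c i (fun t => z * g t - w * h t) (fun t => z * g' t - w * h' t).
Proof.
move=> h1 h2; have k1 := kdZ z (ltW c0) h1; have k2 := kdZ (- w) (ltW c0) h2.
by apply: (kd_eq (kdD k1 k2)) => t; rewrite mulNr.
Qed.

Lemma kd_rk1 j i : kd c i (rk b j) (fun t => (tnth t i / 2)%:C * phi1 j t).
Proof. exact: kd_rk. Qed.

Lemma kd_phi1 j i : kd c i (phi1 j) (fun t => (tnth t i / 2)%:C * phi2 j t).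
Proof.
apply: (kd_eq (kd_lin j%:R b (kd_rk1 j.-1 i) (kd_rk1 j i))) => t //.
by rewrite /phi2; ring.
Qed.

Lemma kd_rk2 j i : kd c i (fun t => (tnth t i / 2)%:C * phi1 j t)
  (fun t => 2^-1 * phi1 j t + (tnth t i / 2)%:C * (tnth t i / 2)%:C * phi2 j t).
Proof.
have h1 := kdZ (2^-1) (lexx 0) (kd_coord R i i).
have := kdM (lexx 0) (ltW c0) h1 (kd_phi1 j i); rewrite add0r => h.
have e2 : (2^-1)%:C = 2^-1 :> R[i] by rewrite fmorphV rmorph_nat.
apply: (kd_eq h) => t; first by rewrite rmorphM /= e2 [2^-1 * _]mulrC.
by rewrite eqxx !rmorphM /= e2; ring.
Qed.

(** [Dk] applied twice to [rk b j]. The sign sg survives in the cross term only. *)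
Definition DD (sg : R) j i t : R[i] := 2^-1 * phi1 j t + (tnth t i / 2)%:C * (tnth t i / 2)%:C * phi2 j t
  - (0 +i* (sg * jw i t)) * ((tnth t i / 2)%:C * phi1 j t) - ((jw i t / 2) ^+ 2)%:C * rk b j t.

Lemma Dk_Dk sg j i : sg ^+ 2 = 1 ->
  let g := rk b j in let g' := fun t => (tnth t i / 2)%:C * phi1 j t in
  let g'' := fun t => 2^-1 * phi1 j t + (tnth t i / 2)%:C * (tnth t i / 2)%:C * phi2 j t in
  Dk sg i (Dk sg i g g') (fun t => - g'' t + (0 +i* (sg / 2 * jw i t)) * g' t) = DD sg j i.
Proof.
move=> sg2 /=; apply/funext => t; rewrite /Dk /DD.
have -> : 0 +i* (sg * jw i t) = 2 * (0 +i* (sg / 2 * jw i t)).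
  by apply: complex_ext => /=; field.
have -> : ((jw i t / 2) ^+ 2)%:C = - ((0 +i* (sg / 2 * jw i t)) * (0 +i* (sg / 2 * jw i t))) :> R[i].
  apply: complex_ext => /=; last by ring.
  by rewrite mul0r sub0r opprK -expr2 !exprMn sg2 mul1r mulrC.
by ring.
Qed.

(** The kernel of L S(q^j e^{-bq}). At b = 1 the coefficient of q^{j+1} vanishes and that of q^j is
    j: the action of L becomes triangular. *)
Definition Lk j t : R[i] := - (2^-1 * (j%:R * (j%:R - 1 + d%:R))) * rk b j.-1 t
  + (j%:R * b + 2^-1 * (b * d%:R) - 2^-1 * d%:R) * rk b j t + 2^-1 * (1 - b ^+ 2) * rk b j.+1 t.

Lemma rkS j t : rk b j.+1 t = qf t * rk b j t.
Proof. by rewrite /rk exprS mulrA. Qed.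

Lemma sum_jw_tnth t : \sum_(i < N) jw i t * tnth t i = 0.
Proof.
rewrite big_split_ord /= -big_split /= big1 // => j _; rewrite /jw.
case: split_ordP => k /eqP; last by rewrite eq_lrshift.
rewrite eq_lshift => /eqP <-; case: split_ordP => l /eqP; first by rewrite eq_rlshift.
by rewrite eq_rshift => /eqP <-; rewrite /tu /tv; ring.
Qed.

Lemma sum_jw2 t : \sum_(i < N) jw i t ^+ 2 = sqn t.
Proof.
rewrite /sqn !big_split_ord /= addrC; congr (_ + _); apply: eq_bigr => j _; rewrite /jw.
  case: split_ordP => l /eqP; first by rewrite eq_rlshift.
  by rewrite eq_rshift => /eqP <-.
case: split_ordP => k /eqP; last by rewrite eq_lrshift.
by rewrite eq_lshift => /eqP <-; rewrite sqrrN.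
Qed.

(** The cross terms add up to a multiple of the scalar product of J t and t, which is 0. The result
    is the same for both signs: multiplication by L on the left and on the right produces the same
    kernel. *)
Lemma sum_DD sg j t : - (2^-1 * \sum_i DD sg j i t) - 2^-1 * d%:R * rk b j t = Lk j t.
Proof.
have e1 : \sum_(i < N) (tnth t i / 2)%:C * (tnth t i / 2)%:C = qf t.
  under eq_bigr do rewrite -rmorphM /=; rewrite -rmorph_sum /qf /sqn mulr_suml.
  by congr (_%:C); apply: eq_bigr => i _; field.
have e2 : \sum_(i < N) (0 +i* (sg * jw i t)) * (tnth t i / 2)%:C = 0.
  transitivity (\sum_(i < N) (0 +i* (sg / 2)) * (jw i t * tnth t i)%:C : R[i]).
    by apply: eq_bigr => i _; apply: complex_ext => /=; field.
  by rewrite -mulr_sumr -rmorph_sum sum_jw_tnth mulr0.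
have e3 : \sum_(i < N) ((jw i t / 2) ^+ 2)%:C = qf t :> R[i].
  rewrite -rmorph_sum /qf -sum_jw2 mulr_suml; congr (_%:C).
  by apply: eq_bigr => i _; field.
have -> : \sum_i DD sg j i t = d%:R * phi1 j t + qf t * phi2 j t - qf t * rk b j t.
  have e4 : \sum_(i < N) (0 +i* (sg * jw i t)) * ((tnth t i / 2)%:C * phi1 j t) = 0.
    by under eq_bigr do rewrite mulrA; rewrite -mulr_suml e2 mul0r.
  have e5 : \sum_(i < N) (2^-1 : R[i]) = d%:R.
    have e6 : 2^-1 + 2^-1 = 1 :> R[i] by field.
    by rewrite sumr_const card_ord mulrnDr -mulrnDl e6.
  by rewrite /DD !sumrB big_split /= -!mulr_suml e1 e3 e4 e5 subr0.
(* j = 0 and j = 1 are apart because [phi2] lowers the index twice. *)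
rewrite /Lk /phi2 /phi1; case: j => [|j] /=; first by rewrite rkS; field.
case: j => [|j] /=; first by rewrite !rkS; field.
by rewrite !rkS -[j.+2%:R]natr1 -[j.+1%:R]natr1; field.
Qed.

Lemma gb_rk' j : gb c (rk b j : T -> R[i]).
Proof. exact: gb_rk. Qed.

Lemma gb_lin3 (x y z : R[i]) j k l : gb c (fun t : T => x * rk b j t + y * rk b k t + z * rk b l t).
Proof. by apply: gbD; [apply: gbD|]; apply: gbZ; exact: gb_rk'. Qed.

Lemma S_lin3 (x y z : R[i]) j k l f :
  S (fun t => x * rk b j t + y * rk b k t + z * rk b l t) f =
  x *: S (rk b j) f + y *: S (rk b k) f + z *: S (rk b l) f.
Proof.
have g1 := gbZ x (gb_rk' j); have g2 := gbZ y (gb_rk' k); have g3 := gbZ z (gb_rk' l).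
rewrite (S_D HW f c0 (gbD g1 g2) g3) (S_D HW f c0 g1 g2).
by rewrite (S_Z HW x f c0 (gb_rk' j)) (S_Z HW y f c0 (gb_rk' k)) (S_Z HW z f c0 (gb_rk' l)).
Qed.

Lemma gb_DD sg j i : sg ^+ 2 = 1 -> gb c (DD sg j i).
Proof.
move=> sg2; rewrite -(Dk_Dk j i sg2); apply: gb_Dk (ltW c0) _.
exact: kd_Dk (ltW c0) (kd_rk1 j i) (kd_rk2 j i).
Qed.

Lemma S_Lk sg j f : sg ^+ 2 = 1 ->
  - (2^-1 *: \sum_i S (DD sg j i) f) - (2^-1 * d%:R) *: S (rk b j) f = S (Lk j) f.
Proof.
move=> sg2; have gD i := gb_DD j i sg2.
have gs := gb_sum (index_enum 'I_N) (ltW c0) gD.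
have -> : Lk j = (fun t => (- 2^-1) * (\sum_i DD sg j i t) + (- (2^-1 * d%:R)) * rk b j t).
  by apply/funext => t; rewrite -(sum_DD sg) !mulNr.
rewrite (S_D HW f c0 (gbZ _ gs) (gbZ _ (gb_rk' j))).
rewrite (S_Z HW _ f c0 gs) (S_Z HW _ f c0 (gb_rk' j)) (S_sum HW _ f c0 gD).
by rewrite !scaleNr.
Qed.

Lemma L0_left j f : oscillator0 A B (S (rk b j) f, S (Lk j) f).
Proof.
have s1 : (1 : R) ^+ 2 = 1 by rewrite expr1n.
rewrite -(S_Lk j f s1); apply: oscillator0_gen2 => i.
exists (S (Dk 1 i (rk b j) (fun t => (tnth t i / 2)%:C * phi1 j t)) f); split.
  exact: gen_left HW _ _ _ _ _ c0 (kd_rk1 j i).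
have kk := kd_Dk 1 (ltW c0) (kd_rk1 j i) (kd_rk2 j i).
by have := @gen_left _ _ _ _ _ _ _ HW c i _ _ f c0 kk; rewrite (Dk_Dk j i s1).
Qed.

(** Together with [L0_left], this says that S(q^j e^{-bq}) commutes with the oscillator. It gives
    control of an arbitrary element of the domain through its images under these operators. *)
Lemma L0_right j f h : oscillator0 A B (f, h) -> S (rk b j) h = S (Lk j) f.
Proof.
have s1 : (-1 : R) ^+ 2 = 1 by rewrite sqrrN expr1n.
move=> /gen2_oscillator0 [q hq ->]; rewrite -(S_Lk j f s1).
have lin := S_linear HW c0 (gb_rk' j).
have SB x y : S (rk b j) (x - y) = S (rk b j) x - S (rk b j) y.
  by have := lin (-1) y x; rewrite !scaleN1r => h3; rewrite addrC h3 addrC.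
have SZ z x : S (rk b j) (z *: x) = z *: S (rk b j) x.
  by have := lin z x 0; rewrite addr0 (S_0 HW c0 (gb_rk' j)) addr0.
have SD x y : S (rk b j) (x + y) = S (rk b j) x + S (rk b j) y.
  by have := lin 1 x y; rewrite !scale1r.
rewrite SB SZ -scaleNr SZ scaleNr; congr (- (_ *: _) - _).
have -> : S (rk b j) (\sum_i q i) = \sum_i S (rk b j) (q i).
  elim: (index_enum _) => [|i r ih]; first by rewrite !big_nil (S_0 HW c0 (gb_rk' j)).
  by rewrite !big_cons SD ih.
apply: eq_bigr => i _; have [p [h1 h2]] := hq i.
rewrite (gen_right HW c0 (kd_rk1 j i) h2) -(Dk_Dk j i s1).
apply: (gen_right HW c0 _ h1).
exact: kd_Dk (ltW c0) (kd_rk1 j i) (kd_rk2 j i).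
Qed.

End OscillatorKernels.

(** * Curves with a derivative in the uniform quadratic sense *)

Section QuadraticDerivative.
Context (R : realType) (x0 x1 : R).
Implicit Types (V : normedModType R[i]).

Definition qbd V (F : R -> V) := exists2 C : R, 0 <= C & forall x, x0 <= x -> x <= x1 -> nrm (F x) <= C.

Definition qdiff V (F F' : R -> V) := exists C e : R, [/\ 0 <= C, 0 < e & forall x h,
  x0 <= x -> x <= x1 -> x0 <= x + h -> x + h <= x1 -> `|h| <= e ->
  nrm (F (x + h) - F x - h%:C *: F' x) <= C * h ^+ 2].

(* F' is the derivative of F on [x0, x1], with a uniformly quadratic remainder. *)
Definition qd V (F F' : R -> V) := [/\ qbd F, qbd F' & qdiff F F'].

Lemma eq_qd V (F F' G G' : R -> V) : F =1 G -> F' =1 G' -> qd F F' -> qd G G'.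
Proof. by move=> /funext <- /funext <-. Qed.

(** Over n equal steps the increments add up to at most n C (L/n)^2 = C L^2 / n. *)
Lemma qd_const V (F : R -> V) : x0 <= x1 -> qdiff F (fun=> 0) -> F x1 = F x0.
Proof.
move=> x01 [C [e [C0 e0 hF]]]; apply/eqP; rewrite -subr_eq0; apply/eqP; apply: nrm_le0 => r r0.
pose L := x1 - x0; have L0 : 0 <= L by rewrite subr_ge0.
(* The first term keeps the step below e, the second makes the total increment at most r. *)
pose n := (Num.truncn (L / e + C * L ^+ 2 / r)).+1.
have n0 : 0 < n%:R :> R by rewrite ltr0n.
have hn : L / e + C * L ^+ 2 / r <= n%:R by apply: ltW; exact: truncnS_gt.
have hn1 : L / e <= n%:R by apply: le_trans hn; rewrite lerDl divr_ge0 ?mulr_ge0 ?sqr_ge0 // ltW.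
have hn2 : C * L ^+ 2 / r <= n%:R by apply: le_trans hn; rewrite lerDr divr_ge0 // ltW.
pose h := L / n%:R; have h0 : 0 <= h by rewrite divr_ge0 // ltW.
have he : `|h| <= e by rewrite ger0_norm // ler_pdivrMr // mulrC -ler_pdivrMr.
have nh : n%:R * h = L by rewrite mulrC divfK // gt_eqF.
have step k : (k <= n)%N -> nrm (F (x0 + k%:R * h) - F x0) <= k%:R * (C * h ^+ 2).
  elim: k => [|k ih] kn; first by rewrite !mul0r addr0 subrr nrm0.
  apply: le_trans (nrm_tri _ _ (F (x0 + k%:R * h))) _; rewrite addrC -[k.+1%:R]natr1 [X in _ <= X]mulrDl mul1r.
  have kh (m : nat) : (m <= n)%N -> x0 + m%:R * h <= x1.
    by move=> mn; rewrite -lerBrDl -/L -nh ler_wpM2r // ler_nat.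
  apply: lerD; first exact: ih (ltnW kn).
  have -> : x0 + (k%:R + 1) * h = x0 + k%:R * h + h by ring.
  have := hF (x0 + k%:R * h) h; rewrite scaler0 subr0; apply => //.
  - by rewrite lerDl mulr_ge0.
  - exact: kh (ltnW kn).
  - by rewrite -addrA lerDl addr_ge0 // mulr_ge0.
  - by have := kh _ kn; rewrite -natr1 mulrDl mul1r addrA.
have := step n (leqnn n); rewrite nh /L [x0 + _]addrC subrK => b1; apply: le_trans b1 _.
have -> : n%:R * (C * h ^+ 2) = C * L ^+ 2 / n%:R by rewrite /h; field; rewrite gt_eqF.
by rewrite ler_pdivrMr // [r * _]mulrC -ler_pdivrMr.
Qed.

Lemma qd_cst V (c : V) : qd (fun=> c) (fun=> 0).
Proof.
split; first by exists (nrm c) => //; exact: nrm_ge0.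
  by exists 0 => // x _ _; rewrite nrm0.
exists 0, 1; split=> // x h _ _ _ _ _.
by rewrite subrr scaler0 subr0 nrm0 mul0r.
Qed.

Lemma qdM V (a a' : R -> cplx R) (F F' : R -> V) : qd a a' -> qd F F' ->
  qd (fun x => (a x : R[i]) *: F x) (fun x => (a' x : R[i]) *: F x + (a x : R[i]) *: F' x).
Proof.
move=> [[A A0 hA] [A' A'0 hA'] [C [e [C0 e0 h1]]]] [[B B0 hB] [B' B'0 hB'] [D [e' [D0 e'0 h2]]]].
split.
- exists (A * B) => [|x l u]; first exact: mulr_ge0.
  by rewrite nrmZ ler_pM ?nrm_ge0 ?hA ?hB.
- exists (A' * B + A * B') => [|x l u]; first by rewrite addr_ge0 ?mulr_ge0.
  apply: le_trans (nrmD _ _) _; rewrite !nrmZ lerD // ler_pM ?nrm_ge0 //; [exact: hA'|exact: hB|exact: hA|exact: hB'].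
exists (C * B + (A + e * A') * D + A' * B'), (Num.min e e'); split.
- by rewrite !addr_ge0 ?mulr_ge0 ?addr_ge0 ?mulr_ge0 // ltW.
- by rewrite lt_min e0.
move=> x h l u l' u'; rewrite le_min => /andP [he he'].
set p := (a (x + h) : R[i]); set q := (a x : R[i]); set r := (a' x : R[i]).
set f1 := F (x + h); set f0 := F x; set g := F' x; set z : R[i] := h%:C.
have -> : p *: f1 - q *: f0 - z *: (r *: f0 + q *: g) =
  (p - (q + z * r)) *: f1 + (q + z * r) *: (f1 - (f0 + z *: g)) + (z * z * r) *: g.
  rewrite scalerBl scalerBr subrKA !scalerDl !scalerDr !scalerA.
  rewrite [z * q]mulrC [z * r * z]mulrAC.
  set v1 := _ *: f0; set v2 := _ *: g; set v3 := _ *: f0; set v4 := _ *: g.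
  have -> : v1 + v2 + (v3 + v4) = v1 + (v3 + v2) + v4 by rewrite [v3 + v2]addrC -!addrA.
  by rewrite [- (_ + v4)]opprD addrA subrK [in RHS]opprD addrA.
have L0 : 0 <= e + e' by rewrite addr_ge0 // ltW.
apply: le_trans (nrmD _ _) _; apply: le_trans (lerD (nrmD _ _) (lexx _)) _.
rewrite !nrmZ !nrmM nrm_real opprD addrA opprD addrA.
have b1 : nrm (p - q - z * r) <= C * h ^+ 2 by exact: h1.
have b2 : nrm (f1 - f0 - z *: g) <= D * h ^+ 2 by exact: h2.
have b3 : nrm (q + z * r) <= A + e * A'.
  apply: le_trans (nrmD _ _) _; rewrite nrmM nrm_real lerD ?hA // ler_pM ?nrm_ge0 //.
  exact: hA'.
have b4 : nrm r <= A' by exact: hA'.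
have b5 : nrm g <= B' by exact: hB'.
have b6 : nrm f1 <= B by exact: hB.
have c1 := ler_pM (nrm_ge0 _) (nrm_ge0 _) b1 b6; have c2 := ler_pM (nrm_ge0 _) (nrm_ge0 _) b3 b2.
have c3 := ler_wpM2l (sqr_ge0 h) (ler_pM (nrm_ge0 _) (nrm_ge0 _) b4 b5).
have -> : `|h| * `|h| * nrm r * nrm g = h ^+ 2 * (nrm r * nrm g).
  by rewrite -expr2 real_normK ?num_real // mulrA.
by apply: le_trans (lerD (lerD c1 c2) c3) _; apply: le_of_eq; ring.
Qed.

Lemma qd_affine (b0 e : R[i]) : qd (fun x => b0 + x%:C * e : cplx R) (fun=> e).
Proof.
split.
- exists (nrm b0 + (`|x0| + `|x1|) * nrm e); first by rewrite addr_ge0 ?mulr_ge0 ?addr_ge0 ?nrm_ge0.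
  move=> x l u; apply: le_trans (nrmD _ _) _; rewrite lerD2l nrmM nrm_real ler_wpM2r ?nrm_ge0 //.
  rewrite ler_norml; have := ler_norm x1; have := ler_norm (- x0); rewrite normrN.
  by have := normr_ge0 x0; have := normr_ge0 x1; move=> *; apply/andP; split; lra.
- by exists (nrm e) => //; exact: nrm_ge0.
exists 0, 1; split=> // x h _ _ _ _ _; rewrite mul0r.
rewrite (_ : _ - _ = 0) ?nrm0 // -[_ *: (e : cplx R)]/(h%:C * e) rmorphD /=.
by rewrite -[LHS]/((b0 + (x%:C + h%:C) * e) - (b0 + x%:C * e) - h%:C * e : R[i]); ring.
Qed.

Lemma qd_inv (b0 e : R[i]) (c : R) : 0 < c ->
  (forall x, x0 <= x -> x <= x1 -> c <= nrm (b0 + x%:C * e)) ->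
  qd (fun x => (b0 + x%:C * e)^-1 : cplx R) (fun x => - e / (b0 + x%:C * e) ^+ 2).
Proof.
move=> c0 hc; have hi x : x0 <= x -> x <= x1 -> nrm (b0 + x%:C * e)^-1 <= c^-1.
  move=> l u; rewrite nrmV lef_pV2 ?posrE ?hc //.
  exact: lt_le_trans (hc x l u).
split.
- by exists c^-1 => //; rewrite invr_ge0 ltW.
- exists (nrm e * (c^-1 * c^-1)); first by rewrite mulr_ge0 ?nrm_ge0 // mulr_ge0 ?invr_ge0 // ltW.
  move=> x l u; rewrite nrmM nrmN ler_wpM2l ?nrm_ge0 // nrmV nrmX -exprVn expr2 -nrmV.
  by rewrite ler_pM ?nrm_ge0 ?hi.
exists (nrm e ^+ 2 * (c^-1 * c^-1 * c^-1)), 1; split=> //.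
  apply: mulr_ge0; first exact: sqr_ge0.
  by rewrite !mulr_ge0 ?invr_ge0 // ltW.
move=> x h l u l' u' _; set w := b0 + x%:C * e; set w' := b0 + (x + h)%:C * e.
have w0 : w != 0 by apply/eqP => h0; have := hc x l u; rewrite -/w h0 nrm0 leNgt c0.
have w0' : w' != 0 by apply/eqP => h0; have := hc _ l' u'; rewrite -/w' h0 nrm0 leNgt c0.
have -> : w'^-1 - w^-1 - h%:C *: (- e / w ^+ 2 : cplx R) = (h ^+ 2)%:C * e ^+ 2 * (w^-1 * w^-1 * w'^-1) :> R[i].
  rewrite -[_ *: (_ : cplx R)]/(h%:C * (- e / w ^+ 2)) rmorphXn /=.
  have ew : w' = w + h%:C * e by rewrite /w' /w rmorphD /=; ring.
  rewrite -[LHS]/((w'^-1 - w^-1 - h%:C * (- e / w ^+ 2)) : R[i]).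
  have w0'' : w + h%:C * e != 0 by rewrite -ew.
  by rewrite ew; field; rewrite w0 w0''.
rewrite nrmM [nrm (_%:C * _)]nrmM nrm_real nrmX ger0_norm ?sqr_ge0 // -mulrA [X in _ <= X]mulrC.
rewrite ler_wpM2l ?sqr_ge0 // ler_wpM2l ?sqr_ge0 // nrmM; apply: ler_pM; rewrite ?nrm_ge0 ?hi //.
by rewrite nrmM; apply: ler_pM; rewrite ?nrm_ge0 ?hi.
Qed.

Lemma qdX (a a' : R -> cplx R) n : qd a a' ->
  qd (fun x => (a x : R[i]) ^+ n : cplx R) (fun x => n%:R * (a x : R[i]) ^+ n.-1 * (a' x : R[i])).
Proof.
move=> ha; elim: n => [|n ih].
  apply: (eq_qd _ _ (qd_cst (1 : cplx R))) => x; first by rewrite expr0.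
  by rewrite !mul0r.
apply: (eq_qd _ _ (qdM ha ih)) => x; first by rewrite exprS.
rewrite -[LHS]/((a' x : R[i]) * (a x : R[i]) ^+ n + (a x : R[i]) * (n%:R * (a x : R[i]) ^+ n.-1 * (a' x : R[i]))).
case: n {ih} => [|n] /=; first by rewrite !expr0; ring.
by rewrite exprS -[n.+2%:R]natr1; ring.
Qed.

Lemma qd_const' V (F F' : R -> V) : x0 <= x1 -> qd F F' ->
  (forall x, x0 <= x -> x <= x1 -> F' x = 0) -> F x1 = F x0.
Proof.
move=> x01 [_ _ [C [e [C0 e0 h]]]] h0; apply: qd_const => //; exists C, e; split=> // x k l u l' u' ke.
by rewrite -[X in _ *: X](h0 x l u); exact: h.
Qed.

Lemma qd_expsq (k : R[i]) : qd (fun x => cexp (k * (x ^+ 2)%:C) : cplx R)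
  (fun x => 2 * k * x%:C * cexp (k * (x ^+ 2)%:C)).
Proof.
pose L := `|x0| + `|x1|; have L0 : 0 <= L by rewrite addr_ge0.
have xL x : x0 <= x -> x <= x1 -> `|x| <= L.
  move=> l u; rewrite ler_norml; have := ler_norm x1; have := ler_norm (- x0); rewrite normrN /L.
  by have := normr_ge0 x0; have := normr_ge0 x1; move=> *; apply/andP; split; lra.
pose M := expR (nrm k * L ^+ 2).
have hM x : x0 <= x -> x <= x1 -> nrm (cexp (k * (x ^+ 2)%:C)) <= M.
  move=> l u; rewrite nrm_cexp ler_expR; apply: le_trans (Re_le_nrm _) _.
  rewrite nrmM nrm_real ler_wpM2l ?nrm_ge0 // normrX lerXn2r ?nnegrE //.
  exact: xL.
split.
- by exists M => //; exact: expR_ge0.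
- exists (2 * nrm k * L * M).
    by apply: mulr_ge0; [apply: mulr_ge0 => //; apply: mulr_ge0 => //; exact: nrm_ge0|exact: expR_ge0].
  move=> x l u; rewrite nrmM; apply: ler_pM; rewrite ?nrm_ge0 ?hM //.
  by rewrite !nrmM nrm_nat nrm_real ler_wpM2l ?xL // mulr_ge0 ?nrm_ge0.
pose K := nrm k * (2 * L + 1).
have K0 : 0 <= K by rewrite mulr_ge0 ?nrm_ge0 // addr_ge0 ?mulr_ge0.
exists (M * (4 * K ^+ 2 * expR K + nrm k)), 1; split=> //.
  apply: mulr_ge0; first exact: expR_ge0.
  by rewrite addr_ge0 ?nrm_ge0 // mulr_ge0 ?expR_ge0 // mulr_ge0 // exprn_ge0.
move=> x h l u l' u' h1; pose dl : R[i] := k * (2 * x * h + h ^+ 2)%:C.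
have -> : k * ((x + h) ^+ 2)%:C = k * (x ^+ 2)%:C + dl.
  by rewrite /dl -mulrDr -rmorphD; congr (_ * _%:C); ring.
rewrite cexpD; set E := cexp (k * _).
have -> : E * cexp dl - E - h%:C *: (2 * k * x%:C * E : cplx R) =
   E * ((cexp dl - 1 - dl) + k * (h ^+ 2)%:C) :> R[i].
  rewrite -[_ *: (_ : cplx R)]/(h%:C * (2 * k * x%:C * E)) /dl !rmorphD !rmorphM /=.
  by rewrite -[LHS]/((E * cexp _ - E - h%:C * (2 * k * x%:C * E)) : R[i]) rmorph_nat; ring.
have nd : nrm dl <= `|h| * K.
  rewrite /dl nrmM nrm_real /K mulrCA ler_wpM2l ?nrm_ge0 //.
  have -> : 2 * x * h + h ^+ 2 = h * (2 * x + h) by ring.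
  rewrite normrM ler_wpM2l //; apply: le_trans (ler_normD _ _) _; rewrite normrM ger0_norm //.
  by have := xL x l u; lra.
have nd1 : nrm dl <= K by apply: le_trans nd _; exact: ler_piMl.
rewrite nrmM -mulrA ler_pM ?nrm_ge0 ?hM //.
apply: le_trans (nrmD _ _) _; rewrite mulrDl lerD //; last first.
  by rewrite nrmM nrm_real ger0_norm ?sqr_ge0.
have q2 : nrm dl ^+ 2 <= h ^+ 2 * K ^+ 2.
  rewrite -[h ^+ 2]real_normK ?num_real // -exprMn lerXn2r ?nnegrE ?nrm_ge0 //.
  by rewrite mulr_ge0.
have eK : expR (nrm dl) <= expR K by rewrite ler_expR.
apply: le_trans (cexp_le2 _) _.
by have := ler_pM (sqr_ge0 (nrm dl)) (expR_ge0 _) q2 eK; lra.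
Qed.

End QuadraticDerivative.

(** * Gaussian integrals with complex parameter and their Fourier transforms *)

Section GaussianIntegrals.
Context (R : realType) (n : nat).
Local Notation T := (n.-tuple R).
Local Notation mu := (lebesgue_tuple R n).
Implicit Types (t : T) (i : 'I_n).

Lemma wgt_mono_c a c c' t : c' <= c -> wgt a c t <= wgt a c' t.
Proof. by move=> h; rewrite ler_expR lerD2l lerN2 ler_wpM2r // sqn_ge0. Qed.

Lemma qf_le t : nrm (qf t) <= wgt 2 0 t.
Proof.
rewrite nrm_real /wgt mul0r subr0 ger0_norm ?divr_ge0 ?sqn_ge0 //.
have h2 : sqn t <= abs1 t ^+ 2.
  rewrite /sqn /abs1 expr2 mulr_suml; apply: ler_sum => i _.
  rewrite -(real_normK (num_real (tnth t i))) expr2 ler_wpM2l //; exact: tnth_le_abs1.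
have e1 : abs1 t <= expR (abs1 t) by apply: le_trans (expR_ge1Dx _); rewrite lerDr.
have e2 : abs1 t ^+ 2 <= expR (2 * abs1 t).
  by rewrite mulr2n mulrDl mul1r expRD -expr2 lerXn2r ?nnegrE ?expR_ge0 ?abs1_ge0.
have := expR_ge0 (2 * abs1 t); lra.
Qed.

Lemma wgt4 t : wgt 4 0 t = wgt 2 0 t ^+ 2.
Proof. by rewrite expr2 wgtM addr0 -natrD. Qed.

Lemma Eb_le (b : R[i]) (be : R) t : be <= complex.Re b -> nrm (Eb b t) <= wgt 0 (be / 4) t.
Proof. by move=> h; rewrite nrm_Eb wgt_mono_c // ler_wpM2r. Qed.

(** The second-order remainder of the exponential costs e^{|h| q}. Since |h| <= be/2, half of the
    decay of [Eb b] absorbs it, whence the rate be/8 in place of be/4. *)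
Lemma Eb_quad (b h : R[i]) (be : R) t : 0 < be -> be <= complex.Re b -> nrm h <= be / 2 ->
  nrm (Eb (b + h) t - Eb b t + h * rk b 1 t) <= nrm h ^+ 2 * (4 * wgt 4 (be / 8) t).
Proof.
move=> be0 hb hh; have -> : Eb (b + h) t - Eb b t + h * rk b 1 t =
    Eb b t * (cexp (- h * qf t) - 1 - (- h * qf t)).
  by rewrite /rk expr1 /Eb opprD mulrDl cexpD; ring.
rewrite nrmM; have q0 : 0 <= sqn t / 4 by rewrite divr_ge0 ?sqn_ge0.
have nq : nrm (qf t) = sqn t / 4 by rewrite nrm_real ger0_norm.
have e1 : nrm (Eb b t) * expR (nrm (- h * qf t)) <= wgt 0 (be / 8) t.
  rewrite nrm_Eb -expRD ler_expR mul0r !sub0r nrmM nrmN nq.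
  have := ler_wpM2r q0 hh; have := ler_wpM2r (sqn_ge0 t) hb; lra.
have e2 : nrm (- h * qf t) ^+ 2 <= nrm h ^+ 2 * wgt 4 0 t.
  rewrite nrmM nrmN exprMn ler_wpM2l ?sqr_ge0 //.
  rewrite wgt4; apply: lerXn2r; rewrite ?nnegrE ?nrm_ge0 ?wgt_ge0 //; exact: qf_le.
apply: le_trans (ler_wpM2l (nrm_ge0 _) (cexp_le2 _)) _.
have -> : wgt 4 (be / 8) t = wgt 4 0 t * wgt 0 (be / 8) t by rewrite wgtM addr0 add0r.
have := ler_pM (sqr_ge0 _) (mulr_ge0 (nrm_ge0 _) (expR_ge0 _)) e2 e1; lra.
Qed.

Lemma BI_qd (X : completeNormedModType R[i]) (x0 x1 : R) (F F' : R -> T -> X) (c a C e : R) :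
  0 < c -> 0 < e ->
  (forall x, bmeas (F x)) -> (forall x, bmeas (F' x)) ->
  (forall x, x0 <= x -> x <= x1 -> forall t, nrm (F x t) <= C * wgt a c t) ->
  (forall x, x0 <= x -> x <= x1 -> forall t, nrm (F' x t) <= C * wgt a c t) ->
  (forall x h, x0 <= x -> x <= x1 -> x0 <= x + h -> x + h <= x1 -> `|h| <= e -> forall t,
     nrm (F (x + h) t - F x t - h%:C *: F' x t) <= h ^+ 2 * (C * wgt a c t)) ->
  0 <= C ->
  qd x0 x1 (fun x => BI mu (F x)) (fun x => BI mu (F' x)).
Proof.
move=> c0 e0 mF mF' bF bF' dF C0.
have CK : 0 <= C * Kw n a c by rewrite mulr_ge0 ?Kw_ge0.
split.
- by exists (C * Kw n a c) => // x l u; have [] := Bint_wgt c0 (mF x) (bF x l u).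
- by exists (C * Kw n a c) => // x l u; have [] := Bint_wgt c0 (mF' x) (bF' x l u).
exists (C * Kw n a c), e; split=> // x h l u l' u' he.
have [i1 _] := Bint_wgt c0 (mF x) (bF x l u); have [i2 _] := Bint_wgt c0 (mF _) (bF _ l' u').
have [i3 _] := Bint_wgt c0 (mF' x) (bF' x l u).
have [i4 e4] := BintZ h%:C i3; have [i5 e5] := BintB i2 i1; have [i6 e6] := BintB i5 i4.
rewrite -e4 -e5 -e6; have [] := Bint_wgt (C := h ^+ 2 * C) (a := a) c0 i6.1.
  by move=> t; rewrite -mulrA; exact: dF.
by move=> _ h1; apply: le_trans h1 _; apply: le_of_eq; ring.
Qed.

Section Path.
Variables (b0 e : R[i]) (be x0 x1 : R).
Hypothesis be0 : 0 < be.
Hypothesis hb : forall x, x0 <= x -> x <= x1 -> be <= complex.Re (b0 + x%:C * e).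
Let b x : R[i] := b0 + x%:C * e.

(** Differentiation under the integral in the parameter b, along an affine path in the right
    half-plane; all differential equations in b below are derived from it. *)
Lemma Eb_path_qd (X : completeNormedModType R[i]) (w : T -> X) (M : R) :
  bmeas w -> (forall t, nrm (w t) <= M) ->
  qd x0 x1 (fun x => BI mu (fun t => Eb (b x) t *: w t))
    (fun x => BI mu (fun t => (- e * rk (b x) 1 t) *: w t)).
Proof.
move=> mw hw; have M0 : 0 <= M.
  have t0 : T by exact: (nseq_tuple n 0).
  exact: le_trans (nrm_ge0 _) (hw t0).
have c0 : 0 < be / 8 by rewrite divr_gt0.
have cc : be / 8 <= be / 4 by lra.
have mE x : bmeas (Eb (b x) : T -> cplx R) by apply: seqcont_bmeas; exact: seqcont_Eb.
have mr x : bmeas ((fun t => - e * rk (b x) 1 t) : T -> cplx R).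
  apply: seqcont_bmeas; apply: (@seqcontZ _ _ (cplx R) (fun=> - e)); first exact: (@seqcont_cst _ _ (cplx R)).
  apply: (@seqcontZ _ _ (cplx R)); last exact: seqcont_Eb.
  by rewrite (_ : (fun t => qf t ^+ 1) = @qf R n); [exact: seqcont_qf|apply/funext => t; rewrite expr1].
pose C := (1 + nrm e + 4 * nrm e ^+ 2) * M.
have ne0 := nrm_ge0 e; have ne2 := sqr_ge0 (nrm e).
have C0 : 0 <= C by rewrite /C; apply: mulr_ge0 => //; lra.
have M1 : M <= C by rewrite /C ler_peMl //; lra.
have M2 : nrm e * M <= C by rewrite /C ler_wpM2r //; lra.
have M3 : 4 * nrm e ^+ 2 * M <= C by rewrite /C ler_wpM2r //; lra.
apply: (@BI_qd X x0 x1 _ _ (be / 8) 4 C (be / 2 / (nrm e + 1))) => //.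
- by rewrite !divr_gt0 // ltr_wpDl.
- by move=> x; apply: bmeasZ.
- by move=> x; apply: bmeasZ.
- move=> x l u t; rewrite nrmZ [X in _ <= X]mulrC ler_pM ?nrm_ge0 //; last exact: le_trans (hw t) M1.
  apply: le_trans (Eb_le t (hb l u)) _; apply: le_trans (wgt_mono_c 0 t cc) _.
  exact: wgt_mono.
- move=> x l u t; rewrite nrmZ nrmM [nrm (_ * Eb _ t)]nrmM nrmN expr1.
  have h1 := Eb_le t (hb l u); have h2 := qf_le t.
  have h3 := ler_pM (nrm_ge0 _) (nrm_ge0 _) h2 h1; rewrite wgtM add0r addr0 in h3.
  have h4 : wgt 2 (be / 4) t <= wgt 4 (be / 8) t.
    by apply: le_trans (wgt_mono_c 2 t cc) _; apply: wgt_mono; rewrite ler_nat.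
  have h5 := ler_pM (mulr_ge0 (nrm_ge0 _) (nrm_ge0 _)) (nrm_ge0 _) (le_trans h3 h4) (hw t).
  have := ler_wpM2l ne0 h5; have := ler_wpM2r (wgt_ge0 4 (be / 8) t) M2; rewrite -/(b x); lra.
move=> x h l u l' u' he t; have he' : nrm (h%:C * e) <= be / 2.
  rewrite nrmM nrm_real; rewrite ler_pdivlMr ?ltr_wpDl // in he.
  by apply: le_trans he; rewrite ler_wpM2l // lerDl.
rewrite scalerA -!scalerBl nrmZ.
have -> : Eb (b (x + h)) t - Eb (b x) t - h%:C * (- e * rk (b x) 1 t) =
   Eb (b x + h%:C * e) t - Eb (b x) t + h%:C * e * rk (b x) 1 t.
  have -> : b (x + h) = b x + h%:C * e by rewrite /b rmorphD /=; ring.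
  by ring.
have h1 := Eb_quad t be0 (hb l u) he'.
have := ler_pM (nrm_ge0 _) (nrm_ge0 _) h1 (hw t).
rewrite nrmM nrm_real exprMn real_normK ?num_real //.
have := ler_wpM2l (sqr_ge0 h) (ler_wpM2r (wgt_ge0 4 (be / 8) t) M3); lra.
Qed.

End Path.

Definition CI (g : T -> R[i]) : R[i] := BI mu (g : T -> cplx R).

Lemma gb_Bint c g : 0 < c -> gb c g -> Bint mu (g : T -> cplx R).
Proof.
move=> c0 [sg [C [a [C0 a0 h]]]].
have [//] := @Bint_wgt R n (cplx R) g C a c c0 (seqcont_bmeas sg) h.
Qed.

(** By translation invariance the increments of g have integral 0, so s times the integral of g' is
    of order s^2. *)
Lemma CI_kd c i g g' : 0 < c -> kd c i g g' -> CI g' = 0.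
Proof.
move=> c0 [bg bg' [C [a [C0 a0 h]]]]; have i1 := gb_Bint c0 bg; have i2 := gb_Bint c0 bg'.
apply: nrm_le0 => e e0; pose K := C * Kw n a c + 1.
have K0 : 0 < K by rewrite ltr_wpDl // mulr_ge0 ?Kw_ge0.
pose s := Num.min 1 (e / K); have s0 : 0 < s by rewrite lt_min ltr01 divr_gt0.
have sK : s <= e / K by rewrite /s ge_min lexx orbT.
have ns : `|s| = s by rewrite ger0_norm // ltW.
have s1 : `|s| <= 1 by rewrite ns ge_min lexx.
have [i3 e3] := BI_shift i s i1; have [i4 e4] := BintZ s%:C i2.
have [i5 e5] := BintB i3 i1; have [i6 e6] := BintB i5 i4.
have [] := Bint_wgt (C := s ^+ 2 * C) (a := a) c0 i6.1.
  by move=> t; rewrite -mulrA; exact: (h s t s1).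
move=> _; rewrite e6 e5 e4 e3 subrr sub0r nrmN nrmZ nrm_real ns.
have -> : s ^+ 2 * C * Kw n a c = s * (s * (C * Kw n a c)) by rewrite expr2 -!(mulrA s).
rewrite (ler_pM2l s0) => h1; apply: le_trans h1 _.
apply: (@le_trans _ _ (e / K * (C * Kw n a c))).
  exact: (ler_wpM2r (mulr_ge0 C0 (Kw_ge0 _ _ _)) sK).
rewrite -[X in _ <= X]mulr1 -mulrA; apply: (ler_wpM2l (ltW e0)).
by rewrite (ler_pdivrMl _ _ K0) mulr1 /K lerDl.
Qed.

Lemma CI_D c g h : 0 < c -> gb c g -> gb c h -> CI (fun t => g t + h t) = CI g + CI h.
Proof. by move=> c0 bg bh; exact: (BI_D (gb_Bint c0 bg) (gb_Bint c0 bh)). Qed.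

Lemma CI_Z c z g : 0 < c -> gb c g -> CI (fun t => z * g t) = z * CI g.
Proof. by move=> c0 bg; have [_ e] := BintZ z (gb_Bint c0 bg); exact: e. Qed.

Lemma CI_sum c (g : 'I_n -> T -> R[i]) : 0 < c -> (forall k, gb c (g k)) ->
  CI (fun t => \sum_k g k t) = \sum_k CI (g k).
Proof.
move=> c0 h; have [_ e] := BI_sum (index_enum 'I_n) (fun k => gb_Bint c0 (h k)).
exact: e.
Qed.

Section OneGaussian.
Variable b : R[i].
Hypothesis b0 : 0 < complex.Re b.
Let c0 : 0 < complex.Re b / 4. Proof. by rewrite divr_gt0. Qed.
Let bE : gb (complex.Re b / 4) (Eb b : T -> R[i]).
Proof.
split; first exact: seqcont_Eb.
by exists 1, 0; split=> // t; rewrite nrm_Eb mul1r.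
Qed.

(** Integrate the i-th partial derivative of t_i e^{-bq} and sum over i. *)
Lemma CI_qf_Eb : n%:R * CI (Eb b) = 2 * b * CI (rk b 1).
Proof.
have h i : kd (complex.Re b / 4) i (fun t => (tnth t i)%:C * Eb b t)
    (fun t => Eb b t + (- 2 * b) * ((tnth t i / 2)%:C * (tnth t i / 2)%:C * Eb b t)).
  have := kdM (lexx 0) (ltW c0) (kd_coord R i i) (kd_Eb i b0); rewrite add0r => h1.
  apply: (kd_eq h1) => t //; rewrite eqxx mul1r; congr (_ + _).
  have -> : (tnth t i)%:C = 2 * (tnth t i / 2)%:C :> R[i].
    by rewrite -[2](rmorph_nat (real_complex R)) -rmorphM /=; congr (_%:C); field.
  by ring.
have g1 i := (h i).
have bg i : gb (complex.Re b / 4) (fun t => Eb b t + (- 2 * b) * ((tnth t i / 2)%:C * (tnth t i / 2)%:C * Eb b t)).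
  by case: (h i).
have : CI (fun t => \sum_i (Eb b t + (- 2 * b) * ((tnth t i / 2)%:C * (tnth t i / 2)%:C * Eb b t))) = 0.
  by rewrite (CI_sum c0 bg) big1 // => i _; exact: CI_kd c0 (h i).
have -> : (fun t => \sum_i (Eb b t + (- 2 * b) * ((tnth t i / 2)%:C * (tnth t i / 2)%:C * Eb b t))) =
   (fun t => n%:R * Eb b t + (- 2 * b) * rk b 1 t).
  apply/funext => t; rewrite big_split /= sumr_const card_ord mulr_natl -mulr_sumr -mulr_suml.
  congr (_ + _ * (_ * _)); rewrite expr1 /qf /sqn mulr_suml rmorph_sum; apply: eq_bigr => i _.
  by rewrite -rmorphM /=; congr (_%:C); field.
have z1 : gb (complex.Re b / 4) (fun t : T => n%:R * Eb b t).
  by have := gbM (gb_cst n n%:R) bE; rewrite add0r.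
have z2 : gb (complex.Re b / 4) (fun t : T => (- 2 * b) * rk b 1 t).
  by have := gbM (gb_cst n (- 2 * b)) (gb_rk n 1 b0); rewrite add0r.
rewrite (CI_D c0 z1 z2) (CI_Z _ c0 bE) (CI_Z _ c0 (gb_rk n 1 b0)) => /eqP.
by rewrite addr_eq0 => /eqP ->; ring.
Qed.

Variable y : 'I_n -> R.
Definition lform t : R := \sum_i y i * tnth t i.
Definition ph (x : R) t : R[i] := expi (- (x * lform t)).

Lemma lform_shift i s t : lform (shiftc i s t) = lform t + s * y i.
Proof.
rewrite /lform (bigD1 i) //= [X in _ = X + _](bigD1 i) //= tnth_shiftc eqxx.
rewrite [X in _ + X = _](eq_bigr (fun j => y j * tnth t j)); first by ring.
by move=> j /negbTE ji; rewrite tnth_shiftc ji addr0.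
Qed.

Lemma seqcont_lform (g : R -> cplx R) : (forall u z, u k @[k --> \oo] --> z -> g (u k) @[k --> \oo] --> g z) ->
  seqcont (fun t => g (lform t)).
Proof.
move=> hg u t ut; apply: hg; rewrite /lform; elim: (index_enum 'I_n) => [|j r ih].
  by rewrite big_nil; under eq_fun do rewrite big_nil; exact: cvg_cst.
rewrite big_cons; under eq_fun do rewrite big_cons.
by apply: cvgD => //; apply: cvgM; [exact: cvg_cst|exact: ut].
Qed.

Lemma gb_ph x : gb 0 (ph x).
Proof.
split; last by exists 1, 0; split=> // t; rewrite nrm_expi mul1r wgt1_ge1.
apply: (seqcont_lform (g := fun z => expi (- (x * z)))) => u z hu.
by apply: expi_cvg; apply: cvgN; apply: cvgM => //; exact: cvg_cst.
Qed.

Lemma kd_ph x i : kd 0 i (ph x) (fun t => (0 +i* (- (x * y i))) * ph x t).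
Proof.
split; first exact: gb_ph.
  by have := gbM (gb_cst n (0 +i* (- (x * y i)))) (gb_ph x); rewrite addr0.
exists (2 * (x * y i) ^+ 2), 0; split=> //.
  by apply: mulr_ge0 => //; exact: sqr_ge0.
move=> s t _; rewrite /ph lform_shift mulrDr opprD expiD; set E := expi _; set z := - (x * (s * y i)).
have -> : E * expi z - E - s%:C * ((0 +i* (- (x * y i))) * E) = E * (expi z - 1 - (0 +i* z)).
  have -> : 0 +i* z = s%:C * (0 +i* (- (x * y i))) by simpc; congr (_ +i* _); rewrite /z; ring.
  by ring.
rewrite nrmM nrm_expi mul1r; apply: le_trans (expi_le2 _) _.
have -> : 2 * z ^+ 2 = s ^+ 2 * (2 * (x * y i) ^+ 2 * 1) by rewrite /z; ring.
rewrite ler_wpM2l ?sqr_ge0 // ler_wpM2l ?wgt1_ge1 //.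
by apply: mulr_ge0 => //; exact: sqr_ge0.
Qed.

Lemma lform_le t : `|lform t| <= (\sum_i `|y i|) * abs1 t.
Proof.
apply: le_trans (ler_norm_sum _ _ _) _; rewrite mulr_suml; apply: ler_sum => i _.
by rewrite normrM ler_wpM2l // tnth_le_abs1.
Qed.

Lemma gb_lform : gb 0 (fun t => (lform t)%:C).
Proof.
split.
  apply: (seqcont_lform (g := fun z => z%:C)) => u z hu.
  by apply: cvg_complex => //=; exact: cvg_cst.
have Y0 : 0 <= \sum_i `|y i| by exact: sumr_ge0.
exists (\sum_i `|y i|), 1; split=> // t; rewrite nrm_real /wgt mul0r subr0 mul1r.
apply: le_trans (lform_le t) _; rewrite ler_wpM2l //.
by apply: le_trans (expR_ge1Dx _); rewrite lerDr.
Qed.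

Let G x := CI (fun t => Eb b t * ph x t).
Let G' x := CI (fun t => Eb b t * ((0 +i* (- lform t)) * ph x t)).
Let y2 := \sum_i y i ^+ 2.

(** The i-th derivative of e^{-bq} times the phase has integral 0. Weighting by y_i and summing
    turns the moment of [lform] in G' into a multiple of G. *)
Lemma G'E x : G' x = - (2 * (x * y2)%:C / b) * G x.
Proof.
have bn0 : b != 0 by apply/eqP => bz; move: b0; rewrite bz ltxx.
have bEp : gb (complex.Re b / 4) (fun t => Eb b t * ph x t) by have := gbM bE (gb_ph x); rewrite addr0.
have h i : kd (complex.Re b / 4) i (fun t => Eb b t * ph x t)
    (fun t => (- b * (tnth t i / 2)%:C * Eb b t) * ph x t + Eb b t * ((0 +i* (- (x * y i))) * ph x t)).
  by have := kdM (ltW c0) (lexx 0) (kd_Eb i b0) (kd_ph x i); rewrite addr0.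
pose g i t := (y i)%:C * ((- b * (tnth t i / 2)%:C * Eb b t) * ph x t + Eb b t * ((0 +i* (- (x * y i))) * ph x t)).
have bg i : gb (complex.Re b / 4) (g i).
  by have [_ hi _] := h i; have := gbM (gb_cst n (y i)%:C) hi; rewrite add0r.
have : CI (fun t => \sum_i g i t) = 0.
  rewrite (CI_sum c0 bg) big1 // => i _; have [_ hi _] := h i.
  by rewrite (CI_Z _ c0 hi) (CI_kd c0 (h i)) mulr0.
have bl : gb (complex.Re b / 4) (fun t => Eb b t * ((0 +i* (- lform t)) * ph x t)).
  have := gbM (gbM (gb_cst n (0 +i* (-1))) gb_lform) (gbM bE (gb_ph x)); rewrite !addr0 !add0r.
  congr gb; apply/funext => t; have -> : 0 +i* (- lform t) = (0 +i* (-1)) * (lform t)%:C by apply: complex_ext => /=; ring.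
  by ring.
have -> : (fun t => \sum_i g i t) = (fun t => (- (0 +i* 1) * (b / 2)) * (Eb b t * ((0 +i* (- lform t)) * ph x t))
   + (- (0 +i* 1) * (x * y2)%:C) * (Eb b t * ph x t)).
  apply/funext => t.
  have -> : (- (0 +i* 1) * (b / 2)) * (Eb b t * ((0 +i* (- lform t)) * ph x t)) =
      \sum_i (y i)%:C * ((- b * (tnth t i / 2)%:C * Eb b t) * ph x t).
    have -> : 0 +i* (- lform t) = - (0 +i* 1) * (lform t)%:C by apply: complex_ext => /=; ring.
    transitivity ((- (0 +i* 1)) * (- (0 +i* 1)) * (b / 2) * Eb b t * ph x t * (lform t)%:C); first by ring.
    rewrite mulrNN ii_N1 /lform rmorph_sum mulr_sumr; apply: eq_bigr => i _.
    have -> : (tnth t i / 2)%:C = (tnth t i)%:C / 2 by rewrite rmorphM fmorphV /= rmorph_nat.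
    by rewrite rmorphM /=; field.
  have -> : (- (0 +i* 1) * (x * y2)%:C) * (Eb b t * ph x t) = \sum_i (y i)%:C * (Eb b t * ((0 +i* (- (x * y i))) * ph x t)).
    rewrite /y2 mulr_sumr rmorph_sum mulr_sumr mulr_suml; apply: eq_bigr => i _.
    have -> : 0 +i* (- (x * y i)) = - (0 +i* 1) * (x * y i)%:C by apply: complex_ext => /=; ring.
    rewrite /= (_ : (x * y i ^+ 2)%:C = x%:C * (y i)%:C * (y i)%:C); last by rewrite -!rmorphM /= -mulrA.
    by rewrite rmorphM /=; ring.
  by rewrite -big_split; apply: eq_bigr => i _; rewrite /g mulrDr.
have z1 := gbM (gb_cst n (- (0 +i* 1) * (b / 2))) bl; rewrite add0r in z1.
have z2 := gbM (gb_cst n (- (0 +i* 1) * (x * y2)%:C)) bEp; rewrite add0r in z2.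
rewrite (CI_D c0 z1 z2) (CI_Z _ c0 bl) (CI_Z _ c0 bEp) -/(G' x) -/(G x) => /eqP.
rewrite addr_eq0 => /eqP h1.
have i0 : (0 +i* 1 : R[i]) != 0 by apply/eqP => /eqP; rewrite eq_complex /= oner_eq0 andbF.
have h2 : b / 2 * G' x = - ((x * y2)%:C * G x).
  apply: (mulfI i0); apply: oppr_inj; transitivity (- (0 +i* 1) * (b / 2) * G' x); first by ring.
  by rewrite h1; ring.
have -> : G' x = 2 / b * (b / 2 * G' x) by field.
by rewrite h2; field.
Qed.

Lemma G_qd : qd 0 1 (G : R -> cplx R) (G' : R -> cplx R).
Proof.
pose Y := \sum_i `|y i|; have Y0 : 0 <= Y by exact: sumr_ge0.
have mk (g : T -> R[i]) c : gb c g -> bmeas (g : T -> cplx R) by case=> sg _; exact: seqcont_bmeas.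
have bl x : gb (complex.Re b / 4) (fun t => Eb b t * ((0 +i* (- lform t)) * ph x t)).
  have := gbM (gbM (gb_cst n (0 +i* (-1))) gb_lform) (gbM bE (gb_ph x)); rewrite !addr0 !add0r.
  congr gb; apply/funext => t; have -> : 0 +i* (- lform t) = (0 +i* (-1)) * (lform t)%:C by apply: complex_ext => /=; ring.
  by ring.
have bEp x : gb (complex.Re b / 4) (fun t => Eb b t * ph x t) by have := gbM bE (gb_ph x); rewrite addr0.
have ni r : nrm (0 +i* r : R[i]) = `|r|.
  by rewrite nrm_def /= expr0n add0r sqrtr_sqr.
have e1 t : abs1 t <= wgt 1 0 t.
  by rewrite /wgt mul0r subr0 mul1r; apply: le_trans (expR_ge1Dx _); rewrite lerDr.
have e2 t : abs1 t ^+ 2 <= wgt 2 0 t.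
  have -> : wgt 2 0 t = wgt 1 0 t ^+ 2 by rewrite expr2 wgtM addr0.
  by rewrite lerXn2r ?nnegrE ?abs1_ge0 ?wgt_ge0.
have w12 t : wgt 1 0 t <= wgt 2 0 t by apply: wgt_mono; rewrite ler1n.
pose C := 1 + Y + 2 * Y ^+ 2; have Y2 := sqr_ge0 Y.
have C0 : 0 <= C by rewrite /C; lra.
apply: (@BI_qd (cplx R) 0 1 (fun x t => Eb b t * ph x t)
  (fun x t => Eb b t * ((0 +i* (- lform t)) * ph x t)) (complex.Re b / 4) 2 C 1) => //.
- by move=> x; exact: mk (bEp x).
- by move=> x; exact: mk (bl x).
- move=> x _ _ t; rewrite nrmM nrm_expi mulr1 nrm_Eb.
  apply: le_trans (wgt_mono _ t (_ : 0 <= 2)) _ => //; rewrite ler_peMl ?wgt_ge0 // /C; lra.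
- move=> x _ _ t; rewrite nrmM [nrm (_ * ph _ _)]nrmM nrm_expi mulr1 nrm_Eb ni normrN.
  have -> : wgt 2 (complex.Re b / 4) t = wgt 0 (complex.Re b / 4) t * wgt 2 0 t by rewrite wgtM addr0 add0r.
  rewrite mulrCA ler_wpM2l ?wgt_ge0 //; apply: le_trans (lform_le t) _.
  have YC : Y <= C by rewrite /C; lra.
  exact: (ler_pM Y0 (abs1_ge0 t) YC (le_trans (e1 t) (w12 t))).
move=> x h _ _ _ _ _ t.
have -> : Eb b t * ph (x + h) t - Eb b t * ph x t - h%:C *: (Eb b t * ((0 +i* (- lform t)) * ph x t) : cplx R) =
   Eb b t * ph x t * (expi (- (h * lform t)) - 1 - (0 +i* (- (h * lform t)))) :> R[i].
  rewrite -[_ *: (_ : cplx R)]/(h%:C * (Eb b t * ((0 +i* (- lform t)) * ph x t))).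
  have -> : 0 +i* (- (h * lform t)) = h%:C * (0 +i* (- lform t)) by apply: complex_ext => /=; ring.
  have -> : ph (x + h) t = ph x t * expi (- (h * lform t)) by rewrite /ph -expiD; congr expi; ring.
  by rewrite -[LHS]/((Eb b t * (ph x t * expi (- (h * lform t))) - Eb b t * ph x t - h%:C * (Eb b t * ((0 +i* (- lform t)) * ph x t))) : R[i]); ring.
rewrite nrmM nrmM nrm_expi mulr1 nrm_Eb.
have -> : wgt 2 (complex.Re b / 4) t = wgt 0 (complex.Re b / 4) t * wgt 2 0 t by rewrite wgtM addr0 add0r.
rewrite [C * _]mulrCA [X in _ <= X]mulrCA ler_wpM2l ?wgt_ge0 //; apply: le_trans (expi_le2 _) _.
rewrite sqrrN exprMn mulrCA ler_wpM2l ?sqr_ge0 //.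
have h1 : lform t ^+ 2 <= Y ^+ 2 * wgt 2 0 t.
  rewrite -(real_normK (num_real (lform t))).
  apply: (@le_trans _ _ ((Y * abs1 t) ^+ 2)).
    by rewrite lerXn2r ?nnegrE ?mulr_ge0 ?abs1_ge0 // lform_le.
  by rewrite exprMn ler_wpM2l ?sqr_ge0.
have := ler_wpM2r (wgt_ge0 2 0 t) (_ : 2 * Y ^+ 2 <= C); rewrite /C; move: (wgt_ge0 2 0 t); lra.
Qed.

(** By [G'E], the product of exp(x^2 |y|^2 / b) and G x has derivative 0 on [0, 1]. *)
Lemma CI_Eb_ph : CI (fun t => Eb b t * ph 1 t) = cexp (- y2%:C / b) * CI (Eb b).
Proof.
have hq := qdM (qd_expsq 0 1 (y2%:C / b)) G_qd.
have := qd_const' ler01 hq.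
have -> : (forall x, 0 <= x -> x <= 1 -> (2 * (y2%:C / b) * x%:C * cexp (y2%:C / b * (x ^+ 2)%:C) : R[i]) *: (G x : cplx R)
   + (cexp (y2%:C / b * (x ^+ 2)%:C) : R[i]) *: (G' x : cplx R) = 0) = True.
  apply/propext; split=> // _ x _ _; rewrite G'E.
  set E := cexp _; rewrite -[LHS]/((2 * (y2%:C / b) * x%:C * E) * G x + E * (- (2 * (x * y2)%:C / b) * G x) : R[i]).
  by rewrite rmorphM /=; ring.
move=> /(_ Logic.I); rewrite expr1n expr0n mulr0 mulr1 cexp0.
rewrite -![_ *: (G _ : cplx R)]/(_ * G _) mul1r => h.
have G0 : G 0 = CI (Eb b).
  by rewrite /G; congr CI; apply/funext => t; rewrite /ph mul0r oppr0 expi0 mulr1.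
have h' : CI (Eb b) = cexp (y2%:C / b) * G 1 by rewrite -G0; exact: (esym h).
rewrite -[LHS]/(G 1) [in RHS]h' mulrA -cexpD mulNr addNr cexp0; exact: (esym (mul1r _)).
Qed.

End OneGaussian.

End GaussianIntegrals.

(** * The value of the complex Gaussian integral *)

Section GaussianNormalisation.
Context (R : realType) (d : nat).
Local Notation N := (d + d)%N.

Lemma CI_Eb_real (be : R) : 0 < be -> be ^+ d * complex.Re (CI (Eb be%:C : N.-tuple R -> R[i])) = (4 * pi) ^+ d
  /\ CI (Eb be%:C : N.-tuple R -> R[i]) = (complex.Re (CI (Eb be%:C : N.-tuple R -> R[i])))%:C.
Proof.
move=> be0; have b0 : 0 < complex.Re be%:C by [].
have e t : Eb be%:C t = (expR (- (be / 4) * sqn (t : N.-tuple R)))%:C.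
  by rewrite /Eb /qf -rmorphN -rmorphM cexp_real /=; congr ((expR _)%:C); ring.
have gE : gb (be / 4) (Eb be%:C : N.-tuple R -> R[i]).
  split; first exact: seqcont_Eb.
  by exists 1, 0; split=> // t; rewrite nrm_Eb mul1r.
have iE := gb_Bint (divr_gt0 be0 (ltr0n _ 4)) gE.
have -> : CI (Eb be%:C : N.-tuple R -> R[i]) = ((4 * pi / be) ^+ d)%:C.
  rewrite /CI; have -> : (Eb be%:C : N.-tuple R -> cplx R) = (fun t => (expR (- (be / 4) * sqn t))%:C) by apply/funext.
  rewrite BI_pos; last 2 first.
  - by move=> t; exact: expR_ge0.
  - by move: iE; congr Bint; apply/funext.
  rewrite gauss_tuple ?divr_gt0 //= exprD -exprMn -expr2 sqr_sqrtr; last by rewrite !divr_ge0 ?pi_ge0 // ltW.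
  by congr ((_ ^+ d)%:C); field; rewrite gt_eqF.
by split=> //=; rewrite -exprMn; congr (_ ^+ d); field; rewrite gt_eqF.
Qed.

(** By [CI_qf_Eb] in dimension 2d, the left side has derivative 0 along the segment from Re b to b,
    and its value at the real end is known. The even dimension avoids any branch of the square
    root. *)
Lemma CI_Eb (b : R[i]) : 0 < complex.Re b -> b ^+ d * CI (Eb b : N.-tuple R -> R[i]) = (4 * pi%:C) ^+ d.
Proof.
move=> b0; pose be := complex.Re b; pose e : R[i] := b - be%:C.
have hb x : 0 <= x -> x <= 1 -> be <= complex.Re (be%:C + x%:C * e).
  by move=> _ _; rewrite /e /be; case: (b) => u v /=; rewrite subrr mulr0 mul0r subr0 addr0.
have m1 : bmeas ((fun=> 1) : N.-tuple R -> cplx R) by exact: bmeas_cst.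
have hw t : nrm ((fun _ : N.-tuple R => 1 : cplx R) t) <= 1 by rewrite nrm1.
have q1 := @Eb_path_qd R N be%:C e be 0 1 b0 hb (cplx R) _ 1 m1 hw.
have q2 := qdM (qdX d (qd_affine 0 1 be%:C e)) q1.
have := qd_const' ler01 q2 _; rewrite mul0r addr0 mul1r.
have -> : be%:C + e = b by rewrite /e addrC subrK.
have eC (c : R[i]) : @BI R _ _ (lebesgue_tuple R N) (cplx R) (fun t => Eb c t *: (1 : cplx R)) = CI (Eb c : N.-tuple R -> R[i]).
  have e1 : (fun t : N.-tuple R => Eb c t *: (1 : cplx R)) = (Eb c : N.-tuple R -> cplx R).
    by apply/funext => t; rewrite -[LHS]/(Eb c t * 1) mulr1.
  exact: (congr1 (fun g : N.-tuple R -> cplx R => BI (lebesgue_tuple R N) g) e1).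
rewrite !eC => h; have [h1 h2] := CI_Eb_real b0; rewrite -[LHS]/((b ^+ d : R[i]) *: (CI (Eb b) : cplx R)) h; last first.
  move=> x x0 x1; set bx := be%:C + x%:C * e.
  have bx0 : 0 < complex.Re bx by apply: lt_le_trans (hb x x0 x1).
  have bxn : bx != 0 by apply/eqP => z; move: bx0; rewrite z ltxx.
  have -> : @BI R _ _ (lebesgue_tuple R N) (cplx R) (fun t => (- e * rk bx 1 t) *: (1 : cplx R)) = - e * CI (rk bx 1 : N.-tuple R -> R[i]).
    rewrite -(CI_Z (- e) (divr_gt0 bx0 (ltr0n _ 4)) (gb_rk N 1 bx0)).
    have e1 : (fun t : N.-tuple R => (- e * rk bx 1 t) *: (1 : cplx R)) = (fun t => - e * rk bx 1 t : cplx R).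
      by apply/funext => t; rewrite -[LHS]/(- e * rk bx 1 t * 1) mulr1.
    exact: (congr1 (fun g : N.-tuple R -> cplx R => BI (lebesgue_tuple R N) g) e1).
  rewrite eC -[LHS]/((d%:R * bx ^+ d.-1 * e) * CI (Eb bx) + bx ^+ d * (- e * CI (rk bx 1)) : R[i]).
  have := CI_qf_Eb N bx0; rewrite natrD => h3.
  have h4 : d%:R * CI (Eb bx : N.-tuple R -> R[i]) = bx * CI (rk bx 1 : N.-tuple R -> R[i]).
    have z2 : (2 : R[i]) != 0 by rewrite pnatr_eq0.
    by apply: (mulfI z2); rewrite [RHS]mulrA -h3 mulrA; congr (_ * _); rewrite mulr_natl mulr2n.
  move: h4; set E := CI (Eb bx : N.-tuple R -> R[i]); set F := CI (rk bx 1 : N.-tuple R -> R[i]).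
  clearbody E F; case: (d) => [|k] h4.
    rewrite mul0r in h4; rewrite !mul0r add0r expr0 mul1r.
    by move/esym/eqP: h4; rewrite mulf_eq0 (negbTE bxn) => /eqP ->; rewrite mulr0.
  by rewrite exprS -[k.+1.-1]/k; transitivity (bx ^+ k * e * (k.+1%:R * E - bx * F)); [ring|rewrite h4 subrr mulr0].
rewrite -[LHS]/(be%:C ^+ d * CI (Eb be%:C)) h2 -rmorphXn -rmorphM /= h1.
by rewrite rmorphXn rmorphM /= rmorph_nat.
Qed.

End GaussianNormalisation.

(** * Limits of complex sequences *)

Section ScalarLimits.
Context (R : realType).
Implicit Types (u v : nat -> cplx R) (l m : cplx R).

Lemma cvg_cplxM u v l m : u k @[k --> \oo] --> l -> v k @[k --> \oo] --> m ->
  ((u k : R[i]) * (v k : R[i]) : cplx R) @[k --> \oo] --> ((l : R[i]) * (m : R[i]) : cplx R).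
Proof. by move=> hu hv; exact: (cvgZ hu hv). Qed.

Lemma cvg_cplxZ (c : R[i]) u l : u k @[k --> \oo] --> l ->
  (c * (u k : R[i]) : cplx R) @[k --> \oo] --> (c * (l : R[i]) : cplx R).
Proof. by move=> hu; exact: (cvgZr hu). Qed.

Lemma cvg_cplxD1 u l : u k @[k --> \oo] --> l ->
  (1 + (u k : R[i]) : cplx R) @[k --> \oo] --> (1 + (l : R[i]) : cplx R).
Proof. by move=> hu; exact: (cvgD (cvg_cst (1 : cplx R)) hu). Qed.

Lemma cvg_cplxX n u l : u k @[k --> \oo] --> l ->
  ((u k : R[i]) ^+ n : cplx R) @[k --> \oo] --> ((l : R[i]) ^+ n : cplx R).
Proof.
move=> hu; elim: n => [|n ih]; first exact: (cvg_cst (1 : cplx R)).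
have := cvg_cplxM hu ih; rewrite -exprS.
by have -> : (fun k => (u k : R[i]) * (u k : R[i]) ^+ n) = (fun k => (u k : R[i]) ^+ n.+1) by apply/funext => k; rewrite exprS.
Qed.

End ScalarLimits.

(** * Gaussian operators on the eigenvectors of the oscillator *)

Section Eigenvectors.
Context (R : realType) (X : completeNormedModType R[i]) (d : nat).
Variables (A B : 'I_d -> set (X * X)) (U V : 'I_d -> R -> {linear X -> X}).
Hypothesis HW : weyl_pair A B U V.
Local Notation N := (d + d)%N.
Local Notation T := (N.-tuple R).
Local Notation mu := (lebesgue_tuple R N).
Local Notation W := (W U V).
Local Notation S := (S U V).
Implicit Types (t : T) (i : 'I_N) (f : X).

(** Otherwise there would be points tending to 0 along which W t f stays away from f, against
    sequential continuity. *)
Lemma W_near f e : 0 < e -> exists2 eta : R, 0 < eta & forall t, sqn t <= eta -> nrm (W t f - f) <= e.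
Proof.
move=> e0; apply: contrapT => h.
have hk k : exists t, sqn t <= k.+1%:R^-1 ^+ 2 /\ e < nrm (W t f - f).
  apply: contrapT => hk; apply: h; exists (k.+1%:R^-1 ^+ 2); first by rewrite exprn_gt0 // invr_gt0.
  by move=> t ht; rewrite leNgt; apply/negP => lt; apply: hk; exists t.
have [t ht] := choice hk.
pose z : T := [tuple 0 | i < N].
have zi i : tnth z i = 0 by rewrite tnth_mktuple.
have tz : tcvg t z.
  move=> i; rewrite zi; apply/norm_cvg0P.
  apply: (@squeeze_cvgr _ _ _ _ (fun=> 0) harmonic); [|exact: cvg_cst|exact: cvg_harmonic].
  near=> k; rewrite normr_ge0 /=; have [h1 _] := ht k.
  rewrite -(@ler_pXn2r _ 2) ?nnegrE ?invr_ge0 //; apply: le_trans h1.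
  rewrite real_normK ?num_real // /sqn (bigD1 i) //= lerDl.
  by apply: sumr_ge0 => j _; exact: sqr_ge0.
have /cvg_nrmP /(_ _ e0) [K hK] := @W_seqcont _ _ _ _ _ _ _ HW f t z tz.
have [_] := ht K; rewrite ltNge => /negP; apply.
by have := hK K (leqnn K); rewrite (W0 HW f zi).
Unshelve. all: by end_near.
Qed.

Lemma int_wgt0 (c : R) : 0 < c -> (\int[mu]_t (wgt 0 c t)%:E = ((pi / c) ^+ d)%:E)%E.
Proof.
move=> c0; have := gauss_tuple N c0; rewrite exprD -exprMn -expr2 sqr_sqrtr ?divr_ge0 ?pi_ge0 ?ltW //.
by move=> <-; apply: eq_integral => t _; rewrite /wgt mul0r sub0r mulNr.
Qed.

(* As Re b grows in a sector, [b ^+ d * Eb b] is (4 pi)^d times an approximate identity. *)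
Lemma S_Eb_approx f (K e : R) : 0 <= K -> 0 < e ->
  exists2 B0 : R, 0 < B0 & forall b : R[i], B0 <= complex.Re b -> nrm b <= K * complex.Re b ->
    nrm (b ^+ d *: S (Eb b) f - (4 * pi%:C) ^+ d *: f) <= e.
Proof.
move=> K0 e0; have [M M0 hM] := W_bound HW.
have p4 : 0 <= 4 * pi :> R by rewrite mulr_ge0 // pi_ge0.
have p8 : 0 <= 8 * pi :> R by rewrite mulr_ge0 // pi_ge0.
pose k1 := K ^+ d * (4 * pi) ^+ d; pose k2 := K ^+ d * (8 * pi) ^+ d * ((M + 1) * nrm f).
have k10 : 0 <= k1 by rewrite mulr_ge0 ?exprn_ge0.
have Mf0 : 0 <= (M + 1) * nrm f by rewrite mulr_ge0 ?nrm_ge0 // addr_ge0.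
have k20 : 0 <= k2 by rewrite mulr_ge0 // mulr_ge0 ?exprn_ge0.
pose e1 := e / (2 * (k1 + 1)).
have e10 : 0 < e1 by rewrite divr_gt0 // mulr_gt0 // ltr_wpDl.
have [eta eta0 heta] := W_near f e10.
have q0 : 0 <= k2 * 16 / (eta * e) by apply: divr_ge0; [exact: mulr_ge0|apply/ltW; exact: mulr_gt0].
(* The part sqn t <= eta contributes k1 e1 <= e/2. The part beyond eta carries the factor [E0], made
   small by B0 through x e^{-x} <= 1 at x = be eta / 8. *)
exists (k2 * 16 / (eta * e) + 1); first by rewrite ltr_wpDl.
move=> b; set be := complex.Re b => hb hK.
have be0 : 0 < be by apply: lt_le_trans hb; rewrite ltr_wpDl.
have bn0 : be != 0 by rewrite gt_eqF.
have gE : gb (be / 4) (Eb b : T -> R[i]).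
  by have := gb_rk N 0 be0; congr gb; apply/funext => t; rewrite /rk expr0 mul1r.
have c4 : 0 < be / 4 by rewrite divr_gt0.
have c8 : 0 < be / 8 by rewrite divr_gt0.
have [i1 e1'] := BI_scalar f (gb_Bint c4 gE).
have [i2 e2'] := BintB (S_Bint HW f c4 gE) i1.
have -> : b ^+ d *: S (Eb b) f - (4 * pi%:C) ^+ d *: f =
    b ^+ d *: BI mu (fun t => Eb b t *: W t f - Eb b t *: f).
  rewrite e2' e1' scalerBr; congr (_ - _); rewrite scalerA; congr (_ *: _).
  exact: (esym (CI_Eb d be0)).
pose E0 := expR (- (be * eta / 8)).
pose G t := e1 * wgt 0 (be / 4) t + (M + 1) * nrm f * E0 * wgt 0 (be / 8) t.
have hG t : nrm (Eb b t *: W t f - Eb b t *: f) <= G t.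
  rewrite -scalerBr nrmZ nrm_Eb -/be /G; case: (leP (sqn t) eta) => ht.
    apply: ler_wpDr; first exact: (mulr_ge0 (mulr_ge0 Mf0 (expR_ge0 _)) (wgt_ge0 _ _ _)).
    by rewrite mulrC ler_wpM2r ?wgt_ge0 // heta.
  apply: ler_wpDl; first by rewrite mulr_ge0 ?wgt_ge0 // ltW.
  have h1 : nrm (W t f - f) <= (M + 1) * nrm f.
    by apply: le_trans (nrmB _ _) _; rewrite mulrDl mul1r lerD2r hM.
  have h2 : wgt 0 (be / 4) t <= E0 * wgt 0 (be / 8) t.
    rewrite -expRD ler_expR; have := ler_wpM2l (ltW c8) (ltW ht); lra.
  by have := ler_pM (wgt_ge0 0 (be / 4) t) (nrm_ge0 _) h2 h1; lra.
have mG : measurable_fun setT G.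
  by apply: measurable_funD; apply: measurable_funM => //; exact: measurable_wgt.
have iG : (\int[mu]_t (G t)%:E = (e1 * (pi / (be / 4)) ^+ d + (M + 1) * nrm f * E0 * (pi / (be / 8)) ^+ d)%:E)%E.
  rewrite /G; under eq_integral do rewrite EFinD [X in (X + _)%E]EFinM [X in (_ + X)%E]EFinM.
  have qM : 0 <= (M + 1) * nrm f * E0 by rewrite mulr_ge0 ?expR_ge0.
  have m1 c : measurable_fun setT (fun t : T => (wgt 0 c t)%:E).
    by apply: measurableT_comp; [exact: EFin_measurable|exact: measurable_wgt].
  rewrite ge0_integralD //; last 4 first.
  - by move=> t _; rewrite -EFinM lee_fin mulr_ge0 ?wgt_ge0 // ltW.
  - by apply: measurable_funeM.
  - by move=> t _; rewrite -EFinM lee_fin mulr_ge0 ?wgt_ge0.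
  - by apply: measurable_funeM.
  rewrite !ge0_integralZl ?lee_fin //; last first.
  - exact: ltW.
  - by move=> t _; rewrite lee_fin wgt_ge0.
  - by move=> t _; rewrite lee_fin wgt_ge0.
  by rewrite !int_wgt0.
have mF : bmeas (fun t => Eb b t *: W t f - Eb b t *: f).
  apply: bmeasB; first exact: (bmeas_gW HW f gE).
  by apply: bmeasZ; [apply: seqcont_bmeas; case: gE|exact: bmeas_cst].
have := BI_leG mF mG hG; move=> /(_ mu (e1 * (pi / (be / 4)) ^+ d + (M + 1) * nrm f * E0 * (pi / (be / 8)) ^+ d)).
rewrite iG lexx => /(_ isT) hI.
rewrite nrmZ nrmX; have hb1 : nrm b ^+ d <= K ^+ d * be ^+ d.
  by rewrite -exprMn lerXn2r ?nnegrE ?nrm_ge0 ?mulr_ge0 // ltW.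
apply: le_trans (ler_pM (exprn_ge0 _ (nrm_ge0 _)) (nrm_ge0 _) hb1 hI) _.
have -> : pi / (be / 4) = 4 * pi / be by field.
have -> : pi / (be / 8) = 8 * pi / be by field.
rewrite !expr_div_n.
have bd0 : be ^+ d != 0 by rewrite expf_neq0.
have -> : K ^+ d * be ^+ d * (e1 * ((4 * pi) ^+ d / be ^+ d) + (M + 1) * nrm f * E0 * ((8 * pi) ^+ d / be ^+ d)) =
   k1 * e1 + k2 * E0 by rewrite /k1 /k2; field.
have h1 : k1 * e1 <= e / 2.
  rewrite /e1 mulrCA ler_pM2l // ler_pdivrMr ?mulr_gt0 // ?ltr_wpDl //.
  by rewrite mulrA mulVf // mul1r lerDl.
have h2 : k2 * E0 <= e / 2.
  have q : be * eta / 8 * E0 <= 1.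
    by rewrite /E0 expRN ler_pdivrMr ?expR_gt0 // mul1r; apply: le_trans (expR_ge1Dx _); rewrite lerDr.
  have q2 : k2 * 16 / (eta * e) <= be by apply: le_trans hb; rewrite lerDl.
  rewrite ler_pdivrMr ?mulr_gt0 // in q2.
  have := ler_wpM2r (expR_ge0 (- (be * eta / 8))) q2; rewrite -/E0.
  have := ler_wpM2l (ltW e0) q; lra.
lra.
Qed.

Lemma inv_cvg0 (c e : R[i]) : complex.Re e = 1 ->
  ((c + k%:R * e)^-1 : cplx R) @[k --> \oo] --> (0 : cplx R).
Proof.
move=> e1; apply/cvg_nrmP => r r0; exists (Num.truncn (r^-1 - complex.Re c)).+1 => k hk.
rewrite subr0 -[nrm _]/(nrm (c + k%:R * e)^-1) nrmV.
have hR : complex.Re (c + k%:R * e) = complex.Re c + k%:R.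
  have -> : (k%:R : R[i]) = (k%:R)%:C by rewrite rmorph_nat.
  by case: (c) (e) e1 => u v [u' v'] /= ->; rewrite mul0r subr0 mulr1.
have h : r^-1 <= nrm (c + k%:R * e).
  apply: le_trans (Re_le_nrm _); rewrite hR.
  have := truncnS_gt (r^-1 - complex.Re c) => h1.
  have : ((Num.truncn (r^-1 - complex.Re c)).+1%:R <= k%:R :> R) by rewrite ler_nat.
  lra.
by rewrite -[r]invrK lef_pV2 ?posrE ?invr_gt0 //; apply: lt_le_trans h; rewrite invr_gt0.
Qed.

(** The case j = 0 of [L0_right] at an eigenvector. As -q e^{-bq} is the b-derivative of e^{-bq},
    this is a first-order differential equation in b for S(e^{-bq}) y. *)
Lemma S_eigen (n : nat) (y : X) (b : R[i]) : oscillator0 A B (y, n%:R *: y) ->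
  0 < complex.Re b -> ((b + 1) * (b - 1)) *: S (rk b 1) y = (d%:R * (b - 1) - 2 * n%:R) *: S (Eb b) y.
Proof.
move=> hy b0; have rk0 : rk b 0 = Eb b :> (T -> R[i]) by apply/funext => t; rewrite /rk expr0 mul1r.
have := L0_right HW b0 0 hy.
rewrite /Lk (S_lin3 HW b0) rk0 => h.
have lin := S_linear HW (divr_gt0 b0 (ltr0n _ 4)) (gb_rk N 0 b0).
have SZ z x : S (Eb b) (z *: x) = z *: S (Eb b) x.
  by rewrite -rk0; have := lin z x 0; rewrite addr0 (S_0 HW (divr_gt0 b0 (ltr0n _ 4)) (gb_rk N 0 b0)) addr0.
move: h; rewrite SZ !mul0r mulr0 oppr0 scale0r add0r => h.
have -> : (d%:R * (b - 1) - 2 * n%:R) = 2 * (0 + 2^-1 * (b * d%:R) - 2^-1 * d%:R - n%:R) by field.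
rewrite -[RHS]scalerA [in RHS]scalerBl h opprD addrA subrr sub0r scalerN scalerA -scaleNr.
by congr (_ *: _); field.
Qed.

Let scal (a b c x g e h : R[i]) (s : X) :
  a *: (b *: s) + c *: (x *: s + g *: (e *: (h *: s))) = (a * b + c * (x + g * (e * h))) *: s.
Proof. by rewrite !scalerA -scalerDl scalerA -scalerDl -(mulrA g). Qed.

(** By [S_eigen], S(e^{-bq}) y is a constant multiple of (b - 1)^n / (b + 1)^{d+n}, and the constant
    is found at infinity, where [S_Eb_approx] applies. The equation is singular at b = 1; the path b
    + x (1 +- i), with the sign of Im b, leads away from this point. *)
Lemma S_Eb_eigen (n : nat) (y : X) (b : R[i]) : oscillator0 A B (y, n%:R *: y) ->
  0 < complex.Re b -> b != 1 ->
  S (Eb b) y = ((b - 1) ^+ n / (b + 1) ^+ (d + n) * (4 * pi%:C) ^+ d) *: y.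
Proof.
move=> hy b0 b1; pose sg : R := if 0 <= complex.Im b then 1 else -1; pose e : R[i] := 1 +i* sg.
have e1 : complex.Re e = 1 by [].
have ReD c x : complex.Re (c + x%:C * e) = complex.Re c + x.
  by rewrite /e; case: (c) => u v /=; rewrite mul0r subr0 mulr1.
pose be := complex.Re b.
have hbe x : 0 <= x -> be <= complex.Re (b + x%:C * e) by move=> x0; rewrite ReD lerDl.
(* Along the path the distance to 1 stays above half of its initial value. *)
pose c := nrm (b - 1) / 2.
have b1n : b - 1 != 0 by rewrite subr_eq0.
have c0 : 0 < c by rewrite divr_gt0 // nrm_gt0.
have hc x : 0 <= x -> c <= nrm ((b - 1) + x%:C * e).
  move=> x0; rewrite -(@ler_pXn2r _ 2) ?nnegrE ?nrm_ge0 ?(ltW c0) // /c expr_div_n !nrm_sqr.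
  rewrite /e /=; case: (b) @sg {e e1 ReD be hbe c b1n c0} => u v sg /=.
  rewrite !mul0r !subr0 !addr0 !mulr1.
  have s1 : sg ^+ 2 = 1 by rewrite /sg; case: ifP => _; rewrite ?sqrrN expr1n.
  have s2 : 0 <= sg * v by rewrite /sg; case: ifP => /= hv; rewrite ?mul1r // mulN1r oppr_ge0 ltW // ltNge hv.
  have -> : (u - 1 + x) ^+ 2 + (v + x * sg) ^+ 2 = ((u - 1) ^+ 2 + v ^+ 2) / 2 ^+ 2 +
     ((u - 1 + 2 * x) ^+ 2 / 2 + (u - 1) ^+ 2 / 4 + 3 / 4 * v ^+ 2 + 2 * (x * (sg * v)) + x ^+ 2 * (sg ^+ 2 - 1)).
    by field.
  rewrite s1 subrr mulr0 addr0 lerDl.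
  have := sqr_ge0 (u - 1); have := sqr_ge0 v; have := sqr_ge0 (u - 1 + 2 * x).
  have := mulr_ge0 x0 s2; lra.
have [M M0 hM] := W_bound HW.
have mW : bmeas (fun t : T => W t y) by exact: (seqcont_bmeas (@W_seqcont _ _ _ _ _ _ _ HW y)).
pose w x := (b - 1) + x%:C * e; pose u x := (b + 1) + x%:C * e; pose p x := b + x%:C * e.
pose Q x := u x ^+ (d + n) *: ((w x)^-1 ^+ n *: S (Eb (p x)) y).
have Q0 x : 0 <= x -> Q x = Q 0.
  move=> x0; have hb' z : 0 <= z -> z <= x -> be <= complex.Re (b + z%:C * e) by move=> z0 _; exact: hbe.
  have hc' z : 0 <= z -> z <= x -> c <= nrm ((b - 1) + z%:C * e) by move=> z0 _; exact: hc.
  have q1 := Eb_path_qd b0 hb' mW (fun t => hM t y).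
  have q2 := qdM (qdX (d + n) (qd_affine 0 x (b + 1) e)) (qdM (qdX n (qd_inv c0 hc')) q1).
  apply: (qd_const' x0 q2) => z z0 zx /=.
  rewrite -/(u z) -/(w z) -/(p z).
  have p0 : 0 < complex.Re (p z) by apply: lt_le_trans (hbe z z0).
  have wn : w z != 0 by apply/eqP => h0; have := hc z z0; rewrite -/(w z) h0 nrm0 leNgt c0.
  have un : u z != 0.
    apply/eqP => h0; have : complex.Re (u z) = 0 by rewrite h0.
    rewrite /u ReD; case: (b) b0 => b' b'' /= b0 /eqP; rewrite gt_eqF //.
    by rewrite ltr_wpDr // addr_gt0.
  have -> : BI mu (fun t => (- e * rk (p z) 1 t) *: W t y) = - e *: S (rk (p z) 1) y.
    exact: (S_Z HW (- e) y (divr_gt0 p0 (ltr0n _ 4)) (gb_rk N 1 p0)).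
  have uw : u z = w z + 2 by rewrite /u /w; ring.
  have := S_eigen hy p0; have -> : p z + 1 = u z by rewrite /u /p; ring.
  have -> : p z - 1 = w z by rewrite /w /p; ring.
  move=> h; have -> : S (rk (p z) 1) y = ((u z * w z)^-1 * (d%:R * w z - 2 * n%:R)) *: S (Eb (p z)) y.
    by rewrite -[RHS]scalerA -h [RHS]scalerA (mulVf (mulf_neq0 un wn)) scale1r.
  rewrite -[BI _ _]/(S (Eb (p z)) y).
  have hu : (d + n)%:R * u z ^+ (d + n).-1 = (d + n)%:R * u z ^+ (d + n) / u z.
    by case: (d + n)%N => [|k]; [rewrite !mul0r|rewrite exprSr mulrA mulfK].
  have hw : n%:R * (w z)^-1 ^+ n.-1 = n%:R * (w z)^-1 ^+ n * w z.
    by case: (n) => [|k]; [rewrite !mul0r|rewrite exprSr mulrA mulfVK].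
  rewrite hu hw; set P := u z ^+ _; set Q' := _ ^+ n.
  rewrite scal (_ : _ + _ = 0) ?scale0r //.
  rewrite natrD; move: un; rewrite uw => un; field; by rewrite wn un.
(* Here u = p (1 + 1/p) = w (1 + 2/w), so that both scalar factors tend to 1 along the path. *)
have QE x : 0 <= x -> Q x = ((1 + (p x)^-1) ^+ d * (1 + 2 * (w x)^-1) ^+ n) *: (p x ^+ d *: S (Eb (p x)) y).
  move=> x0; have wn : w x != 0 by apply/eqP => h0; have := hc x x0; rewrite -/(w x) h0 nrm0 leNgt c0.
  have pn : p x != 0.
    by apply/eqP => h0; have := hbe x x0; rewrite -/(p x) h0 leNgt b0.
  rewrite /Q !scalerA; congr (_ *: _).
  have -> : u x = p x * (1 + (p x)^-1) by rewrite mulrDr mulr1 divff // /u /p; ring.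
  have h2 : w x * (1 + 2 * (w x)^-1) = p x * (1 + (p x)^-1).
    by rewrite !mulrDr !mulr1 divff // mulrCA divff // /w /p; ring.
  rewrite exprD -[in X in _ * X * _]h2 !exprMn exprVn.
  by have : w x ^+ n != 0 by [rewrite expf_neq0]; move=> hn; field.
have zk : (Q k%:R) @[k --> \oo] --> (4 * pi%:C) ^+ d *: y.
  have -> : (fun k : nat => Q k%:R) = (fun k => ((1 + (b + k%:R * e)^-1) ^+ d * (1 + 2 * ((b - 1) + k%:R * e)^-1) ^+ n) *:
     (p k%:R ^+ d *: S (Eb (p k%:R)) y)).
    by apply/funext => k; rewrite QE // /p /w rmorph_nat.
  pose a0 k : cplx R := (b + k%:R * e)^-1; pose a1 k : cplx R := ((b - 1) + k%:R * e)^-1.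
  have z0 : a0 k @[k --> \oo] --> (0 : cplx R) by exact: inv_cvg0.
  have z1 : a1 k @[k --> \oo] --> (0 : cplx R) by exact: inv_cvg0.
  have z3 := @cvg_cplxX R d (fun k => 1 + (a0 k : R[i])) (1 + 0 : R[i]) (cvg_cplxD1 z0).
  have z2 := @cvg_cplxX R n (fun k => 1 + 2 * (a1 k : R[i])) (1 + 2 * 0 : R[i]) (@cvg_cplxD1 R (fun k => 2 * (a1 k : R[i])) (2 * 0 : R[i]) (@cvg_cplxZ R (2 : R[i]) a1 (0 : cplx R) z1)).
  have := @cvg_cplxM R (fun k => (1 + (a0 k : R[i])) ^+ d) (fun k => (1 + 2 * (a1 k : R[i])) ^+ n) ((1 + 0) ^+ d : R[i]) ((1 + 2 * 0) ^+ n : R[i]) z3 z2; rewrite mulr0 addr0 !expr1n mulr1 => z4.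
  rewrite -[X in _ --> X]scale1r; apply: cvgZ; first exact: z4.
  (* K bounds |p| / Re p along the path, since |e| <= 2. *)
  apply/cvg_nrmP => r r0; pose K := nrm b / be + 2.
  have K0 : 0 <= K by rewrite addr_ge0 // divr_ge0 ?nrm_ge0 // ltW.
  have [B0 B00 hB] := S_Eb_approx y K0 r0.
  exists (Num.truncn B0).+1 => k hk; apply: hB.
    rewrite /p ReD; have : ((Num.truncn B0).+1%:R <= k%:R :> R) by rewrite ler_nat.
    by have := truncnS_gt B0; move: b0; lra.
  rewrite /p ReD; apply: le_trans (nrmD _ _) _; rewrite nrmM nrm_real ger0_norm ?ler0n //.
  have ne : nrm e <= 2.
    rewrite -(@ler_pXn2r _ 2) ?nnegrE ?nrm_ge0 // nrm_sqr /e /= /sg; case: ifP => _; lra.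
  rewrite /K -/be mulrDl mulrDr divfK ?gt_eqF //.
  have h1 := ler_wpM2l (ler0n R k) ne.
  have h2 : 0 <= nrm b / be * k%:R by rewrite mulr_ge0 // divr_ge0 ?nrm_ge0 // ltW.
  have : 0 < be by []; lra.
have Q0' : Q 0 = (4 * pi%:C) ^+ d *: y.
  apply: cvg_uniq zk; have -> : (fun k : nat => Q k%:R) = fun=> Q 0 by apply/funext => k; exact: Q0.
  exact: cvg_cst.
have un : b + 1 != 0.
  apply/eqP => h0; have : complex.Re (b + 1) = 0 by rewrite h0.
  by case: (b) b0 => b' b'' /= b0 /eqP; rewrite gt_eqF // addr_gt0.
have wn : b - 1 != 0 by rewrite subr_eq0.
rewrite mulrC [in RHS]mulrC -scalerA -Q0' /Q /u /w /p !mul0r !addr0 !scalerA -[LHS]scale1r; congr (_ *: _).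
rewrite exprVn; have h1 : (b - 1) ^+ n != 0 by rewrite expf_neq0.
have h2 : (b + 1) ^+ (d + n) != 0 by rewrite expf_neq0.
by field; rewrite h1 h2.
Qed.

End Eigenvectors.

(** * Vectors in the closure of a subspace *)

Section ApproximableVectors.
Context (R : realType) (X : completeNormedModType R[i]).
Variable Q : set X.
Hypothesis Q0 : Q 0.
Hypothesis QL : forall (c : R[i]) x y, Q x -> Q y -> Q (c *: x + y).

Definition approx (x : X) := forall e : R, 0 < e -> exists2 y, Q y & nrm (x - y) <= e.

Lemma approx_Q x : Q x -> approx x.
Proof. by move=> qx e e0; exists x; rewrite // subrr nrm0 ltW. Qed.

Lemma approx_lin (c : R[i]) x y : approx x -> approx y -> approx (c *: x + y).
Proof.
move=> hx hy e e0; pose k := nrm c + 1; have k0 : 0 < k by rewrite ltr_wpDl ?nrm_ge0.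
have e1 : 0 < e / 2 / k by rewrite !divr_gt0.
have e2 : 0 < e / 2 by rewrite divr_gt0.
have [x' qx xx] := hx _ e1; have [y' qy yy] := hy _ e2; exists (c *: x' + y'); first exact: QL.
rewrite opprD addrACA -scalerBr; apply: le_trans (nrmD _ _) _; rewrite nrmZ [e]splitr lerD //.
rewrite ler_pdivlMr // in xx; apply: le_trans xx; rewrite mulrC ler_wpM2l ?nrm_ge0 //.
by rewrite /k lerDl.
Qed.

Lemma approxZ (c : R[i]) x : approx x -> approx (c *: x).
Proof. by move=> hx; rewrite -[_ *: _]addr0; apply: approx_lin => //; exact: approx_Q. Qed.

Lemma approx_sum I (r : seq I) (F : I -> X) : (forall i, approx (F i)) -> approx (\sum_(i <- r) F i).
Proof.
move=> h; elim: r => [|i r ih]; first by rewrite big_nil; exact: approx_Q.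
by rewrite big_cons -[F i]scale1r; exact: approx_lin.
Qed.

Lemma approx_lim x : (forall e : R, 0 < e -> exists2 y, approx y & nrm (x - y) <= e) -> approx x.
Proof.
move=> h e e0; have e2 : 0 < e / 2 by rewrite divr_gt0.
have [y hy xy] := h _ e2; have [z qz yz] := hy _ e2; exists z => //.
by apply: le_trans (nrm_tri _ _ y) _; rewrite [e]splitr lerD.
Qed.

End ApproximableVectors.

(** * Density of the ranges of S(q^j e^{-q}) *)

Section Density.
Context (R : realType) (X : completeNormedModType R[i]) (d : nat).
Variables (A B : 'I_d -> set (X * X)) (U V : 'I_d -> R -> {linear X -> X}).
Hypothesis HW : weyl_pair A B U V.
Local Notation N := (d + d)%N.
Local Notation T := (N.-tuple R).
Local Notation mu := (lebesgue_tuple R N).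
Local Notation W := (W U V).
Local Notation S := (S U V).
Implicit Types (t : T) (f : X).

Lemma rk_real (a : R) j t : rk a%:C j t = ((sqn t / 4) ^+ j * expR (- a * (sqn t / 4)))%:C.
Proof. by rewrite /rk /Eb /qf -rmorphN -rmorphM cexp_real -rmorphXn -rmorphM. Qed.

(** The Taylor polynomial in h of q^j e^{-(a+h)q}: the powers of q raise j, at the fixed parameter
    a. *)
Definition taylor_rk (a h : R) j m t : R[i] :=
  \sum_(0 <= l < m) ((- h) ^+ l / l`!%:R)%:C * rk a%:C (j + l) t.

Lemma taylor_rkE (a h : R) j m t : taylor_rk a h j m t =
  ((sqn t / 4) ^+ j * expR (- a * (sqn t / 4)) * series (exp_coeff (- h * (sqn t / 4))) m)%:C.
Proof.
rewrite /taylor_rk /series /= mulr_sumr rmorph_sum; apply: eq_bigr => l _.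
rewrite rk_real -rmorphM; congr (_%:C); rewrite exp_coeffE /=.
rewrite [(- h * _) ^+ l]exprMn exprD; move: (_ ^+ j) (_ ^+ l) (_ ^+ l) (expR _) (_^-1) => x1 x2 x3 x4 x5; ring.
Qed.

Lemma series_exp_le (x : R) m : `|series (exp_coeff x) m| <= expR `|x|.
Proof.
apply: le_trans (_ : series (exp_coeff `|x|) m <= _).
  apply: le_trans (ler_norm_sum _ _ _) _; apply: ler_sum => l _.
  by rewrite !exp_coeffE normrM normrX ger0_norm.
apply: nondecreasing_cvgn_le; last exact: is_cvg_series_exp_coeff.
by apply: nondecreasing_series => n _ _; exact: exp_coeff_ge0.
Qed.

(** The partial sums of e^{-hq} are bounded by e^{hq}. For h <= a/2 all the kernels lie below q^j
    e^{-aq/2}, and dominated convergence applies. *)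
Lemma S_taylor (a h : R) j f : 0 < a -> 0 <= h -> h <= a / 2 ->
  S (taylor_rk a h j m) f @[m --> \oo] --> S (rk (a + h)%:C j) f.
Proof.
move=> a0 h0 ha; have b0 : 0 < complex.Re (a / 2)%:C by rewrite /= divr_gt0.
have ac : 0 < complex.Re a%:C by [].
have ahc : 0 < complex.Re (a + h)%:C by rewrite /= ltr_wpDr.
have [_ [C [a' [C0 a'0 hC]]]] := gb_rk N j b0.
have [M M0 hM] := W_bound HW.
have c0 : 0 < complex.Re (a / 2)%:C / 4 by rewrite divr_gt0.
apply: (@BI_cvg _ _ _ _ _ _ _ (fun t => C * wgt a' (complex.Re (a / 2)%:C / 4) t * (M * nrm f))).
- move=> m; apply: (bmeas_gW HW f (c := complex.Re a%:C / 4)).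
  apply: gb_sum; first by rewrite /= divr_ge0 // ltW.
  by move=> l; apply: gbZ; exact: gb_rk.
- exact: (bmeas_gW HW f (gb_rk N j ahc)).
- move=> t; apply: cvgZ; last exact: cvg_cst.
  have -> : (fun m => taylor_rk a h j m t) = (fun m => ((sqn t / 4) ^+ j * expR (- a * (sqn t / 4)) * series (exp_coeff (- h * (sqn t / 4))) m)%:C).
    by apply/funext => m; exact: taylor_rkE.
  have -> : rk (a + h)%:C j t = ((sqn t / 4) ^+ j * expR (- a * (sqn t / 4)) * expR (- h * (sqn t / 4)))%:C.
    by rewrite rk_real -mulrA -expRD -mulrDl opprD.
  apply: cvg_complex => //=; last exact: cvg_cst.
  apply: cvgM; first exact: cvg_cst.
  exact: is_cvg_series_exp_coeff.
- by apply: measurable_funM => //; apply: measurable_funM => //; exact: measurable_wgt.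
- move=> m t; rewrite nrmZ; apply: ler_pM; rewrite ?nrm_ge0 //.
  apply: le_trans (hC t); rewrite taylor_rkE rk_real !nrm_real.
  have q0 : 0 <= sqn t / 4 by rewrite divr_ge0 ?sqn_ge0.
  rewrite -mulrA normrM [X in _ <= X]normrM; apply: ler_wpM2l => //.
  rewrite normrM (ger0_norm (expR_ge0 _)) (ger0_norm (expR_ge0 _)).
  apply: le_trans (ler_wpM2l (expR_ge0 _) (series_exp_le _ _)) _.
  rewrite -expRD ler_expR normrM normrN !ger0_norm //.
  by have := ler_wpM2r q0 ha; lra.
under eq_integral do rewrite mulrAC EFinM.
have q0 : 0 <= C * (M * nrm f) by rewrite mulr_ge0 // mulr_ge0 ?nrm_ge0.
rewrite ge0_integralZl //; last first.
- by move=> t _; rewrite lee_fin wgt_ge0.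
- by apply: measurableT_comp; [exact: EFin_measurable|exact: measurable_wgt].
have := int_wgt N a' c0; move=> hi; apply: lte_mul_pinfty => //.
by apply: le_lt_trans hi _; rewrite ltry.
Qed.

(** Taylor expansion leads from the parameter 1 to 3/2 and, repeated, to (3/2)^k, without leaving
    the closed span; for large k the normalised operators with j = 0 approximate the identity. *)
Lemma S_rk_dense (Q : set X) f : Q 0 -> (forall (c : R[i]) x y, Q x -> Q y -> Q (c *: x + y)) ->
  (forall j, Q (S (rk 1 j) f)) -> approx Q f.
Proof.
move=> Q0 QL hQ.
have h1 k j : approx Q (S (rk ((3 / 2) ^+ k)%:C j) f).
  elim: k j => [|k ih] j; first by rewrite expr0; exact: approx_Q.
  have a0 : 0 < (3 / 2 : R) ^+ k by rewrite exprn_gt0 // divr_gt0.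
  have -> : (3 / 2 : R) ^+ k.+1 = (3 / 2) ^+ k + (3 / 2) ^+ k / 2 by rewrite exprS; field.
  apply: approx_lim => e e0.
  have := @S_taylor ((3 / 2) ^+ k) ((3 / 2) ^+ k / 2) j f a0 (ltW (divr_gt0 a0 (ltr0n _ 2))) (lexx _).
  move=> /cvg_nrmP /(_ _ e0) [m hm]; have {hm} := hm m (leqnn m); rewrite nrmC => hm.
  eexists; last exact: hm.
  have ac : 0 < complex.Re ((3 / 2) ^+ k)%:C / 4 :> R by rewrite divr_gt0.
  have gr l : gb (complex.Re ((3 / 2) ^+ k)%:C / 4) (rk ((3 / 2 : R) ^+ k)%:C (j + l) : T -> R[i]) by exact: gb_rk.
  rewrite /taylor_rk (S_sum HW _ f ac (fun l => gbZ _ (gr l))).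
  apply: (approx_sum Q0 QL) => l; rewrite (S_Z HW _ f ac (gr l)).
  exact: (approxZ Q0 QL).
apply: approx_lim => e e0.
have p0 : (4 * pi%:C : R[i]) ^+ d != 0.
  rewrite expf_neq0 // mulf_neq0 ?pnatr_eq0 //; apply/eqP => /(congr1 (@complex.Re R)) /= /eqP.
  by rewrite gt_eqF // pi_gt0.
pose P := (4 * pi%:C : R[i]) ^+ d; have nP : 0 < nrm P by rewrite nrm_gt0.
have eP : 0 < e * nrm P by rewrite mulr_gt0.
have [B0 B00 hB] := S_Eb_approx HW f ler01 eP.
have [k hk] : exists k, B0 <= (3 / 2) ^+ k.
  (* Bernoulli: (3/2)^k >= 1 + k/2. *)
  exists (Num.truncn (2 * B0)).+1; apply: (@le_trans _ _ (1 + (Num.truncn (2 * B0)).+1%:R / 2)).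
    by have := truncnS_gt (2 * B0); lra.
  elim: (_.+1) => [|m ih]; first by rewrite mul0r addr0 expr0.
  have := ler0n R m; rewrite exprS -[m.+1%:R]natr1 => m0; lra.
have a0 : 0 < (3 / 2 : R) ^+ k by rewrite exprn_gt0 // divr_gt0.
exists (P^-1 *: (((3 / 2) ^+ k)%:C ^+ d *: S (rk ((3 / 2) ^+ k)%:C 0) f)).
  by do 2!apply: (approxZ Q0 QL).
have -> : rk ((3 / 2) ^+ k)%:C 0 = Eb ((3 / 2) ^+ k)%:C :> (T -> R[i]).
  by apply/funext => t; rewrite /rk expr0 mul1r.
have := hB ((3 / 2) ^+ k)%:C hk; rewrite mul1r nrm_real ger0_norm ?(ltW a0) // => /(_ (lexx _)).
rewrite -[X in _ - X *: f]/P => h2.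
have -> : f = P^-1 *: (P *: f) by rewrite scalerA mulVf // scale1r.
rewrite [X in _ - (_ *: (_ *: S _ X))](_ : _ = f); last by rewrite scalerA mulVf // scale1r.
by rewrite nrmC -scalerBr nrmZ nrmV ler_pdivrMl // [X in _ <= X]mulrC.
Qed.

End Density.

(** * Partial derivatives of complex functions on R^n *)

Section Partials.
Context (R : realType) (n : nat).
Local Notation E := 'rV[R]_n.
Implicit Types (f g : E -> R[i]) (i : 'I_n) (x : E).

Definition cdf f := forall x, differentiable (fun y : E => complex.Re (f y)) x /\
  differentiable (fun y : E => complex.Im (f y)) x.

Lemma cdfD f g : cdf f -> cdf g -> cdf (fun y => f y + g y).
Proof.
move=> hf hg x; have [a b] := hf x; have [c e] := hg x.
have -> : (fun y => complex.Re (f y + g y)) = (fun y => complex.Re (f y)) + (fun y => complex.Re (g y)).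
  by apply/funext => y /=; rewrite raddfD.
have -> : (fun y => complex.Im (f y + g y)) = (fun y => complex.Im (f y)) + (fun y => complex.Im (g y)).
  by apply/funext => y /=; rewrite raddfD.
by split; apply: differentiableD.
Qed.

Lemma partialD i f g x : cdf f -> cdf g ->
  partial i (fun y => f y + g y) x = partial i f x + partial i g x.
Proof.
move=> hf hg; have [a b] := hf x; have [c e] := hg x; rewrite /partial.
have -> : (fun y => complex.Re (f y + g y)) = (fun y => complex.Re (f y)) + (fun y => complex.Re (g y)).
  by apply/funext => y /=; rewrite raddfD.
have -> : (fun y => complex.Im (f y + g y)) = (fun y => complex.Im (f y)) + (fun y => complex.Im (g y)).
  by apply/funext => y /=; rewrite raddfD.
by rewrite !deriveD //; apply: diff_derivable.
Qed.

Let ReM f g : (fun y => complex.Re (f y * g y)) =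
  (fun y => complex.Re (f y)) * (fun y => complex.Re (g y)) - (fun y => complex.Im (f y)) * (fun y => complex.Im (g y)).
Proof.
apply/funext => y; rewrite -[RHS]/(complex.Re (f y) * complex.Re (g y) - complex.Im (f y) * complex.Im (g y)).
by case: (f y) (g y) => a b [c e].
Qed.

Let ImM f g : (fun y => complex.Im (f y * g y)) =
  (fun y => complex.Re (f y)) * (fun y => complex.Im (g y)) + (fun y => complex.Im (f y)) * (fun y => complex.Re (g y)).
Proof.
apply/funext => y; rewrite -[RHS]/(complex.Re (f y) * complex.Im (g y) + complex.Im (f y) * complex.Re (g y)).
by case: (f y) (g y) => a b [c e].
Qed.

Lemma cdfM f g : cdf f -> cdf g -> cdf (fun y => f y * g y).
Proof.
move=> hf hg x; have [a b] := hf x; have [c e] := hg x; rewrite ReM ImM; split.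
  by apply: differentiableB; apply: differentiableM.
by apply: differentiableD; apply: differentiableM.
Qed.

Lemma partialM i f g x : cdf f -> cdf g ->
  partial i (fun y => f y * g y) x = partial i f x * g x + f x * partial i g x.
Proof.
move=> hf hg; have [a b] := hf x; have [c e] := hg x; rewrite /partial ReM ImM.
have dd (h : E -> R) v : differentiable h x -> derivable h x v by exact: diff_derivable.
have dM (h k : E -> R) v : differentiable h x -> differentiable k x -> derivable (h * k) x v.
  by move=> h1 h2; apply: diff_derivable; exact: differentiableM.
rewrite deriveB ?deriveD; [|exact: dM..]; rewrite !deriveM; [|exact: dd..].
rewrite /GRing.scale /=; move: ('D_ _ _ _) ('D_ _ _ _) ('D_ _ _ _) ('D_ _ _ _) => p q r s.
case: (f x) (g x) => u v [u' v'] /=.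
by apply: complex_ext => /=; ring.
Qed.

Lemma cdf_cst (c : R[i]) : cdf (fun=> c).
Proof. by move=> x; split; exact: differentiable_cst. Qed.

Lemma partial_cst i (c : R[i]) x : partial i (fun=> c) x = 0.
Proof. by rewrite /partial !derive_cst. Qed.

Definition coordC i x : R[i] := (x ord0 i)%:C.

Lemma cdf_coord i : cdf (coordC i).
Proof.
move=> x; split; first exact: (@differentiable_coord R 1 n x ord0 i).
exact: differentiable_cst.
Qed.

Lemma derive_coord i k x : 'D_(delta_mx ord0 i) (fun y : E => y ord0 k) x = (k == i)%:R.
Proof.
rewrite /derive; apply: cvg_lim => //; apply: cvg_near_cst; near=> h.
have h0 : h != 0 by near: h; exact: nbhs_dnbhs_neq.
by rewrite /= !mxE addrK eqxx /= /GRing.scale /= mulrA mulVf // mul1r.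
Unshelve. all: by end_near.
Qed.

Lemma partial_coord i k x : partial i (coordC k) x = (k == i)%:R.
Proof.
rewrite /partial /= derive_coord derive_cst; by case: eqP.
Qed.

Definition rho x : R := \sum_i x ord0 i ^+ 2.

Lemma rho_ge0 x : 0 <= rho x.
Proof. by apply: sumr_ge0 => i _; exact: sqr_ge0. Qed.

Lemma differentiable_rho x : differentiable rho x.
Proof.
have dc k : differentiable (fun y : E => y ord0 k) x by exact: (@differentiable_coord R 1 n x ord0 k).
have -> : rho = \sum_k ((fun y : E => y ord0 k) * (fun y : E => y ord0 k)) by apply/funext => y; rewrite /rho fct_sumE.
by apply: differentiable_sum => i; exact: differentiableM.
Qed.

Lemma derive_rho i x : 'D_(delta_mx ord0 i) rho x = 2 * x ord0 i.
Proof.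
have dc k : differentiable (fun y : E => y ord0 k) x by exact: (@differentiable_coord R 1 n x ord0 k).
have -> : rho = \sum_k ((fun y : E => y ord0 k) * (fun y : E => y ord0 k)) by apply/funext => y; rewrite /rho fct_sumE.
rewrite derive_sum; last by move=> k; apply: diff_derivable; exact: differentiableM.
rewrite (bigD1 i) //= big1 ?addr0.
  rewrite deriveM; [|exact: diff_derivable..]; rewrite derive_coord eqxx.
  by rewrite /GRing.scale /= mulr1 mulr2n mulrDl !mul1r.
move=> k ki; rewrite deriveM; [|exact: diff_derivable..]; rewrite derive_coord (negbTE ki).
by rewrite /GRing.scale /= mulr0 addr0.
Qed.

Lemma derive_comp_rho (h : R -> R) (h' : R) i x : is_derive (rho x) 1 h h' ->
  differentiable (fun y => h (rho y)) x /\ 'D_(delta_mx ord0 i) (fun y => h (rho y)) x = 2 * x ord0 i * h'.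
Proof.
move=> hh; have dh : differentiable h (rho x) by apply/derivable1_diffP; exact: ex_derive.
have dr := differentiable_rho x.
have dc : differentiable (h \o rho) x by exact: differentiable_comp.
split=> //; rewrite -[LHS]/('D_(delta_mx ord0 i) (h \o rho) x) deriveE // diff_comp //=.
rewrite -(deriveE (delta_mx ord0 i) dr) derive_rho diff1E // derive1E.
by rewrite (@derive_val _ _ _ _ _ _ _ hh).
Qed.

Definition gau (la : R[i]) x : R[i] := cexp (- la * (rho x)%:C).

Lemma gau_derive (la : R[i]) i x :
  (differentiable (fun y => complex.Re (gau la y)) x /\ differentiable (fun y => complex.Im (gau la y)) x) /\
  partial i (gau la) x = - (2 * la) * (coordC i x * gau la x).
Proof.
pose a := complex.Re la; pose b := complex.Im la.
pose hr (t : R) := expR (- a * t) * cos (- b * t); pose hi (t : R) := expR (- a * t) * sin (- b * t).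
have eg (t : R) : - la * t%:C = (- a * t) +i* (- b * t).
  by rewrite /a /b; case: (la) => u v; apply: complex_ext => /=; ring.
have eR : (fun y => complex.Re (gau la y)) = (fun y => hr (rho y)).
  by apply/funext => y; rewrite /gau eg /cexp /= mul0r subr0.
have eI : (fun y => complex.Im (gau la y)) = (fun y => hi (rho y)).
  by apply/funext => y; rewrite /gau eg /cexp /= mul0r addr0.
have lin (c t : R) : is_derive t 1 (fun s => c * s) c.
  by apply: is_derive_eq; rewrite /GRing.scale /= mulr1.
have dexp t := @is_derive1_comp R expR (fun s => - a * s) t _ _ (is_derive_expR _) (lin _ _).
have dcos t := @is_derive1_comp R (@cos R) (fun s => - b * s) t _ _ (is_derive_cos _) (lin _ _).
have dsin t := @is_derive1_comp R (@sin R) (fun s => - b * s) t _ _ (is_derive_sin _) (lin _ _).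
pose hr' (t : R) : R := expR (- a * t) * (- a * cos (- b * t) + b * sin (- b * t)).
pose hi' (t : R) : R := expR (- a * t) * (- a * sin (- b * t) - b * cos (- b * t)).
have dr (t : R) : is_derive t (1 : R) hr (hr' t).
  have -> : hr = (expR \o (fun s => - a * s)) * (@cos R \o (fun s => - b * s)) by [].
  by apply: is_derive_eq; rewrite /GRing.scale /hr' /hi' /=; ring.
have di (t : R) : is_derive t (1 : R) hi (hi' t).
  have -> : hi = (expR \o (fun s => - a * s)) * (@sin R \o (fun s => - b * s)) by [].
  by apply: is_derive_eq; rewrite /GRing.scale /hr' /hi' /=; ring.
have [d1 p1] := derive_comp_rho i (dr (rho x)); have [d2 p2] := derive_comp_rho i (di (rho x)).
rewrite /hr' in p1; rewrite /hi' in p2; rewrite eR eI; split=> //; rewrite /partial eR eI p1 p2 /gau eg /cexp /coordC.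
have -> : 2 * la = (2 * a) +i* (2 * b).
  by rewrite /a /b; case: (la) => u v; apply: complex_ext => /=; ring.
by apply: complex_ext => /=; ring.
Qed.

Lemma cdf_gau la : cdf (gau la).
Proof.
(* In dimension 0 there is no coordinate to apply [gau_derive] to, and [gau la] is constant. *)
move=> x; case: (posnP n) => [n0|n0]; last by have [] := gau_derive la (Ordinal n0) x.
have -> : gau la = fun=> gau la x.
  by apply/funext => y; congr (gau la); apply/rowP => -[k hk]; exfalso; move: hk; rewrite n0.
exact: (cdf_cst (gau la x) x).
Qed.

Lemma cdf_sum I (r : seq I) (F : I -> E -> R[i]) : (forall k, cdf (F k)) -> cdf (fun y => \sum_(k <- r) F k y).
Proof.
move=> h; elim: r => [|k r ih].
  by have -> : (fun y => \sum_(k <- [::]) F k y) = fun=> 0 by [apply/funext => y; rewrite big_nil]; exact: cdf_cst.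
have -> : (fun y => \sum_(j <- k :: r) F j y) = fun y => F k y + \sum_(j <- r) F j y.
  by apply/funext => y; rewrite big_cons.
exact: cdfD.
Qed.

Lemma partial_sum i I (r : seq I) (F : I -> E -> R[i]) x : (forall k, cdf (F k)) ->
  partial i (fun y => \sum_(k <- r) F k y) x = \sum_(k <- r) partial i (F k) x.
Proof.
move=> h; elim: r => [|k r ih].
  have -> : (fun y => \sum_(k <- [::]) F k y) = fun=> 0 by apply/funext => y; rewrite big_nil.
  by rewrite partial_cst big_nil.
have -> : (fun y => \sum_(j <- k :: r) F j y) = fun y => F k y + \sum_(j <- r) F j y.
  by apply/funext => y; rewrite big_cons.
by rewrite partialD ?ih ?big_cons //; exact: cdf_sum.
Qed.

End Partials.

(** * Derivatives and seminorms of sums of Gaussians *)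

Section GaussianSymbols.
Context (R : realType) (n : nat).
Local Notation E := 'rV[R]_n.
Variable p : seq (R[i] * R[i]).
Implicit Types (i : 'I_n) (x : E) (l s : seq 'I_n) (k : nat).

(** Up to sign, the k-th derivative of the symbol as a function of [rho]. *)
Definition Fk k x : R[i] := \sum_(q <- p) q.1 * q.2 ^+ k * gau q.2 x.
Definition sym x : R[i] := \sum_(q <- p) q.1 * gau q.2 x.

Let cdf_term (c la : R[i]) : cdf (fun x : E => c * gau la x).
Proof. by apply: cdfM; [exact: cdf_cst|exact: cdf_gau]. Qed.

Lemma cdf_Fk k : cdf (Fk k).
Proof. by apply: cdf_sum => q. Qed.

Lemma partial_Fk i k x : partial i (Fk k) x = - 2 * (coordC i x * Fk k.+1 x).
Proof.
rewrite partial_sum // /Fk !mulr_sumr; apply: eq_bigr => q _.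
rewrite partialM; [|exact: cdf_cst|exact: cdf_gau]; rewrite partial_cst mul0r add0r.
have [_ ->] := gau_derive q.2 i x; rewrite exprSr; ring.
Qed.

Definition mon l x : R[i] := \prod_(i <- l) coordC i x.

Lemma cdf_mon l : cdf (mon l).
Proof.
elim: l => [|i l ih].
  by have -> : mon [::] = fun=> 1 by [apply/funext => x; rewrite /mon big_nil]; exact: cdf_cst.
have -> : mon (i :: l) = fun x => coordC i x * mon l x by apply/funext => x; rewrite /mon big_cons.
by apply: cdfM => //; exact: cdf_coord.
Qed.

Fixpoint dmon i l : seq (seq 'I_n) :=
  if l is j :: l' then (if j == i then [:: l'] else [::]) ++ [seq j :: m | m <- dmon i l'] else [::].

Lemma partial_mon i l x : partial i (mon l) x = \sum_(m <- dmon i l) mon m x.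
Proof.
elim: l => [|j l ih] /=.
  have -> : mon [::] = fun=> 1 by apply/funext => y; rewrite /mon big_nil.
  by rewrite partial_cst big_nil.
have -> : mon (j :: l) = fun x => coordC j x * mon l x by apply/funext => y; rewrite /mon big_cons.
rewrite partialM; [|exact: cdf_coord|exact: cdf_mon]; rewrite ih partial_coord big_cat /= big_map mulr_sumr.
congr (_ + _); first by case: eqP => _; rewrite ?big_seq1 ?mul1r ?big_nil ?mul0r.
by apply: eq_bigr => m _; rewrite /mon big_cons.
Qed.

Lemma size_dmon i l : (size (dmon i l) <= size l)%N.
Proof.
elim: l => [//|j l ih] /=; rewrite size_cat size_map; case: eqP => _ /=; first by rewrite add1n.
by rewrite add0n; exact: leqW.
Qed.

Lemma dmon_size i l m : m \in dmon i l -> (size m).+1 = size l.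
Proof.
elim: l m => [//|j l ih] m /=; rewrite mem_cat => /orP[|/mapP[m' /ih h ->]]; last by rewrite /= h.
by case: eqP => // _; rewrite inE => /eqP ->.
Qed.

(* A term (c, l, k) stands for c * x^l * Fk k. *)
Local Notation term := (R[i] * seq 'I_n * nat)%type.
Definition ev_term (t : term) x : R[i] := t.1.1 * (mon t.1.2 x * Fk t.2 x).
Definition ev (ts : seq term) x : R[i] := \sum_(t <- ts) ev_term t x.
(** The head comes from the derivative of [Fk], the tail from the derivative of the monomial. *)
Definition dterm i (t : term) : seq term :=
  (- 2 * t.1.1, i :: t.1.2, t.2.+1) :: [seq (t.1.1, m, t.2) | m <- dmon i t.1.2].
Definition dterms i (ts : seq term) := flatten [seq dterm i t | t <- ts].

Lemma cdf_ev_term t : cdf (ev_term t).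
Proof. by apply: cdfM; [exact: cdf_cst|apply: cdfM; [exact: cdf_mon|exact: cdf_Fk]]. Qed.

Lemma cdf_ev ts : cdf (ev ts).
Proof. by apply: cdf_sum => t; exact: cdf_ev_term. Qed.

Lemma ev_cat ts ts' x : ev (ts ++ ts') x = ev ts x + ev ts' x.
Proof. exact: big_cat. Qed.

Lemma partial_ev_term i t x : partial i (ev_term t) x = ev (dterm i t) x.
Proof.
rewrite partialM; [|exact: cdf_cst|by apply: cdfM; [exact: cdf_mon|exact: cdf_Fk]].
rewrite partial_cst mul0r add0r partialM; [|exact: cdf_mon|exact: cdf_Fk].
rewrite partial_mon partial_Fk /ev big_cons big_map addrC mulrDr; congr (_ + _).
  by rewrite /ev_term /= /mon big_cons; ring.
by rewrite mulr_suml mulr_sumr.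
Qed.

Lemma partial_ev i ts : partial i (ev ts) = ev (dterms i ts).
Proof.
apply/funext => x; rewrite partial_sum; last by move=> t; exact: cdf_ev_term.
rewrite /dterms; elim: ts => [|t ts ih]; first by rewrite /ev !big_nil.
by rewrite big_cons ih partial_ev_term -ev_cat.
Qed.

Definition ts0 : seq term := [:: (1, [::], 0%N)].

Lemma ev_ts0 : ev ts0 = sym.
Proof.
apply/funext => x; rewrite /ev big_seq1 /ev_term /= mul1r /mon big_nil mul1r.
by apply: eq_bigr => q _; rewrite expr0 mulr1.
Qed.

Lemma partials_sym s : foldr (@partial R n) sym s = ev (foldr dterms ts0 s).
Proof. by elim: s => [|i s ih] /=; rewrite ?ev_ts0 // ih partial_ev. Qed.

Lemma smooth_sym : smooth sym.
Proof. by move=> s x /=; rewrite partials_sym; exact: cdf_ev. Qed.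

Definition cnorm (ts : seq term) : R := \sum_(t <- ts) nrm t.1.1.

(** A derivative either adds a coordinate and raises k by 1, or removes a coordinate at the same k.
    The balance ties the degree of the monomial to the power of lambda. *)
Lemma dterms_wf s t : t \in foldr dterms ts0 s -> (size t.1.2 + size s = t.2.*2)%N /\ (t.2 <= size s)%N.
Proof.
elim: s t => [|i s ih] t /=; first by rewrite inE => /eqP ->.
move=> /flatten_mapP [t' /ih [h1 h2]]; rewrite inE => /orP[/eqP -> /=|/mapP [m /dmon_size hm -> /=]].
  by rewrite addSn addnS h1 doubleS ltnS.
by rewrite addnS -addSn hm h1; split=> //; exact: leqW.
Qed.

Lemma cnorm_cat ts ts' : cnorm (ts ++ ts') = cnorm ts + cnorm ts'.
Proof. exact: big_cat. Qed.

(** Differentiating a term of degree at most 2M gives one term with twice the coefficient and at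
    most 2M others with the same coefficient. *)
Lemma cnorm_dterms s M : (size s <= M)%N ->
  cnorm (foldr dterms ts0 s) <= (2 + M.*2%:R) ^+ size s.
Proof.
elim: s => [|i s ih] sM /=; first by rewrite /cnorm big_seq1 /= nrm1 expr0.
have {}ih := ih (ltnW sM); rewrite exprS; apply: le_trans (ler_wpM2l _ ih); last by rewrite addr_ge0.
have : forall t, t \in foldr dterms ts0 s -> (size t.1.2 <= M.*2)%N.
  move=> t /dterms_wf [h1 h2]; apply: leq_trans (leq_addr (size s) _) _; rewrite h1 leq_double.
  exact: leq_trans h2 (ltnW sM).
elim: (foldr _ _ _) => [|t ts iht] h; first by rewrite /cnorm !big_nil mulr0.
have {}iht : cnorm (dterms i ts) <= (2 + M.*2%:R) * cnorm ts.
  by apply: iht => t' ht'; apply: h; rewrite inE ht' orbT.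
rewrite -[dterms _ _]/(dterm i t ++ dterms i ts) cnorm_cat -[t :: ts]cat1s cnorm_cat mulrDr lerD //.
have -> : cnorm (dterm i t) = 2 * nrm t.1.1 + nrm t.1.1 *+ size (dmon i t.1.2).
  rewrite -[dterm i t]cat1s cnorm_cat /cnorm big_seq1 nrmM nrmN nrm_nat; congr (_ + _).
  by rewrite big_map /= big_const_seq count_predT iter_addr_0.
have -> : cnorm [:: t] = nrm t.1.1 by rewrite /cnorm big_seq1.
rewrite [in X in _ <= X]mulrDl lerD2l.
rewrite -[nrm _ *+ size _]mulr_natl ler_wpM2r ?nrm_ge0 // ler_nat.
apply: leq_trans (size_dmon i t.1.2) _; apply: h; exact: mem_head.
Qed.

Lemma multi_partialE m (e : 'I_m -> 'I_n) (al : 'I_m -> nat) (f : E -> R[i]) :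
  multi_partial e al f = foldr (@partial R n) f (flatten [seq nseq (al j) (e j) | j <- enum 'I_m]).
Proof.
rewrite /multi_partial; elim: (enum _) => [//|j r ih] /=; rewrite foldr_cat -ih.
by elim: (al j) => [//|k ihk] /=; rewrite ihk.
Qed.

Lemma size_multi m (e : 'I_m -> 'I_n) (al : 'I_m -> nat) :
  size (flatten [seq nseq (al j) (e j) | j <- enum 'I_m]) = (\sum_j al j)%N.
Proof.
rewrite size_flatten /shape -map_comp sumnE big_map big_enum /=.
by apply: eq_bigr => j _; rewrite size_nseq.
Qed.

Definition rt x : R := Num.sqrt (1 + rho x).

Lemma rt_ge1 x : 1 <= rt x.
Proof. by rewrite -[X in X <= _]sqrtr1 ler_wsqrtr // lerDl rho_ge0. Qed.

Lemma rt_sqr x : rt x ^+ 2 = 1 + rho x.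
Proof. by rewrite sqr_sqrtr // addr_ge0 ?rho_ge0. Qed.

Lemma coord_rt i x : `|x ord0 i| <= rt x.
Proof.
rewrite -(@ler_pXn2r _ 2) ?nnegrE ?sqrtr_ge0 // rt_sqr real_normK ?num_real // /rho (bigD1 i) //=.
rewrite addrCA lerDl addr_ge0 //; apply: sumr_ge0 => j _; exact: sqr_ge0.
Qed.

Lemma mon_rt l x : nrm (mon l x) <= rt x ^+ size l.
Proof.
elim: l => [|i l ih]; first by rewrite /mon big_nil nrm1 expr0.
rewrite /mon big_cons nrmM nrm_real exprS; apply: ler_pM => //; rewrite ?nrm_ge0 //.
exact: coord_rt.
Qed.

(** Since a <= |s|, the total power a + |l| of sqrt(1 + rho) is at most |s| + |l| = 2k. Hence the
    quantities (1 + rho)^k |F_k| control everything, whichever coordinates are involved. *)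
Lemma ev_bound s M (A : R) (a : nat) x : (size s <= M)%N -> (a <= size s)%N ->
  (forall k, (k <= M)%N -> (1 + rho x) ^+ k * nrm (Fk k x) <= A) ->
  rt x ^+ a * nrm (ev (foldr dterms ts0 s) x) <= (2 + M.*2%:R) ^+ M * A.
Proof.
move=> sM as_ hA; have A0 : 0 <= A.
  by apply: le_trans (hA 0%N _) => //; rewrite expr0 mul1r nrm_ge0.
have q0 : 0 <= rt x by apply: le_trans (rt_ge1 x).
apply: (@le_trans _ _ (cnorm (foldr dterms ts0 s) * A)); last first.
  apply: ler_wpM2r => //; apply: le_trans (cnorm_dterms sM) _.
  by rewrite ler_weXn2l // -[X in X <= _]addr0 lerD // ?ler0n // ler1n.
have := @dterms_wf s; rewrite /cnorm; elim: (foldr _ _ _) => [|t ts ih] h.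
  by rewrite /ev !big_nil nrm0 mulr0 mul0r.
have {}ih : rt x ^+ a * nrm (ev ts x) <= (\sum_(t <- ts) nrm t.1.1) * A.
  by apply: ih => t' ht'; apply: h; rewrite inE ht' orbT.
rewrite /ev big_cons [in X in _ <= X]big_cons mulrDl.
apply: le_trans (ler_wpM2l (exprn_ge0 _ q0) (nrmD _ _)) _; rewrite mulrDr lerD //.
have [h1 h2] := h t (mem_head _ _).
rewrite /ev_term !nrmM mulrCA ler_wpM2l ?nrm_ge0 //.
apply: le_trans (hA t.2 (leq_trans h2 sM)); rewrite mulrA ler_wpM2r ?nrm_ge0 //.
apply: le_trans (ler_wpM2l (exprn_ge0 _ q0) (mon_rt _ _)) _.
rewrite -exprD -rt_sqr -exprM ler_weXn2l ?rt_ge1 // mul2n -h1 addnC leq_add2l.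
exact: as_.
Qed.

Hypothesis p_gt0 : forall q, q \in p -> 0 < complex.Re q.2.

(** From 1 + rho <= (1 + n/al) e^{al rho / n} with n = a + 1, raised to the power n; one Gaussian at
    a time. *)
Lemma Fk_decay (a : nat) k : exists C : R, forall x, rt x ^+ a * nrm (Fk k x) <= C.
Proof.
rewrite /Fk; move: p_gt0; elim: (p) => [|q r ih] h.
  by exists 0 => x; rewrite big_nil nrm0 mulr0.
have [|C hC] := ih; first by move=> q' hq; apply: h; rewrite inE hq orbT.
have q0 : 0 < complex.Re q.2 by apply: h; rewrite mem_head.
pose al := complex.Re q.2; pose K := (1 + a.+1%:R / al) ^+ a.+1 * nrm (q.1 * q.2 ^+ k).
exists (K + C) => x; have t0 : 0 <= rt x by apply: le_trans (rt_ge1 x).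
rewrite big_cons; apply: le_trans (ler_wpM2l (exprn_ge0 _ t0) (nrmD _ _)) _.
rewrite mulrDr lerD //; rewrite nrmM mulrCA [K]mulrC ler_wpM2l ?nrm_ge0 //.
have -> : nrm (gau q.2 x) = expR (- (al * rho x)).
  rewrite /gau nrm_cexp; congr expR; rewrite /al; case: (q.2) => u v /=; ring.
have a1 : 0 < a.+1%:R :> R by rewrite ltr0n.
have r0 := rho_ge0 x; pose w := al * rho x / a.+1%:R.
have w0 : 0 <= w by rewrite /w divr_ge0 ?mulr_ge0 // ltW.
have h1 : 1 + rho x <= (1 + a.+1%:R / al) * expR w.
  apply: le_trans (ler_wpM2l _ (expR_ge1Dx w)); last by rewrite addr_ge0 // divr_ge0 // ltW.
  have -> : (1 + a.+1%:R / al) * (1 + w) = 1 + rho x + (a.+1%:R / al + w).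
    by rewrite /w; field; rewrite !gt_eqF.
  by rewrite lerDl addr_ge0 // divr_ge0 // ltW.
have h2 : rt x ^+ a <= (1 + rho x) ^+ a.+1.
  rewrite -rt_sqr -exprM ler_weXn2l ?rt_ge1 //; rewrite mulSn mul1n; exact: leq_trans (leqnSn a) (leq_addl _ _).
apply: le_trans (ler_wpM2r (expR_ge0 _) h2) _.
have h3 : (1 + rho x) ^+ a.+1 <= (1 + a.+1%:R / al) ^+ a.+1 * expR (al * rho x).
  have -> : expR (al * rho x) = expR w ^+ a.+1.
    by rewrite -expRM_natl /w; congr expR; field; rewrite gt_eqF.
  rewrite -exprMn lerXn2r ?nnegrE //; first by rewrite addr_ge0.
  by rewrite mulr_ge0 ?expR_ge0 // addr_ge0 // divr_ge0 // ltW.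
apply: le_trans (ler_wpM2r (expR_ge0 _) h3) _.
by rewrite -mulrA -expRD subrr expR0 mulr1.
Qed.

Lemma ev_decay (a : nat) ts : exists C : R, forall x, rt x ^+ a * nrm (ev ts x) <= C.
Proof.
elim: ts => [|t ts [C hC]]; first by exists 0 => x; rewrite /ev big_nil nrm0 mulr0.
have [D hD] := Fk_decay (a + size t.1.2) t.2.
exists (nrm t.1.1 * D + C) => x; have t0 : 0 <= rt x by apply: le_trans (rt_ge1 x).
rewrite /ev big_cons; apply: le_trans (ler_wpM2l (exprn_ge0 _ t0) (nrmD _ _)) _.
rewrite mulrDr lerD // /ev_term !nrmM mulrCA ler_wpM2l ?nrm_ge0 //.
apply: le_trans (hD x); rewrite exprD mulrA ler_wpM2r ?nrm_ge0 // ler_wpM2l ?exprn_ge0 //.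
exact: mon_rt.
Qed.

Lemma schwartz_sym : schwartz sym.
Proof.
split; first exact: smooth_sym.
move=> al be; have [C hC] := ev_decay (\sum_i al i)%N (foldr dterms ts0 (flatten [seq nseq (be j) (id j) | j <- enum 'I_n])).
exists C => x; rewrite multi_partialE partials_sym; apply: le_trans (hC x).
rewrite ler_wpM2r ?nrm_ge0 // normr_prod.
have t0 : 0 <= rt x by apply: le_trans (rt_ge1 x).
elim: (index_enum _) => [|i r ih]; first by rewrite !big_nil expr0.
rewrite !big_cons exprD; apply: ler_pM => //; first exact: prodr_ge0.
by rewrite normrX lerXn2r ?nnegrE // coord_rt.
Qed.

End GaussianSymbols.

(** At most m + m derivatives occur, and the |alpha| derivatives in xi pay for the weight in xi. The
    type 0 seminorms of a radial sum of Gaussians are thus governed by functions of rho alone. *)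
Lemma seminorm0_sym (R : realType) (d m : nat) (p : seq (R[i] * R[i])) (A : R) :
  (forall q, q \in p -> 0 < complex.Re q.2) ->
  (forall k (x : 'rV[R]_(d + d)), (k <= m.*2)%N -> (1 + rho x) ^+ k * nrm (Fk p k x) <= A) ->
  seminorm0 m (@sym R (d + d) p) <= (2 + m.*2.*2%:R) ^+ m.*2 * A.
Proof.
move=> p0 hA; have C0 : 0 <= (2 + m.*2.*2%:R) ^+ m.*2 * A.
  rewrite mulr_ge0 ?exprn_ge0 ?addr_ge0 //.
  by apply: le_trans (hA 0%N 0 _) => //; rewrite expr0 mul1r nrm_ge0.
apply: bigmax_le => // al hal; apply: bigmax_le => // be hbe; apply: ge_sup.
  by eexists; exists 0.
move=> _ [z _ <-]; rewrite !multi_partialE -foldr_cat partials_sym.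
set s := _ ++ _; have sz : size s = (\sum_j al j + \sum_j be j)%N by rewrite size_cat !size_multi.
have sM : (size s <= m.*2)%N by rewrite sz -addnn leq_add.
have aS : (\sum_j al j <= size s)%N by rewrite sz leq_addr.
have hb := ev_bound sM aS (fun k hk => hA k z hk).
apply: le_trans hb.
rewrite ler_wpM2r ?nrm_ge0 // lerXn2r ?nnegrE ?sqrtr_ge0 // /bracket /rt ler_wsqrtr // lerD2l.
rewrite /dot /rho big_split_ord /=; apply: le_trans (_ : \sum_(j < d) z ord0 (rshift d j) ^+ 2 <= _).
  by apply: ler_sum => j _; rewrite mxE -expr2.
by rewrite lerDr; apply: sumr_ge0 => j _; exact: sqr_ge0.
Qed.

Lemma BI_sum_seq (R : realType) disp (T : measurableType disp) (mu : {measure set T -> \bar R})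
    (V : completeNormedModType R[i]) (I : eqType) (r : seq I) (F : I -> T -> V) :
  (forall i, i \in r -> Bint mu (F i)) ->
  Bint mu (fun t => \sum_(i <- r) F i t) /\
  BI mu (fun t => \sum_(i <- r) F i t) = \sum_(i <- r) BI mu (F i).
Proof.
elim: r => [|i r ih] h.
  have -> : (fun t => \sum_(i <- [::]) F i t) = fun=> 0 by apply/funext => t; rewrite big_nil.
  by rewrite big_nil; split; [exact: Bint0|exact: BI0].
have [|i1 e1] := ih; first by move=> j jr; apply: h; rewrite inE jr orbT.
have i2 : Bint mu (F i) by apply: h; exact: mem_head.
have -> : (fun t => \sum_(j <- i :: r) F j t) = fun t => F i t + \sum_(j <- r) F j t.
  by apply/funext => t; rewrite big_cons.
by rewrite big_cons -e1; split; [exact: BintD|exact: BI_D].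
Qed.

Lemma Re_inv_gt0 (R : realType) (z : R[i]) : 0 < complex.Re z -> 0 < complex.Re z^-1.
Proof.
case: z => a b /= a0; apply: mulr_gt0 => //; rewrite invr_gt0 ltr_wpDr ?sqr_ge0 //.
exact: exprn_gt0.
Qed.

(** * The Weyl calculus on sums of Gaussians *)

Section SymbolCalculus.
Context (R : realType) (X : completeNormedModType R[i]) (d : nat).
Variables (A B : 'I_d -> set (X * X)) (U V : 'I_d -> R -> {linear X -> X}).
Hypothesis HW : weyl_pair A B U V.
Local Notation N := (d + d)%N.
Local Notation T := (N.-tuple R).
Local Notation mu := (lebesgue_tuple R N).
Local Notation W := (W U V).
Local Notation S := (S U V).
Implicit Types (t : T) (f : X) (p : seq (R[i] * R[i])).

Lemma rho_vec t : rho (vec t) = sqn t.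
Proof. by rewrite /rho /sqn; apply: eq_bigr => i _; rewrite mxE. Qed.

Lemma gau_vec (la : R[i]) t : gau la (vec t) = Eb (4 * la) t.
Proof.
rewrite /gau rho_vec /Eb /qf; congr cexp.
have -> : (sqn t / 4)%:C = (sqn t)%:C / 4 by rewrite rmorphM fmorphV /= rmorph_nat.
by field.
Qed.

(** Each Gaussian e^{-lam rho} is [Eb b] with b = 4 lam, to which [CI_Eb_ph] and [CI_Eb] apply. *)
Lemma fourier_sym p (w : 'rV[R]_N) : (forall q, q \in p -> 0 < complex.Re q.2) ->
  fourier (@sym R N p) w = \sum_(q <- p) q.1 / (2 * q.2) ^+ d * cexp (- (rho w)%:C / (4 * q.2)).
Proof.
move=> p0; pose y i := w ord0 i.
pose F (q : R[i] * R[i]) t : cplx R := q.1 * (Eb (4 * q.2) t * ph y 1 t).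
have Re4 (q : R[i] * R[i]) : q \in p -> 0 < complex.Re (4 * q.2).
  move=> /p0; rewrite -[4](rmorph_nat (real_complex R)); case: (q.2) => a b /= a0.
  by rewrite mul0r subr0 mulr_gt0.
have iF q : q \in p -> Bint mu (F q) /\ BI mu (F q) = q.1 * (cexp (- (rho w)%:C / (4 * q.2)) * CI (Eb (4 * q.2) : T -> R[i])).
  move=> qp; have b0 := Re4 q qp; have c0 : 0 < complex.Re (4 * q.2) / 4 by rewrite divr_gt0.
  have gE : gb (complex.Re (4 * q.2) / 4) (Eb (4 * q.2) : T -> R[i]).
    by have := gb_rk N 0 b0; congr gb; apply/funext => t; rewrite /rk expr0 mul1r.
  have gP := gbM gE (gb_ph y 1); rewrite addr0 in gP.
  have [i1 e1] := BintZ q.1 (gb_Bint c0 gP); split; first exact: i1.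
  exact: (etrans e1 (congr1 (fun z : R[i] => q.1 * z) (CI_Eb_ph b0 y))).
have [i1 e1] := BI_sum_seq (fun q qp => (iF q qp).1).
rewrite /fourier.
have -> : (fun t : T => sym p (vec t) * expi (- dot (vec t) w)) = (fun t => \sum_(q <- p) F q t).
  apply/funext => t; rewrite /sym mulr_suml; apply: eq_bigr => q _.
  rewrite /F gau_vec -mulrA /ph mul1r; congr (_ * (_ * expi (- _))).
  by rewrite /dot /lform; apply: eq_bigr => i _; rewrite mxE mulrC.
rewrite -(BI_complex i1) e1 big_seq mulr_sumr [RHS]big_seq; apply: eq_bigr => q qp.
rewrite (iF q qp).2; have b0 := Re4 q qp; have hE := CI_Eb d b0; move: hE.
move: (CI _) => G hE; have l0 : q.2 != 0.
  by apply/eqP => z; have := p0 q qp; rewrite z ltxx.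
have pi0 : (pi%:C : R[i]) != 0.
  by apply/eqP => /(congr1 (@complex.Re R)) /= /eqP; rewrite gt_eqF // pi_gt0.
have -> : G = (4 * pi%:C) ^+ d / (4 * q.2) ^+ d.
  by rewrite -hE mulrAC divff ?mul1r // expf_neq0 // mulf_neq0 // pnatr_eq0.
have -> : (((2 * pi) ^+ d)^-1)%:C = ((2 * pi%:C) ^+ d)^-1 :> R[i].
  by rewrite fmorphV rmorphXn rmorphM /= rmorph_nat.
set E := cexp _; rewrite !exprMn.
have h4 : (4 : R[i]) ^+ d = 2 ^+ d * 2 ^+ d by rewrite -exprMn -natrM.
have n2 : (2 : R[i]) ^+ d != 0 by rewrite expf_neq0 // pnatr_eq0.
have n3 : q.2 ^+ d != 0 by rewrite expf_neq0.
have n4 : (pi%:C : R[i]) ^+ d != 0 by rewrite expf_neq0.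
by rewrite h4; field; rewrite n2 n3 n4.
Qed.

(** The Fourier transform of e^{-lam rho} is a multiple of the kernel e^{-q/lam}. *)
Lemma weyl_sym p f : (forall q, q \in p -> 0 < complex.Re q.2) ->
  weyl_calculus U V (@sym R N p) f =
  \sum_(q <- p) (q.1 / (2 * q.2) ^+ d / (2 * pi%:C) ^+ d) *: S (Eb q.2^-1) f.
Proof.
move=> p0; rewrite /weyl_calculus.
pose F (q : R[i] * R[i]) t : X := (q.1 / (2 * q.2) ^+ d) *: (Eb q.2^-1 t *: W t f).
have iF q : q \in p -> Bint mu (F q) /\ BI mu (F q) = (q.1 / (2 * q.2) ^+ d) *: S (Eb q.2^-1) f.
  move=> qp; have b0 := Re_inv_gt0 (p0 q qp); have c0 : 0 < complex.Re q.2^-1 / 4 by rewrite divr_gt0.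
  have gE : gb (complex.Re q.2^-1 / 4) (Eb q.2^-1 : T -> R[i]).
    by have := gb_rk N 0 b0; congr gb; apply/funext => t; rewrite /rk expr0 mul1r.
  exact: (BintZ (q.1 / (2 * q.2) ^+ d) (S_Bint HW f c0 gE)).
have [i1 e1] := BI_sum_seq (fun q qp => (iF q qp).1).
have -> : (fun t : T => fourier (sym p) (vec t) *: weyl_exp U V (lsubmx (vec t)) (rsubmx (vec t)) f) =
   (fun t => \sum_(q <- p) F q t).
  apply/funext => t; rewrite W_weyl_exp fourier_sym // scaler_suml big_seq [RHS]big_seq.
  apply: eq_bigr => q qp; rewrite /F scalerA; congr (_ * cexp _ *: _).
  rewrite rho_vec /qf.
  have -> : (sqn t / 4)%:C = (sqn t)%:C / 4 by rewrite rmorphM fmorphV /= rmorph_nat.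
  have l0 : q.2 != 0 by apply/eqP => z; have := p0 q qp; rewrite z ltxx.
  by field.
transitivity ((((2 * pi) ^+ d)^-1)%:C *: \sum_(q <- p) BI mu (F q)); first by congr (_ *: _); exact: e1.
rewrite scaler_sumr big_seq [RHS]big_seq.
apply: eq_bigr => q qp; rewrite (iF q qp).2 scalerA; congr (_ *: _).
by rewrite mulrC fmorphV rmorphXn rmorphM /= rmorph_nat.
Qed.

(** Mehler's formula: for lam = tanh(t/2) the quotient (1 - lam)/(1 + lam) is e^{-t}, so that (1 +
    lam)^d e^{-lam rho} is the symbol of e^{-tL}. *)
Lemma weyl_sym_eigen p (n : nat) (y : X) : (forall q, q \in p -> 0 < complex.Re q.2 /\ q.2 != 1) ->
  oscillator0 A B (y, n%:R *: y) ->
  weyl_calculus U V (@sym R N p) y =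
  (\sum_(q <- p) q.1 / (1 + q.2) ^+ d * ((1 - q.2) / (1 + q.2)) ^+ n) *: y.
Proof.
move=> p0 hy; rewrite weyl_sym; last by move=> q /p0 [].
rewrite scaler_suml big_seq [RHS]big_seq; apply: eq_bigr => q /p0 [l0 l1].
have ln : q.2 != 0 by apply/eqP => z; rewrite z ltxx in l0.
have l1' : q.2^-1 != 1 by rewrite invr_eq1.
rewrite (S_Eb_eigen HW hy (Re_inv_gt0 l0) l1') scalerA; congr (_ *: _).
have pl : 1 + q.2 != 0.
  apply/eqP => /(congr1 (@complex.Re R)) /eqP; case: (q.2) l0 => a b /= a0.
  by rewrite gt_eqF // addr_gt0.
have pi0 : (pi%:C : R[i]) != 0.
  by apply/eqP => /(congr1 (@complex.Re R)) /= /eqP; rewrite gt_eqF // pi_gt0.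
have -> : q.2^-1 - 1 = (1 - q.2) / q.2 by field.
have -> : q.2^-1 + 1 = (1 + q.2) / q.2 by field.
rewrite !expr_div_n !exprMn !exprD.
have h4 : (4 : R[i]) ^+ d = 2 ^+ d * 2 ^+ d by rewrite -exprMn -natrM.
have n1 : (1 + q.2) ^+ d != 0 by rewrite expf_neq0.
have n1' : (1 + q.2) ^+ n != 0 by rewrite expf_neq0.
have n2 : (2 : R[i]) ^+ d != 0 by rewrite expf_neq0 // pnatr_eq0.
have n3 : q.2 ^+ d != 0 by rewrite expf_neq0.
have n3' : q.2 ^+ n != 0 by rewrite expf_neq0.
have n4 : (pi%:C : R[i]) ^+ d != 0 by rewrite expf_neq0.
rewrite h4; move: n1 n1' n2 n3 n3' n4.
move: ((1 + q.2) ^+ d) ((1 + q.2) ^+ n) ((1 - q.2) ^+ n) (q.2 ^+ d) (q.2 ^+ n) (2 ^+ d) (pi%:C ^+ d) => x1 x2 x3 x4 x5 x6 x7.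
by move=> n1 n1' n2 n3 n3' n4; field; rewrite n1 n1' n2 n3 n3' n4.
Qed.

Lemma weyl_sym_sum p (n : nat) (y : nat -> X) : (forall q, q \in p -> 0 < complex.Re q.2) ->
  weyl_calculus U V (@sym R N p) (\sum_(k < n) y k) =
  \sum_(k < n) weyl_calculus U V (@sym R N p) (y k).
Proof.
move=> p0; rewrite weyl_sym //; under [RHS]eq_bigr do rewrite weyl_sym //.
rewrite exchange_big /= big_seq [RHS]big_seq; apply: eq_bigr => q qp.
rewrite -scaler_sumr; congr (_ *: _).
have b0 := Re_inv_gt0 (p0 q qp); have c0 : 0 < complex.Re q.2^-1 / 4 by rewrite divr_gt0.
have gE : gb (complex.Re q.2^-1 / 4) (Eb q.2^-1 : T -> R[i]).
  by have := gb_rk N 0 b0; congr gb; apply/funext => t; rewrite /rk expr0 mul1r.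
have lin := S_linear HW c0 gE.
elim: (index_enum _) => [|k r ih]; first by rewrite !big_nil (S_0 HW c0 gE).
by rewrite !big_cons -ih; have := lin 1 (y k) (\sum_(j <- r) y j); rewrite !scale1r.
Qed.

(** The factors (1 + lam)^d cancel the normalisation in [weyl_sym_eigen]. The boundedness of the
    Weyl calculus becomes a multiplier theorem on sums of eigenvectors, under a condition on
    functions of the single variable r = rho. *)
Lemma multiplier_bound : bounded_weyl_calculus_type0 U V ->
  exists (M : nat) (C0 : R), 0 <= C0 /\
  forall (p : seq (R[i] * R[i])) (D : R) (n : nat) (y : nat -> X),
    (forall q, q \in p -> 0 < complex.Re q.2 /\ q.2 != 1) ->
    (forall k, oscillator0 A B (y k, k%:R *: y k)) ->
    (forall k r, (k <= M)%N -> 0 <= r ->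
       (1 + r) ^+ k * nrm (\sum_(q <- p) q.1 * (1 + q.2) ^+ d * q.2 ^+ k * cexp (- q.2 * r%:C)) <= D) ->
    nrm (\sum_(k < n) (\sum_(q <- p) q.1 * ((1 - q.2) / (1 + q.2)) ^+ k) *: y k) <=
    C0 * D * nrm (\sum_(k < n) y k).
Proof.
move=> [m [C hC]]; exists m.*2, (`|C| * (2 + m.*2.*2%:R) ^+ m.*2).
have M0 : 0 <= (2 + m.*2.*2%:R : R) ^+ m.*2 by rewrite exprn_ge0 ?addr_ge0.
split; first by rewrite mulr_ge0.
move=> p D n y p0 hy hD; pose p' := [seq (q.1 * (1 + q.2) ^+ d, q.2) | q <- p].
have p0' q : q \in p' -> 0 < complex.Re q.2 /\ q.2 != 1 by move=> /mapP [q' /p0 h ->].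
have p0'' q : q \in p' -> 0 < complex.Re q.2 by move=> /p0' [].
have -> : \sum_(k < n) (\sum_(q <- p) q.1 * ((1 - q.2) / (1 + q.2)) ^+ k) *: y k =
    weyl_calculus U V (@sym R N p') (\sum_(k < n) y k).
  rewrite weyl_sym_sum //; apply: eq_bigr => k _; rewrite (weyl_sym_eigen p0' (hy k)) big_map /=.
  congr (_ *: _); rewrite big_seq [RHS]big_seq; apply: eq_bigr => q /p0 [l0 _].
  have pl : 1 + q.2 != 0.
    apply/eqP => /(congr1 (@complex.Re R)) /eqP; case: (q.2) l0 => a b /= a0.
    by rewrite gt_eqF // addr_gt0.
  by rewrite mulfK // expf_neq0.
have hs := @schwartz_sym R N p' p0''; apply: le_trans (hC _ hs _) _.
have h1 : seminorm0 m (@sym R N p') <= (2 + m.*2.*2%:R) ^+ m.*2 * D.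
  apply: seminorm0_sym => // k x km; have := hD k (rho x) km (rho_ge0 x).
  by rewrite /Fk big_map.
rewrite ler_wpM2r ?nrm_ge0 // -mulrA.
have D0 : 0 <= (2 + m.*2.*2%:R) ^+ m.*2 * D.
  rewrite mulr_ge0 //; apply: le_trans (hD 0%N 0 _ _) => //.
  by rewrite expr0 mul1r nrm_ge0.
apply: (@le_trans _ _ (`|C| * seminorm0 m (@sym R N p'))).
  rewrite ler_wpM2r ?ler_norm //; exact: bigmax_ge_id.
by rewrite ler_wpM2l.
Qed.

End SymbolCalculus.

(** * Integrals over subsets of the line *)

Section RestrictedIntegrals.
Context (R : realType).
Local Notation leb := (@lebesgue_measure R).

Definition on (V : normedModType R[i]) (P : pred R) (h : R -> V) (r : R) : V := if P r then h r else 0.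

Lemma smap_pred (P : pred R) : measurable [set r | P r] -> smap P.
Proof.
move=> mP; split; first by apply: (@sub_finite_set _ _ [set: bool]) => //; exact: finite_finset.
move=> [|]; first by have -> : P @^-1` [set true] = [set r | P r].
have -> : P @^-1` [set false] = ~` [set r | P r]; last exact: measurableC.
by apply/seteqP; split=> r /=; [move=> ->|move/negP/negbTE].
Qed.

Lemma bmeas_on (V : normedModType R[i]) (P : pred R) (h : R -> V) :
  measurable [set r | P r] -> bmeas h -> bmeas (on P h).
Proof.
move=> mP [s [ms cs]]; exists (fun k => on P (s k)); split=> [k|t].
  exact: (smap2 (fun b x => if b then x else 0 : V) (smap_pred mP) (ms k)).
by rewrite /on; case: (P t) => //; exact: cvg_cst.
Qed.

Lemma on_if (V : normedModType R[i]) (P : pred R) (h k : R -> V) :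
  (forall r, P r -> h r = k r) -> on P h = on P k.
Proof. by move=> e; apply/funext => r; rewrite /on; case: ifP => // /e. Qed.

Lemma bmeas_pos (V : normedModType R[i]) (h : R -> V) :
  (forall (u : nat -> R) (x : R), 0 < x -> u k @[k --> \oo] --> x -> h (u k) @[k --> \oo] --> h x) ->
  bmeas (on (fun r => 0 < r) h).
Proof.
move=> hc; pose P (r : R) := 0 < r.
have mP : measurable [set r | P r] by rewrite (_ : [set _ | _] = `]0, +oo[%classic) //; apply/seteqP; split=> r /=; rewrite in_itv /= andbT.
exists (fun k => on P (h \o grid k)); split=> [k|t].
  have h1 := smap_pred mP; have h2 := @smap_grid R k.
  exact: (@smap2 _ _ _ _ _ (fun (b : bool) (x : R) => if b then h x else 0 : V) _ _ h1 h2).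
rewrite /on -/(P t); case: ifP => pt; last exact: cvg_cst.
by apply: hc => //; apply: (@grid_cvg _ (fun=> t)); exact: cvg_cst.
Qed.

Lemma int_on (P : pred R) (M : R) : measurable [set r | P r] -> 0 <= M ->
  (\int[leb]_r (if P r then M else 0)%:E = M%:E * leb [set r | P r])%E.
Proof.
move=> mP M0; under eq_integral => r _.
  have -> : (if P r then M else 0)%:E = (M%:E * (\1_([set r | P r]) r)%:E)%E.
    by rewrite indicE -EFinM; case: ifP => h; [rewrite mem_set // mulr1|rewrite memNset /= ?h // mulr0].
  over.
rewrite ge0_integralZl //; last first.
- by apply: measurableT_comp; [exact: EFin_measurable|exact: measurable_indic].
by rewrite integral_indic // setIT.
Qed.

End RestrictedIntegrals.

(** * Integrals over segments and the fundamental theorem of calculus *)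

Section SegmentIntegrals.
Context (R : realType).
Local Notation leb := (@lebesgue_measure R).
Implicit Types (a b m : R) (h : R -> cplx R).

Definition ccont a b h := forall (u : nat -> R) (x : R), (forall k, a <= u k /\ u k <= b) ->
  a <= x -> x <= b -> u k @[k --> \oo] --> x -> h (u k) @[k --> \oo] --> h x.

Definition oc a b : pred R := fun r => (a < r) && (r <= b).

Definition CS a b h : R[i] := BI leb (on (oc a b) h).

Lemma measurable_oc a b : measurable [set r | oc a b r].
Proof.
by rewrite (_ : [set _ | _] = `]a, b]%classic) //; apply/seteqP; split=> r /=; rewrite in_itv.
Qed.

Definition clamp a b (r : R) := Num.min b (Num.max a r).

Lemma clamp_dist a b (x y : R) : `|clamp a b x - clamp a b y| <= `|x - y|.
Proof.
wlog xy : x y / x <= y => [hw|].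
  by case: (leP x y) => [/hw //|/ltW /hw]; rewrite distrC [in leRHS]distrC.
have cxy : clamp a b x <= clamp a b y by rewrite /clamp le_min2 ?le_max2.
rewrite distrC [in leRHS]distrC !ger0_norm ?subr_ge0 //.
by rewrite /clamp /Num.min /Num.max; case: (ltP a x) => ?; case: (ltP a y) => ?; do !case: ltP => ?; lra.
Qed.

(** Clamping the variable to [a, b] extends h to a continuous function on R that agrees with h on
    the segment. *)
Lemma ccont_bmeas a b h : a <= b -> ccont a b h -> bmeas (on (oc a b) h).
Proof.
move=> ab hc; pose cl := clamp a b.
have cla r : a <= cl r by rewrite le_min ab le_max lexx.
have clb r : cl r <= b by rewrite ge_min lexx.
rewrite (@on_if _ _ _ h (h \o cl)); last first.
  move=> r /andP[ar rb] /=; congr h; by rewrite /cl /clamp max_r ?(ltW ar) // min_r.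
apply: bmeas_on; first exact: measurable_oc.
apply: bmeas_seqcontR => u x ux; apply: hc => //.
apply/cvgrPdist_le => e e0; near=> k; apply: le_trans (clamp_dist _ _ _ _) _.
by near: k; move/cvgrPdist_le: ux; exact.
Unshelve. all: by end_near.
Qed.

Lemma CS_Bint a b h M : a <= b -> ccont a b h -> (forall r, a <= r -> r <= b -> nrm (h r) <= M) ->
  Bint leb (on (oc a b) h) /\ nrm (CS a b h) <= M * (b - a).
Proof.
move=> ab hc hM; have M0 : 0 <= M by exact: le_trans (nrm_ge0 _) (hM a (lexx _) ab).
have mh := ccont_bmeas ab hc.
pose G r := if oc a b r then M else 0.
have mG : measurable_fun setT G.
  exact: (smap_measurable (smap_comp (fun b : bool => if b then M else 0) (smap_pred (measurable_oc a b)))).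
have hG r : nrm (on (oc a b) h r) <= G r.
  rewrite /on /G; case: ifP => [/andP[ar rb]|_]; last by rewrite nrm0.
  exact: hM (ltW ar) rb.
have iG : (\int[leb]_r (G r)%:E = (M * (b - a))%:E)%E.
  rewrite int_on //; last exact: measurable_oc.
  have -> : [set r | oc a b r] = `]a, b]%classic by apply/seteqP; split=> r /=; rewrite in_itv.
  rewrite lebesgue_measure_itv /= lte_fin; case: ifP => [_|/negbT]; first by rewrite -EFinB -EFinM.
  by rewrite -leNgt => ba; have -> : a = b by [apply/eqP; rewrite eq_le ab ba]; rewrite subrr mule0 mulr0.
have h1 := @le_Bint R _ _ leb (cplx R) _ G mh mG hG; have h2 := @BI_leG R _ _ leb (cplx R) _ G (M * (b - a)) mh mG hG.
by split; [apply: h1; rewrite iG ltry|apply: h2; rewrite iG].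
Qed.

End SegmentIntegrals.

Section SegmentCalculus.
Context (R : realType).
Local Notation leb := (@lebesgue_measure R).
Implicit Types (a b m : R) (h : R -> cplx R).

Definition seg a b h := ccont a b h /\ exists M : R, forall r, a <= r -> r <= b -> nrm (h r) <= M.

Lemma seg_Bint a b h : a <= b -> seg a b h -> Bint leb (on (oc a b) h).
Proof. by move=> ab [hc [M hM]]; have [] := CS_Bint ab hc hM. Qed.

Lemma CS_le a b h M : a <= b -> seg a b h -> (forall r, a <= r -> r <= b -> nrm (h r) <= M) ->
  nrm (CS a b h) <= M * (b - a).
Proof. by move=> ab [hc _] hM; have [] := CS_Bint ab hc hM. Qed.

Lemma seg_sub a b a' b' h : a <= a' -> b' <= b -> seg a b h -> seg a' b' h.
Proof.
move=> aa bb [hc [M hM]]; split=> [u x hu ax xb ux|].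
  apply: hc => //; [move=> k; have [h1 h2] := hu k; split; [exact: le_trans h1|exact: le_trans bb]|exact: le_trans ax|exact: le_trans bb].
by exists M => r ar rb; apply: hM; [exact: le_trans ar|exact: le_trans bb].
Qed.

Lemma seg_cst a b (c : cplx R) : seg a b (fun=> c).
Proof. by split; [move=> u x _ _ _ _; exact: cvg_cst|exists (nrm c)]. Qed.

Lemma segD a b h k : seg a b h -> seg a b k -> seg a b (fun r => h r + k r).
Proof.
move=> [hc [M hM]] [kc [M' kM]]; split.
  by move=> u x hu ax xb ux; apply: cvgD; [exact: hc|exact: kc].
exists (M + M') => r ar rb; apply: le_trans (nrmD _ _) _.
by rewrite lerD ?hM ?kM.
Qed.

Lemma segM a b h k : seg a b h -> seg a b k -> seg a b (fun r => (h r : R[i]) * (k r : R[i])).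
Proof.
move=> [hc [M hM]] [kc [M' kM]]; split.
  by move=> u x hu ax xb ux; apply: cvg_cplxM; [exact: hc|exact: kc].
exists (M * M') => r ar rb; rewrite -[nrm _]/(nrm ((h r : R[i]) * (k r : R[i]))) nrmM.
by rewrite ler_pM ?nrm_ge0 //; [exact: hM|exact: kM].
Qed.

Lemma segZ a b (c : R[i]) h : seg a b h -> seg a b (fun r => c * (h r : R[i])).
Proof. by move=> hh; apply: (segM (seg_cst a b c) hh). Qed.

Lemma seg_id a b : seg a b (fun r => r%:C).
Proof.
split; first by move=> u x _ _ _ ux; apply: cvg_complex => //; exact: cvg_cst.
exists (`|a| + `|b|) => r ar rb; rewrite nrm_real ler_norml.
have := ler_norm b; have := ler_norm (- a); rewrite normrN.
by have := normr_ge0 a; have := normr_ge0 b; move=> *; apply/andP; split; lra.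
Qed.

Lemma seg_expi a b : seg a b (fun r => expi r).
Proof.
split; first by move=> u x _ _ _ ux; exact: expi_cvg.
by exists 1 => r _ _; rewrite nrm_expi.
Qed.

Lemma CS_D a b h k : a <= b -> seg a b h -> seg a b k ->
  CS a b (fun r => h r + k r) = CS a b h + CS a b k.
Proof.
move=> ab sh sk; rewrite /CS -[RHS](BI_D (seg_Bint ab sh) (seg_Bint ab sk)).
have -> : on (oc a b) (fun r => h r + k r) = (fun r => on (oc a b) h r + on (oc a b) k r) => [|//].
by apply/funext => r; rewrite /on; case: ifP => // _; rewrite addr0.
Qed.

Lemma CS_Z a b (c : R[i]) h : a <= b -> seg a b h -> CS a b (fun r => c * (h r : R[i])) = c * CS a b h.
Proof.
move=> ab sh; have [_ e] := BintZ c (seg_Bint ab sh); rewrite /CS -[RHS]e.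
have -> : on (oc a b) (fun r => c * (h r : R[i]) : cplx R) = (fun r => c *: on (oc a b) h r) => [|//].
by apply/funext => r; rewrite /on; case: ifP => // _; rewrite scaler0.
Qed.

Lemma CS_split a m b h : a <= m -> m <= b -> seg a b h -> CS a b h = CS a m h + CS m b h.
Proof.
move=> am mb sh; have s1 := seg_sub (lexx a) mb sh; have s2 := seg_sub am (lexx b) sh.
rewrite /CS -[RHS](BI_D (seg_Bint am s1) (seg_Bint mb s2)).
have -> : on (oc a b) h = (fun r => on (oc a m) h r + on (oc m b) h r) => [|//].
apply/funext => r; rewrite /on /oc; case: (leP r m) => rm.
  by rewrite (le_trans rm mb) !andbT /= addr0.
by rewrite (le_lt_trans am rm) /= add0r.
Qed.

(** Halving the interval k times divides the bound by 2^k. *)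
Lemma additive_zero a b (J : R -> R -> R[i]) C :
  (forall x y z, a <= x -> x <= y -> y <= z -> z <= b -> J x z = J x y + J y z) ->
  (forall x y, a <= x -> x <= y -> y <= b -> nrm (J x y) <= C * (y - x) ^+ 2) -> a <= b -> J a b = 0.
Proof.
move=> hadd hC ab.
have step k x y : a <= x -> x <= y -> y <= b -> nrm (J x y) <= C * (y - x) ^+ 2 / 2 ^+ k.
  elim: k x y => [|k ih] x y ax xy yb; first by rewrite expr0 divr1 hC.
  pose m := (x + y) / 2; have xm : x <= m by rewrite /m; lra.
  have my : m <= y by rewrite /m; lra.
  rewrite (hadd x m y) //; apply: le_trans (nrmD _ _) _.
  have h1 := ih x m ax xm (le_trans my yb); have h2 := ih m y (le_trans ax xm) my yb.
  apply: le_trans (lerD h1 h2) _; rewrite [2 ^+ k.+1]exprS /m le_eqVlt; apply/orP; left; apply/eqP.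
  by field; rewrite expf_neq0.
apply: nrm_le0 => e e0; have C0 : 0 <= `|C| * (b - a) ^+ 2 / e by rewrite divr_ge0 ?(ltW e0) // mulr_ge0 ?sqr_ge0.
pose k := (Num.truncn (`|C| * (b - a) ^+ 2 / e)).+1; apply: le_trans (step k a b (lexx _) ab (lexx _)) _.
have h1 : `|C| * (b - a) ^+ 2 / e <= 2 ^+ k.
  apply: (@le_trans _ _ k%:R); first by apply: ltW; exact: truncnS_gt.
  by rewrite -natrX ler_nat ltnW // ltn_expl.
rewrite ler_pdivrMr // in h1; rewrite ler_pdivrMr ?exprn_gt0 // [e * _]mulrC; apply: le_trans h1.
by rewrite ler_wpM2r ?sqr_ge0 // ler_norm.
Qed.

(** The defect [CS x y h - (F y - F x)] is additive in the interval and quadratic in its length. *)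
Lemma CS_antideriv a b h (F : R -> R[i]) C : 0 <= C -> a <= b -> seg a b h ->
  (forall x y, a <= x -> x <= y -> y <= b -> nrm (h y - h x) <= C * (y - x)) ->
  (forall x y, a <= x -> x <= y -> y <= b -> nrm (F y - F x - (y - x)%:C * h x) <= C * (y - x) ^+ 2) ->
  CS a b h = F b - F a.
Proof.
move=> C00 ab sh hh hF.
have sub x y : a <= x -> y <= b -> seg x y h by move=> ax yb; exact: seg_sub ax yb sh.
apply/eqP; rewrite -subr_eq0; apply/eqP.
apply: (@additive_zero a b (fun x y => CS x y h - (F y - F x)) (2 * C)) => // [x y z ax xy yz zb|x y ax xy yb].
  by rewrite (CS_split xy yz (sub x z ax zb)); move: (CS x y h) (CS y z h) => p q; ring.
have e0 : CS x y h = CS x y (fun r => (h x : R[i]) * 1 + (h r - h x)).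
  have e : on (oc x y) h = on (oc x y) (fun r => (h x : R[i]) * 1 + (h r - h x) : cplx R).
    by apply: on_if => r _; rewrite mulr1 addrC subrK.
  exact: (congr1 (fun g => BI leb g) e).
have e1 : CS x y (fun=> 1) = (y - x)%:C.
  rewrite /CS; have -> : on (oc x y) (fun=> 1 : cplx R) = (fun r => (if oc x y r then 1 else 0)%:C).
    by apply/funext => r; rewrite /on; case: ifP.
  rewrite BI_real; last first.
    have -> : (fun r => (if oc x y r then 1 else 0)%:C : cplx R) = on (oc x y) (fun=> 1 : cplx R).
      by apply/funext => r; rewrite /on; case: ifP.
    exact: (seg_Bint xy (seg_cst x y 1)).
  rewrite (int_on (measurable_oc x y) ler01).
  have -> : [set r | oc x y r] = `]x, y]%classic by apply/seteqP; split=> r /=; rewrite in_itv.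
  rewrite lebesgue_measure_itv /= lte_fin mul1e; case: ifP => [_|/negbT]; first by rewrite -EFinB.
  by rewrite -leNgt => yx; have -> : x = y by [apply/eqP; rewrite eq_le xy yx]; rewrite subrr.
have s1 := seg_cst x y (1 : cplx R).
have s2 : seg x y (fun r => h r - h x) by apply: segD; [exact: sub|exact: seg_cst].
have -> : CS x y h = (h x : R[i]) * (y - x)%:C + CS x y (fun r => h r - h x).
  by rewrite e0 (CS_D xy (segZ (h x) s1) s2) (CS_Z _ xy s1) e1.
have b1 : nrm (CS x y (fun r => h r - h x)) <= C * (y - x) * (y - x).
  have C0 r : x <= r -> r <= y -> nrm (h r - h x) <= C * (y - x).
    move=> xr ry; apply: le_trans (hh x r ax xr (le_trans ry yb)) _.
    by apply: (ler_wpM2l C00); rewrite lerD2r.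
  exact: CS_le xy s2 C0.
have b2 := hF x y ax xy yb.
have -> : (h x : R[i]) * (y - x)%:C + CS x y (fun r => h r - h x) - (F y - F x) =
   CS x y (fun r => h r - h x) - (F y - F x - (y - x)%:C * h x) by ring.
apply: le_trans (nrmB _ _) _; apply: le_trans (lerD b1 b2) _.
by apply: le_of_eq; ring.
Qed.

Lemma CS_cst a b (c : R[i]) : a <= b -> CS a b (fun=> c) = (b - a)%:C * c.
Proof.
move=> ab; rewrite (@CS_antideriv a b (fun=> c) (fun x => x%:C * c) 0 (lexx 0) ab (seg_cst a b c)).
- by rewrite -mulrBl -rmorphB.
- by move=> x y _ _ _; rewrite subrr nrm0 mul0r.
- by move=> x y _ _ _; rewrite -mulrBl -rmorphB subrr nrm0 mul0r.
Qed.

Lemma CS_id a b : a <= b -> CS a b (fun r => r%:C) = ((b ^+ 2 - a ^+ 2) / 2)%:C.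
Proof.
move=> ab; rewrite (@CS_antideriv a b (fun r => r%:C) (fun x => (x ^+ 2 / 2)%:C) 1 ler01 ab (seg_id a b)).
- by rewrite -rmorphB -mulrBl.
- by move=> x y _ xy _; rewrite -rmorphB nrm_real mul1r ger0_norm ?subr_ge0.
move=> x y _ _ _; rewrite -rmorphB -rmorphM -rmorphB nrm_real mul1r.
have -> : y ^+ 2 / 2 - x ^+ 2 / 2 - (y - x) * x = (y - x) ^+ 2 / 2 by field.
by rewrite ger0_norm ?divr_ge0 ?sqr_ge0 // ler_pdivrMr // ler_peMr ?sqr_ge0 // ler1n.
Qed.

Lemma CS_expi a b (k : R) : a <= b ->
  CS a b (fun s => k%:C * (0 +i* 1) * expi (k * s)) = expi (k * b) - expi (k * a).
Proof.
move=> ab; have sE : seg a b (fun s => expi (k * s) : cplx R).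
  split; last by exists 1 => r _ _; rewrite nrm_expi.
  by move=> u x _ _ _ ux; apply: expi_cvg; apply: cvgM => //; exact: cvg_cst.
have ni : nrm (0 +i* 1 : R[i]) = 1 by rewrite nrm_def /= expr0n expr1n add0r sqrtr1.
apply: (@CS_antideriv a b _ (fun s => expi (k * s)) (2 * k ^+ 2) _ ab).
- by apply: mulr_ge0; rewrite ?sqr_ge0.
- exact: (segZ (k%:C * (0 +i* 1)) sE).
- move=> x y _ xy _; rewrite -mulrBr nrmM nrmM ni mulr1 nrm_real.
  have -> : expi (k * y) - expi (k * x) = expi (k * x) * (expi (k * (y - x)) - 1).
    by rewrite mulrBr mulr1 -expiD; congr (expi _ - _); ring.
  rewrite nrmM nrm_expi mul1r; apply: le_trans (ler_wpM2l (normr_ge0 k) (expi_le _)) _.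
  rewrite normrM mulrA -[`|k| * `|k|]expr2 real_normK ?num_real // ger0_norm ?subr_ge0 //.
  have := mulr_ge0 (sqr_ge0 k) (_ : 0 <= y - x); rewrite subr_ge0 => /(_ xy); lra.
move=> x y _ xy _.
have -> : expi (k * y) - expi (k * x) - (y - x)%:C * (k%:C * (0 +i* 1) * expi (k * x)) =
   expi (k * x) * (expi (k * (y - x)) - 1 - (0 +i* (k * (y - x)))).
  have -> : 0 +i* (k * (y - x)) = (y - x)%:C * (k%:C * (0 +i* 1)).
    by apply: complex_ext => /=; ring.
  have -> : expi (k * y) = expi (k * x) * expi (k * (y - x)) by rewrite -expiD; congr expi; ring.
  by ring.
rewrite nrmM nrm_expi mul1r; apply: le_trans (expi_le2 _) _.
by rewrite exprMn mulrA.
Qed.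

End SegmentCalculus.

(** * Bisection of boxes *)

Section Bisection.
Context (R : realType).

(* Goursat's bisection argument for an additive function of boxes. *)
Lemma bisection_zero (J : R -> R -> R -> R -> R[i]) (a0 b0 S T : R) : 0 <= S -> 0 <= T ->
  (forall x y z s t, a0 <= x -> x <= y -> y <= z -> z <= a0 + S -> b0 <= s -> s <= t -> t <= b0 + T ->
     J x z s t = J x y s t + J y z s t) ->
  (forall x y r s t, a0 <= x -> x <= y -> y <= a0 + S -> b0 <= r -> r <= s -> s <= t -> t <= b0 + T ->
     J x y r t = J x y r s + J x y s t) ->
  (forall x s, a0 <= x -> x <= a0 + S -> b0 <= s -> s <= b0 + T -> forall e, 0 < e ->
     exists k : nat, forall x' s', a0 <= x' -> x' + S / 2 ^+ k <= a0 + S -> b0 <= s' -> s' + T / 2 ^+ k <= b0 + T ->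
       x' <= x -> x <= x' + S / 2 ^+ k -> s' <= s -> s <= s' + T / 2 ^+ k ->
       nrm (J x' (x' + S / 2 ^+ k) s' (s' + T / 2 ^+ k)) <= e / 4 ^+ k) ->
  J a0 (a0 + S) b0 (b0 + T) = 0.
Proof.
move=> S0 T0 hx hs hloc; apply: nrm_le0 => e e0; rewrite leNgt; apply/negP => he.
pose sx k := S / 2 ^+ k; pose ty k := T / 2 ^+ k.
have sx0 k : 0 <= sx k by rewrite divr_ge0 ?exprn_ge0.
have ty0 k : 0 <= ty k by rewrite divr_ge0 ?exprn_ge0.
have sxS k : sx k = sx k.+1 + sx k.+1 by rewrite /sx exprS; field; rewrite expf_neq0.
have tyS k : ty k = ty k.+1 + ty k.+1 by rewrite /ty exprS; field; rewrite expf_neq0.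
(* A box of generation k that still carries more than its share e / 4^k; one of its quarters does so
   again. *)
pose ok k (p : R * R) := [/\ a0 <= p.1, p.1 + sx k <= a0 + S, b0 <= p.2, p.2 + ty k <= b0 + T &
  e / 4 ^+ k < nrm (J p.1 (p.1 + sx k) p.2 (p.2 + ty k))].
pose nx k (p q : R * R) := [/\ p.1 <= q.1, q.1 + sx k.+1 <= p.1 + sx k, p.2 <= q.2 & q.2 + ty k.+1 <= p.2 + ty k].
have step k p : ok k p -> exists q, ok k.+1 q /\ nx k p q.
  move=> [h1 h2 h3 h4 h5]; apply: contrapT => hn.
  have small q : nx k p q -> nrm (J q.1 (q.1 + sx k.+1) q.2 (q.2 + ty k.+1)) <= e / 4 ^+ k.+1.
    move=> [n1 n2 n3 n4]; rewrite leNgt; apply/negP => lt; apply: hn; exists q; split=> //; split=> //.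
    - exact: le_trans n1.
    - exact: le_trans h2.
    - exact: le_trans n3.
    - exact: le_trans h4.
  have s1 := sx0 k.+1; have t1 := ty0 k.+1; have eS := sxS k; have eT := tyS k.
  move: h5; apply/negP; rewrite -leNgt.
  rewrite (hx _ (p.1 + sx k.+1)) //; [|by lra..].
  rewrite (hs p.1 _ _ (p.2 + ty k.+1)) //; [|by lra..].
  rewrite (hs (p.1 + sx k.+1) _ _ (p.2 + ty k.+1)) //; [|by lra..].
  have e1 : p.1 + sx k = p.1 + sx k.+1 + sx k.+1 by rewrite eS addrA.
  have e2 : p.2 + ty k = p.2 + ty k.+1 + ty k.+1 by rewrite eT addrA.
  rewrite e1 e2.
  have b1 : _ := small (p.1, p.2) (_ : nx k p _); have b2 : _ := small (p.1, p.2 + ty k.+1) (_ : nx k p _).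
  have b3 : _ := small (p.1 + sx k.+1, p.2) (_ : nx k p _).
  have b4 : _ := small (p.1 + sx k.+1, p.2 + ty k.+1) (_ : nx k p _).
  rewrite /= in b1 b2 b3 b4.
  apply: le_trans (nrmD _ _) _; apply: le_trans (lerD (nrmD _ _) (nrmD _ _)) _.
  have -> : e / 4 ^+ k = (e / 4 ^+ k.+1 + e / 4 ^+ k.+1) + (e / 4 ^+ k.+1 + e / 4 ^+ k.+1).
    by rewrite exprS; field; rewrite expf_neq0.
  apply: lerD; apply: lerD; [apply: b1|apply: b2|apply: b3|apply: b4]; split=> /=;
    move: s1 t1 eS eT; clear; lra.
have step' : forall kp : nat * (R * R), exists q, ok kp.1 kp.2 -> ok kp.1.+1 q /\ nx kp.1 kp.2 q.
  move=> [k p] /=; have [/step [q hq]|h] := pselect (ok k p); first by exists q.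
  by exists p.
have [F hF] := choice step'.
pose P := fix P k := if k is m.+1 then F (m, P m) else (a0, b0).
have okP k : ok k (P k).
  elim: k => [|k ih]; last by have [] := hF (k, P k) ih.
  by split=> /=; rewrite /sx /ty ?expr0 ?divr1.
have nxP k : nx k (P k) (P k.+1) by have [] := hF (k, P k) (okP k).
have mono1 m k : (m <= k)%N -> (P m).1 <= (P k).1 /\ (P k).1 + sx k <= (P m).1 + sx m.
  move=> /subnK <-; elim: (k - m)%N => [|j [ih1 ih2]]; first by rewrite add0n.
  by have [n1 n2 _ _] := nxP (j + m)%N; rewrite addSn; split; [exact: le_trans n1|exact: le_trans n2 _].
have mono2 m k : (m <= k)%N -> (P m).2 <= (P k).2 /\ (P k).2 + ty k <= (P m).2 + ty m.
  move=> /subnK <-; elim: (k - m)%N => [|j [ih1 ih2]]; first by rewrite add0n.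
  by have [_ _ n1 n2] := nxP (j + m)%N; rewrite addSn; split; [exact: le_trans n1|exact: le_trans n2 _].
(* The nested boxes shrink to the point (x, s), where the local estimate contradicts [okP]. *)
pose x := sup (range (fun k => (P k).1)); pose s := sup (range (fun k => (P k).2)).
have bx m k : (P k).1 <= (P m).1 + sx m.
  case: (leqP m k) => mk; first by apply: le_trans (mono1 m k mk).2; rewrite lerDl.
  by apply: le_trans (mono1 k m (ltnW mk)).1 _; rewrite lerDl.
have bs m k : (P k).2 <= (P m).2 + ty m.
  case: (leqP m k) => mk; first by apply: le_trans (mono2 m k mk).2; rewrite lerDl.
  by apply: le_trans (mono2 k m (ltnW mk)).1 _; rewrite lerDl.
have xl k : (P k).1 <= x.
  by apply: ub_le_sup; [exists ((P 0%N).1 + sx 0%N) => _ [j _ <-]; exact: bx|exists k].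
have sl k : (P k).2 <= s.
  by apply: ub_le_sup; [exists ((P 0%N).2 + ty 0%N) => _ [j _ <-]; exact: bs|exists k].
have xu k : x <= (P k).1 + sx k.
  by apply: ge_sup; [exists (P 0%N).1, 0%N|move=> _ [j _ <-]; exact: bx].
have su k : s <= (P k).2 + ty k.
  by apply: ge_sup; [exists (P 0%N).2, 0%N|move=> _ [j _ <-]; exact: bs].
have [q1 q2 q3 q4 _] := okP 0%N.
have [k hk] := hloc x s (le_trans q1 (xl 0%N)) (le_trans (xu 0%N) q2) (le_trans q3 (sl 0%N)) (le_trans (su 0%N) q4) e e0.
have [p1 p2 p3 p4] := okP k; rewrite ltNge => /negP; apply.
exact: hk p1 p2 p3 p4 (xl k) (xu k) (sl k) (su k).
Qed.

End Bisection.

(** * Cauchy's theorem on polar rectangles *)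

Section PolarCauchy.
Context (R : realType).
Implicit Types (g : R[i] -> R[i]) (z w : R[i]).
Local Notation ii := (0 +i* 1 : R[i]).

(** Complex differentiability at one point, with no continuity of the derivative: just what
    bisection uses. *)
Definition hol g z := exists g' : R[i], forall e : R, 0 < e -> exists2 dl : R, 0 < dl &
  forall w, nrm (w - z) <= dl -> nrm (g w - g z - g' * (w - z)) <= e * nrm (w - z).

Lemma hol_cont g z (u : nat -> cplx R) : hol g z -> u k @[k --> \oo] --> (z : cplx R) ->
  (g (u k) : cplx R) @[k --> \oo] --> (g z : cplx R).
Proof.
move=> [g' hg] /cvg_nrmP hu; apply/cvg_nrmP => e e0; have [dl d0 hd] := hg 1 ltr01.
pose K := 1 + nrm g'; have K0 : 0 < K by rewrite ltr_wpDr ?nrm_ge0.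
have m0 : 0 < Num.min dl (e / K) by rewrite lt_min d0 divr_gt0.
have [N hN] := hu _ m0; exists N => k /hN; rewrite le_min => /andP[h1 h2].
have h3 := hd _ h1; rewrite -[nrm _]/(nrm (g (u k) - g z : R[i])).
have -> : g (u k) - g z = (g (u k) - g z - g' * ((u k : R[i]) - z)) + g' * ((u k : R[i]) - z) by ring.
apply: le_trans (nrmD _ _) _; rewrite nrmM; apply: le_trans (lerD h3 (lexx _)) _.
rewrite -mulrDl -/K; apply: le_trans (ler_wpM2l (ltW K0) h2) _.
by rewrite mulrC divfK // gt_eqF.
Qed.

Lemma expi_dist (s t : R) : nrm (expi s - expi t) <= `|s - t|.
Proof.
have -> : expi s - expi t = expi t * (expi (s - t) - 1).
  by rewrite mulrBr mulr1 -expiD; congr (expi _ - _); ring.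
by rewrite nrmM nrm_expi mul1r expi_le.
Qed.

(** [ray] and [arc] are the integrands of g dz along a ray, where dz = e^{is} dr, and along an arc,
    where dz = i r e^{is} ds. *)
Definition ray g (s : R) (r : R) : cplx R := g (r%:C * expi s) * expi s.
Definition arc g (r : R) (s : R) : cplx R := g (r%:C * expi s) * (r%:C * (ii * expi s)).
Definition box g r1 r2 s1 s2 : R[i] :=
  CS r1 r2 (ray g s1) - CS r1 r2 (ray g s2) + CS s1 s2 (arc g r2) - CS s1 s2 (arc g r1).

Definition pregion g (a a' b b' M : R) := forall r s, a <= r -> r <= a' -> b <= s -> s <= b' ->
  hol g (r%:C * expi s) /\ nrm (g (r%:C * expi s)) <= M.

Section Region.
Variables (a a' b b' : R).
Hypothesis a0 : 0 <= a.

Let polar_cvg_r (u : nat -> R) (x s : R) : u k @[k --> \oo] --> x ->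
  ((u k)%:C * expi s : cplx R) @[k --> \oo] --> (x%:C * expi s : cplx R).
Proof.
move=> ux; apply: cvg_cplxM; last exact: cvg_cst.
by apply: cvg_complex => //; exact: cvg_cst.
Qed.

Let polar_cvg_s (u : nat -> R) (x r : R) : u k @[k --> \oo] --> x ->
  (r%:C * expi (u k) : cplx R) @[k --> \oo] --> (r%:C * expi x : cplx R).
Proof. by move=> ux; apply: cvg_cplxM; [exact: cvg_cst|exact: expi_cvg]. Qed.

Lemma seg_ray g M s : pregion g a a' b b' M -> b <= s -> s <= b' -> seg a a' (ray g s).
Proof.
move=> hg bs sb; apply: segM; last exact: seg_cst.
split=> [u x hu ax xa ux|]; last by exists M => r ar ra; have [] := hg r s ar ra bs sb.
by apply: (hol_cont (hg x s ax xa bs sb).1); exact: polar_cvg_r.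
Qed.

Lemma seg_arc g M r : pregion g a a' b b' M -> a <= r -> r <= a' -> seg b b' (arc g r).
Proof.
move=> hg ar ra; apply: segM; last by apply: segZ; apply: segZ; exact: seg_expi.
split=> [u x hu bx xb ux|]; last by exists M => s bs sb; have [] := hg r s ar ra bs sb.
by apply: (hol_cont (hg r x ar ra bx xb).1); exact: polar_cvg_s.
Qed.

Lemma CS_arc_le g M r m : b <= b' -> pregion g a a' b b' M -> a <= r -> r <= a' ->
  (forall s, b <= s -> s <= b' -> nrm (g (r%:C * expi s)) <= m) -> nrm (CS b b' (arc g r)) <= m * r * (b' - b).
Proof.
move=> bb hg ar ra hm; apply: CS_le bb (seg_arc hg ar ra) _ => s bs sb.
have r0 : 0 <= r by exact: le_trans ar.
rewrite /arc -[nrm _]/(nrm (g (r%:C * expi s) * (r%:C * (ii * expi s)))) nrmM nrmM nrmM nrm_i nrm_expi.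
by rewrite !mulr1 nrm_real ger0_norm // ler_wpM2r // hm.
Qed.

Lemma CS_ray_le g M s m : a <= a' -> pregion g a a' b b' M -> b <= s -> s <= b' ->
  (forall r, a <= r -> r <= a' -> nrm (g (r%:C * expi s)) <= m) -> nrm (CS a a' (ray g s)) <= m * (a' - a).
Proof.
move=> aa hg bs sb hm; apply: CS_le aa (seg_ray hg bs sb) _ => r ar ra.
by rewrite /ray -[nrm _]/(nrm (g (r%:C * expi s) * expi s)) nrmM nrm_expi mulr1 hm.
Qed.

Lemma box_D g h M M' : a <= a' -> b <= b' -> pregion g a a' b b' M -> pregion h a a' b b' M' ->
  box (fun z => g z + h z) a a' b b' = box g a a' b b' + box h a a' b b'.
Proof.
move=> aa bb hg hh.
have er s : ray (fun z => g z + h z) s = (fun r => ray g s r + ray h s r).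
  by apply/funext => r; rewrite /ray mulrDl.
have ea r : arc (fun z => g z + h z) r = (fun s => arc g r s + arc h r s).
  by apply/funext => s; rewrite /arc mulrDl.
rewrite /box !er !ea.
rewrite (CS_D aa (seg_ray hg (lexx b) bb) (seg_ray hh (lexx b) bb)).
rewrite (CS_D aa (seg_ray hg bb (lexx _)) (seg_ray hh bb (lexx _))).
rewrite (CS_D bb (seg_arc hg (lexx a) aa) (seg_arc hh (lexx a) aa)).
rewrite (CS_D bb (seg_arc hg aa (lexx _)) (seg_arc hh aa (lexx _))).
move: (CS a a' (ray g b)) (CS a a' (ray h b)) (CS a a' (ray g b')) (CS a a' (ray h b')).
move: (CS b b' (arc g a)) (CS b b' (arc h a)) (CS b b' (arc g a')) (CS b b' (arc h a')).
by move=> *; ring.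
Qed.

Lemma box_affine (c k : R[i]) : a <= a' -> b <= b' -> box (fun z => c + k * z) a a' b b' = 0.
Proof.
move=> aa bb; have ray_e s : CS a a' (ray (fun z => c + k * z) s) =
    c * expi s * (a' - a)%:C + k * (expi s * expi s) * ((a' ^+ 2 - a ^+ 2) / 2)%:C.
  have -> : ray (fun z => c + k * z) s = (fun r => (c * expi s) * 1 + (k * (expi s * expi s)) * r%:C).
    by apply/funext => r; rewrite /ray; ring.
  have s1 := seg_cst a a' (1 : cplx R); have s2 := seg_id a a'.
  rewrite (CS_D aa (segZ _ s1) (segZ _ s2)) (CS_Z _ aa s1) (CS_Z _ aa s2) CS_cst // CS_id //.
  by rewrite mulr1.
have arc_e r : CS b b' (arc (fun z => c + k * z) r) =
    c * r%:C * (expi b' - expi b) + k * (r%:C * r%:C) / 2 * (expi b' * expi b' - expi b * expi b).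
  have -> : arc (fun z => c + k * z) r = (fun s => (c * r%:C) * (1%:C * ii * expi (1 * s)) +
      (k * (r%:C * r%:C) / 2) * (2%:C * ii * expi (2 * s))).
    apply/funext => s; rewrite /arc mul1r.
    have -> : expi (2 * s) = expi s * expi s by rewrite -expiD; congr expi; ring.
    by rewrite rmorph1 rmorph_nat; field.
  have s1 (q : R) : seg b b' (fun s => q%:C * ii * expi (q * s)).
    apply: segZ; split; last by exists 1 => s _ _; rewrite nrm_expi.
    by move=> u x _ _ _ ux; apply: expi_cvg; apply: cvgM => //; exact: cvg_cst.
  rewrite (CS_D bb (segZ _ (s1 1)) (segZ _ (s1 2))) (CS_Z _ bb (s1 1)) (CS_Z _ bb (s1 2)) !CS_expi // !mul1r.
  have e2 (s : R) : expi (2 * s) = expi s * expi s by rewrite -expiD; congr expi; ring.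
  by rewrite !e2.
rewrite /box !ray_e !arc_e.
have -> : ((a' ^+ 2 - a ^+ 2) / 2)%:C = (a'%:C * a'%:C - a%:C * a%:C) / 2 :> R[i].
  by rewrite rmorphM rmorphB !rmorphXn fmorphV /= rmorph_nat !expr2.
by rewrite rmorphB /=; field.
Qed.

End Region.

Lemma pregion_sub g a a' b b' c c' s s' M : a <= c -> c' <= a' -> b <= s -> s' <= b' ->
  pregion g a a' b b' M -> pregion g c c' s s' M.
Proof.
move=> h1 h2 h3 h4 hg r t cr rc st ts; apply: hg.
- exact: le_trans cr.
- exact: le_trans h2.
- exact: le_trans st.
- exact: le_trans h4.
Qed.

Lemma hol_affine (c k z : R[i]) : hol (fun z => c + k * z) z.
Proof.
exists k => e e0; exists 1 => // w _.
have -> : c + k * w - (c + k * z) - k * (w - z) = 0 by ring.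
by rewrite nrm0 mulr_ge0 ?nrm_ge0 // ltW.
Qed.

Lemma holD g h z : hol g z -> hol h z -> hol (fun z => g z + h z) z.
Proof.
move=> [g' hg] [h' hh]; exists (g' + h') => e e0; have e2 : 0 < e / 2 by rewrite divr_gt0.
have [d1 d10 h1] := hg _ e2; have [d2 d20 h2] := hh _ e2.
exists (Num.min d1 d2); first by rewrite lt_min d10.
move=> w; rewrite le_min => /andP[w1 w2].
have -> : g w + h w - (g z + h z) - (g' + h') * (w - z) =
  (g w - g z - g' * (w - z)) + (h w - h z - h' * (w - z)) by ring.
by apply: le_trans (nrmD _ _) _; rewrite [e]splitr mulrDl lerD // ?h1 ?h2.
Qed.

(** Near a point g is affine up to e' |z - z0|, and affine functions integrate to 0 around a polar
    rectangle. A box of generation k has perimeter and diameter of order 2^{-k}, so its integral is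
    of order e' / 4^k. *)
Lemma polar_cauchy g a a' b b' M : 0 <= a -> a <= a' -> b <= b' -> pregion g a a' b b' M ->
  CS a a' (ray g b) - CS a a' (ray g b') = CS b b' (arc g a) - CS b b' (arc g a').
Proof.
move=> a0 aa bb hg; pose S := a' - a; pose T := b' - b.
have S0 : 0 <= S by rewrite subr_ge0.
have T0 : 0 <= T by rewrite subr_ge0.
have a'0 := le_trans a0 aa.
have eS : a + S = a' by rewrite addrC subrK.
have eT : b + T = b' by rewrite addrC subrK.
suff : box g a (a + S) b (b + T) = 0.
  rewrite /box eS eT => h; apply/eqP; rewrite -subr_eq0; apply/eqP; rewrite -[RHS]h.
  by move: (CS a a' (ray g b)) (CS a a' (ray g b')) (CS b b' (arc g a)) (CS b b' (arc g a')) => *; ring.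
apply: (@bisection_zero R (box g) a b S T S0 T0).
- move=> x y z s t ax xy yz za bs st tb; rewrite eS in za; rewrite eT in tb.
  have xz := le_trans xy yz.
  have hs := pregion_sub ax za bs tb hg.
  rewrite /box (CS_split xy yz (seg_ray hs (lexx s) st)) (CS_split xy yz (seg_ray hs st (lexx t))).
  move: (CS x y _) (CS y z _) (CS x y _) (CS y z _) (CS s t _) (CS s t _) (CS s t _) => *; ring.
- move=> x y r s t ax xy ya br rs st tb; rewrite eS in ya; rewrite eT in tb.
  have hs := pregion_sub ax ya br tb hg.
  rewrite /box (CS_split rs st (seg_arc hs (lexx x) xy)) (CS_split rs st (seg_arc hs xy (lexx y))).
  move: (CS x y _) (CS x y _) (CS x y _) (CS r s _) (CS s t _) (CS r s _) (CS s t _) => *; ring.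
move=> x s ax xa bs sb e e0; rewrite eS in xa; rewrite eT in sb.
have [[g' hg'] _] := hg x s ax xa bs sb; set z0 := x%:C * expi s in hg'.
(* L / 2^k bounds the diameter, and twice this the perimeter, of the polar boxes of generation k. *)
pose L := S + a' * T; have L0 : 0 <= L by rewrite addr_ge0 // mulr_ge0.
(* Diameter times perimeter is at most 2 L^2 / 4^k; the added 1 covers L = 0. *)
pose e' := e / (2 * L ^+ 2 + 1).
have q0 : 0 < 2 * L ^+ 2 + 1 by rewrite ltr_wpDl // mulr_ge0 ?sqr_ge0.
have e'0 : 0 < e' by rewrite divr_gt0.
have [dl d0 hd] := hg' _ e'0.
pose k := (Num.truncn (L / dl)).+1; exists k => x' s' ax' xa' bs' sb' x'x xx' s's ss'.
rewrite eS in xa'; rewrite eT in sb'.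
have p2 : 0 < (2 : R) ^+ k by rewrite exprn_gt0.
set Sk := S / 2 ^+ k in xa' xx' *; set Tk := T / 2 ^+ k in sb' ss' *.
have Sk0 : 0 <= Sk by rewrite divr_ge0 // ltW.
have Tk0 : 0 <= Tk by rewrite divr_ge0 // ltW.
have Lk : L / 2 ^+ k <= dl.
  rewrite ler_pdivrMr // mulrC -ler_pdivrMr //; apply: (@le_trans _ _ k%:R).
    by apply: ltW; exact: truncnS_gt.
  by rewrite -natrX ler_nat ltnW // ltn_expl.
have xxk : x' <= x' + Sk by rewrite lerDl.
have ssk : s' <= s' + Tk by rewrite lerDl.
have hs := pregion_sub ax' xa' bs' sb' hg.
pose h w := g w + ((- g z0 + g' * z0) + (- g') * w).
have zdist r t : x' <= r -> r <= x' + Sk -> s' <= t -> t <= s' + Tk -> nrm (r%:C * expi t - z0) <= L / 2 ^+ k.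
  move=> r1 r2 t1 t2; have -> : r%:C * expi t - z0 = (r - x)%:C * expi t + x%:C * (expi t - expi s).
    by rewrite /z0 rmorphB; ring.
  apply: le_trans (nrmD _ _) _; rewrite nrmM nrm_expi mulr1 nrmM !nrm_real.
  have -> : L / 2 ^+ k = Sk + a' * Tk by rewrite /L /Sk /Tk mulrDl mulrA.
  apply: lerD; first by rewrite ler_norml; apply/andP; split; lra.
  rewrite (ger0_norm (le_trans a0 ax)); apply: ler_pM; rewrite ?nrm_ge0 //; first exact: le_trans ax.
  by apply: le_trans (expi_dist _ _) _; rewrite ler_norml; apply/andP; split; lra.
have hb r t : x' <= r -> r <= x' + Sk -> s' <= t -> t <= s' + Tk ->
    nrm (h (r%:C * expi t)) <= e' * (L / 2 ^+ k).
  move=> r1 r2 t1 t2; have zd := zdist r t r1 r2 t1 t2.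
  have := hd _ (le_trans zd Lk); set w := r%:C * _.
  have -> : g w - g z0 - g' * (w - z0) = h w by rewrite /h; ring.
  by move=> hw; apply: le_trans hw _; rewrite ler_wpM2l // ltW.
have hh : pregion h x' (x' + Sk) s' (s' + Tk) (e' * (L / 2 ^+ k)).
  move=> r t r1 r2 t1 t2; split; last exact: hb.
  by apply: holD; [exact: (hs r t r1 r2 t1 t2).1|exact: hol_affine].
have lb : pregion (fun w => (g z0 - g' * z0) + g' * w) x' (x' + Sk) s' (s' + Tk) (M + e' * (L / 2 ^+ k)).
  move=> r t r1 r2 t1 t2; split; first exact: hol_affine.
  set w := r%:C * _; have -> : g z0 - g' * z0 + g' * w = g w - h w by rewrite /h; ring.
  apply: le_trans (nrmB _ _) _; apply: lerD; first exact: (hs r t r1 r2 t1 t2).2.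
  exact: hb.
have -> : box g x' (x' + Sk) s' (s' + Tk) = box h x' (x' + Sk) s' (s' + Tk).
  have e1 := box_D xxk ssk hh lb; have e2 := box_affine (g z0 - g' * z0) g' xxk ssk.
  have e3 : g = (fun w => h w + ((g z0 - g' * z0) + g' * w)) by apply/funext => w; rewrite /h; ring.
  rewrite [in LHS]e3; apply: (etrans e1); rewrite e2; exact: addr0.
have x'0 := le_trans a0 ax'.
have r1 t : s' <= t -> t <= s' + Tk -> nrm (CS x' (x' + Sk) (ray h t)) <= e' * (L / 2 ^+ k) * Sk.
  move=> t1 t2; have := CS_ray_le xxk hh t1 t2 (fun r r1 r2 => hb r t r1 r2 t1 t2).
  by rewrite addrAC subrr add0r.
have eL0 : 0 <= e' * (L / 2 ^+ k) by rewrite mulr_ge0 ?(ltW e'0) // divr_ge0 // ltW.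
have r2 r : x' <= r -> r <= x' + Sk -> nrm (CS s' (s' + Tk) (arc h r)) <= e' * (L / 2 ^+ k) * (a' * Tk).
  move=> ra rb; have := CS_arc_le x'0 ssk hh ra rb (fun t t1 t2 => hb r t ra rb t1 t2).
  rewrite [s' + Tk - s']addrAC subrr add0r => h1; apply: le_trans h1 _.
  by rewrite -mulrA ler_wpM2l // ler_wpM2r // (le_trans rb).
rewrite /box.
apply: le_trans (nrmB _ _) _; apply: le_trans (lerD (nrmD _ _) (lexx _)) _.
apply: le_trans (lerD (lerD (nrmB _ _) (lexx _)) (lexx _)) _.
have b1 := r1 s' (lexx _) ssk; have b2 := r1 (s' + Tk) ssk (lexx _).
have b3 := r2 (x' + Sk) xxk (lexx _); have b4 := r2 x' (lexx _) xxk.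
apply: le_trans (lerD (lerD (lerD b1 b2) b3) b4) _.
have -> : e' * (L / 2 ^+ k) * Sk + e' * (L / 2 ^+ k) * Sk + e' * (L / 2 ^+ k) * (a' * Tk) + e' * (L / 2 ^+ k) * (a' * Tk) =
   e' * (2 * L ^+ 2) / 4 ^+ k.
  have -> : (4 : R) ^+ k = 2 ^+ k * 2 ^+ k by rewrite -exprMn -natrM.
  by rewrite /Sk /Tk /L; field; rewrite gt_eqF.
rewrite ler_wpM2r ?invr_ge0 ?exprn_ge0 // /e' mulrAC ler_pdivrMr // ler_wpM2l ?(ltW e0) // lerDl //.
Qed.

End PolarCauchy.

Lemma two_div_le (R : realType) (D T e K : R) : 0 < K -> 0 < e -> 2 * D * T / e <= K -> D * T / K + D * T / K <= e.
Proof. by move=> K0 e0; rewrite ler_pdivrMr // => h; rewrite -mulrDl ler_pdivrMr //; lra. Qed.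

Lemma nrm_lim_ev (R : realType) (V : normedModType R[i]) (u : nat -> V) (l : V) (c : R) :
  u n @[n --> \oo] --> l -> (exists N, forall n, (N <= n)%N -> nrm (u n) <= c) -> nrm l <= c.
Proof.
move=> ul [N hN]; apply/ler_addgt0Pr => e e0; have [M hM] := (cvg_nrmP _ _).1 ul e e0.
have h1 := hN _ (leq_maxl N M); have h2 := hM _ (leq_maxr N M).
have := nrm_tri l 0 (u (maxn N M)); rewrite !subr0 nrmC => h; apply: le_trans h _.
by rewrite addrC lerD.
Qed.

Lemma cvg_cplxB (R : realType) (u v : nat -> cplx R) (l m : cplx R) :
  u k @[k --> \oo] --> l -> v k @[k --> \oo] --> m ->
  ((u k : R[i]) - (v k : R[i]) : cplx R) @[k --> \oo] --> ((l : R[i]) - (m : R[i]) : cplx R).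
Proof. by move=> hu hv; exact: (cvgB hu hv). Qed.

Lemma measurable_onR (R : realType) (P : pred R) (f : R -> R) : measurable [set r | P r] ->
  measurable_fun setT f -> measurable_fun setT (fun r => if P r then f r else 0).
Proof.
move=> mP mf; have -> : (fun r => if P r then f r else 0) = f \_ [set r | P r].
  by apply/funext => r; rewrite patchE; case: ifP => h; [rewrite mem_set|rewrite memNset //= h].
by apply/(measurable_restrictT _ _).1 => //; exact: measurable_funTS.
Qed.

(** * Absolutely convergent integrals over the half-line *)

Section HalfLine.
Context (R : realType).
Local Notation leb := (@lebesgue_measure R).
Implicit Types (V : completeNormedModType R[i]).

Definition pos : pred R := fun r => 0 < r.
Definition PI V (h : R -> V) : V := BI leb (on pos h).

Definition pcont (V : normedModType R[i]) (h : R -> V) := forall (u : nat -> R) (x : R),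
  0 < x -> u k @[k --> \oo] --> x -> h (u k) @[k --> \oo] --> h x.

Lemma measurable_pos : measurable [set r | pos r].
Proof.
by rewrite (_ : [set _ | _] = `]0, +oo[%classic) //; apply/seteqP; split=> r /=; rewrite in_itv /= andbT.
Qed.

(** The primitive is an arctangent, and an arc of radius r costs r / (1 + r^2) times its angle,
    which tends to 0 both at 0 and at infinity. *)
Definition maj (C : R) (r : R) : R := if 0 < r then C * (1 + r ^+ 2)^-1 else 0.

Lemma maj_ge0 C r : 0 <= C -> 0 <= maj C r.
Proof. by move=> C0; rewrite /maj; case: ifP => // _; rewrite mulr_ge0 ?invr_ge0 ?addr_ge0 ?sqr_ge0. Qed.

Lemma measurable_maj C : measurable_fun setT (maj C).
Proof.
apply: (measurable_onR measurable_pos); apply: measurable_funM => //.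
by apply: continuous_measurable_fun; exact: continuous_oneDsqrV.
Qed.

Lemma int_maj C : 0 <= C -> (\int[leb]_r (maj C r)%:E <= (C * (pi / 2))%:E)%E.
Proof.
move=> C0; have -> : (fun r => (maj C r)%:E) = (fun r => (C%:E * (if 0 < r then (oneDsqr r)^-1 else 0)%:E))%E.
  by apply/funext => r; rewrite /maj -EFinM; case: ifP => _; rewrite ?mulr0.
have mo : measurable_fun setT (fun r : R => (oneDsqr r)^-1).
  by apply: continuous_measurable_fun; exact: continuous_oneDsqrV.
have o0 (r : R) : 0 <= (oneDsqr r)^-1 by rewrite invr_ge0 /oneDsqr addr_ge0 ?sqr_ge0.
rewrite ge0_integralZl //; last first.
- by move=> r _; rewrite lee_fin; case: ifP.
- apply: measurableT_comp; first exact: EFin_measurable.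
  exact: (measurable_onR measurable_pos mo).
rewrite EFinM lee_wpmul2l ?lee_fin // -integral0y_oneDsqr.
rewrite [leRHS]integral_mkcond; apply: ge0_le_integral => //.
- by move=> r _; rewrite lee_fin; case: ifP.
- apply: measurableT_comp; first exact: EFin_measurable.
  exact: (measurable_onR measurable_pos mo).
- apply/(measurable_restrictT _ _).1 => //; apply: measurable_funTS.
  by apply: measurableT_comp; [exact: EFin_measurable|exact: mo].
move=> r _; rewrite patchE; case: ifP => [r0|_]; last by case: ifP; rewrite // lee_fin.
by rewrite mem_set //= in_itv /= andbT ltW.
Qed.

Section Majorised.
Variables (V : completeNormedModType R[i]) (h : R -> V).
Hypothesis hc : pcont h.

Lemma bmeas_P (P : pred R) : measurable [set r | P r] -> (forall r, P r -> 0 < r) -> bmeas (on P h).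
Proof.
move=> mP hP; have -> : on P h = on P (on pos h).
  by apply: on_if => r /hP r0; rewrite /on /pos r0.
exact: bmeas_on mP (bmeas_pos hc).
Qed.

Lemma PI_le C : 0 <= C -> (forall r, 0 < r -> nrm (h r) <= C * (1 + r ^+ 2)^-1) ->
  Bint leb (on pos h) /\ nrm (PI h) <= C * (pi / 2).
Proof.
move=> C0 hC; have hG r : nrm (on pos h r) <= maj C r.
  by rewrite /on /pos /maj; case: ifP => [/hC//|_]; rewrite nrm0.
have mh := bmeas_P measurable_pos (fun r => id).
have i1 := int_maj C0; have mG := measurable_maj C.
have h1 := @le_Bint R _ _ leb V _ (maj C) mh mG hG; have h2 := @BI_leG R _ _ leb V _ (maj C) _ mh mG hG i1.
by split; [apply: h1; apply: le_lt_trans i1 _; rewrite ltry|exact: h2].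
Qed.

End Majorised.

Lemma PI_cvg V (h_ : nat -> R -> V) (h : R -> V) C : 0 <= C -> (forall k, pcont (h_ k)) -> pcont h ->
  (forall r, 0 < r -> h_ k r @[k --> \oo] --> h r) ->
  (forall k r, 0 < r -> nrm (h_ k r) <= C * (1 + r ^+ 2)^-1) ->
  PI (h_ k) @[k --> \oo] --> PI h.
Proof.
move=> C0 ck ch hk hC.
apply: (@BI_cvg R _ _ leb V (fun k => on pos (h_ k)) (on pos h) (maj C)).
- by move=> k; apply: bmeas_P => //; exact: measurable_pos.
- by apply: bmeas_P => //; exact: measurable_pos.
- by move=> r; rewrite /on /pos; case: ifP => [/hk//|_]; exact: cvg_cst.
- exact: measurable_maj.
- by move=> k r; rewrite /on /pos /maj; case: ifP => [/hC//|_]; rewrite nrm0.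
- by apply: le_lt_trans (int_maj C0) _; rewrite ltry.
Qed.

Lemma PI_CS (h : R -> cplx R) C : 0 <= C -> pcont h -> (forall r, 0 < r -> nrm (h r) <= C * (1 + r ^+ 2)^-1) ->
  (CS k.+1%:R^-1 k.+1%:R h : cplx R) @[k --> \oo] --> PI h.
Proof.
move=> C0 ch hC; have p k (r : R) : oc k.+1%:R^-1 k.+1%:R r -> 0 < r.
  by move=> /andP[h1 _]; apply: le_lt_trans h1; rewrite invr_ge0.
apply: (@BI_cvg R _ _ leb (cplx R) (fun k => on (oc k.+1%:R^-1 k.+1%:R) h) (on pos h) (maj C)).
- by move=> k; apply: bmeas_P => //; [exact: measurable_oc|exact: p].
- by apply: bmeas_P => //; exact: measurable_pos.
- move=> r; rewrite /on /pos; case: ifP => r0; last first.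
    have -> : (fun k => if oc k.+1%:R^-1 k.+1%:R r then h r else 0) = fun=> 0.
      by apply/funext => k; case: ifP => // /p; rewrite r0.
    exact: cvg_cst.
  apply: cvg_near_cst; near=> k; rewrite /oc.
  have k0 : 0 < k.+1%:R :> R by rewrite ltr0n.
  have -> : k.+1%:R^-1 < r.
    rewrite invf_plt ?posrE //; near: k; exists (Num.truncn r^-1) => // k /= hk.
    by apply: lt_le_trans (truncnS_gt _) _; rewrite ler_nat ltnS.
  suff -> : r <= k.+1%:R by [].
  near: k; exists (Num.truncn r) => // k /= hk.
  by apply: le_trans (ltW (truncnS_gt _)) _; rewrite ler_nat ltnS.
- exact: measurable_maj.
- move=> k r; rewrite /on; case: ifP => [/p r0|_]; last by rewrite nrm0 maj_ge0.
  by rewrite /maj r0 hC.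
- by apply: le_lt_trans (int_maj C0) _; rewrite ltry.
Unshelve. all: by end_near.
Qed.

Lemma CS0_cvg (h : R -> cplx R) C a : 0 < a -> 0 <= C -> pcont h -> (forall r, 0 < r -> nrm (h r) <= C * (1 + r ^+ 2)^-1) ->
  (CS k.+1%:R^-1 a h : cplx R) @[k --> \oo] --> (CS 0 a h : cplx R).
Proof.
move=> a0 C0 ch hC; have p k (r : R) : oc k.+1%:R^-1 a r -> 0 < r.
  by move=> /andP[h1 _]; apply: le_lt_trans h1; rewrite invr_ge0.
have p0 (r : R) : oc 0 a r -> 0 < r by case/andP.
apply: (@BI_cvg R _ _ leb (cplx R) (fun k => on (oc k.+1%:R^-1 a) h) (on (oc 0 a) h) (maj C)).
- by move=> k; apply: bmeas_P => //; [exact: measurable_oc|exact: p].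
- by apply: bmeas_P => //; exact: measurable_oc.
- move=> r; rewrite /on; case: (ltP 0 r) => r0; last first.
    have -> : (fun k => if oc k.+1%:R^-1 a r then h r else 0) = fun=> 0.
      by apply/funext => k; case: ifP => // /p; rewrite ltNge r0.
    have -> : oc 0 a r = false by apply/negP => /p0; rewrite ltNge r0.
    exact: cvg_cst.
  apply: cvg_near_cst; near=> k; rewrite /oc r0.
  have -> //: k.+1%:R^-1 < r.
  rewrite invf_plt ?posrE ?ltr0n //; near: k; exists (Num.truncn r^-1) => // k /= hk.
  by apply: lt_le_trans (truncnS_gt _) _; rewrite ler_nat ltnS.
- exact: measurable_maj.
- move=> k r; rewrite /on; case: ifP => [/p r0|_]; last by rewrite nrm0 maj_ge0.
  by rewrite /maj r0 hC.
- by apply: le_lt_trans (int_maj C0) _; rewrite ltry.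
Unshelve. all: by end_near.
Qed.

End HalfLine.

Lemma arc_small (R : realType) (K r D T : R) : 0 < K -> 0 < r -> r = K \/ r = K^-1 -> 0 <= D -> 0 <= T ->
  D * (1 + r ^+ 2)^-1 * r * T <= D * T / K.
Proof.
move=> K0 r0 hr D0 T0; have q0 : 0 < 1 + r ^+ 2 by rewrite ltr_wpDr ?sqr_ge0.
have h : (1 + r ^+ 2)^-1 * r <= K^-1.
  rewrite mulrC ler_pdivrMr // mulrC -ler_pdivrMr ?invr_gt0 // invrK.
  case: hr => ->; first by rewrite -expr2 lerDr.
  by rewrite mulVf ?gt_eqF // lerDl sqr_ge0.
have := ler_wpM2l (mulr_ge0 D0 T0) h; lra.
Qed.

Lemma mulr_div_cancel (R : realType) (A T r : R) : 0 < r -> A / r * r * T = A * T.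
Proof. by move=> r0; rewrite divfK // gt_eqF. Qed.

(** * Rotating the ray of integration *)

Section RayShift.
Context (R : realType).
Variables (g : R[i] -> R[i]) (b b' D : R).
Hypothesis bb : b <= b'.
Hypothesis D0 : 0 <= D.
Hypothesis hg : forall r s, 0 < r -> b <= s -> s <= b' -> hol g (r%:C * expi s).
Hypothesis hD : forall r s, 0 < r -> b <= s -> s <= b' -> nrm (g (r%:C * expi s)) <= D * (1 + r ^+ 2)^-1.

Lemma pregion_pos a a' : 0 < a -> pregion g a a' b b' D.
Proof.
move=> a0 r s ar _ bs sb; have r0 := lt_le_trans a0 ar; split; first exact: hg.
apply: le_trans (hD r0 bs sb) _; rewrite ler_piMr // invf_le1 ?lerDl ?sqr_ge0 //.
by rewrite ltr_wpDr ?sqr_ge0.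
Qed.

Lemma pcont_ray s : b <= s -> s <= b' -> pcont (ray g s).
Proof.
move=> bs sb u x x0 ux; apply: cvg_cplxM; last exact: cvg_cst.
apply: (hol_cont (hg x0 bs sb)); apply: cvg_cplxM; last exact: cvg_cst.
by apply: cvg_complex => //; exact: cvg_cst.
Qed.

Lemma ray_maj s r : b <= s -> s <= b' -> 0 < r -> nrm (ray g s r) <= D * (1 + r ^+ 2)^-1.
Proof.
move=> bs sb r0; rewrite /ray -[nrm _]/(nrm (g (r%:C * expi s) * expi s)) nrmM nrm_expi mulr1.
exact: hD.
Qed.

(** Cauchy's theorem between the radii 1/(k+1) and k+1; by [arc_small] both arcs contribute
    O(1/k). *)
Lemma ray_shift : PI (ray g b) = PI (ray g b').
Proof.
have c1 := PI_CS D0 (pcont_ray (lexx b) bb) (fun r => ray_maj (lexx b) bb).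
have c2 := PI_CS D0 (pcont_ray bb (lexx b')) (fun r => ray_maj bb (lexx b')).
have c3 := @cvg_cplxB R (fun k => CS k.+1%:R^-1 k.+1%:R (ray g b)) (fun k => CS k.+1%:R^-1 k.+1%:R (ray g b'))
  (PI (ray g b)) (PI (ray g b')) c1 c2.
suff c4 : ((CS k.+1%:R^-1 k.+1%:R (ray g b) : R[i]) - (CS k.+1%:R^-1 k.+1%:R (ray g b') : R[i]) : cplx R) @[k --> \oo] --> (0 : cplx R).
  by apply: subr0_eq; exact: (cvg_uniq c3 c4).
apply/cvg_nrmP => e e0; exists (Num.truncn (2 * D * (b' - b) / e)).+1 => k hk; rewrite subr0.
have k0 : 0 < k.+1%:R :> R by rewrite ltr0n.
have ki0 : 0 < k.+1%:R^-1 :> R by rewrite invr_gt0.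
have kk : k.+1%:R^-1 <= k.+1%:R :> R by apply: (@le_trans _ _ 1); [rewrite invf_le1 // ler1n|rewrite ler1n].
have hr := @pregion_pos _ k.+1%:R ki0; have := polar_cauchy (ltW ki0) kk bb hr.
set x := CS _ _ (ray g b); set y := CS _ _ (ray g b') => exy.
rewrite -[nrm _]/(nrm (x - y)) exy.
have bnd r : 0 < r -> k.+1%:R^-1 <= r -> r <= k.+1%:R -> nrm (CS b b' (arc g r)) <= D * (1 + r ^+ 2)^-1 * r * (b' - b).
  move=> r0 r1 r2; apply: (CS_arc_le (ltW ki0) bb hr r1 r2) => s bs sb; exact: hD.
have T0 : 0 <= b' - b by rewrite subr_ge0.
have small r : 0 < r -> r = k.+1%:R \/ r = k.+1%:R^-1 -> _ := fun r0 h => @arc_small R k.+1%:R r D (b' - b) k0 r0 h D0 T0.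
apply: le_trans (nrmB _ _) _.
have b1 := le_trans (bnd _ ki0 (lexx _) kk) (small _ ki0 (or_intror erefl)).
have b2 := le_trans (bnd _ k0 kk (lexx _)) (small _ k0 (or_introl erefl)).
apply: le_trans (lerD b1 b2) _.
have : 2 * D * (b' - b) / e <= k.+1%:R.
  apply: le_trans (ltW (truncnS_gt _)) _; rewrite ler_nat; exact: leqW.
by move=> h; exact: (two_div_le k0 e0 h).
Qed.

(** Cut at the radius a, the two rays differ by arcs, and an arc of any radius costs at most A (b' -
    b) if |g| <= A / r. The bound is independent of a and of D. *)
Lemma ray_shift_trunc A a : 0 < a -> (forall r s, 0 < r -> b <= s -> s <= b' -> nrm (g (r%:C * expi s)) <= A / r) ->
  nrm (CS 0 a (ray g b) - CS 0 a (ray g b')) <= 2 * A * (b' - b).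
Proof.
move=> a0 hA.
have c1 := CS0_cvg a0 D0 (pcont_ray (lexx b) bb) (fun r => ray_maj (lexx b) bb).
have c2 := CS0_cvg a0 D0 (pcont_ray bb (lexx b')) (fun r => ray_maj bb (lexx b')).
have c3 := @cvg_cplxB R (fun k => CS k.+1%:R^-1 a (ray g b)) (fun k => CS k.+1%:R^-1 a (ray g b'))
  (CS 0 a (ray g b)) (CS 0 a (ray g b')) c1 c2.
apply: (nrm_lim_ev c3).
exists (Num.truncn a^-1) => k hk.
have k0 : 0 < k.+1%:R :> R by rewrite ltr0n.
have ki0 : 0 < k.+1%:R^-1 :> R by rewrite invr_gt0.
have ka : k.+1%:R^-1 <= a.
  rewrite invf_ple ?posrE //; apply: le_trans (ltW (truncnS_gt _)) _; by rewrite ler_nat ltnS.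
have hr := @pregion_pos _ a ki0; have := polar_cauchy (ltW ki0) ka bb hr.
set x := CS _ _ (ray g b); set y := CS _ _ (ray g b') => exy.
rewrite -[nrm _]/(nrm (x - y)) exy.
have bnd r : 0 < r -> k.+1%:R^-1 <= r -> r <= a -> nrm (CS b b' (arc g r)) <= A * (b' - b).
  move=> r0 r1 r2; have := CS_arc_le (ltW ki0) bb hr r1 r2 (fun s bs sb => hA r s r0 bs sb).
  by rewrite (mulr_div_cancel _ _ r0).
apply: le_trans (nrmB _ _) _.
have b1 := bnd _ ki0 (lexx _) ka; have b2 := bnd _ a0 ka (lexx _).
by apply: le_trans (lerD b1 b2) _; apply: le_of_eq; ring.
Qed.

End RayShift.

(** * The symbol of e^{-tL} compared with a step function of t *)

Section SymbolEstimates.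
Context (R : realType).
Implicit Types (w la : R[i]) (ta r a c : R) (k d : nat).

Lemma exp_poly c k : 0 < c -> exists2 C : R, 0 <= C & forall a, 0 <= a -> (1 + a) ^+ k * expR (- (c * a)) <= C.
Proof.
move=> c0; have k0 : 0 < k.+1%:R :> R by rewrite ltr0n.
have q0 : 0 <= 1 + k.+1%:R / c by rewrite addr_ge0 // divr_ge0 // ltW.
exists ((1 + k.+1%:R / c) ^+ k.+1); first by rewrite exprn_ge0.
move=> a a0; pose w := c * a / k.+1%:R.
have w0 : 0 <= w by rewrite /w divr_ge0 ?mulr_ge0 // ltW.
have h1 : 1 + a <= (1 + k.+1%:R / c) * expR w.
  apply: le_trans (ler_wpM2l q0 (expR_ge1Dx w)).
  have -> : (1 + k.+1%:R / c) * (1 + w) = 1 + a + (k.+1%:R / c + w).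
    by rewrite /w; field; rewrite !gt_eqF.
  by rewrite lerDl addr_ge0 // divr_ge0 // ltW.
apply: (@le_trans _ _ ((1 + a) ^+ k.+1 * expR (- (c * a)))).
  rewrite ler_wpM2r ?expR_ge0 // exprS ler_peMl ?exprn_ge0 ?addr_ge0 // lerDl //.
have h3 : (1 + a) ^+ k.+1 <= (1 + k.+1%:R / c) ^+ k.+1 * expR (c * a).
  have -> : expR (c * a) = expR w ^+ k.+1.
    by rewrite -expRM_natl /w; congr expR; field; rewrite gt_eqF.
  by rewrite -exprMn lerXn2r ?nnegrE // ?addr_ge0 // mulr_ge0 ?expR_ge0.
apply: le_trans (ler_wpM2r (expR_ge0 _) h3) _.
by rewrite -mulrA -expRD subrr expR0 mulr1.
Qed.

(** Integrable against da / a at both ends, which is what makes its sums against 1/j bounded in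
    [hump_sum]. *)
Definition hump a := a / (1 + a) ^+ 2.

Lemma hump_ge0 a : 0 <= a -> 0 <= hump a.
Proof. by move=> a0; rewrite divr_ge0 // exprn_ge0 // addr_ge0. Qed.

(** For k = 0 the left side tends to 1 at a = 0, whereas [hump] vanishes there; hence the
    restriction to a >= 1 in this case. *)
Lemma exp_hump c k : 0 < c -> exists2 C : R, 0 <= C & forall a, 0 <= a -> (0 < k)%N || (1 <= a) ->
  a ^+ k * expR (- (c * a)) <= C * hump a.
Proof.
move=> c0; have [C C0 hC] := exp_poly k.+2 c0; exists C => // a a0 ha.
have q0 : 0 < 1 + a by rewrite ltr_wpDr.
rewrite /hump mulrA ler_pdivlMr ?exprn_gt0 //.
have h1 : a ^+ k * (1 + a) ^+ 2 <= a * (1 + a) ^+ k.+2.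
  case: k ha {hC} => [|k] /= ha.
    by rewrite expr0 mul1r ler_peMl // exprn_ge0 // ltW.
  rewrite exprS -mulrA ler_wpM2l // -[k.+3]addn2 exprD ler_wpM2r ?sqr_ge0 //.
  apply: (@le_trans _ _ ((1 + a) ^+ k)); first by rewrite lerXn2r ?nnegrE ?(ltW q0) // lerDr.
  by rewrite exprS ler_peMl ?exprn_ge0 ?(ltW q0) // lerDl.
rewrite mulrAC; apply: le_trans (ler_wpM2r (expR_ge0 _) h1) _.
by rewrite -mulrA mulrC ler_wpM2r // hC.
Qed.

Lemma cexp_dist2 (u v : R[i]) : complex.Re u <= 0 -> complex.Re v <= 0 -> nrm (cexp u - cexp v) <= 2 * nrm (u - v).
Proof.
wlog : u v / complex.Re u <= complex.Re v.
  move=> h u0 v0; case: (leP (complex.Re u) (complex.Re v)) => [uv|/ltW vu]; first exact: h.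
  by rewrite nrmC [in X in _ <= X]nrmC; exact: h.
move=> uv u0 v0; have -> : cexp u - cexp v = cexp v * (cexp (u - v) - 1).
  by rewrite mulrBr mulr1 -cexpD; congr (cexp _ - _); ring.
have h : complex.Re (u - v) <= 0 by rewrite raddfB /= subr_le0.
rewrite nrmM; apply: le_trans (ler_wpM2l (nrm_ge0 _) (cexp_le0 h)) _.
rewrite ler_piMl ?mulr_ge0 ?nrm_ge0 // nrm_cexp -[X in _ <= X](@expR0 R) ler_expR //.
Qed.

Lemma pow_dist (x y : R[i]) (M : R) k : 1 <= M -> nrm x <= M -> nrm y <= M ->
  nrm (x ^+ k - y ^+ k) <= k%:R * M ^+ k * nrm (x - y).
Proof.
move=> M1 xM yM; have M0 : 0 <= M by exact: le_trans M1.
elim: k => [|k ih]; first by rewrite !expr0 subrr nrm0 !mul0r.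
have -> : x ^+ k.+1 - y ^+ k.+1 = x * (x ^+ k - y ^+ k) + (x - y) * y ^+ k by rewrite !exprS; ring.
apply: le_trans (nrmD _ _) _; rewrite !nrmM nrmX.
have h1 := ler_pM (nrm_ge0 _) (nrm_ge0 _) xM ih.
have h2 : nrm (x - y) * nrm y ^+ k <= nrm (x - y) * M ^+ k.+1.
  rewrite ler_wpM2l ?nrm_ge0 // exprS; apply: (@le_trans _ _ (M ^+ k)).
    by rewrite lerXn2r ?nnegrE ?nrm_ge0.
  by rewrite ler_peMl ?exprn_ge0.
apply: le_trans (lerD h1 h2) _; rewrite -[k.+1%:R]natr1 exprS le_eqVlt; apply/orP; left; apply/eqP; ring.
Qed.

Variable c0 : R.
Hypothesis c00 : 0 < c0.

(* the symbol of e^{-tL} is a multiple of exp(- lam * rho), lam = tanh (t/2), t = ta * w *)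
Definition ee w ta : R[i] := cexp (- (ta%:C * w)).
Definition lam w ta : R[i] := (1 - ee w ta) / (1 + ee w ta).
Definition dir w := nrm w = 1 /\ c0 <= complex.Re w.

(** c1 bounds |1 + ee| from below, B bounds both |lam| and |lam| / ta, and c2 is the constant in Re
    lam >= c2 min(1, ta). *)
Let c1 := 1 - expR (- (c0 / 2)).
Let B := 1 + 2 / c1.
Let c2 := c0 / (2 * (1 + 2 * c0)).

Let c10 : 0 < c1.
Proof. by rewrite subr_gt0 -[X in _ < X](@expR0 R) ltr_expR oppr_lt0 divr_gt0. Qed.

Let c11 : c1 <= 1. Proof. by rewrite /c1 gerBl expR_ge0. Qed.

Let B1 : 1 <= B. Proof. by rewrite /B lerDl divr_ge0 // ltW. Qed.

Let c20 : 0 < c2. Proof. by rewrite divr_gt0 // mulr_gt0 // addr_gt0 // mulr_gt0. Qed.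

Let c2l : c2 <= 1.
Proof. by rewrite /c2 ler_pdivrMr ?mulr_gt0 ?addr_gt0 ?mulr_gt0 // mul1r; move: c00; lra. Qed.

Lemma nrm_ee w ta : dir w -> 0 <= ta -> nrm (ee w ta) <= expR (- (c0 * ta)).
Proof.
move=> [_ hw] t0; rewrite /ee nrm_cexp ler_expR; case: w hw => u v /= hw.
by rewrite mul0r subr0 lerN2 [ta * u]mulrC ler_wpM2r.
Qed.

Lemma nrm_1ee w ta : dir w -> 0 <= ta -> nrm (1 - ee w ta) <= 2 * ta.
Proof.
move=> [w1 hw] t0; rewrite nrmC; apply: le_trans (cexp_le0 _) _.
  by case: w hw {w1} => u v /= hw; rewrite mul0r subr0 oppr_le0 mulr_ge0 // (le_trans (ltW c00)).
by rewrite nrmN nrmM w1 mulr1 nrm_real ger0_norm.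
Qed.

(** For ta <= 1/2 the exponential is within distance 1 of 1; beyond, its modulus is at most
    e^{-c0/2}. *)
Lemma nrm_1pee w ta : dir w -> 0 <= ta -> c1 <= nrm (1 + ee w ta).
Proof.
move=> hw t0; case: (leP ta (1 / 2)) => ht.
  apply: le_trans c11 _; have := nrm_1ee hw t0.
  have := nrm_tri (2 : R[i]) 0 (1 - ee w ta); rewrite !subr0.
  have -> : 2 - (1 - ee w ta) = 1 + ee w ta by ring.
  by rewrite nrm_nat; lra.
have h1 := nrm_tri (1 : R[i]) 0 (1 + ee w ta); rewrite !subr0 nrm1 in h1.
rewrite (_ : 1 - (1 + ee w ta) = - ee w ta) in h1; last by ring.
rewrite nrmN in h1; have h2 := nrm_ee hw t0.
have h3 : expR (- (c0 * ta)) <= expR (- (c0 / 2)).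
  by rewrite ler_expR lerN2 ler_wpM2l ?(ltW c00) // -[2^-1]mul1r ltW.
by rewrite /c1; lra.
Qed.

Let pee_neq0 w ta : dir w -> 0 <= ta -> 1 + ee w ta != 0.
Proof.
by move=> hw t0; apply/eqP => e; have := lt_le_trans c10 (nrm_1pee hw t0); rewrite e nrm0 ltxx.
Qed.

Lemma lam_le w ta : dir w -> 0 <= ta -> nrm (lam w ta) <= B * ta.
Proof.
move=> hw t0; have h := nrm_1pee hw t0; have n0 := lt_le_trans c10 h.
rewrite /lam nrmM nrmV ler_pdivrMr //; apply: le_trans (nrm_1ee hw t0) _.
have h2 := ler_wpM2l (mulr_ge0 (le_trans ler01 B1) t0) h; apply: le_trans h2.
have -> : B * ta * c1 = c1 * ta + 2 * ta by rewrite /B; field; rewrite gt_eqF.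
by rewrite lerDr mulr_ge0 // ltW.
Qed.

Lemma lam_le1 w ta : dir w -> 0 <= ta -> nrm (lam w ta) <= B.
Proof.
move=> hw t0; have h := nrm_1pee hw t0; have n0 := lt_le_trans c10 h.
rewrite /lam nrmM nrmV ler_pdivrMr //.
have h2 : nrm (1 - ee w ta) <= 2.
  apply: le_trans (nrmB _ _) _; rewrite nrm1; have := nrm_ee hw t0.
  have : expR (- (c0 * ta)) <= 1 by rewrite -[X in _ <= X](@expR0 R) ler_expR oppr_le0 mulr_ge0 // ltW.
  lra.
have h3 := ler_wpM2l (le_trans ler01 B1) h; apply: le_trans h3; apply: le_trans h2 _.
have -> : B * c1 = c1 + 2 by rewrite /B; field; rewrite gt_eqF.
by rewrite lerDr ltW.
Qed.

Lemma lam_sub1 w ta : dir w -> 0 <= ta -> nrm (lam w ta - 1) <= B * expR (- (c0 * ta)).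
Proof.
move=> hw t0; have h := nrm_1pee hw t0; have n0 := lt_le_trans c10 h.
have -> : lam w ta - 1 = - 2 * ee w ta / (1 + ee w ta) by rewrite /lam; field; exact: pee_neq0.
rewrite nrmM nrmV ler_pdivrMr // nrmM nrmN nrm_nat.
have h2 := ler_wpM2l (mulr_ge0 (le_trans ler01 B1) (expR_ge0 (- (c0 * ta)))) h; apply: le_trans h2.
have := nrm_ee hw t0 => h4.
set E := expR _ in h4 *; have -> : B * E * c1 = c1 * E + 2 * E by rewrite /B; field; rewrite gt_eqF.
by have := mulr_ge0 (ltW c10) (expR_ge0 (- (c0 * ta))); rewrite -/E; lra.
Qed.

(** Re lam = (1 - |ee|^2) / |1 + ee|^2, and 1 - |ee|^2 >= 2 c0 m / (1 + 2 c0 m) for m = min(1,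
    ta). *)
Lemma Re_lam w ta : dir w -> 0 <= ta -> c2 * Num.min 1 ta <= complex.Re (lam w ta).
Proof.
move=> hw t0; have h := nrm_1pee hw t0; have n0 := lt_le_trans c10 h.
have hRe : complex.Re (lam w ta) = (1 - nrm (ee w ta) ^+ 2) / nrm (1 + ee w ta) ^+ 2.
  have := pee_neq0 hw t0; rewrite !nrm_sqr /lam; case: (ee w ta) => u v /= hn.
  rewrite add0r; field; apply: contra hn => /eqP hz; rewrite eq_complex /= add0r.
  have u0 : (1 + u) ^+ 2 = 0 by have := sqr_ge0 (1 + u); have := sqr_ge0 v; move: hz; lra.
  have v0 : v ^+ 2 = 0 by have := sqr_ge0 (1 + u); have := sqr_ge0 v; move: hz; lra.
  by move/eqP: u0; rewrite sqrf_eq0 => ->; move/eqP: v0; rewrite sqrf_eq0 => ->.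
have e1 : nrm (ee w ta) <= 1.
  apply: le_trans (nrm_ee hw t0) _; rewrite -[X in _ <= X](@expR0 R) ler_expR oppr_le0 mulr_ge0 // ltW //.
have n2 : nrm (1 + ee w ta) <= 2.
  by apply: le_trans (nrmD _ _) _; rewrite nrm1; lra.
have n4 : nrm (1 + ee w ta) ^+ 2 <= 4.
  have -> : (4 : R) = 2 ^+ 2 by rewrite -natrX.
  by rewrite lerXn2r ?nnegrE ?nrm_ge0.
rewrite hRe ler_pdivlMr ?exprn_gt0 //.
set m := Num.min 1 ta; have m0 : 0 <= m by rewrite le_min ler01.
have m1 : m <= 1 by rewrite ge_min lexx.
have mt : m <= ta by rewrite ge_min lexx orbT.
apply: le_trans (ler_wpM2l (mulr_ge0 (ltW c20) m0) n4) _.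
have h2 : nrm (ee w ta) ^+ 2 <= expR (- (2 * c0 * m)).
  have -> : expR (- (2 * c0 * m)) = expR (- (c0 * m)) ^+ 2 by rewrite expr2 -expRD; congr expR; ring.
  rewrite lerXn2r ?nnegrE ?nrm_ge0 ?expR_ge0 //; apply: le_trans (nrm_ee hw t0) _.
  by rewrite ler_expR lerN2 ler_wpM2l // ltW.
have h3 : expR (- (2 * c0 * m)) <= (1 + 2 * c0 * m)^-1.
  rewrite expRN lef_pV2 ?posrE ?expR_gt0 ?expR_ge1Dx //.
  by rewrite ltr_wpDr // !mulr_ge0 // ltW.
have q0 : 0 < 1 + 2 * c0 * m by rewrite ltr_wpDr // !mulr_ge0 // ltW.
suff h4 : c2 * m * 4 <= 1 - (1 + 2 * c0 * m)^-1 by lra.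
have -> : 1 - (1 + 2 * c0 * m)^-1 = 2 * c0 * m / (1 + 2 * c0 * m) by field; rewrite gt_eqF.
have -> : c2 * m * 4 = 2 * c0 * m / (1 + 2 * c0).
  by rewrite /c2; field; rewrite gt_eqF // addr_gt0 // mulr_gt0.
rewrite ler_wpM2l ?mulr_ge0 ?(ltW c00) // lef_pV2 ?posrE //; last by rewrite addr_gt0 // mulr_gt0.
by rewrite lerD2l ler_piMr // mulr_ge0 // ltW.
Qed.

(** The k-th derivative in rho, up to sign and at rho = r, of the symbol (1 + lam)^d e^{-lam rho},
    with the weight (1 + r)^k of the seminorms. [linf] is its value at lam = 1, the limit as t tends
    to infinity. *)
Definition ell k d w ta r : R[i] := ((1 + r) ^+ k)%:C * (lam w ta ^+ k * (1 + lam w ta) ^+ d * cexp (- lam w ta * r%:C)).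
Definition linf k d r : R := (1 + r) ^+ k * (2 ^+ d * expR (- r)).
(** For small t the symbol is near 1, its derivatives near 0, as long as t (1 + r) <= 1; for t > 1
    it is near its limit at infinity. The direction w does not enter, which lets the two rays be
    combined. *)
Definition stp k d ta r : R[i] :=
  (if (k == 0)%N && (ta * (1 + r) <= 1) then 1 else 0) + (if 1 < ta then (linf k d r)%:C else 0).

Lemma linf_real k d r : (linf k d r)%:C = ((1 + r) ^+ k)%:C * (2 ^+ d * cexp (- 1 * r%:C)).
Proof.
have e : (2 : R[i]) = (2 : R)%:C by rewrite -(rmorph_nat (real_complex R)).
have -> : (2 : R[i]) ^+ d = ((2 : R) ^+ d)%:C by rewrite e rmorphXn.
by rewrite /linf mulN1r -rmorphN cexp_real -!rmorphM.
Qed.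

(** With a = ta (1 + r): for ta <= 1, k = 0 and a <= 1 the symbol is 1 + O(a); for ta <= 1
    otherwise, Re lam >= c2 ta gives exponential decay in a; for ta > 1, lam - 1 is exponentially
    small in ta while the decay in r has the fixed rate c2. *)
Lemma ell_bound k d : exists2 C : R, 0 <= C & forall w ta r, dir w -> 0 < ta -> 0 <= r ->
  nrm (ell k d w ta r - stp k d ta r) <= C * (hump (ta * (1 + r)) + hump ta).
Proof.
have [C1 C10 hC1] := exp_hump k c20.
have [C2 C20 hC2] := exp_poly k.+1 c20.
have [C3 C30 hC3] := exp_hump 0 c00.
(* [K1]: ta <= 1 with decay in a. [K2]: ta <= 1 with expansion at a = 0, where a <= 4 [hump a].
   [K3]: ta > 1. *)
pose K1 := B ^+ k * (1 + B) ^+ d * expR c2 * C1.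
pose K2 := (d%:R * (1 + B) ^+ d + 2) * B * 4.
pose K3 := (k%:R * B ^+ k * (1 + B) ^+ d + d%:R * (1 + B) ^+ d + 2 ^+ d * 2) * B * C2 * C3.
have B0 : 0 <= B by exact: le_trans B1.
have B10 : 0 <= 1 + B by rewrite addr_ge0.
have K10 : 0 <= K1 by rewrite /K1; do !apply: mulr_ge0; rewrite ?exprn_ge0 ?expR_ge0.
have K20 : 0 <= K2 by rewrite /K2; do !apply: mulr_ge0 => //; rewrite addr_ge0 // mulr_ge0 ?exprn_ge0.
have K30 : 0 <= K3.
  by rewrite /K3; do 3!apply: mulr_ge0 => //; rewrite !addr_ge0 //; do !apply: mulr_ge0; rewrite ?exprn_ge0.
exists (K1 + K2 + K3); first by rewrite !addr_ge0.
move=> w ta r hw t0 r0; have t0' := ltW t0; have r10 : 0 <= 1 + r by rewrite addr_ge0.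
set a := ta * (1 + r); have a0 : 0 <= a by rewrite mulr_ge0.
have ha0 := hump_ge0 a0; have ht0 := hump_ge0 t0'.
set l := lam w ta; have lB := lam_le1 hw t0'; rewrite -/l in lB.
have l1B : nrm (1 + l) <= 1 + B by apply: le_trans (nrmD _ _) _; rewrite nrm1 lerD2l.
have hRe := Re_lam hw t0'; rewrite -/l in hRe.
have Rel0 : 0 <= complex.Re l by apply: le_trans hRe; rewrite mulr_ge0 ?(ltW c20) // le_min ler01.
have Rexp : complex.Re (- l * r%:C) <= 0.
  by case: (l) Rel0 => u v /= u0; rewrite mulr0 subr0 mulNr oppr_le0 mulr_ge0.
have nE : nrm (cexp (- l * r%:C)) <= expR (- (c2 * Num.min 1 ta * r)).
  rewrite nrm_cexp ler_expR; case: (l) hRe => u v /= hRe.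
  by rewrite mulr0 subr0 mulNr lerN2 ler_wpM2r.
suff [h|[h|h]] : nrm (ell k d w ta r - stp k d ta r) <= K1 * hump a \/
   nrm (ell k d w ta r - stp k d ta r) <= K2 * hump a \/ nrm (ell k d w ta r - stp k d ta r) <= K3 * hump ta.
- apply: le_trans h _; rewrite mulrDr; apply: ler_wpDr; first by rewrite mulr_ge0 // !addr_ge0.
  by rewrite ler_wpM2r // -addrA lerDl addr_ge0.
- apply: le_trans h _; rewrite mulrDr; apply: ler_wpDr; first by rewrite mulr_ge0 // !addr_ge0.
  by rewrite ler_wpM2r // addrAC lerDr addr_ge0.
- apply: le_trans h _; rewrite mulrDr; apply: ler_wpDl; first by rewrite mulr_ge0 // !addr_ge0.
  by rewrite ler_wpM2r // lerDr addr_ge0.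
rewrite /ell /stp -/l -/a; case: (leP ta 1) => t1.
  rewrite addr0; have mt : Num.min 1 ta = ta by rewrite min_r.
  rewrite mt in nE; have lt := lam_le hw t0'; rewrite -/l in lt.
  case: ifP => [/andP[/eqP k0 a1]|hk].
    right; left; rewrite k0 !expr0 !mul1r.
    have -> : (1 + l) ^+ d * cexp (- l * r%:C) - 1 =
      ((1 + l) ^+ d - 1 ^+ d) * cexp (- l * r%:C) + (cexp (- l * r%:C) - 1) by rewrite expr1n; ring.
    apply: le_trans (nrmD _ _) _; rewrite nrmM.
    have M1 : 1 <= 1 + B by rewrite lerDl.
    have p1 : nrm (1 : R[i]) <= 1 + B by rewrite nrm1.
    have b1 := pow_dist d M1 l1B p1; rewrite (_ : 1 + l - 1 = l) in b1; last by ring.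
    have b2 : nrm (cexp (- l * r%:C)) <= 1.
      by rewrite nrm_cexp -[X in _ <= X](@expR0 R) ler_expR.
    have b3 := cexp_le0 Rexp; rewrite nrmM nrmN nrm_real (ger0_norm r0) in b3.
    have b4 := ler_pM (nrm_ge0 _) (nrm_ge0 _) b1 b2; rewrite mulr1 in b4.
    apply: le_trans (lerD b4 b3) _.
    have t_a : ta <= a by rewrite /a mulrDr mulr1 lerDl mulr_ge0.
    have b5 : nrm l <= B * a by apply: le_trans lt _; rewrite ler_wpM2l.
    have b6 : nrm l * r <= B * a.
      apply: le_trans (ler_wpM2r r0 lt) _; rewrite -mulrA ler_wpM2l // /a mulrDr mulr1 lerDr //.
    have dB0 : 0 <= d%:R * (1 + B) ^+ d by rewrite mulr_ge0 ?exprn_ge0.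
    have b7 := lerD (ler_wpM2l dB0 b5) (ler_wpM2l (ler0n R 2) b6).
    apply: le_trans b7 _; have -> : K2 * hump a = (d%:R * (1 + B) ^+ d + 2) * (B * (4 * hump a)) by rewrite /K2; ring.
    rewrite -mulrDl ler_wpM2l ?addr_ge0 // ler_wpM2l // /hump mulrA ler_pdivlMr ?exprn_gt0 ?ltr_wpDr //.
    rewrite [4 * a]mulrC ler_wpM2l //; have -> : (4 : R) = 2 ^+ 2 by rewrite -natrX.
    by rewrite lerXn2r ?nnegrE ?addr_ge0 // -[2]/(1 + 1) lerD2l.
  left; rewrite subr0 nrmM nrm_real ger0_norm ?exprn_ge0 // nrmM nrmM !nrmX.
  have b1 : nrm l ^+ k <= (B * ta) ^+ k by rewrite lerXn2r ?nnegrE ?nrm_ge0 ?mulr_ge0.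
  have b2 : nrm (1 + l) ^+ d <= (1 + B) ^+ d by rewrite lerXn2r ?nnegrE ?nrm_ge0.
  have b3 := ler_pM (exprn_ge0 k (nrm_ge0 l)) (exprn_ge0 d (nrm_ge0 (1 + l))) b1 b2.
  have b4 := ler_pM (mulr_ge0 (exprn_ge0 k (nrm_ge0 l)) (exprn_ge0 d (nrm_ge0 (1 + l)))) (nrm_ge0 _) b3 nE.
  apply: le_trans (ler_wpM2l (exprn_ge0 k r10) b4) _.
  have b5 : expR (- (c2 * ta * r)) <= expR c2 * expR (- (c2 * a)).
    by rewrite -expRD ler_expR /a; have := ler_wpM2l (ltW c20) t1; lra.
  have hk' : (0 < k)%N || (1 <= a).
    move: hk; case: (posnP k) => [k0|k0 _] // /=; by case: (ltP 1 a) => [/ltW ->|].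
  have b6 := hC1 a a0 hk'.
  have q0 : 0 <= (1 + r) ^+ k * ((B * ta) ^+ k * (1 + B) ^+ d) by do !apply: mulr_ge0; rewrite exprn_ge0 ?mulr_ge0.
  rewrite mulrA; apply: le_trans (ler_wpM2l q0 b5) _.
  have -> : (1 + r) ^+ k * ((B * ta) ^+ k * (1 + B) ^+ d) * (expR c2 * expR (- (c2 * a))) =
     B ^+ k * (1 + B) ^+ d * expR c2 * (a ^+ k * expR (- (c2 * a))) by rewrite /a !exprMn; ring.
  rewrite /K1 -(mulrA _ C1) ler_wpM2l //; do !apply: mulr_ge0; rewrite ?exprn_ge0 ?expR_ge0 //.
right; right; have -> : (k == 0)%N && (a <= 1) = false.
  by apply/negbTE; rewrite negb_and -ltNge; apply/orP; right; apply: lt_le_trans t1 _; rewrite /a mulrDr mulr1 lerDl mulr_ge0.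
rewrite add0r; have mt : Num.min 1 ta = 1 by rewrite min_l // ltW.
rewrite mt mulr1 in nE.
have -> : (linf k d r)%:C = ((1 + r) ^+ k)%:C * (2 ^+ d * cexp (- 1 * r%:C)) :> R[i].
  exact: linf_real.
rewrite -mulrBr nrmM nrm_real ger0_norm ?exprn_ge0 //.
set E := cexp (- l * _); set E1 := cexp (- 1 * _).
(* The power, the prefactor and the exponential are moved to lam = 1 one after the other. *)
have -> : l ^+ k * (1 + l) ^+ d * E - 2 ^+ d * E1 =
   ((l ^+ k - 1 ^+ k) * (1 + l) ^+ d + ((1 + l) ^+ d - 2 ^+ d)) * E + 2 ^+ d * (E - E1) by rewrite expr1n; ring.
have p1 : nrm (1 : R[i]) <= B by rewrite nrm1.
have p2 : nrm (2 : R[i]) <= 1 + B by rewrite nrm_nat -[2]/(1 + 1) lerD2l.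
have M1 : 1 <= 1 + B by rewrite lerDl.
have b1 := pow_dist k B1 lB p1; have b2 := pow_dist d M1 l1B p2.
rewrite (_ : 1 + l - 2 = l - 1) in b2; last by ring.
have b3 : nrm (1 + l) ^+ d <= (1 + B) ^+ d by rewrite lerXn2r ?nnegrE ?nrm_ge0.
have b4 : nrm (E - E1) <= expR (- (c2 * r)) * (2 * (nrm (l - 1) * r)).
  (* The decay e^{-c2 r} common to both terms is taken out, as Re lam >= c2 and c2 <= 1; what
     remains are two exponents with nonpositive real part. *)
  have -> : E - E1 = cexp (- (c2 * r))%:C * (cexp (- (l - c2%:C) * r%:C) - cexp (- (1 - c2%:C) * r%:C)).
    by rewrite mulrBr -!cexpD /E /E1; congr (cexp _ - cexp _); rewrite rmorphN rmorphM /=; ring.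
  rewrite nrmM cexp_real nrm_real ger0_norm ?expR_ge0 // ler_wpM2l ?expR_ge0 //.
  apply: le_trans (cexp_dist2 _ _) _.
  - case: (l) hRe => u v /=; rewrite mt mulr1 => hRe; rewrite mulr0 subr0 mulNr oppr_le0 mulr_ge0 // subr_ge0 //.
  - by rewrite /= mulr0 subr0 mulNr oppr_le0 mulr_ge0 // subr_ge0.
  have -> : - (l - c2%:C) * r%:C - - (1 - c2%:C) * r%:C = - (l - 1) * r%:C by ring.
  by rewrite nrmM nrmN nrm_real (ger0_norm r0).
have ls := lam_sub1 hw t0'; rewrite -/l in ls.
set X := nrm (l - 1) in b1 b2 b4 ls; have X0 : 0 <= X by exact: nrm_ge0.
set e2 := expR (- (c2 * r)) in b4 nE.
have e20 : 0 <= e2 by exact: expR_ge0.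
have bP : nrm ((l ^+ k - 1 ^+ k) * (1 + l) ^+ d + ((1 + l) ^+ d - 2 ^+ d)) <=
   (k%:R * B ^+ k * (1 + B) ^+ d + d%:R * (1 + B) ^+ d) * X.
  apply: le_trans (nrmD _ _) _; rewrite nrmM nrmX.
  have := ler_pM (nrm_ge0 _) (exprn_ge0 d (nrm_ge0 (1 + l))) b1 b3 => b5.
  by apply: le_trans (lerD b5 b2) _; apply: le_of_eq; ring.
set P := k%:R * B ^+ k * (1 + B) ^+ d + d%:R * (1 + B) ^+ d in bP.
have P0 : 0 <= P by rewrite /P addr_ge0 //; do !apply: mulr_ge0; rewrite ?exprn_ge0.
have b6 : nrm (((l ^+ k - 1 ^+ k) * (1 + l) ^+ d + ((1 + l) ^+ d - 2 ^+ d)) * E + 2 ^+ d * (E - E1)) <=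
   (P + 2 ^+ d * 2) * X * (1 + r) * e2.
  apply: le_trans (nrmD _ _) _; rewrite nrmM [nrm (2 ^+ d * _)]nrmM nrmX nrm_nat.
  have b7 := ler_pM (nrm_ge0 _) (nrm_ge0 _) bP nE.
  have d0 : 0 <= (2 : R) ^+ d by rewrite exprn_ge0.
  have b8 := ler_wpM2l d0 b4.
  apply: le_trans (lerD b7 b8) _.
  have z1 : 0 <= P * X * r * e2 by do !apply: mulr_ge0.
  have z2 : 0 <= 2 ^+ d * 2 * X * e2 by do !apply: mulr_ge0.
  have -> : (P + 2 ^+ d * 2) * X * (1 + r) * e2 = P * X * e2 + 2 ^+ d * (e2 * (2 * (X * r))) + (P * X * r * e2 + 2 ^+ d * 2 * X * e2) by ring.
  by rewrite lerDl addr_ge0.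
apply: le_trans (ler_wpM2l (exprn_ge0 k r10) b6) _.
have b9 := hC2 r r0; rewrite -/e2 in b9.
have t1' : (0 < 0)%N || (1 <= ta) by rewrite ltW.
have b10 := hC3 ta t0' t1'; rewrite expr0 mul1r in b10.
have b11 := le_trans ls (ler_wpM2l B0 b10).
have Pd0 : 0 <= P + 2 ^+ d * 2 by rewrite addr_ge0 // mulr_ge0 // exprn_ge0.
have b12 := ler_pM X0 (mulr_ge0 (exprn_ge0 k.+1 r10) e20) b11 b9.
have -> : (1 + r) ^+ k * ((P + 2 ^+ d * 2) * X * (1 + r) * e2) = (P + 2 ^+ d * 2) * (X * ((1 + r) ^+ k.+1 * e2)).
  by rewrite exprS; ring.
apply: le_trans (ler_wpM2l Pd0 b12) _.
by rewrite /K3 -/P le_eqVlt; apply/orP; left; apply/eqP; ring.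
Qed.

End SymbolEstimates.

(** * Summation over the times *)

Section SymbolSum.
Context (R : realType).

(** The terms are x / (1 + jx)^2, dominated by the increments of Jx / (1 + Jx), a quantity below
    1. *)
Lemma hump_sum (x : R) J : 0 <= x -> \sum_(j < J) j.+1%:R^-1 * hump (j.+1%:R * x) <= 1.
Proof.
move=> x0; apply: (@le_trans _ _ (J%:R * x / (1 + J%:R * x))).
  elim: J => [|J ih]; first by rewrite big_ord0 !mul0r.
  rewrite big_ord_recr /=; apply: le_trans (lerD ih (lexx _)) _.
  have u0 : 0 <= J%:R * x by rewrite mulr_ge0.
  rewrite /hump -natr1; have : (J%:R + 1 : R) != 0 by rewrite natr1 pnatr_eq0.
  move: (J%:R : R) u0 => m u0 m0.
  have p1 : 0 < 1 + m * x by rewrite ltr_wpDr.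
  have p2 : 0 < 1 + (m + 1) * x by rewrite mulrDl mul1r addrA ltr_wpDr.
  have -> : (m + 1)^-1 * ((m + 1) * x / (1 + (m + 1) * x) ^+ 2) = x / (1 + (m + 1) * x) / (1 + (m + 1) * x).
    by field; rewrite m0 gt_eqF.
  have -> : (m + 1) * x / (1 + (m + 1) * x) = m * x / (1 + m * x) + x / (1 + (m + 1) * x) / (1 + m * x).
    by field; rewrite !gt_eqF.
  rewrite lerD2l ler_wpM2l ?divr_ge0 ?(ltW p2) // lef_pV2 ?posrE // mulrDl mul1r addrA lerDl //.
have u0 : 0 <= J%:R * x by rewrite mulr_ge0.
by rewrite ler_pdivrMr ?ltr_wpDr // mul1r lerDr.
Qed.

(** [P] holds on an initial segment, so the sum is one of the partial sums. *)
Lemma prefix_sum (D : nat -> R[i]) (P : pred nat) J (A : R) : 0 <= A ->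
  (forall J', (J' <= J)%N -> nrm (\sum_(j < J') D j) <= A) -> (forall j, P j.+1 -> P j) ->
  nrm (\sum_(j < J) (if P j then D j else 0)) <= A.
Proof.
move=> A0 hD hP; elim: J hD => [|J ih] hD; first by rewrite big_ord0 nrm0.
case PJ : (P J); last first.
  by rewrite big_ord_recr /= PJ addr0; apply: ih => J' h; apply: hD; exact: leqW.
have hall j : (j <= J)%N -> P j.
  by move=> jJ; rewrite -(subKn jJ); elim: (J - j)%N => [|i h]; [rewrite subn0|
    case: (ltnP i J) => hi; [apply: hP; rewrite -subSn // subSS|by move: h; move/eqP: hi (hi) => -> hi; rewrite (_ : J - i.+1 = 0)%N //; apply/eqP; rewrite subn_eq0 leqW]].
rewrite (eq_bigr (fun j : 'I_J.+1 => D j)); first exact: hD.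
by move=> j _; rewrite hall // -ltnS.
Qed.

Lemma suffix_sum (D : nat -> R[i]) (P : pred nat) J (A : R) : 0 <= A ->
  (forall J', (J' <= J)%N -> nrm (\sum_(j < J') D j) <= A) -> (forall j, P j.+1 -> P j) ->
  nrm (\sum_(j < J) (if ~~ P j then D j else 0)) <= 2 * A.
Proof.
move=> A0 hD hP; have h1 := prefix_sum A0 hD hP; have h2 := hD J (leqnn J).
rewrite (eq_bigr (fun j : 'I_J => D j - (if P j then D j else 0))); last first.
  by move=> j _; case: (P j); rewrite ?subrr ?subr0.
rewrite sumrB; apply: le_trans (nrmB _ _) _; apply: le_trans (lerD h2 h1) _.
by rewrite mulr_natl mulr2n.
Qed.

(** On each ray apart, the distances to the step function are summed in absolute value by
    [hump_sum]. The step function is common to the rays, so it multiplies cp - cm, and it is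
    piecewise constant in j: only sums over an initial segment, for small times, and over a final
    one, for large times, remain. *)
Lemma symbol_bound (c0 : R) k d : 0 < c0 -> exists2 C : R, 0 <= C &
  forall wp wm (de : R) J (cp cm : nat -> R[i]) (A r : R), dir c0 wp -> dir c0 wm -> 0 < de -> 0 <= A -> 0 <= r ->
  (forall j, (j < J)%N -> nrm (cp j) <= A / j.+1%:R) -> (forall j, (j < J)%N -> nrm (cm j) <= A / j.+1%:R) ->
  (forall J', (J' <= J)%N -> nrm (\sum_(j < J') (cp j - cm j)) <= A) ->
  nrm (\sum_(j < J) (cp j * ell k d wp (j.+1%:R * de) r - cm j * ell k d wm (j.+1%:R * de) r)) <= C * A.
Proof.
move=> c00; have [C C_0 hC] := ell_bound c00 k d.
have [C4 C40 hC4] := @exp_poly R 1 k ltr01.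
have q2 : 0 <= (2 : R) ^+ d by rewrite exprn_ge0.
exists (C * 2 + C * 2 + 1 + 2 * (C4 * 2 ^+ d)).
  by rewrite !addr_ge0 // ?mulr_ge0 // mulr_ge0.
move=> wp wm de J cp cm A r hp hm de0 A0 r0 hcp hcm hs.
have part (c : nat -> R[i]) w : dir c0 w -> (forall j, (j < J)%N -> nrm (c j) <= A / j.+1%:R) ->
    nrm (\sum_(j < J) c j * (ell k d w (j.+1%:R * de) r - stp k d (j.+1%:R * de) r)) <= C * 2 * A.
  move=> hw hc; apply: le_trans (nrm_sum _ _ _) _.
  have r10 : 0 <= de * (1 + r) by rewrite mulr_ge0 ?(ltW de0) // addr_ge0.
  have s1 := hump_sum J r10; have s2 := hump_sum J (ltW de0).
  apply: (@le_trans _ _ (\sum_(j < J) (C * A * (j.+1%:R^-1 * hump (j.+1%:R * (de * (1 + r)))) + C * A * (j.+1%:R^-1 * hump (j.+1%:R * de))))).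
    apply: ler_sum => j _; rewrite nrmM.
    have t0 : 0 < j.+1%:R * de by rewrite mulr_gt0 // ltr0n.
    have b := ler_pM (nrm_ge0 _) (nrm_ge0 _) (hc j (ltn_ord j)) (hC w _ r hw t0 r0).
    apply: le_trans b _; rewrite -mulrA.
    move: (hump _) (hump _) => h1 h2; apply: le_of_eq; ring.
  rewrite big_split /= -!mulr_sumr.
  have CA : 0 <= C * A by rewrite mulr_ge0.
  apply: le_trans (lerD (ler_wpM2l CA s1) (ler_wpM2l CA s2)) _.
  by apply: le_of_eq; ring.
have bp := part cp wp hp hcp; have bm := part cm wm hm hcm.
(* The two conditions of [stp] as predicates of j, each true on an initial segment. *)
pose P1 (j : nat) := (k == 0)%N && (j.+1%:R * de * (1 + r) <= 1).
pose P2 (j : nat) := j.+1%:R * de <= 1.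
have mono (j : nat) : j.+1%:R * de <= j.+2%:R * de by rewrite ler_wpM2r ?(ltW de0) // ler_nat.
have hP1 j : P1 j.+1 -> P1 j.
  move=> /andP[k0 h]; rewrite /P1 k0 /=; apply: le_trans h; rewrite ler_wpM2r // addr_ge0 //.
have hP2 j : P2 j.+1 -> P2 j by apply: le_trans.
have b1 := @prefix_sum (fun j => cp j - cm j) P1 J A A0 hs hP1; have b2 := @suffix_sum (fun j => cp j - cm j) P2 J A A0 hs hP2.
have e : \sum_(j < J) (cp j * ell k d wp (j.+1%:R * de) r - cm j * ell k d wm (j.+1%:R * de) r) =
   \sum_(j < J) cp j * (ell k d wp (j.+1%:R * de) r - stp k d (j.+1%:R * de) r) -
   \sum_(j < J) cm j * (ell k d wm (j.+1%:R * de) r - stp k d (j.+1%:R * de) r) +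
   (\sum_(j < J) (if P1 j then cp j - cm j else 0) + (linf k d r)%:C * \sum_(j < J) (if ~~ P2 j then cp j - cm j else 0)).
  rewrite mulr_sumr -sumrB -!big_split /=; apply: eq_bigr => j _.
  rewrite /stp /P1 /P2 -ltNge; move: (ell _ _ _ _ _) (ell _ _ _ _ _) => x y.
  by case: ifP => _; case: ifP => _; ring.
rewrite e; apply: le_trans (nrmD _ _) _.
have -> : (C * 2 + C * 2 + 1 + 2 * (C4 * 2 ^+ d)) * A = C * 2 * A + C * 2 * A + (A + C4 * 2 ^+ d * (2 * A)) by ring.
apply: lerD; first by apply: le_trans (nrmB _ _) _; exact: lerD.
apply: le_trans (nrmD _ _) _; apply: lerD => //.
rewrite nrmM nrm_real; apply: ler_pM => //; first exact: nrm_ge0.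
have h := hC4 r r0; rewrite mul1r in h.
rewrite ger0_norm /linf; last by rewrite mulr_ge0 ?exprn_ge0 ?mulr_ge0 ?expR_ge0 // addr_ge0.
by rewrite mulrCA mulrC ler_wpM2r.
Qed.

Lemma lam_ee (c0 : R) w ta : 0 < c0 -> dir c0 w -> 0 <= ta -> (1 - lam w ta) / (1 + lam w ta) = ee w ta.
Proof.
move=> c00 hw t0; have h := nrm_1pee c00 hw t0.
have n0 : 1 + ee w ta != 0.
  apply/eqP => e; move: h; rewrite e nrm0 subr_le0 -[X in X <= _](@expR0 R) ler_expR oppr_ge0.
  by rewrite leNgt divr_gt0.
have -> : 1 - lam w ta = 2 * ee w ta / (1 + ee w ta) by rewrite /lam; field.
have -> : 1 + lam w ta = 2 / (1 + ee w ta) by rewrite /lam; field.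
by field.
Qed.

Lemma lam_neq1 (c0 : R) w ta : 0 < c0 -> dir c0 w -> 0 <= ta -> lam w ta != 1.
Proof.
move=> c00 hw t0; apply/eqP => e; have := lam_ee c00 hw t0; rewrite e subrr mul0r => e2.
by have := nrm_cexp (- (ta%:C * w)); rewrite -/(ee w ta) -e2 nrm0 => /esym/eqP; rewrite gt_eqF // expR_gt0.
Qed.

Lemma Re_lam_gt0 (c0 : R) w ta : 0 < c0 -> dir c0 w -> 0 < ta -> 0 < complex.Re (lam w ta).
Proof.
move=> c00 hw t0; apply: lt_le_trans (Re_lam c00 hw (ltW t0)).
rewrite mulr_gt0 ?divr_gt0 ?mulr_gt0 ?addr_gt0 ?mulr_gt0 //; by rewrite lt_min ltr01.
Qed.

Lemma sum_pairs (Z : zmodType) (T : eqType) J (f g : nat -> T) (F : T -> Z) :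
  \sum_(q <- [seq f j | j <- iota 0 J] ++ [seq g j | j <- iota 0 J]) F q = \sum_(j < J) (F (f j) + F (g j)).
Proof.
rewrite big_cat /= !big_map -{1 2}[J]subn0 -/(index_iota 0 J) !big_mkord -big_split //.
Qed.

End SymbolSum.

(** * The multiplier estimate for combinations of the operators e^{-tL} *)

Section CalculusBound.
Context (R : realType) (X : completeNormedModType R[i]) (d : nat).
Variables (A B : 'I_d -> set (X * X)) (U V : 'I_d -> R -> {linear X -> X}).
Hypothesis HW : weyl_pair A B U V.

(** The Gaussians of both rays are put into one symbol, with the sign in the coefficients, so that
    the seminorms see the cancellation between the rays. The constants for the finitely many k are
    merged into their sum. *)
Lemma calculus_bound (c0 : R) : 0 < c0 -> bounded_weyl_calculus_type0 U V -> exists2 K : R, 0 <= K &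
  forall wp wm (de : R) J (cp cm : nat -> R[i]) (D : R) n (y : nat -> X), dir c0 wp -> dir c0 wm -> 0 < de -> 0 <= D ->
  (forall j, (j < J)%N -> nrm (cp j) <= D / j.+1%:R) -> (forall j, (j < J)%N -> nrm (cm j) <= D / j.+1%:R) ->
  (forall J', (J' <= J)%N -> nrm (\sum_(j < J') (cp j - cm j)) <= D) ->
  (forall k, oscillator0 A B (y k, k%:R *: y k)) ->
  nrm (\sum_(k < n) (\sum_(j < J) (cp j * ee wp (j.+1%:R * de) ^+ k - cm j * ee wm (j.+1%:R * de) ^+ k)) *: y k)
    <= K * D * nrm (\sum_(k < n) y k).
Proof.
move=> c00 hb; have [M [C0 [C00 hM]]] := multiplier_bound HW hb.
pose Q k (C : R) := 0 <= C /\ forall wp wm (de : R) J (cp cm : nat -> R[i]) (A r : R), dir c0 wp -> dir c0 wm -> 0 < de -> 0 <= A -> 0 <= r ->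
  (forall j, (j < J)%N -> nrm (cp j) <= A / j.+1%:R) -> (forall j, (j < J)%N -> nrm (cm j) <= A / j.+1%:R) ->
  (forall J', (J' <= J)%N -> nrm (\sum_(j < J') (cp j - cm j)) <= A) ->
  nrm (\sum_(j < J) (cp j * ell k d wp (j.+1%:R * de) r - cm j * ell k d wm (j.+1%:R * de) r)) <= C * A.
have hQ k : exists C, Q k C by have [C h1 h2] := symbol_bound k d c00; exists C; split.
have [C hC] := boolp.choice hQ.
pose CM := \sum_(k < M.+1) C k.
have CM0 : 0 <= CM by apply: sumr_ge0 => k _; case: (hC k).
have CMk k : (k <= M)%N -> C k <= CM.
  move=> kM; rewrite /CM (bigD1 (Ordinal (kM : (k < M.+1)%N))) //= lerDl.
  by apply: sumr_ge0 => i _; case: (hC i).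
exists (C0 * CM); first exact: mulr_ge0.
move=> wp wm de J cp cm D n y hp hm de0 D0 hcp hcm hs hy.
pose fp j := (cp j, lam wp (j.+1%:R * de)); pose fm j := (- cm j, lam wm (j.+1%:R * de)).
have t0 (j : nat) : 0 < j.+1%:R * de by rewrite mulr_gt0 // ltr0n.
have h1 q : q \in [seq fp j | j <- iota 0 J] ++ [seq fm j | j <- iota 0 J] -> 0 < complex.Re q.2 /\ q.2 != 1.
  rewrite mem_cat => /orP[] /mapP[j _ ->] /=; split.
  - exact: (Re_lam_gt0 c00 hp).
  - exact: (lam_neq1 c00 hp (ltW (t0 j))).
  - exact: (Re_lam_gt0 c00 hm).
  - exact: (lam_neq1 c00 hm (ltW (t0 j))).
have h2 k r : (k <= M)%N -> 0 <= r -> (1 + r) ^+ k * nrm (\sum_(q <- [seq fp j | j <- iota 0 J] ++ [seq fm j | j <- iota 0 J]) q.1 * (1 + q.2) ^+ d * q.2 ^+ k * cexp (- q.2 * r%:C)) <= CM * D.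
  move=> kM r0; rewrite sum_pairs /=.
  have -> : (1 + r) ^+ k = nrm ((1 + r) ^+ k)%:C.
    by rewrite nrm_real ger0_norm // exprn_ge0 // addr_ge0.
  rewrite -nrmM mulr_sumr.
  have [_ hk] := hC k; have := hk wp wm de J cp cm D r hp hm de0 D0 r0 hcp hcm hs => hk'.
  apply: le_trans (ler_wpM2r D0 (CMk k kM)); move: hk'.
  rewrite (eq_bigr (fun j : 'I_J => ((1 + r) ^+ k)%:C * (cp j * (1 + lam wp (j.+1%:R * de)) ^+ d * lam wp (j.+1%:R * de) ^+ k * cexp (- lam wp (j.+1%:R * de) * r%:C) + - cm j * (1 + lam wm (j.+1%:R * de)) ^+ d * lam wm (j.+1%:R * de) ^+ k * cexp (- lam wm (j.+1%:R * de) * r%:C)))) //.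
  by move=> j _; rewrite /ell; ring.
have := hM _ _ n y h1 hy h2.
rewrite mulrA (eq_bigr (fun k : 'I_n => (\sum_(j < J) (cp j * ee wp (j.+1%:R * de) ^+ k - cm j * ee wm (j.+1%:R * de) ^+ k)) *: y k)) //.
move=> k _; congr (_ *: _); rewrite sum_pairs; apply: eq_bigr => j _.
by rewrite /= (lam_ee c00 hp (ltW (t0 j))) (lam_ee c00 hm (ltW (t0 j))) mulNr.
Qed.

End CalculusBound.


Lemma le_limP (R : realType) (V W : normedModType R[i]) (t : nat -> V) (s : nat -> W) f g (M : R) :
  t n @[n --> \oo] --> f -> s n @[n --> \oo] --> g -> 0 <= M ->
  (forall n, nrm (t n) <= M * nrm (s n)) -> nrm f <= M * nrm g.
Proof.
move=> hf hg M0 h; rewrite leNgt; apply/negP => lt.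
pose e := (nrm f - M * nrm g) / (2 * (M + 1)).
have n0 : 0 < M + 1 by rewrite ltr_wpDl.
have e0 : 0 < e by rewrite divr_gt0 ?subr_gt0 // mulr_gt0.
have [N hN] := (proj1 (cvg_nrmP _ _) hf) _ e0; have [N' hN'] := (proj1 (cvg_nrmP _ _) hg) _ e0.
have h1 := hN _ (leq_maxl N N'); have h2 := hN' _ (leq_maxr N N'); have h3 := h (maxn N N').
move: (t _) (s _) h1 h2 h3 => u v h1 h2 h3.
have a1 : nrm f <= nrm u + e by apply: le_trans (lerD (lexx (nrm u)) h1); rewrite -nrmC; apply: le_trans (nrmD _ _); rewrite addrC subrK.
have a2 : nrm v <= nrm g + e by apply: le_trans (lerD (lexx (nrm g)) h2); apply: le_trans (nrmD _ _); rewrite addrC subrK.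
have a3 : nrm f - M * nrm g = 2 * ((M + 1) * e) by rewrite /e; field; rewrite gt_eqF.
have a4 := ler_wpM2l M0 a2; have a5 : 0 < (M + 1) * e by exact: mulr_gt0.
lra.
Qed.

(** * Closure and resolvents of an operator acting triangularly on a dense family of ranges *)

Section EigenvectorExpansion.
Context (R : realType) (X : completeNormedModType R[i]).
Variables (L0 : set (X * X)) (x_ : nat -> X -> X) (c_ : nat -> R[i]) (M_ : nat -> R).
Hypothesis L00 : L0 (0, 0).
Hypothesis L0lin : forall (c : R[i]) f g f' g', L0 (f, g) -> L0 (f', g') -> L0 (c *: f + f', c *: g + g').
Hypothesis xB : forall j f g, x_ j (f - g) = x_ j f - x_ j g.
Hypothesis xZ : forall j (c : R[i]) f, x_ j (c *: f) = c *: x_ j f.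
Hypothesis xM : forall j f, nrm (x_ j f) <= M_ j * nrm f.
Hypothesis c0 : c_ 0 = 0.
Hypothesis L0x : forall j f, L0 (x_ j f, j%:R *: x_ j f - c_ j *: x_ j.-1 f).
Hypothesis xL0 : forall j f h, L0 (f, h) -> x_ j h = j%:R *: x_ j f - c_ j *: x_ j.-1 f.
Hypothesis x_dense : forall (Q : set X) f, Q 0 -> (forall (c : R[i]) x y, Q x -> Q y -> Q (c *: x + y)) ->
  (forall j, Q (x_ j f)) -> approx Q f.

Let L := closure L0.

Definition eigs (y : nat -> X) := forall k, L0 (y k, k%:R *: y k).
(** One vector per eigenvalue suffices for the whole span, since it may be 0 and eigenspaces are
    linear. *)
Definition sp : set X := [set x | exists n y, eigs y /\ x = \sum_(k < n) y k].

Lemma eigs_lin (c : R[i]) y y' : eigs y -> eigs y' -> eigs (fun k => c *: y k + y' k).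
Proof.
by move=> h h' k; rewrite scalerDr scalerA mulrC -scalerA; exact: L0lin (h k) (h' k).
Qed.

Lemma eigs0 : eigs (fun=> 0).
Proof. by move=> k; rewrite scaler0. Qed.

Lemma eigsZ (c : nat -> R[i]) y : eigs y -> eigs (fun k => c k *: y k).
Proof.
move=> h k; have := L0lin (c k) (h k) L00.
by rewrite !addr0 [c k *: (_ *: _)]scalerA mulrC -scalerA.
Qed.

Lemma sp_widen y n N : eigs y -> (n <= N)%N ->
  exists2 y', eigs y' & \sum_(k < n) y k = \sum_(k < N) y' k.
Proof.
move=> h nN; exists (fun k => if (k < n)%N then y k else 0).
  by move=> k /=; case: ifP => _; rewrite ?scaler0.
by rewrite (big_ord_widen N) // big_mkcond.
Qed.

Lemma sp0 : sp 0.
Proof. by exists 0%N, (fun=> 0); split; [exact: eigs0|rewrite big_ord0]. Qed.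

Lemma sp_lin (c : R[i]) x x' : sp x -> sp x' -> sp (c *: x + x').
Proof.
move=> [n [y [h ->]]] [n' [y' [h' ->]]].
have [z hz ->] := sp_widen h (leq_maxl n n'); have [z' hz' ->] := sp_widen h' (leq_maxr n n').
exists (maxn n n'), (fun k => c *: z k + z' k); split; first exact: eigs_lin.
by rewrite big_split /= scaler_sumr.
Qed.

Lemma L0_sum n (f g : 'I_n -> X) : (forall k, L0 (f k, g k)) -> L0 (\sum_k f k, \sum_k g k).
Proof.
move=> h; pose P (p : X * X) := L0 p.
apply: (@big_ind2 X X (fun a b => L0 (a, b))) => // a b a' b' h1 h2.
by have := L0lin 1 h1 h2; rewrite !scale1r.
Qed.

(** By induction on j, x_j f is sent by L0 to (j+1) times x_{j+1} f, minus a sum of eigenvectors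
    with smaller eigenvalues, once j is replaced by j+1; the coefficients a_k = c_{j+1} / (k -
    (j+1)) correct x_{j+1} f into an eigenvector of eigenvalue j+1. *)
Lemma x_sp j f : sp (x_ j f).
Proof.
suff [y [h ->]] : exists y, eigs y /\ x_ j f = \sum_(k < j.+1) y k by exists j.+1, y.
elim: j => [|j [y [h e]]].
  exists (fun k => if k == 0 then x_ 0 f else 0); split.
    move=> [|k] /=; last by rewrite scaler0.
    by have := L0x 0 f; rewrite c0 scale0r subr0.
  by rewrite big_ord1.
pose a (k : nat) : R[i] := c_ j.+1 / (k%:R - j.+1%:R).
pose z := x_ j.+1 f + \sum_(k < j.+1) a k *: y k.
exists (fun k => if (k < j.+1)%N then - a k *: y k else if k == j.+1 then z else 0); split.
  move=> k /=; case: ifP => kj; first exact: (eigsZ (fun k => - a k) h).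
  case: eqP => [->|_]; last by rewrite scaler0.
  have h1 := L0_sum (fun k : 'I_j.+1 => eigsZ a h k).
  have := L0lin 1 (L0x j.+1 f) h1; rewrite !scale1r.
  congr (L0 (_, _)); rewrite /= e scalerDr -addrA; congr (_ + _).
  rewrite !scaler_sumr -sumrN -big_split /=; apply: eq_bigr => i _.
  rewrite !scalerA -scaleNr -scalerDl; congr (_ *: _); rewrite /a.
  have n0 : (i : nat)%:R - j.+1%:R != 0 :> R[i].
    by rewrite subr_eq0 eqr_nat ltn_eqF.
  move: n0; move: (i%:R : R[i]) (j.+1%:R : R[i]) (c_ j.+1) => u v w n0; by field.
rewrite big_ord_recr /= ltnn eqxx /z.
rewrite (eq_bigr (fun k : 'I_j.+1 => - (a k *: y k))); last by move=> i _; rewrite ltn_ord scaleNr.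
by rewrite sumrN addrCA addNr addr0.
Qed.

Lemma sp_dense f : approx sp f.
Proof. exact: x_dense sp0 sp_lin (fun j => x_sp j f). Qed.

(** The relation holds on L0 and passes to the closure because the maps x_j are bounded. *)
Lemma L_x j f h : L (f, h) -> x_ j h = j%:R *: x_ j f - c_ j *: x_ j.-1 f.
Proof.
move=> /closure_pairP hL; apply/eqP; rewrite -subr_eq0; apply/eqP; apply: nrm_le0 => e e0.
(* The sum of the bounds of the three error terms; the added 1 makes it positive. *)
pose K := `|M_ j| + nrm (j%:R : R[i]) * `|M_ j| + nrm (c_ j) * `|M_ j.-1| + 1.
have K0 : 0 < K.
  by rewrite ltr_pwDr // !addr_ge0 // mulr_ge0 ?nrm_ge0.
have [f' [h' [/xL0 -/(_ j) e1 [e2 e3]]]] := hL _ (divr_gt0 e0 K0).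
have -> : x_ j h - (j%:R *: x_ j f - c_ j *: x_ j.-1 f) =
    x_ j (h - h') - (j%:R *: x_ j (f - f') - c_ j *: x_ j.-1 (f - f')).
  rewrite !xB e1 !scalerBr -[RHS]addrA -opprD; congr (_ - _).
  by rewrite addrACA -opprD [_ + (_ - _)]addrC subrK [_ + (_ - _)]addrC subrK.
have bx i g : nrm g <= e / K -> nrm (x_ i g) <= `|M_ i| * (e / K).
  move=> hg; apply: le_trans (xM _ _) _; apply: le_trans (ler_wpM2r (nrm_ge0 _) (ler_norm _)) _.
  exact: ler_wpM2l.
rewrite -nrmC in e2; rewrite -nrmC in e3.
apply: le_trans (nrmB _ _) _.
have b2 : nrm (j%:R *: x_ j (f - f') - c_ j *: x_ j.-1 (f - f')) <=
    nrm (j%:R : R[i]) * (`|M_ j| * (e / K)) + nrm (c_ j) * (`|M_ j.-1| * (e / K)).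
  apply: le_trans (nrmB _ _) _; rewrite !nrmZ.
  by apply: lerD; apply: ler_wpM2l; rewrite ?nrm_ge0 //; exact: bx.
apply: le_trans (lerD (bx j _ e3) b2) _; rewrite addrA.
have -> : `|M_ j| * (e / K) + nrm (j%:R : R[i]) * (`|M_ j| * (e / K)) + nrm (c_ j) * (`|M_ j.-1| * (e / K)) = (K - 1) * e / K.
  by rewrite /K; field; rewrite gt_eqF.
by rewrite ler_pdivrMr // mulrC ler_wpM2l ?(ltW e0) // gerBl.
Qed.

(** The density hypothesis applied to the zero subspace. *)
Lemma x_eq0 h : (forall j, x_ j h = 0) -> h = 0.
Proof.
move=> hx; apply: nrm_le0 => e e0.
have [//| |j|y /= -> he] := @x_dense [set 0] h _ _ _ e e0.
- by move=> c x y /= -> ->; rewrite scaler0 addr0.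
- exact: hx.
- by rewrite subr0 in he.
Qed.

Lemma L_lin (c : R[i]) f g f' g' : L (f, g) -> L (f', g') -> L (c *: f + f', c *: g + g').
Proof.
move=> /closure_pairP h /closure_pairP h'; apply/closure_pairP => e e0.
pose K := nrm c + 1; have K0 : 0 < K by rewrite ltr_wpDl ?nrm_ge0.
have [a [b [ab [ha hb]]]] := h _ (divr_gt0 e0 K0).
have [a' [b' [ab' [ha' hb']]]] := h' _ (divr_gt0 e0 K0).
exists (c *: a + a'), (c *: b + b'); split; first exact: L0lin.
have k (u u' v v' : X) : nrm (u - v) <= e / K -> nrm (u' - v') <= e / K -> nrm (c *: u + u' - (c *: v + v')) <= e.
  move=> h1 h2; rewrite opprD addrACA -scalerBr; apply: le_trans (nrmD _ _) _.
  rewrite nrmZ; apply: le_trans (lerD (ler_wpM2l (nrm_ge0 _) h1) h2) _.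
  by rewrite -[X in _ + X]mul1r -mulrDl mulrC divfK // gt_eqF.
by split; apply: k.
Qed.

Lemma L_L0 f g : L0 (f, g) -> L (f, g).
Proof. exact: subset_closure. Qed.

Lemma L_operator : is_operator L.
Proof.
split; first exact: L_L0; split; first exact: L_lin.
have x0 j : x_ j 0 = 0 by have := xZ j 0 0; rewrite !scale0r.
move=> g hg; apply: x_eq0 => j; rewrite (L_x _ hg) !x0.
by rewrite !scaler0 subrr.
Qed.

(** The relation reads (j - z) x_j f = c_j x_{j-1} f; as c_0 = 0 and z is no natural number, all x_j
    f vanish by induction. *)
Lemma L_inj (z : R[i]) f : (forall k : nat, z != k%:R) -> L (f, z *: f) -> f = 0.
Proof.
move=> hz hL; apply: x_eq0.
have st j : c_ j *: x_ j.-1 f = 0 -> x_ j f = 0.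
  move=> e; have := L_x j hL; rewrite e subr0 xZ => /eqP.
  by rewrite -subr_eq0 -scalerBl scaler_eq0 subr_eq0 (negbTE (hz j)) => /eqP.
by elim=> [|j ih]; apply: st; [rewrite c0 scale0r|rewrite /= ih scaler0].
Qed.

(** An a priori resolvent estimate on sums of eigenvectors. It is enough to solve (z - L) f = g for
    every g with the same bound. *)
Definition eigen_bound (z : R[i]) (M : R) := (forall k : nat, z != k%:R) /\ 0 <= M /\
  forall n y, eigs y -> nrm (\sum_(k < n) (z - k%:R)^-1 *: y k) <= M * nrm (\sum_(k < n) y k).

Lemma L_eigen_sum (z : R[i]) n y : (forall k : nat, z != k%:R) -> eigs y ->
  L (\sum_(k < n) (z - k%:R)^-1 *: y k, z *: (\sum_(k < n) (z - k%:R)^-1 *: y k) - \sum_(k < n) y k).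
Proof.
move=> hz hy; pose a (k : nat) := (z - k%:R)^-1.
rewrite (_ : _ - _ = \sum_(k < n) k%:R *: (a k *: y k)).
  by apply: L_L0; apply: L0_sum => k; exact: (eigsZ a hy).
rewrite scaler_sumr -sumrB; apply: eq_bigr => k _.
rewrite -[X in _ - X]scale1r !scalerA -scalerBl; congr (_ *: _); rewrite /a.
have n0 : z - k%:R != 0 by rewrite subr_eq0.
move: (k%:R : R[i]) n0 => u n0; by field.
Qed.

Lemma L_sub (z : R[i]) f g f' g' : L (f, z *: f - g) -> L (f', z *: f' - g') ->
  L (f - f', z *: (f - f') - (g - g')).
Proof.
move=> h h'; have := @L_lin (-1) _ _ _ _ h' h; rewrite !scaleN1r addrC.
congr (L (_, _)); rewrite addrC scalerBr !opprD !opprK -!addrA; congr (_ + _).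
by rewrite addrCA.
Qed.

Lemma closure_L f g : (forall e : R, 0 < e -> exists a b, L (a, b) /\ nrm (a - f) <= e /\ nrm (b - g) <= e) -> L (f, g).
Proof.
move=> h; have : closure L (f, g) by exact/closure_pairP.
by rewrite (_ : closure L = L) // -(proj1 (closure_id _)) //; exact: closed_closure.
Qed.

Section Resolvent.
Variables (z : R[i]) (M : R).
Hypothesis zM : eigen_bound z M.

Lemma L_uniq f f' g : L (f, z *: f - g) -> L (f', z *: f' - g) -> f = f'.
Proof.
move=> h h'; apply: subr0_eq; apply: (L_inj zM.1); have := L_sub h h'.
by rewrite subrr subr0.
Qed.

(** On [sp] the solution is explicit. The estimate and uniqueness turn an approximation of g from
    [sp] into a Cauchy sequence of solutions, and L is closed. *)
Lemma resolvent_ex g : exists2 f, L (f, z *: f - g) & nrm f <= M * nrm g.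
Proof.
have [zn [M0 hM]] := zM.
have [s hs] : exists s : nat -> X, forall n, sp (s n) /\ nrm (g - s n) <= n.+1%:R^-1.
  suff /boolp.choice[s] : forall n, exists y, sp y /\ nrm (g - y) <= n.+1%:R^-1 by exists s.
  move=> n; have n0 : 0 < n.+1%:R^-1 :> R by rewrite invr_gt0.
  by have [y] := sp_dense g n0; exists y.
have sol x : sp x -> exists2 f, L (f, z *: f - x) & nrm f <= M * nrm x.
  move=> [n [y [hy ->]]]; exists (\sum_(k < n) (z - k%:R)^-1 *: y k); [exact: L_eigen_sum|exact: hM].
have [t ht] : exists t : nat -> X, forall n, L (t n, z *: t n - s n) /\ nrm (t n) <= M * nrm (s n).
  suff /boolp.choice[t] : forall n, exists t, L (t, z *: t - s n) /\ nrm t <= M * nrm (s n) by exists t.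
  by move=> n; have [f] := sol _ (hs n).1; exists f.
have td n m : nrm (t n - t m) <= M * nrm (s n - s m).
  have sd : sp (s n - s m) by have := @sp_lin (-1) _ _ (hs m).1 (hs n).1; rewrite scaleN1r addrC.
  have [f f1 f2] := sol _ sd.
  by rewrite (_ : t n - t m = f) //; apply: L_uniq f1; exact: L_sub (ht n).1 (ht m).1.
have cs : s n @[n --> \oo] --> g.
  apply/cvg_nrmP => e e0; exists (Num.truncn e^-1).+1 => n hn; rewrite nrmC.
  apply: le_trans (hs n).2 _; rewrite invf_ple ?posrE ?ltr0n //.
  apply: le_trans (ltW (truncnS_gt _)) _; rewrite ler_nat; exact: leqW.
have [f hf] : exists f : X, t n @[n --> \oo] --> f.
  apply: cauchy_nrm => e e0.
  have e1 : 0 < e / (2 * (M + 1)) by rewrite divr_gt0 // mulr_gt0 // ltr_wpDl.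
  have [N hN] := (proj1 (cvg_nrmP _ _) cs) _ e1; exists N => m n hm hn.
  apply: le_trans (td _ _) _; apply: (@le_trans _ _ ((M + 1) * (e / (2 * (M + 1)) + e / (2 * (M + 1))))).
    apply: ler_pM => //; rewrite ?nrm_ge0 ?lerDl //.
    by apply: le_trans (nrm_tri _ _ g) _; apply: lerD; [exact: hN|rewrite nrmC; exact: hN].
  have n0 : M + 1 != 0 by rewrite gt_eqF // ltr_wpDl.
  by apply: le_of_eq; field.
exists f.
  have cL : (z *: t n - s n) @[n --> \oo] --> z *: f - g.
    by apply: cvgB => //; apply: cvgZ => //; exact: cvg_cst.
  apply: closure_L => e e0.
  have [N hN] := (proj1 (cvg_nrmP _ _) hf) _ e0; have [N' hN'] := (proj1 (cvg_nrmP _ _) cL) _ e0.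
  exists (t (maxn N N')), (z *: t (maxn N N') - s (maxn N N')); split; first exact: (ht _).1.
  by split; [apply: hN; exact: leq_maxl|apply: hN'; exact: leq_maxr].
apply: (le_limP hf cs M0) => n; exact: (ht n).2.
Qed.

End Resolvent.

End EigenvectorExpansion.

(** * Riemann sums of exponentials *)

Section GeometricSums.
Context (R : realType).
Implicit Types (v z w : R[i]) (x de : R).

Lemma expRN_le_inv x : 0 < x -> expR (- x) <= x^-1.
Proof.
move=> x0; rewrite expRN lef_pV2 ?posrE ?expR_gt0 //.
by apply: le_trans (expR_ge1Dx x); rewrite lerDr.
Qed.

Lemma exp_sum x J : 0 <= x -> \sum_(j < J) x * expR (- (j.+1%:R * x)) <= 1.
Proof.
move=> x0; apply: (@le_trans _ _ (1 - expR (- (J%:R * x)))); last by rewrite gerBl expR_ge0.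
elim: J => [|J ih]; first by rewrite big_ord0 mul0r oppr0 expR0 subrr.
rewrite big_ord_recr /=; apply: le_trans (lerD ih (lexx _)) _.
have -> : J.+1%:R * x = J%:R * x + x by rewrite -natr1 mulrDl mul1r.
rewrite opprD expRD; move: (expR (- (J%:R * x))) (expR_ge0 (- (J%:R * x))) => E E0.
have h : (1 + x) * expR (- x) <= 1.
  by rewrite -[leRHS](expRxMexpNx_1 x) ler_wpM2r ?expR_ge0 // expR_ge1Dx.
have := ler_wpM2l E0 h; lra.
Qed.

(** Multiplied by de, a Riemann sum of the integral of e^{tau v} over tau > 0, which is -1/v for Re
    v < 0. *)
Definition geo v de J := \sum_(j < J) cexp (de%:C * v) ^+ j.+1.

Lemma Re_scale de v : complex.Re (de%:C * v) = de * complex.Re v.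
Proof. by case: v => a b /=; rewrite mul0r subr0. Qed.

Lemma nrm_cexp_scale v de n : nrm (cexp (de%:C * v) ^+ n) = expR (n%:R * (de * complex.Re v)).
Proof. by rewrite nrmX nrm_cexp Re_scale -expRM_natl. Qed.

Lemma geo_le v (a de : R) J : 0 < a -> complex.Re v <= - a -> 0 < de -> nrm (geo v de J) <= (de * a)^-1.
Proof.
move=> a0 va de0; apply: le_trans (nrm_sum _ _ _) _.
have q0 : 0 < de * a by exact: mulr_gt0.
rewrite -[leRHS]mul1r ler_pdivlMr // mulrC mulr_sumr.
apply: le_trans (exp_sum J (ltW q0)); apply: ler_sum => j _; apply: ler_wpM2l; first exact: ltW.
rewrite nrm_cexp_scale ler_expR -mulrN ler_wpM2l // -mulrN.
by apply: ler_wpM2l => //; exact: ltW.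
Qed.

(** From (1 - Q) T = Q - Q^{J+1} with Q = e^{de v} = 1 + de v + O(de^2). The tail Q^{J+1} is O(de)
    once the horizon J de is at least 1/de. *)
Lemma geo_rate v : complex.Re v < 0 -> exists2 C : R, 0 <= C & forall de J,
  0 < de -> de <= 1 -> 1 <= de ^+ 2 * J%:R -> nrm (de%:C * geo v de J + v^-1) <= C * de.
Proof.
move=> v0; pose a := - complex.Re v; have a0 : 0 < a by rewrite oppr_gt0.
have vn0 : v != 0 by apply: contraTneq v0 => ->; rewrite ltxx.
have nv : 0 < nrm v by rewrite nrm_gt0.
exists ((4 * nrm v ^+ 2 * expR (nrm v) / a + 2 * nrm v + a^-1) / nrm v).
  rewrite divr_ge0 ?addr_ge0 ?mulr_ge0 ?expR_ge0 ?exprn_ge0 ?invr_ge0 ?nrm_ge0 //; exact: ltW.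
move=> de J de0 de1 dJ; pose Q := cexp (de%:C * v); pose T := geo v de J.
have hT : nrm T <= (de * a)^-1 by apply: geo_le => //; rewrite /a opprK.
have eT : (1 - Q) * T = Q - Q ^+ J.+1.
  rewrite /T /geo -/Q; elim: (J) => [|n ih]; first by rewrite big_ord0 mulr0 expr1 subrr.
  rewrite big_ord_recr /= mulrDr ih mulrBl mul1r -exprS; ring.
have nd : nrm (de%:C * v) = de * nrm v by rewrite nrmM nrm_real gtr0_norm.
have h1 : nrm (Q - 1 - de%:C * v) <= 4 * (de * nrm v) ^+ 2 * expR (nrm v).
  apply: le_trans (cexp_le2 _) _; rewrite nd ler_wpM2l // ?mulr_ge0 ?exprn_ge0 ?mulr_ge0 ?(ltW de0) ?nrm_ge0 //.
  by rewrite ler_expR ler_piMl // ltW.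
have h2 : nrm (Q - 1) <= 2 * (de * nrm v).
  by rewrite -nd; apply: cexp_le0; rewrite Re_scale pmulr_rle0 // ltW.
have h3 : nrm (Q ^+ J.+1) <= de / a.
  rewrite nrm_cexp_scale; have J0 : 0 < J%:R :> R.
    by rewrite ltNge; apply/negP => Jl; move: dJ; rewrite leNgt (le_lt_trans _ ltr01) // pmulr_rle0 // exprn_gt0.
  have -> : J.+1%:R * (de * complex.Re v) = - (J.+1%:R * (de * a)) by rewrite /a !mulrN opprK.
  have p0 : 0 < J%:R * (de * a) by rewrite !mulr_gt0.
  apply: (@le_trans _ _ (expR (- (J%:R * (de * a))))).
    by rewrite ler_expR lerN2 ler_wpM2r ?ler_nat // ltW // mulr_gt0.
  apply: le_trans (expRN_le_inv p0) _; rewrite invf_ple ?posrE // ?divr_gt0 // invf_div.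
  rewrite ler_pdivrMr // mulrC.
  have -> : de * (J%:R * (de * a)) = a * (de ^+ 2 * J%:R) by ring.
  by rewrite ler_peMr // ltW.
have e1 : de%:C * T + v^-1 = - ((Q - 1 - de%:C * v) * T + (Q - 1) - Q ^+ J.+1) / v.
  apply: (mulIf vn0); rewrite mulrDl mulVf // divfK //.
  have -> : (Q - 1 - de%:C * v) * T = - ((1 - Q) * T) - de%:C * v * T by ring.
  by rewrite eT; ring.
rewrite e1 nrmM nrmV nrmN mulrAC ler_wpM2r ?invr_ge0 ?nrm_ge0 //.
apply: le_trans (nrmB _ _) _; rewrite [leRHS]mulrDl; apply: lerD; last by rewrite mulrC.
apply: le_trans (nrmD _ _) _; rewrite [leRHS]mulrDl; apply: lerD; last by apply: le_trans h2 _; rewrite mulrCA mulrC.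
rewrite nrmM; apply: le_trans (ler_pM (nrm_ge0 _) (nrm_ge0 _) h1 hT) _.
by apply: le_of_eq; field; rewrite !gt_eqF.
Qed.

(** With (m+1)^2 nodes at mesh 1/(m+1), the mesh tends to 0 while the horizon m+1 tends to
    infinity. *)
Definition step (m : nat) : R := m.+1%:R^-1.
Definition nstep (m : nat) : nat := (m.+1 ^ 2)%N.

Lemma step_gt0 m : 0 < step m. Proof. by rewrite invr_gt0 ltr0n. Qed.
Lemma step_le1 m : step m <= 1. Proof. by rewrite invf_le1 ?ler1n ?ltr0n. Qed.
Lemma step_nstep m : 1 <= step m ^+ 2 * (nstep m)%:R.
Proof. by rewrite /nstep natrX -exprMn mulVf ?pnatr_eq0 // expr1n. Qed.

Lemma cvg_step (V : normedModType R[i]) (u : nat -> V) (l : V) (C : R) : 0 <= C ->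
  (forall m, nrm (u m - l) <= C * step m) -> u m @[m --> \oo] --> l.
Proof.
move=> C0 h; apply/cvg_nrmP => e e0; exists (Num.truncn (C / e)).+1 => m hm.
apply: le_trans (h m) _; rewrite ler_pdivrMr ?ltr0n // mulrC -ler_pdivrMr //.
apply: le_trans (ltW (truncnS_gt _)) _; rewrite ler_nat; exact: leqW.
Qed.

Lemma cvg_sums (V : normedModType R[i]) I (r : seq I) (u : nat -> I -> V) (l : I -> V) :
  (forall i, u m i @[m --> \oo] --> l i) -> (\sum_(i <- r) u m i) @[m --> \oo] --> \sum_(i <- r) l i.
Proof.
move=> h; elim: r => [|i r ih].
  by rewrite big_nil; under eq_fun do rewrite big_nil; exact: cvg_cst.
by rewrite big_cons; under eq_fun do rewrite big_cons; exact: cvgD.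
Qed.

Lemma geo_cvg v : complex.Re v < 0 -> ((step m)%:C * geo v (step m) (nstep m) : cplx R) @[m --> \oo] --> (- v^-1 : cplx R).
Proof.
move=> v0; have [C C0 hC] := geo_rate v0; apply: (cvg_step C0) => m.
by rewrite -[nrm _]/(nrm ((step m)%:C * geo v (step m) (nstep m) - (- v^-1))) opprK; apply: hC; [exact: step_gt0|exact: step_le1|exact: step_nstep].
Qed.

End GeometricSums.

(** * Directions of integration in the right half-plane *)

Section Directions.
Context (R : realType).
Implicit Types (s t r : R).

(** For s <= |arg z| <= pi, the rotation by [wdir] carries z into the left half-plane while the
    direction itself stays in the right one. The angle pi/2 - s/2 gives both the same margin
    sin(s/2). *)
Definition kap s := sin (s / 2).
Definition wdir s t := expi ((if 0 <= t then 1 else -1) * (pi / 2 - s / 2)).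

Lemma kap_gt0 s : 0 < s -> s < pi -> 0 < kap s.
Proof. by move=> s0 sp; apply: sin_gt0_pi; apply/andP; split; rewrite ?divr_gt0 //; lra. Qed.

Lemma cos_far s u : 0 < s -> s <= u -> u <= pi -> cos (pi / 2 - s / 2 + u) <= - kap s.
Proof.
move=> s0 su up; have -> : pi / 2 - s / 2 + u = (u - s / 2) + pi / 2 by ring.
rewrite cosDpihalf lerN2 /kap -subr_ge0.
have -> : u - s / 2 = u / 2 + (u - s) / 2 by field.
have -> : s / 2 = u / 2 - (u - s) / 2 by field.
rewrite sinD sinB opprB.
have -> (a b : R) : a + b + (b - a) = 2 * b by ring.
rewrite !mulr_ge0 //; first by apply: cos_ge0_pihalf; apply/andP; split; lra.
by apply: sin_ge0_pi; apply/andP; split; lra.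
Qed.

Lemma wdir_dir s t : 0 < s -> s < pi -> dir (kap s) (wdir s t).
Proof.
move=> s0 sp; split; first exact: nrm_expi.
have e : cos (pi / 2 - s / 2) = kap s by rewrite /kap -cosN opprB cosBpihalf.
by rewrite /wdir /=; case: ifP => _; rewrite ?mul1r ?mulN1r ?cosN e.
Qed.

Lemma wdir_far s t r : 0 < s -> s <= `|t| -> `|t| <= pi -> 0 <= r ->
  complex.Re (wdir s t * (r%:C * expi t)) <= - (kap s * r).
Proof.
move=> s0 st tp r0; rewrite mulrCA Re_scale /wdir -expiD.
rewrite -[leRHS]mulNr [leRHS]mulrC ler_wpM2l //=; apply: le_trans (cos_far s0 st tp).
case: ifP => t0; first by rewrite mul1r ger0_norm.
by rewrite mulN1r -cosN opprD opprK ltr0_norm // ltNge t0.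
Qed.

Lemma Re_wzk s t r k : 0 < s -> s < pi -> s <= `|t| -> `|t| <= pi -> 0 <= r ->
  complex.Re (wdir s t * (r%:C * expi t - k%:R)) <= - (kap s * r) - kap s * k%:R.
Proof.
move=> s0 sp st tp r0; rewrite mulrBr raddfB /= lerB //; first exact: wdir_far.
rewrite [wdir s t * _]mulrC; have [_ h] := wdir_dir t s0 sp.
have -> : (k%:R : R[i]) = (k%:R)%:C by rewrite rmorph_nat.
by rewrite Re_scale mulrC ler_wpM2l.
Qed.

End Directions.

(** * The closed oscillator: single-valuedness and resolvents *)

Section OscillatorSpectrum.
Context (R : realType) (X : completeNormedModType R[i]) (d : nat).
Variables (A B : 'I_d -> set (X * X)) (U V : 'I_d -> R -> {linear X -> X}).
Hypothesis HW : weyl_pair A B U V.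
Local Notation L0 := (oscillator0 A B).
Local Notation L := (oscillator A B).

Let square_lin (D : set (X * X)) (c : R[i]) f g f' g' : is_operator D ->
  square D (f, g) -> square D (f', g') -> square D (c *: f + f', c *: g + g').
Proof. by move=> [_ [h _]] [u [h1 h2]] [u' [h1' h2']]; exists (c *: u + u'); split; exact: h. Qed.

Let square0 (D : set (X * X)) : is_operator D -> square D (0, 0).
Proof. by move=> [h _]; exists 0. Qed.

Let sum_squares_lin (D : 'I_d -> set (X * X)) (c : R[i]) f g f' g' : (forall j, is_operator (D j)) ->
  sum_squares D (f, g) -> sum_squares D (f', g') -> sum_squares D (c *: f + f', c *: g + g').
Proof.
move=> hD [u [h1 /= ->]] [u' [h1' /= ->]]; exists (fun j => c *: u j + u' j); split.
  by move=> j; exact: square_lin.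
by rewrite big_split /= scaler_sumr.
Qed.

Let sum_squares0 (D : 'I_d -> set (X * X)) : (forall j, is_operator (D j)) -> sum_squares D (0, 0).
Proof. by move=> hD; exists (fun=> 0); split; [move=> j; exact: square0|rewrite big1]. Qed.

Let opA j : is_operator (A j). Proof. by case: (weyl_A HW j). Qed.
Let opB j : is_operator (B j). Proof. by case: (weyl_B HW j). Qed.

Lemma oscillator0_lin (c : R[i]) f g f' g' : L0 (f, g) -> L0 (f', g') -> L0 (c *: f + f', c *: g + g').
Proof.
move=> [h [k [h1 [h2 /= ->]]]] [h' [k' [h1' [h2' /= ->]]]].
exists (c *: h + h'), (c *: k + k'); split; first exact: sum_squares_lin.
split; first exact: sum_squares_lin.
rewrite /= !scalerDr !scalerN !scalerA ![_ * c]mulrC opprD.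
move: (_ *: h) (_ *: k) (_ *: h') (_ *: k') (_ *: f) (_ *: f') => p q r s t u.
by rewrite addrACA [p + q + _]addrACA.
Qed.

Lemma oscillator00 : L0 (0, 0).
Proof.
exists 0, 0; split; first exact: sum_squares0; split; first exact: sum_squares0.
by rewrite /= addr0 !scaler0 subrr.
Qed.

Let xs j f : X := S U V (rk 1 j) f.
Let cs (j : nat) : R[i] := 2^-1 * (j%:R * (j%:R - 1 + d%:R)).
Let R1 : 0 < complex.Re (1 : R[i]). Proof. exact: ltr01. Qed.

(** At b = 1 the term in q^{j+1} disappears; this supplies the triangular relations of the abstract
    expansion. *)
Let S_Lk1 j f : S U V (Lk 1 j) f = j%:R *: xs j f - cs j *: xs j.-1 f.
Proof.
rewrite /Lk (S_lin3 HW R1) expr1n subrr mulr0 scale0r addr0 scaleNr addrC; congr (_ *: _ - _).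
by rewrite mulr1 mul1r addrK.
Qed.

Let xs_left j f : L0 (xs j f, j%:R *: xs j f - cs j *: xs j.-1 f).
Proof. by rewrite -S_Lk1; exact: L0_left. Qed.

Let xs_right j f h : L0 (f, h) -> xs j h = j%:R *: xs j f - cs j *: xs j.-1 f.
Proof. by rewrite -S_Lk1; exact: L0_right. Qed.

Let q0 : 0 < complex.Re (1 : R[i]) / 4. Proof. by rewrite divr_gt0. Qed.

Let xsB j f g : xs j (f - g) = xs j f - xs j g.
Proof.
have h : xs j (-1 *: g + f) = -1 *: xs j g + xs j f by exact: (S_linear HW q0 (gb_rk (d + d) j R1)).
by move: h; rewrite !scaleN1r addrC => ->; rewrite addrC.
Qed.

Let xsZ j (c : R[i]) f : xs j (c *: f) = c *: xs j f.
Proof.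
have h : xs j (c *: f + 0) = c *: xs j f + xs j 0 by exact: (S_linear HW q0 (gb_rk (d + d) j R1)).
have h0 : xs j 0 = 0 by exact: (S_0 HW q0 (gb_rk (d + d) j R1)).
by move: h; rewrite h0 !addr0.
Qed.

Let xsM : exists M_ : nat -> R, forall j f, nrm (xs j f) <= M_ j * nrm f.
Proof.
suff /boolp.choice[M_ h] : forall j, exists M, forall f, nrm (xs j f) <= M * nrm f by exists M_.
by move=> j; have [M _ h] := S_bnd HW q0 (gb_rk (d + d) j R1); exists M.
Qed.

Let cs0 : cs 0 = 0. Proof. by rewrite /cs mul0r mulr0. Qed.

Let xs_dense (Q : set X) f : Q 0 -> (forall (c : R[i]) x y, Q x -> Q y -> Q (c *: x + y)) ->
  (forall j, Q (xs j f)) -> approx Q f.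
Proof. exact: (S_rk_dense HW). Qed.

Lemma oscillator_dense f : approx (sp L0) f.
Proof. exact: sp_dense oscillator00 oscillator0_lin cs0 xs_left xs_dense f. Qed.

Lemma oscillator_operator : is_operator L.
Proof.
have [M_ hM] := xsM.
exact: L_operator oscillator00 oscillator0_lin xsB xsZ hM xs_right xs_dense.
Qed.

Section Resolvent.
Variables (z : R[i]) (M : R).
Hypothesis zM : eigen_bound L0 z M.

Lemma oscillator_uniq f f' g : L (f, z *: f - g) -> L (f', z *: f' - g) -> f = f'.
Proof.
have [M_ hM] := xsM.
move=> h1 h2; exact (L_uniq oscillator0_lin xsB xsZ hM cs0 xs_right xs_dense zM h1 h2).
Qed.

Lemma oscillator_solve g : exists2 f, L (f, z *: f - g) & nrm f <= M * nrm g.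
Proof.
have [M_ hM] := xsM.
exact (resolvent_ex oscillator00 oscillator0_lin xsB xsZ hM cs0 xs_left xs_right xs_dense zM g).
Qed.

Lemma resolventE f g : L (f, z *: f - g) -> resolvent L z g = f.
Proof.
move=> h; rewrite /resolvent; case: xgetP => [y _ [h' [h1 h2]]|/(_ f) /= []].
  by apply: oscillator_uniq h; rewrite -h2 opprB addrC subrK.
by exists (z *: f - g); split=> //; rewrite opprB addrC subrK.
Qed.

Lemma resolventP g : L (resolvent L z g, z *: resolvent L z g - g) /\ nrm (resolvent L z g) <= M * nrm g.
Proof. by have [f h1 h2] := oscillator_solve g; rewrite (resolventE h1). Qed.

Lemma resolvent_eigen n y : eigs L0 y ->
  resolvent L z (\sum_(k < n) y k) = \sum_(k < n) (z - k%:R)^-1 *: y k.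
Proof. by move=> hy; apply: resolventE; apply: L_eigen_sum zM.1 hy; [exact: oscillator00|exact: oscillator0_lin]. Qed.

Lemma resolvent_setP : resolvent_set L z.
Proof.
have eq f h g : z *: f - h = g -> h = z *: f - g by move=> <-; rewrite opprB addrC subrK.
split=> [g|].
  have [f h _] := oscillator_solve g; exists f; split.
    by exists (z *: f - g); split=> //; rewrite opprB addrC subrK.
  by move=> f' [h' [h1 /eq h2]]; apply: (oscillator_uniq h); rewrite -h2.
exists M => f h fh; have [f' h1 h2] := oscillator_solve (z *: f - h).
have e : f = f' by apply: (oscillator_uniq _ h1); rewrite opprB addrC subrK.
by rewrite {1}e.
Qed.

End Resolvent.

Lemma resolvent_lin z M (c : R[i]) g g' : eigen_bound L0 z M ->
  resolvent L z (c *: g + g') = c *: resolvent L z g + resolvent L z g'.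
Proof.
move=> zM; apply: (resolventE zM); have [h _] := resolventP zM g; have [h' _] := resolventP zM g'.
have := oscillator_operator.2.1 c _ _ _ _ h h'; congr (L (_, _)).
rewrite !scalerDr !scalerN opprD !scalerA [c * z]mulrC.
move: (_ *: resolvent _ _ g) (_ *: g) (_ *: resolvent _ _ g') => p q r; exact: addrACA.
Qed.

(** The resolvent identity: the difference is the resolvent at z applied to (z' - z) times the
    resolvent at z' of g. *)
Lemma resolvent_diff z z' M M' g : eigen_bound L0 z M -> eigen_bound L0 z' M' -> 0 <= M ->
  nrm (resolvent L z g - resolvent L z' g) <= M * M' * nrm (z' - z) * nrm g.
Proof.
move=> zM zM' M0; have [h _] := resolventP zM g; have [h' b'] := resolventP zM' g.
have e : L (resolvent L z g - resolvent L z' g,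
    z *: (resolvent L z g - resolvent L z' g) - (z' - z) *: resolvent L z' g).
  have := oscillator_operator.2.1 (-1) _ _ _ _ h' h; rewrite !scaleN1r; congr (L (_, _)); first exact: addrC.
  have idt (a u c g0 : X) : - (a - g0) + (c - g0) = c - u - (a - u) by rewrite !opprB addrC !addrA !subrK.
  by rewrite scalerBl scalerBr; exact: idt.
have [_] := resolventP zM ((z' - z) *: resolvent L z' g); rewrite (resolventE zM e) => b.
apply: le_trans b _; rewrite -!mulrA ler_wpM2l // nrmZ mulrCA ler_wpM2l ?nrm_ge0 //.
Qed.

Section FarBound.
Hypothesis hb : bounded_weyl_calculus_type0 U V.

(** On the eigenvalue k, 1/(z - k) is -w times the integral of e^{tau w (z - k)} over tau > 0. The
    Riemann sums have coefficients at most D/j and total mass at most D for D = 1 / (kap s r);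
    [calculus_bound] applies with zero coefficients on the second ray. *)
Lemma far_bound s : 0 < s -> s < pi -> exists2 M : R, 0 <= M & forall r t, 0 < r ->
  s <= `|t| -> `|t| <= pi -> eigen_bound L0 (r%:C * expi t) (M / r).
Proof.
move=> s0 sp; have k0 := kap_gt0 s0 sp; have [K K0 hK] := calculus_bound HW k0 hb.
exists (K / kap s); first by rewrite divr_ge0 // ltW.
move=> r t r0 st tp; pose z := r%:C * expi t; pose w := wdir s t; have dw : dir (kap s) w := wdir_dir t s0 sp.
have hz (k : nat) : complex.Re (w * (z - k%:R)) <= - (kap s * r).
  apply: le_trans (Re_wzk k s0 sp st tp (ltW r0)) _; rewrite gerBl mulr_ge0 //; exact: ltW.
have kr : 0 < kap s * r by exact: mulr_gt0.
have hz0 (k : nat) : complex.Re (w * (z - k%:R)) < 0 by apply: le_lt_trans (hz k) _; rewrite oppr_lt0.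
have zk (k : nat) : z != k%:R.
  by apply/eqP => e; have := hz0 k; rewrite e subrr mulr0 ltxx.
split=> //; split; first by rewrite !divr_ge0 // ltW.
move=> n y hy.
pose cp m (j : nat) : R[i] := - (w * (step R m)%:C) * cexp ((j.+1%:R * step R m)%:C * (w * z)).
have hwz : complex.Re (w * z) <= - (kap s * r) by have := hz 0%N; rewrite subr0.
have ncp m j : nrm (cp m j) <= step R m * expR (- (j.+1%:R * (step R m * (kap s * r)))).
  rewrite nrmM nrmN nrmM dw.1 mul1r nrm_real ger0_norm ?(ltW (step_gt0 _ _)) //.
  rewrite ler_wpM2l ?(ltW (step_gt0 _ _)) // nrm_cexp Re_scale ler_expR.
  have -> : - (j.+1%:R * (step R m * (kap s * r))) = j.+1%:R * step R m * - (kap s * r) by ring.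
  by rewrite ler_wpM2l // mulr_ge0 // ltW // step_gt0.
have D0 : 0 <= (kap s * r)^-1 by rewrite invr_ge0 ltW.
have h1 m j : (j < nstep m)%N -> nrm (cp m j) <= (kap s * r)^-1 / j.+1%:R.
  move=> _; apply: le_trans (ncp m j) _; have sm := step_gt0 R m.
  have p0 : 0 < j.+1%:R * (step R m * (kap s * r)) by rewrite mulr_gt0 ?ltr0n // mulr_gt0.
  apply: le_trans (ler_wpM2l (ltW sm) (expRN_le_inv p0)) _.
  by apply: le_of_eq; field; rewrite !gt_eqF // mulr_gt0.
have h2 m j : (j < nstep m)%N -> nrm (0 : R[i]) <= (kap s * r)^-1 / j.+1%:R by rewrite nrm0 divr_ge0.
have h3 m J : (J <= nstep m)%N -> nrm (\sum_(j < J) (cp m j - 0)) <= (kap s * r)^-1.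
  move=> _; apply: le_trans (nrm_sum _ _ _) _; have sm := step_gt0 R m.
  rewrite -[leRHS]mul1r ler_pdivlMr // mulr_suml.
  apply: le_trans (exp_sum J (ltW (mulr_gt0 sm kr))); apply: ler_sum => j _.
  by rewrite subr0 mulrAC ler_wpM2r ?ncp // ltW.
have hK' m := hK w w (step R m) (nstep m) (cp m) (fun=> 0) _ n y dw dw (step_gt0 R m) D0 (h1 m) (h2 m) (h3 m) hy.
have -> : K / kap s / r = K * (kap s * r)^-1 by rewrite invfM mulrA.
pose a m (k : nat) : R[i] := - w * ((step R m)%:C * geo (w * (z - k%:R)) (step R m) (nstep m)).
have ea m (k : nat) : \sum_(j < nstep m) (cp m j * ee w (j.+1%:R * step R m) ^+ k - 0 * ee w (j.+1%:R * step R m) ^+ k) = a m k.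
  rewrite /a /geo !mulr_sumr; apply: eq_bigr => j _.
  have idt (u v p q : R[i]) : - (u * v) * p * q - 0 * q = - u * (v * (p * q)) by ring.
  rewrite /cp idt; congr (_ * (_ * _)); rewrite /ee -!cexp_natr -cexpD; congr cexp.
  rewrite rmorphM /= rmorph_nat; ring.
have hK2 m : nrm (\sum_(k < n) a m k *: y k) <= K * (kap s * r)^-1 * nrm (\sum_(k < n) y k).
  by apply: le_trans (hK' m); apply: le_of_eq; congr nrm; apply: eq_bigr => k _; rewrite ea.
apply: (nrm_lim_le _ hK2); apply: cvg_sums => k; apply: cvgZ; last exact: cvg_cst.
have wn0 : w != 0 by apply/eqP => e; have [] := dw; rewrite e nrm0 => /eqP; rewrite eq_sym oner_eq0.
have -> : (z - k%:R)^-1 = - w * (- (w * (z - k%:R))^-1).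
  by rewrite mulrNN invfM mulrA mulfV // mul1r.
by apply: cvg_cplxM; [exact: cvg_cst|exact: geo_cvg].
Qed.

End FarBound.

End OscillatorSpectrum.

(** * Sectoriality of L for every positive angle *)

Section Sectoriality.
Context (R : realType).
Implicit Types (s t r : R).

Lemma polar_form (z : R[i]) : z != 0 -> exists2 t : R, `|t| <= pi & z = (nrm z)%:C * expi t.
Proof.
move=> z0; have n0 : 0 < nrm z by rewrite nrm_gt0.
pose x := complex.Re z / nrm z; pose y := complex.Im z / nrm z.
have xy : x ^+ 2 + y ^+ 2 = 1.
  by rewrite /x /y !expr_div_n -mulrDl -nrm_sqr divff // expf_neq0 // gt_eqF.
have x1 : -1 <= x <= 1.
  by rewrite -ler_norml -(ler_pXn2r (ltn0Sn 1)) ?nnegrE // expr1n -normrX ger0_norm ?sqr_ge0 // -xy lerDl sqr_ge0.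
have sy : Num.sqrt (1 - x ^+ 2) = `|y| by rewrite -xy addrAC subrr add0r sqrtr_sqr.
have ez t : cos t = x -> sin t = y -> z = (nrm z)%:C * expi t.
  rewrite /expi => -> ->; rewrite /x /y; move: (nrm z) n0 => m n0; case: (z) => a b /=.
  apply/eqP; rewrite eq_complex /= !mul0r subr0 addr0 ![m * _]mulrC.
  by have m0 : m != 0 by [rewrite gt_eqF]; rewrite !divfK // !eqxx.
have a0 := acos_ge0 x1; have ap := acos_lepi x1.
case: (lerP 0 y) => y0.
  exists (acos x); first by rewrite ger0_norm.
  by apply: ez; rewrite ?sin_acos ?acosK // sy ger0_norm.
exists (- acos x); first by rewrite normrN ger0_norm.
by apply: ez; rewrite ?cosN ?sinN ?sin_acos ?acosK // sy ltr0_norm // opprK.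
Qed.

Lemma far_of_not_closure s (z : R[i]^o) : 0 < s -> ~ closure (sector s) z ->
  exists r t, [/\ 0 < r, s <= `|t|, `|t| <= pi & z = r%:C * expi t].
Proof.
move=> s0 hz; have z0 : (z : R[i]) != 0.
  apply/eqP => e; apply: hz; apply/closureP => e0 e00; exists (e0%:C * expi 0).
    by exists e0, 0; rewrite normr0.
  by rewrite e subr0 -[nrm _]/(nrm (e0%:C * expi 0)) nrmM nrm_expi mulr1 nrm_real gtr0_norm.
have [t tp e] := polar_form z0; exists (nrm (z : R[i])), t; split=> //; first by rewrite nrm_gt0.
rewrite leNgt; apply/negP => ts; apply: hz; apply: subset_closure.
by exists (nrm (z : R[i])), t; split; [rewrite nrm_gt0|split].
Qed.

Context (X : completeNormedModType R[i]) (d : nat).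
Variables (A B : 'I_d -> set (X * X)) (U V : 'I_d -> R -> {linear X -> X}).
Hypothesis HW : weyl_pair A B U V.
Hypothesis hb : bounded_weyl_calculus_type0 U V.
Local Notation L := (oscillator A B).

Lemma oscillator_sectorial s : 0 < s -> s < pi -> sectorial L s.
Proof.
move=> s0 sp; have [M M0 hM] := far_bound HW hb s0 sp.
split; first exact: oscillator_operator HW.
split; first exact: closed_closure.
split.
  move=> z hz; apply/not_notP => hc; apply: hz.
  by have [r [t [r0 st tp ->]]] := far_of_not_closure s0 hc; exact: resolvent_setP HW _ _ (hM r t r0 st tp).
exists M => z hc g; have [r [t [r0 st tp ->]]] := far_of_not_closure s0 hc.
have [_ h] := resolventP HW (hM r t r0 st tp) g.
rewrite nrmZ nrmM nrm_expi mulr1 nrm_real gtr0_norm //.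
apply: le_trans (ler_wpM2l (ltW r0) h) _.
by apply: le_of_eq; field; rewrite gt_eqF.
Qed.

Lemma oscillator_angle s : 0 < s -> s < pi -> sectoriality_angles L s.
Proof. by move=> s0 sp; split=> //; split=> //; exact: oscillator_sectorial. Qed.

Lemma omega_le s : 0 < s -> s < pi -> omega L <= s.
Proof. by move=> s0 sp; apply: ge_inf; [exists 0 => t [/ltW]|exact: oscillator_angle]. Qed.

Lemma omega_ge0 : 0 <= omega L.
Proof.
apply: lb_le_inf; last by move=> t [/ltW].
by exists (pi / 2); apply: oscillator_angle; have := pi_gt0 R; lra.
Qed.

End Sectoriality.

(** * Integrals dominated by an exponential *)

Section ExponentialMajorant.
Context (R : realType).
Local Notation leb := (@lebesgue_measure R).

Definition emaj (C a r : R) : R := if 0 < r then C * expR (- (a * r)) else 0.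

Lemma measurable_emaj C a : measurable_fun setT (emaj C a).
Proof.
apply: (measurable_onR (@measurable_pos R)); apply: measurable_funM => //.
apply: measurableT_comp; first exact: measurable_expR.
by apply: measurableT_comp => //; apply: measurable_funM.
Qed.

Lemma int_emaj C a : 0 <= C -> 0 < a -> (\int[leb]_r (emaj C a r)%:E <= (C / a)%:E)%E.
Proof.
move=> C0 a0; have Ca : 0 <= C / a by rewrite divr_ge0 // ltW.
apply: (@le_trans _ _ (\int[leb]_r ((C / a)%:E * (exponential_pdf a r)%:E))%E).
  apply: ge0_le_integral => //.
  - by move=> r _; rewrite lee_fin /emaj; case: ifP => // _; rewrite mulr_ge0 ?expR_ge0.
  - by apply: measurableT_comp; [exact: EFin_measurable|exact: measurable_emaj].
  - apply: measurable_funeM.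
    by apply: measurableT_comp; [exact: EFin_measurable|exact: measurable_exponential_pdf].
  - move=> r _; rewrite -EFinM lee_fin /emaj; case: ifP => r0.
      by rewrite exponential_pdfE ?(ltW r0) // mulrA divfK ?gt_eqF // mulNr.
    by rewrite mulr_ge0 // exponential_pdf_ge0 // ltW.
rewrite ge0_integralZl //.
- by rewrite integral_exponential_pdf // mule1.
- by apply: measurableT_comp; [exact: EFin_measurable|exact: measurable_exponential_pdf].
- by move=> r _; rewrite lee_fin exponential_pdf_ge0 // ltW.
Qed.

Lemma BI_exp_le (V : completeNormedModType R[i]) (h : R -> V) C a : 0 <= C -> 0 < a -> bmeas h ->
  (forall r, nrm (h r) <= emaj C a r) -> Bint leb h /\ nrm (BI leb h) <= C / a.
Proof.
move=> C0 a0 mh hC; have i1 := int_emaj C0 a0; have mG := measurable_emaj C a.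
have h1 := @le_Bint R _ _ leb V _ (emaj C a) mh mG hC; have h2 := @BI_leG R _ _ leb V _ (emaj C a) _ mh mG hC i1.
by split; [apply: h1; apply: le_lt_trans i1 _; rewrite ltry|exact: h2].
Qed.

End ExponentialMajorant.

Lemma cvg_cplxV (R : realType) (u : nat -> cplx R) (l : cplx R) : (l : R[i]) != 0 ->
  u k @[k --> \oo] --> l -> ((u k : R[i])^-1 : cplx R) @[k --> \oo] --> ((l : R[i])^-1 : cplx R).
Proof. by move=> l0 h; apply: (@cvgV R[i] _ _ _ (u : nat -> R[i]^o) l). Qed.

(** * The discretised Laplace representation along one ray *)

Section OneRay.
Context (R : realType).
Local Notation leb := (@lebesgue_measure R).
Variables (ps : R -> R[i]) (zt w : R[i]) (kp A D : R).
Hypothesis kp0 : 0 < kp.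
Hypothesis nw : nrm w = 1.
Hypothesis nz : nrm zt = 1.
Hypothesis A0 : 0 <= A.
Hypothesis D0 : 0 <= D.
Hypothesis Hre : complex.Re (w * zt) <= - kp.
Hypothesis Hrew : 0 <= complex.Re w.
Hypothesis pc : pcont (ps : R -> cplx R).
Hypothesis pA : forall r, 0 < r -> nrm (ps r) <= A.
Hypothesis pD : forall r, 0 < r -> nrm (ps r / r%:C) <= D * (1 + r ^+ 2)^-1.

(** The derivative in ta of the integral [Hh] of these functions is the density with which e^{-ta w
    L} enters phi(L). Increments of [Hh], rather than samples of its derivative, are used because
    their partial sums telescope. *)
Definition hk (ta r : R) : R[i] := ps r / r%:C * cexp (ta%:C * (r%:C * (w * zt))).
Definition Hh (ta : R) : R[i] := PI (hk ta : R -> cplx R).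

Let cvg_real (u : nat -> R) (x : R) : u k @[k --> \oo] --> x -> ((u k)%:C : cplx R) @[k --> \oo] --> (x%:C : cplx R).
Proof. by move=> h; apply: cvg_complex => //; exact: cvg_cst. Qed.

Let real_neq0 (r : R) : 0 < r -> r%:C != 0 :> R[i].
Proof. by move=> r0; rewrite eq_complex /= eqxx andbT gt_eqF. Qed.

Lemma pcont_psr : pcont (fun r => ps r / r%:C : cplx R).
Proof.
move=> u x x0 ux; apply: cvg_cplxM; first exact: pc.
by apply: cvg_cplxV; [exact: real_neq0|exact: cvg_real].
Qed.

Lemma pcont_hk ta : pcont (hk ta : R -> cplx R).
Proof.
move=> u x x0 ux; apply: cvg_cplxM; first exact: pcont_psr.
apply: cexp_cvg; apply: cvg_cplxM; first exact: cvg_cst.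
by apply: cvg_cplxM; [exact: cvg_real|exact: cvg_cst].
Qed.

Lemma cexp_ray ta r : 0 <= ta -> 0 < r -> nrm (cexp (ta%:C * (r%:C * (w * zt)))) <= expR (- (kp * ta * r)).
Proof.
move=> t0 r0; rewrite nrm_cexp !Re_scale ler_expR.
have -> : - (kp * ta * r) = ta * (r * - kp) by ring.
by rewrite ler_wpM2l // ler_wpM2l // ltW.
Qed.

Lemma hk_le ta r : 0 <= ta -> 0 < r -> nrm (hk ta r) <= D * (1 + r ^+ 2)^-1.
Proof.
move=> t0 r0; rewrite nrmM; apply: le_trans (pD r0).
rewrite ler_piMr ?nrm_ge0 //; apply: le_trans (cexp_ray t0 r0) _.
by rewrite -expR0 ler_expR oppr_le0 !mulr_ge0 // ltW.
Qed.

Lemma Bint_hk ta : 0 <= ta -> Bint leb (on (@pos R) (hk ta : R -> cplx R)).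
Proof. by move=> t0; have [] := PI_le (@pcont_hk ta) D0 (fun r => hk_le t0). Qed.

(** The increments start at the time de and not at 0: the bound in [hc_le] needs a positive left
    end. *)
Definition hc de j : R[i] := Hh (j.+2%:R * de) - Hh (j.+1%:R * de).

Lemma hk_diff de j r : hk (j.+2%:R * de) r - hk (j.+1%:R * de) r =
  ps r / r%:C * (cexp (de%:C * (r%:C * (w * zt))) - 1) * cexp ((j.+1%:R * de)%:C * (r%:C * (w * zt))).
Proof.
rewrite /hk (_ : j.+2%:R * de = de + j.+1%:R * de); last by rewrite -natr1; ring.
by rewrite rmorphD mulrDl cexpD; ring.
Qed.

Lemma hcE de j : 0 < de -> Bint leb (on (@pos R) (fun r => hk (j.+2%:R * de) r - hk (j.+1%:R * de) r : cplx R)) /\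
  hc de j = PI (fun r => hk (j.+2%:R * de) r - hk (j.+1%:R * de) r : cplx R).
Proof.
move=> de0; have h i : 0 <= i%:R * de by rewrite mulr_ge0 // ltW.
have [h1 h2] := BintB (Bint_hk (h j.+2)) (Bint_hk (h j.+1)).
have e : on (@pos R) (fun r => hk (j.+2%:R * de) r - hk (j.+1%:R * de) r : cplx R) =
  (fun r => on (@pos R) (hk (j.+2%:R * de) : R -> cplx R) r - on (@pos R) (hk (j.+1%:R * de) : R -> cplx R) r).
  by apply/funext => r; rewrite /on; case: ifP => // _; rewrite subr0.
by rewrite /hc /Hh /PI e.
Qed.

(** The increment of the exponential is at most 2 de r, which cancels 1/r; the remaining exponential
    has integral 1 / (kp (j+1) de). *)
Lemma hc_le de j : 0 < de -> nrm (hc de j) <= 2 * A / kp / j.+1%:R.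
Proof.
move=> de0; have [[mb _] ->] := hcE j de0.
have j0 : 0 < j.+1%:R :> R by rewrite ltr0n.
have t0 : 0 < kp * (j.+1%:R * de) by rewrite !mulr_gt0.
have C0 : 0 <= 2 * A * de by rewrite !mulr_ge0 // ltW.
have [|_ h] := BI_exp_le C0 t0 mb.
  move=> r; rewrite /on /emaj /pos; case: ifP => r0; last by rewrite nrm0.
  rewrite -[nrm _]/(nrm (hk (j.+2%:R * de) r - hk (j.+1%:R * de) r)) hk_diff nrmM.
  apply: ler_pM; rewrite ?nrm_ge0 //; last first.
    by apply: le_trans (cexp_ray _ r0) _ => //; rewrite ltW // mulr_gt0.
  rewrite !nrmM nrmV nrm_real gtr0_norm //.
  have b : nrm (cexp (de%:C * (r%:C * (w * zt))) - 1) <= 2 * (de * r).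
    have -> : 2 * (de * r) = 2 * nrm (de%:C * (r%:C * (w * zt))).
      by rewrite !nrmM nw nz !nrm_real !gtr0_norm // !mulr1.
    apply: cexp_le0; rewrite !Re_scale pmulr_rle0 // pmulr_rle0 //.
    by apply: le_trans Hre _; rewrite oppr_le0 ltW.
  apply: le_trans (ler_pM _ _ (ler_wpM2r _ (pA r0)) b) _; rewrite ?nrm_ge0 ?invr_ge0 ?(ltW r0) //.
    by rewrite divr_ge0 ?nrm_ge0 // ltW.
  by apply: le_of_eq; field; rewrite gt_eqF.
apply: le_trans h _; apply: le_of_eq.
by move: (j.+1%:R : R) j0 => n n0; field; rewrite !gt_eqF.
Qed.

Let vk (k : nat) r : R[i] := r%:C * (w * zt) - w * k%:R.

Let Re_vk k r : 0 < r -> complex.Re (vk k r) <= - (kp * r).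
Proof.
move=> r0; rewrite /vk raddfB /= -[leRHS]subr0; apply: lerB.
  by rewrite Re_scale mulrC -mulNr ler_wpM2r // ltW.
have -> : w * k%:R = (k%:R)%:C * w by rewrite rmorph_nat mulrC.
by rewrite Re_scale mulr_ge0.
Qed.

(** Summed under the integral over r, the times form a geometric progression. *)
Lemma hc_sumE de J k : 0 < de ->
  \sum_(j < J) hc de j * ee w (j.+1%:R * de) ^+ k =
  PI (fun r => ps r / r%:C * (cexp (de%:C * (r%:C * (w * zt))) - 1) * geo (vk k r) de J : cplx R).
Proof.
move=> de0; pose f (j : 'I_J) : R -> cplx R := fun r =>
  (ee w (j.+1%:R * de) ^+ k : R[i]) * (on (@pos R) (fun r => hk (j.+2%:R * de) r - hk (j.+1%:R * de) r : cplx R) r : R[i]).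
have hf j : Bint leb (f j) /\ BI leb (f j) = ee w (j.+1%:R * de) ^+ k * hc de j.
  have [b1 b2] := hcE j de0; have [] := BintZ (ee w (j.+1%:R * de) ^+ k) b1.
  by rewrite b2; split.
have [_ hs] := BI_sum (index_enum 'I_J) (fun j => (hf j).1).
rewrite (eq_bigr (fun j => BI leb (f j) : R[i])); last by move=> j _; rewrite (hf j).2 mulrC.
transitivity (BI leb (fun t => \sum_(i <- index_enum 'I_J) f i t)); first by rewrite hs.
apply: (congr1 (fun q : R -> cplx R => BI leb q : R[i])); apply/funext => r; rewrite /on /f /on; case: ifP => r0; last first.
  by rewrite big1 // => j _; rewrite mulr0.
rewrite /geo mulr_sumr; apply: eq_bigr => j _; rewrite hk_diff mulrC -[LHS]mulrA; congr (_ * _).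
rewrite /ee -!cexp_natr -cexpD; congr cexp.
rewrite /vk !rmorphM /= rmorph_nat; ring.
Qed.

(** Write y = r w zt. Under the integral (e^{de y} - 1) / de tends to y, and de times the geometric
    sum to -1 / (y - w k); the majorant 2D/kp times 1 / (1 + r^2) holds for every mesh. *)
Lemma hc_sum_cvg k :
  (\sum_(j < nstep m) hc (step R m) j * ee w (j.+1%:R * step R m) ^+ k : cplx R) @[m --> \oo] -->
  (- (PI (fun r => ps r * zt / (r%:C * zt - k%:R) : cplx R) : R[i]) : cplx R).
Proof.
under eq_fun do rewrite (hc_sumE _ _ (step_gt0 _ _)).
pose g r : R[i] := - (ps r * zt / (r%:C * zt - k%:R)).
have wn0 : w != 0 by apply/eqP => e; have := nw; rewrite e nrm0 => /eqP; rewrite eq_sym oner_eq0.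
have ev r : vk k r = w * (r%:C * zt - k%:R) by rewrite /vk; ring.
have v0 r : 0 < r -> r%:C * zt - k%:R != 0.
  move=> r0; apply/eqP => e; have := Re_vk k r0; rewrite ev e mulr0 oppr_ge0 leNgt.
  by rewrite mulr_gt0.
have cg : pcont (fun r => ps r * zt / (r%:C * zt - k%:R) : cplx R).
  move=> u x x0 ux; apply: cvg_cplxM; first by apply: cvg_cplxM; [exact: pc|exact: cvg_cst].
  apply: cvg_cplxV; first exact: v0.
  by apply: cvg_cplxB; [apply: cvg_cplxM; [exact: cvg_real|exact: cvg_cst]|exact: cvg_cst].
have bg r : 0 < r -> nrm (ps r * zt / (r%:C * zt - k%:R)) <= D / kp * (1 + r ^+ 2)^-1.
  move=> r0; have kr : 0 < kp * r by exact: mulr_gt0.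
  have h : kp * r <= nrm (r%:C * zt - k%:R).
    have -> : nrm (r%:C * zt - k%:R) = nrm (vk k r) by rewrite ev nrmM nw mul1r.
    rewrite -nrmN; apply: le_trans (Re_le_nrm _); rewrite raddfN /= lerNr; exact: Re_vk.
  rewrite !nrmM nz mulr1 nrmV; have h' := pD r0; rewrite nrmM nrmV nrm_real gtr0_norm // in h'.
  apply: (@le_trans _ _ (nrm (ps r) * (kp * r)^-1)).
    by rewrite ler_wpM2l ?nrm_ge0 // lef_pV2 ?posrE // (lt_le_trans kr).
  rewrite invfM mulrCA mulrC [D / kp]mulrC -[leRHS]mulrA mulrC ler_wpM2l // ltW // invr_gt0 //.
have eg : - (PI (fun r => ps r * zt / (r%:C * zt - k%:R) : cplx R) : R[i]) = PI (g : R -> cplx R).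
  have [|b1 _] := PI_le cg (_ : 0 <= D / kp) bg; first by rewrite divr_ge0 // ltW.
  have [_ b2] := BintZ (-1) b1; rewrite -[LHS]mulN1r; transitivity (BI leb (fun t : R => (-1 : R[i]) *: on (@pos R) (fun r => ps r * zt / (r%:C * zt - k%:R) : cplx R) t)); first by rewrite b2.
  apply: (congr1 (fun q : R -> cplx R => BI leb q : R[i])).
  by apply/funext => r; rewrite /on; case: ifP => _; rewrite ?scaler0 // -[LHS]/(-1 * _) mulN1r.
rewrite eg; apply: (@PI_cvg R (cplx R) _ _ (2 * D / kp)).
- by rewrite divr_ge0 ?mulr_ge0 // ltW.
- move=> m u x x0 ux; apply: cvg_cplxM.
    apply: cvg_cplxM; first exact: pcont_psr.
    apply: cvg_cplxB; last exact: cvg_cst.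
    apply: cexp_cvg; apply: cvg_cplxM; first exact: cvg_cst.
    by apply: cvg_cplxM; [exact: cvg_real|exact: cvg_cst].
  rewrite /geo; apply: cvg_sums => j; apply: cvg_cplxX; apply: cexp_cvg; apply: cvg_cplxM; first exact: cvg_cst.
  by apply: cvg_cplxB; [apply: cvg_cplxM; [exact: cvg_real|exact: cvg_cst]|exact: cvg_cst].
- move=> u x x0 ux; apply: (@cvgN R[i] (cplx R)); exact: cg.
- move=> r r0; pose y := r%:C * (w * zt).
  have -> : g r = ps r / r%:C * (y * (- (vk k r)^-1)).
    by rewrite /g /y ev; field; rewrite wn0 real_neq0 // v0.
  have cq : ((step R m)%:C^-1 * (cexp ((step R m)%:C * y) - 1) : cplx R) @[m --> \oo] --> (y : cplx R).
    have C0 : 0 <= 4 * nrm y ^+ 2 * expR (nrm y) by rewrite !mulr_ge0 ?expR_ge0 ?exprn_ge0 ?nrm_ge0.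
    apply: (cvg_step C0) => m; have s0 := step_gt0 R m; have s1 := step_le1 R m.
    rewrite -[nrm _]/(nrm ((step R m)%:C^-1 * (cexp ((step R m)%:C * y) - 1) - y)).
    have -> : (step R m)%:C^-1 * (cexp ((step R m)%:C * y) - 1) - y =
        (step R m)%:C^-1 * (cexp ((step R m)%:C * y) - 1 - (step R m)%:C * y).
      by rewrite [RHS]mulrBr mulKf // real_neq0.
    rewrite nrmM nrmV nrm_real gtr0_norm // mulrC ler_pdivrMr //.
    apply: le_trans (cexp_le2 _) _; rewrite nrmM nrm_real gtr0_norm //.
    have h : expR (step R m * nrm y) <= expR (nrm y) by rewrite ler_expR ler_piMl ?nrm_ge0.
    have p0 : 0 <= 4 * (step R m * nrm y) ^+ 2 by rewrite mulr_ge0 ?exprn_ge0 ?mulr_ge0 ?nrm_ge0 // ltW.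
    apply: le_trans (ler_wpM2l p0 h) _.
    by apply: le_of_eq; ring.
  have vn : complex.Re (vk k r) < 0.
    by apply: le_lt_trans (Re_vk k r0) _; rewrite oppr_lt0 mulr_gt0.
  have -> : (fun m => ps r / r%:C * (cexp ((step R m)%:C * (r%:C * (w * zt))) - 1) * geo (vk k r) (step R m) (nstep m) : cplx R) =
     (fun m => ps r / r%:C * ((step R m)%:C^-1 * (cexp ((step R m)%:C * y) - 1) * ((step R m)%:C * geo (vk k r) (step R m) (nstep m))) : cplx R).
    apply/funext => m; rewrite /y; have := real_neq0 (step_gt0 R m).
    move: (step R m)%:C (cexp _) (geo _ _ _) (ps r / r%:C) => a b c e a0; by field.
  apply: cvg_cplxM; first exact: cvg_cst.
  by apply: cvg_cplxM; [exact: cq|exact: geo_cvg].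
- move=> m r r0; have s0 := step_gt0 R m; have kr : 0 < kp * r by exact: mulr_gt0.
  rewrite -[nrm _]/(nrm (ps r / r%:C * (cexp ((step R m)%:C * (r%:C * (w * zt))) - 1) * geo (vk k r) (step R m) (nstep m))).
  have b : nrm (cexp ((step R m)%:C * (r%:C * (w * zt))) - 1) <= 2 * (step R m * r).
    have -> : 2 * (step R m * r) = 2 * nrm ((step R m)%:C * (r%:C * (w * zt))).
      by rewrite !nrmM nw nz !nrm_real !gtr0_norm // !mulr1.
    apply: cexp_le0; rewrite !Re_scale pmulr_rle0 // pmulr_rle0 //.
    by apply: le_trans Hre _; rewrite oppr_le0 ltW.
  have b2 := geo_le (nstep m) kr (Re_vk k r0) s0.
  rewrite nrmM [nrm (_ / _ * _)]nrmM -mulrA.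
  have b3 := ler_pM (nrm_ge0 _) (nrm_ge0 _) b b2.
  have b4 := ler_pM (nrm_ge0 _) (mulr_ge0 (nrm_ge0 _) (nrm_ge0 _)) (pD r0) b3.
  apply: le_trans b4 _; apply: le_of_eq.
  by move: (step R m) s0 => s s0; have q0 : 0 < 1 + r ^+ 2 by [rewrite ltr_wpDr ?sqr_ge0]; field; rewrite !gt_eqF.
Qed.

(** For r <= 1/ta the exponential is 1 + O(ta r); for r > 1/ta, 1/r <= ta and the exponential is
    integrable. The factor e^{kp} lets a single exponential majorant serve on both ranges. *)
Lemma Hh_trunc ta : 0 < ta ->
  nrm (Hh ta - CS 0 ta^-1 (fun r => ps r / r%:C : cplx R)) <= 2 * A * expR kp / kp.
Proof.
move=> t0; have ti : 0 < ta^-1 by rewrite invr_gt0.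
have [b1 _] := PI_le (@pcont_hk ta) D0 (fun r => hk_le (ltW t0)).
have p0 (r : R) : oc 0 ta^-1 r -> 0 < r by case/andP.
have b2 : Bint leb (on (oc 0 ta^-1) (fun r => ps r / r%:C : cplx R)).
  have mb := bmeas_P pcont_psr (@measurable_oc R 0 ta^-1) p0.
  apply: (@le_Bint R _ _ leb (cplx R) _ (maj D) mb (measurable_maj D)).
    by move=> r; rewrite /on; case: ifP => [/p0 r0|_]; [rewrite /maj r0; exact: pD|rewrite nrm0 maj_ge0].
  by apply: le_lt_trans (int_maj D0) _; rewrite ltry.
have [b3 b4] := BintB b1 b2.
rewrite -[X in nrm X](b4).
have C0 : 0 <= 2 * A * expR kp * ta by rewrite !mulr_ge0 ?expR_ge0 // ltW.
have kt : 0 < kp * ta by exact: mulr_gt0.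
have [|_ h] := BI_exp_le C0 kt b3.1; last first.
  apply: le_trans h _; apply: le_of_eq; field.
  by rewrite !gt_eqF.
move=> r; rewrite /on /emaj /pos /oc; case: ifP => r0; last by rewrite subr0 nrm0.
case: ifP => rt.
  rewrite -[nrm _]/(nrm (hk ta r - ps r / r%:C)) /hk -[X in _ - X]mulr1 -mulrBr nrmM.
  have b : nrm (cexp (ta%:C * (r%:C * (w * zt))) - 1) <= 2 * (ta * r).
    have -> : 2 * (ta * r) = 2 * nrm (ta%:C * (r%:C * (w * zt))).
      by rewrite !nrmM nw nz !nrm_real !gtr0_norm // !mulr1.
    apply: cexp_le0; rewrite !Re_scale pmulr_rle0 // pmulr_rle0 //.
    by apply: le_trans Hre _; rewrite oppr_le0 ltW.
  rewrite nrmM nrmV nrm_real gtr0_norm //.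
  apply: le_trans (ler_pM _ _ (ler_wpM2r _ (pA r0)) b) _; rewrite ?mulr_ge0 ?nrm_ge0 ?invr_ge0 ?(ltW r0) //.
  have -> : A / r * (2 * (ta * r)) = 2 * A * ta * 1 by field; rewrite gt_eqF.
  have -> : 2 * A * expR kp * ta * expR (- (kp * ta * r)) = 2 * A * ta * (expR kp * expR (- (kp * ta * r))) by ring.
  rewrite ler_wpM2l ?mulr_ge0 ?(ltW t0) //.
  rewrite -expRD -[X in X <= _](@expR0 R) ler_expR subr_ge0 -mulrA ler_piMr ?(ltW kp0) //.
  by rewrite mulrC -ler_pdivlMr // mul1r.
rewrite subr0 /hk nrmM nrmM nrmV nrm_real gtr0_norm //.
have rt' : ta^-1 <= r by move/negbT: rt; rewrite ?r0 /= -ltNge => /ltW.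
have b : A / r <= A * ta by rewrite ler_wpM2l // invf_ple ?posrE.
apply: le_trans (ler_pM _ (nrm_ge0 _) (le_trans (ler_wpM2r _ (pA r0)) b) (cexp_ray (ltW t0) r0)) _.
- by rewrite mulr_ge0 ?nrm_ge0 ?invr_ge0 // ltW.
- by rewrite invr_ge0 ltW.
rewrite ler_wpM2r ?expR_ge0 //.
have e1 : 1 <= expR kp by rewrite -[X in X <= _](@expR0 R) ler_expR ltW.
have -> : 2 * A * expR kp * ta = A * ta * (2 * expR kp) by ring.
by rewrite ler_peMr ?mulr_ge0 ?(ltW t0) //; lra.
Qed.

End OneRay.

(** * Rules for pointwise complex differentiability *)

Section Holomorphic.
Context (R : realType).
Implicit Types (g h : R[i] -> R[i]) (z w c : R[i]).

Lemma holM g h z : hol g z -> hol h z -> hol (fun z => g z * h z) z.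
Proof.
move=> [g' hg] [h' hh]; exists (g' * h z + g z * h') => e e0.
pose H := nrm (h z) + nrm h' + 1; pose G := nrm (g z) + 1; pose N := nrm g' * (nrm h' + 1) + 1.
have H0 : 0 < H by rewrite ltr_wpDl ?addr_ge0 ?nrm_ge0.
have G0 : 0 < G by rewrite ltr_wpDl ?nrm_ge0.
have n1 : 0 <= nrm h' + 1 by rewrite addr_ge0 ?nrm_ge0.
have N0 : 0 < N by rewrite ltr_wpDl // mulr_ge0 ?nrm_ge0.
have e30 : 0 < e / 3 by rewrite divr_gt0.
have [d1 d10 h1] := hg _ (divr_gt0 e30 H0); have [d2 d20 h2] := hh _ (divr_gt0 e30 G0).
have [d3 d30 h3] := hh _ ltr01.
exists (Num.min 1 (Num.min (e / 3 / N) (Num.min d1 (Num.min d2 d3)))).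
  by rewrite !lt_min ltr01 divr_gt0 // d10 d20.
move=> w; rewrite !le_min => /and5P[w1 wN wd1 wd2 wd3]; have n0 := nrm_ge0 (w - z).
have hL : nrm (h w - h z) <= (nrm h' + 1) * nrm (w - z).
  have -> : h w - h z = (h w - h z - h' * (w - z)) + h' * (w - z) by ring.
  apply: le_trans (nrmD _ _) _; rewrite nrmM mulrDl addrC; apply: lerD => //; exact: h3.
have hH : nrm (h w) <= H.
  have -> : h w = h z + (h w - h z) by ring.
  apply: le_trans (nrmD _ _) _; rewrite /H -addrA lerD2l; apply: le_trans hL _.
  by rewrite ler_piMr.
have -> : g w * h w - g z * h z - (g' * h z + g z * h') * (w - z) =
  (g w - g z - g' * (w - z)) * h w + g' * (w - z) * (h w - h z) + g z * (h w - h z - h' * (w - z)) by ring.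
have b1 : nrm ((g w - g z - g' * (w - z)) * h w) <= e / 3 * nrm (w - z).
  rewrite nrmM; apply: le_trans (ler_pM (nrm_ge0 _) (nrm_ge0 _) (h1 _ wd1) hH) _.
  by rewrite mulrAC divfK // gt_eqF.
have b2 : nrm (g' * (w - z) * (h w - h z)) <= e / 3 * nrm (w - z).
  rewrite !nrmM; apply: le_trans (ler_wpM2l _ hL) _; first by rewrite mulr_ge0 ?nrm_ge0.
  have -> : nrm g' * nrm (w - z) * ((nrm h' + 1) * nrm (w - z)) = (nrm g' * (nrm h' + 1)) * nrm (w - z) * nrm (w - z) by ring.
  rewrite ler_wpM2r //; apply: (@le_trans _ _ (N * nrm (w - z))).
    by rewrite ler_wpM2r // /N lerDl.
  by rewrite mulrC -ler_pdivlMr.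
have b3 : nrm (g z * (h w - h z - h' * (w - z))) <= e / 3 * nrm (w - z).
  rewrite nrmM; apply: le_trans (ler_pM (nrm_ge0 _) (nrm_ge0 _) (_ : _ <= G) (h2 _ wd2)) _; first by rewrite lerDl.
  have -> : G * (e / 3 / G * nrm (w - z)) = e / 3 * nrm (w - z) by field; rewrite gt_eqF.
  exact: lexx.
apply: le_trans (nrmD _ _) _; apply: le_trans (lerD (le_trans (nrmD _ _) (lerD b1 b2)) b3) _.
by apply: le_of_eq; field.
Qed.

Lemma hol_inv c z : z != c -> hol (fun z => (z - c)^-1) z.
Proof.
move=> zc; have u0 : z - c != 0 by rewrite subr_eq0.
pose m := nrm (z - c); have m0 : 0 < m by rewrite nrm_gt0.
exists (- (z - c)^-2) => e e0; exists (Num.min (m / 2) (e * m ^+ 3 / 2)).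
  by rewrite lt_min !divr_gt0 // mulr_gt0 // exprn_gt0.
move=> w; rewrite le_min => /andP[w1 w2].
have hm : m / 2 <= nrm (w - c).
  have h : m <= nrm (w - c) + nrm (w - z).
    by rewrite /m -[nrm (w - z)]nrmN; apply: le_trans (nrmD _ _); rewrite (_ : w - c - (w - z) = z - c) //; ring.
  by move: h w1; move: (nrm (w - c)) (nrm (w - z)) => a b; lra.
have p0 : 0 < nrm (w - c) by apply: lt_le_trans hm; rewrite divr_gt0.
have v0 : w - c != 0 by apply/eqP => e1; move: p0; rewrite e1 nrm0 ltxx.
have -> : (w - c)^-1 - (z - c)^-1 - - (z - c)^-2 * (w - z) = (w - z) / ((w - c) * (z - c) ^+ 2) * (w - z).
  by field; rewrite u0 v0.
rewrite nrmM ler_wpM2r ?nrm_ge0 // nrmM nrmV nrmM nrmX -/m ler_pdivrMr ?mulr_gt0 ?exprn_gt0 //.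
apply: le_trans w2 _; apply: (@le_trans _ _ (e * (m / 2 * m ^+ 2))).
  by apply: le_of_eq; field.
by rewrite ler_wpM2l ?(ltW e0) // ler_wpM2r // exprn_ge0 // ltW.
Qed.

Lemma derivable_hol (phi : R[i]^o -> R[i]^o) z : derivable phi z 1 -> hol phi z.
Proof.
rewrite /derivable => /cvg_ex [l /cvgrPdist_le hl]; exists l => e e0.
have e0' : 0 < e%:C :> R[i] by rewrite ltcR.
have /= [_ /complex_le [dl dl0 <-] hd] := hl _ e0'.
exists (dl / 2) => [|w wz]; first by rewrite divr_gt0.
have [->|wn] := eqVneq w z.
  by rewrite !subrr mulr0 subr0 nrm0 mulr0.
pose k := w - z; have k0 : k != 0 by rewrite subr_eq0.
have kp : 0 < nrm k by rewrite nrm_gt0.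
have := hd k; rewrite /ball_ /= sub0r normrN => /(_ _ k0) h.
have {h} : `|(l : R[i]) - k^-1 * (phi (k * 1 + z) - phi z)| <= e%:C.
  apply: h; rewrite nrmE ltcR; apply: le_lt_trans wz _; lra.
rewrite nrmE lecR mulr1 /k subrK -/k => h.
have -> : phi w - phi z - l * k = - k * (l - k^-1 * (phi w - phi z)).
  have idt (a q De : R[i]) : q != 0 -> De - a * q = - q * (a - q^-1 * De) by move=> q0; field.
  exact: idt.
by rewrite nrmM nrmN mulrC ler_wpM2r ?nrm_ge0.
Qed.

End Holomorphic.

(** * Distance from the rays to the eigenvalues *)

Section FarDistance.
Context (R : realType).

Lemma far_dist (s t r : R) (k : nat) : 0 < s -> s < pi -> s <= `|t| -> `|t| <= pi -> 0 <= r ->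
  kap s * r <= nrm (r%:C * expi t - k%:R).
Proof.
move=> s0 sp st tp r0; have [w1 _] := wdir_dir t s0 sp; have h := Re_wzk k s0 sp st tp r0.
rewrite -[leRHS]mul1r -w1 -nrmM -nrmN; apply: le_trans (Re_le_nrm _).
rewrite raddfN /= lerNr; apply: le_trans h _; rewrite gerBl mulr_ge0 //.
exact: ltW (kap_gt0 s0 sp).
Qed.

Lemma far_neq (s t r : R) (k : nat) : 0 < s -> s < pi -> s <= `|t| -> `|t| <= pi -> 0 < r ->
  r%:C * expi t != k%:R.
Proof.
move=> s0 sp st tp r0; have h := far_dist k s0 sp st tp (ltW r0).
apply/eqP => e; move: h; rewrite e subrr nrm0 leNgt => /negP; apply.
by rewrite mulr_gt0 // kap_gt0.
Qed.

End FarDistance.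

(** * Bounded holomorphic functions with decay at 0 and at infinity *)

Section GoodFunctions.
Context (R : realType).
Local Notation leb := (@lebesgue_measure R).
Variables (theta A D : R) (phi : R[i] -> R[i]).
Hypothesis th0 : 0 < theta.
Hypothesis thp : theta < pi.
Hypothesis A0 : 0 <= A.
Hypothesis D0 : 0 <= D.
Hypothesis hphi : forall r s, 0 < r -> `|s| < theta -> hol phi (r%:C * expi s).
Hypothesis phiA : forall r s, 0 < r -> `|s| < theta -> nrm (phi (r%:C * expi s)) <= A.
Hypothesis phiD : forall r s, 0 < r -> `|s| < theta -> nrm (phi (r%:C * expi s)) / r <= D * (1 + r ^+ 2)^-1.

(** The contribution of the ray of angle t to 2 pi i phi(k), up to orientation. *)
Definition mval (k : nat) t : R[i] := PI (ray (fun z => phi z / (z - k%:R)) t).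

Lemma hol_ray_fun k s r t : 0 < s -> s < theta -> 0 < r -> s <= `|t| -> `|t| < theta ->
  hol (fun z => phi z / (z - k%:R)) (r%:C * expi t) /\
  nrm (phi (r%:C * expi t) / (r%:C * expi t - k%:R)) <= D / kap s * (1 + r ^+ 2)^-1.
Proof.
move=> s0 st r0 h1 h2; have sp := lt_trans st thp; have tp : `|t| <= pi by apply/ltW/(lt_trans h2).
have n0 := far_neq k s0 sp h1 tp r0; have k0 := kap_gt0 s0 sp.
split; first by apply: holM; [exact: hphi|exact: hol_inv].
have hd := far_dist k s0 sp h1 tp (ltW r0); have kr : 0 < kap s * r by exact: mulr_gt0.
rewrite nrmM nrmV; apply: (@le_trans _ _ (nrm (phi (r%:C * expi t)) * (kap s * r)^-1)).
  by rewrite ler_wpM2l ?nrm_ge0 // lef_pV2 ?posrE // (lt_le_trans kr).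
have -> : nrm (phi (r%:C * expi t)) * (kap s * r)^-1 = nrm (phi (r%:C * expi t)) / r / kap s.
  by field; rewrite !gt_eqF.
by rewrite [leRHS]mulrAC ler_wpM2r ?invr_ge0 ?(ltW k0) // phiD.
Qed.

Lemma mval_ray k s b b' : 0 < s -> s < theta -> b <= b' -> (forall t, b <= t -> t <= b' -> s <= `|t| /\ `|t| < theta) ->
  mval k b = mval k b'.
Proof.
move=> s0 st bb h; have k0 := kap_gt0 s0 (lt_trans st thp).
apply: (@ray_shift R _ b b' (D / kap s)) => //; first by rewrite divr_ge0 // ltW.
  by move=> r t r0 /h h1 /h1 [h2 h3]; case: (hol_ray_fun k s0 st r0 h2 h3).
by move=> r t r0 /h h1 /h1 [h2 h3]; case: (hol_ray_fun k s0 st r0 h2 h3).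
Qed.

(** The rays between the two angles avoid the positive axis, which contains the poles. The contour
    angle, which may approach 0 or theta, can thus be replaced by a fixed one. *)
Lemma mval_shift k nu nu' : 0 < nu -> nu < theta -> 0 < nu' -> nu' < theta ->
  mval k nu = mval k nu' /\ mval k (- nu) = mval k (- nu').
Proof.
wlog le : nu nu' / nu <= nu' => [hw|] a b c e.
  case: (leP nu nu') => h; first exact: hw.
  by have [-> ->] := hw nu' nu (ltW h) c e a b.
split.
  apply: (mval_ray k a b le) => t h1 h2; rewrite ger0_norm ?(le_trans (ltW a)) //; split=> //.
  exact: le_lt_trans h2 e.
symmetry; apply: (mval_ray k a b); first by rewrite lerN2.
move=> t h1 h2; have t0 : t <= 0 by apply: le_trans h2 _; rewrite oppr_le0 ltW.
by rewrite ler0_norm //; split; [rewrite lerNr|apply: le_lt_trans e; rewrite lerNl].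
Qed.

Let nu0 := theta / 2.
Let n00 : 0 < nu0. Proof. by rewrite divr_gt0. Qed.
Let n0t : nu0 < theta. Proof. by rewrite /nu0; move: th0; lra. Qed.
Let n0p : nu0 < pi. Proof. exact: lt_trans n0t thp. Qed.
Let kp := kap nu0.
Let kp0 : 0 < kp. Proof. exact: kap_gt0. Qed.

Section OneSide.
Variable t : R.
Hypothesis ht : `|t| = nu0.

Let tt : `|t| < theta. Proof. by rewrite ht. Qed.
Let w := wdir nu0 t.
Let ps r := phi (r%:C * expi t).

Let dw : dir kp w. Proof. exact: wdir_dir. Qed.
Let Hre : complex.Re (w * expi t) <= - kp.
Proof.
have := wdir_far n00 (_ : nu0 <= `|t|) (_ : `|t| <= pi) ler01.
by rewrite mulr1 mul1r; apply; rewrite ht // ltW.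
Qed.
Let Hrew : 0 <= complex.Re w. Proof. by case: dw => _; apply: le_trans; exact: ltW. Qed.
Let pc : pcont (ps : R -> cplx R).
Proof.
move=> u x x0 ux; apply: (hol_cont (hphi x0 tt)); apply: cvg_cplxM; last exact: cvg_cst.
by apply: cvg_complex => //; exact: cvg_cst.
Qed.
Let pA r : 0 < r -> nrm (ps r) <= A. Proof. by move=> r0; exact: phiA. Qed.
Let pD r : 0 < r -> nrm (ps r / r%:C) <= D * (1 + r ^+ 2)^-1.
Proof. by move=> r0; rewrite nrmM nrmV nrm_real gtr0_norm //; exact: phiD. Qed.

Definition sc (t de : R) j : R[i] := hc (fun r => phi (r%:C * expi t)) (expi t) (wdir nu0 t) de j.
Definition sH (t ta : R) : R[i] := Hh (fun r => phi (r%:C * expi t)) (expi t) (wdir nu0 t) ta.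

Lemma sc_le de j : 0 < de -> nrm (sc t de j) <= 2 * A / kp / j.+1%:R.
Proof. exact: (hc_le kp0 dw.1 (nrm_expi t) A0 D0 Hre pc pA pD). Qed.

Lemma sc_cvg k :
  (\sum_(j < nstep m) sc t (step R m) j * ee w (j.+1%:R * step R m) ^+ k : cplx R) @[m --> \oo] -->
  (- mval k t : cplx R).
Proof.
have h := hc_sum_cvg kp0 dw.1 (nrm_expi t) D0 Hre Hrew pc pD (k := k).
suff -> : mval k t = PI (fun r => ps r * expi t / (r%:C * expi t - k%:R) : cplx R) by exact: h.
by apply: (congr1 (fun q : R -> cplx R => PI q : R[i])); apply/funext => r; rewrite /ray /ps mulrAC.
Qed.

Lemma sH_trunc ta : 0 < ta ->
  nrm (sH t ta - CS 0 ta^-1 (ray (fun z => phi z / z) t)) <= 2 * A * expR kp / kp.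
Proof.
move=> t0; have h := Hh_trunc kp0 dw.1 (nrm_expi t) A0 D0 Hre pc pA pD t0.
suff -> : CS 0 ta^-1 (ray (fun z => phi z / z) t) = CS 0 ta^-1 (fun r => ps r / r%:C : cplx R) by exact: h.
apply: (congr1 (fun q : R -> cplx R => BI leb q : R[i])); apply/funext => r; rewrite /on; case: ifP => // /andP[r0 _].
have r0' : r%:C != 0 :> R[i] by rewrite eq_complex /= eqxx andbT gt_eqF.
have et : expi t != 0 by apply/eqP => e; have := nrm_expi t; rewrite e nrm0 => /eqP; rewrite eq_sym oner_eq0.
by rewrite /ray /ps; field; rewrite et r0'.
Qed.

End OneSide.

(** 2/kp comes from single coefficients, by [sc_le]. The other summand is twice the bound of
    [sH_diff], since a partial sum telescopes to a difference of two values. *)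
Definition CA : R := 2 / kp + 2 * (4 * expR kp / kp + 2 * theta).

Lemma CA_ge0 : 0 <= CA.
Proof. by rewrite /CA !addr_ge0 // ?divr_ge0 ?mulr_ge0 ?addr_ge0 ?divr_ge0 ?mulr_ge0 ?expR_ge0 // ltW. Qed.

(** Each [sH] is compared with the integral of phi(z)/z over its ray up to the radius 1/ta. These
    two integrals differ by a bounded amount, because phi(z)/z is holomorphic between the rays. *)
Lemma sH_diff ta : 0 < ta -> nrm (sH nu0 ta - sH (- nu0) ta) <= A * (4 * expR kp / kp + 2 * theta).
Proof.
move=> t0; have ti : 0 < ta^-1 by rewrite invr_gt0.
have h1 := sH_trunc (ger0_norm (ltW n00)) t0.
have hm : `|- nu0| = nu0 by rewrite normrN ger0_norm // ltW.
have h2 := sH_trunc hm t0.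
have bb : - nu0 <= nu0 by rewrite ge0_cp // ltW.
have in_ s : - nu0 <= s -> s <= nu0 -> `|s| < theta by move=> a b; apply: le_lt_trans n0t; rewrite ler_norml a.
have zE r s : 0 < r -> nrm (phi (r%:C * expi s) / (r%:C * expi s)) = nrm (phi (r%:C * expi s)) / r.
  by move=> r0; rewrite nrmM nrmV nrmM nrm_expi mulr1 nrm_real gtr0_norm.
have h3 : nrm (CS 0 ta^-1 (ray (fun z => phi z / z) (- nu0)) - CS 0 ta^-1 (ray (fun z => phi z / z) nu0)) <= 2 * A * (nu0 - - nu0).
  apply: (@ray_shift_trunc R _ (- nu0) nu0 D) => //.
  - move=> r s r0 a b; apply: holM; first by apply: hphi => //; exact: in_.
    have h : hol (fun z => (z - 0)^-1) (r%:C * expi s).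
      apply: hol_inv; apply/eqP => e; have := nrmM r%:C (expi s); rewrite e nrm0 nrm_expi mulr1 nrm_real gtr0_norm //.
      by move=> /eqP; rewrite lt_eqF.
    by move: h; congr hol; apply/funext => z; rewrite subr0.
  - by move=> r s r0 a b; rewrite zE //; apply: phiD => //; exact: in_.
  - by move=> r s r0 a b; rewrite zE // ler_wpM2r ?invr_ge0 ?(ltW r0) //; apply: phiA => //; exact: in_.
move: h1 h2 h3; move: (sH _ _) (sH _ _) (CS _ _ _) (CS _ _ _) => b a e c h1 h2 h3.
have -> : a - b = (a - c) - (b - e) - (e - c) by ring.
apply: le_trans (nrmB _ _) _; apply: le_trans (lerD (le_trans (nrmB _ _) (lerD h1 h2)) h3) _.
by apply: le_of_eq; rewrite /nu0; field; rewrite gt_eqF.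
Qed.

Context (X : completeNormedModType R[i]) (d : nat).
Variables (B1 B2 : 'I_d -> set (X * X)) (K : R).
Hypothesis K0 : 0 <= K.
Hypothesis hK : forall wp wm (de : R) J (cp cm : nat -> R[i]) (D : R) n (y : nat -> X), dir kp wp -> dir kp wm -> 0 < de -> 0 <= D ->
  (forall j, (j < J)%N -> nrm (cp j) <= D / j.+1%:R) -> (forall j, (j < J)%N -> nrm (cm j) <= D / j.+1%:R) ->
  (forall J', (J' <= J)%N -> nrm (\sum_(j < J') (cp j - cm j)) <= D) ->
  (forall k, oscillator0 B1 B2 (y k, k%:R *: y k)) ->
  nrm (\sum_(k < n) (\sum_(j < J) (cp j * ee wp (j.+1%:R * de) ^+ k - cm j * ee wm (j.+1%:R * de) ^+ k)) *: y k)
    <= K * D * nrm (\sum_(k < n) y k).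

(** The multiplier estimate is applied to the increments on the rays of angle nu0 and -nu0; its
    bound does not involve the mesh, which then tends to 0. *)
Lemma mval_bound n y : eigs (oscillator0 B1 B2) y ->
  nrm (\sum_(k < n) (mval k (- nu0) - mval k nu0) *: y k) <= K * (A * CA) * nrm (\sum_(k < n) y k).
Proof.
move=> hy; have hp : `|nu0| = nu0 by rewrite ger0_norm // ltW.
have hm : `|- nu0| = nu0 by rewrite normrN.
have Dn : 0 <= A * CA by rewrite mulr_ge0 // CA_ge0.
have le1 : 2 * A / kp <= A * CA.
  have -> : 2 * A / kp = A * (2 / kp) by rewrite mulrAC mulrC.
  by rewrite ler_wpM2l // /CA lerDl mulr_ge0 // addr_ge0 ?divr_ge0 ?mulr_ge0 ?expR_ge0 // ltW.
have h1 t (ht : `|t| = nu0) m j : (j < nstep m)%N -> nrm (sc t (step R m) j) <= A * CA / j.+1%:R.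
  move=> _; apply: le_trans (sc_le ht j (step_gt0 R m)) _; by rewrite ler_wpM2r.
have h3 m J : (J <= nstep m)%N -> nrm (\sum_(j < J) (sc nu0 (step R m) j - sc (- nu0) (step R m) j)) <= A * CA.
  move=> _; have s0 := step_gt0 R m; pose G ta := sH nu0 ta - sH (- nu0) ta.
  have -> : \sum_(j < J) (sc nu0 (step R m) j - sc (- nu0) (step R m) j) = G (J.+1%:R * step R m) - G (1 * step R m).
    elim: J => [|J ih]; first by rewrite big_ord0 subrr.
    have idt (p q u v c : R[i]) : p - u - c + (q - p - (v - u)) = q - v - c by ring.
    have e t : sc t (step R m) J = sH t (J.+2%:R * step R m) - sH t (J.+1%:R * step R m) by [].
    by rewrite big_ord_recr /= ih !e /G; exact: idt.
  apply: le_trans (nrmB _ _) _; have p1 : 0 < J.+1%:R * step R m by rewrite mulr_gt0.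
  have p2 : 0 < 1 * step R m by rewrite mul1r.
  apply: le_trans (lerD (sH_diff p1) (sH_diff p2)) _.
  have -> : A * CA = A * (4 * expR kp / kp + 2 * theta) + A * (4 * expR kp / kp + 2 * theta) + A * (2 / kp).
    by rewrite /CA; move: (4 * _ / _) (2 / kp) => a b; ring.
  by rewrite lerDl mulr_ge0 // divr_ge0 // ltW.
have dp := wdir_dir nu0 n00 n0p; have dm := wdir_dir (- nu0) n00 n0p.
have b m := hK n dp dm (step_gt0 R m) Dn (h1 nu0 hp m) (h1 (- nu0) hm m) (h3 m) hy.
apply: (nrm_lim_le _ b); apply: cvg_sums => k; apply: cvgZ; last exact: cvg_cst.
under eq_fun do rewrite sumrB.
have -> : mval k (- nu0) - mval k nu0 = - mval k nu0 - (- mval k (- nu0)) by rewrite opprK addrC.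
by apply: cvg_cplxB; exact: sc_cvg.
Qed.

End GoodFunctions.

(** * The contour integral defining phi(L) *)

Section ContourIntegrals.
Context (R : realType) (X : completeNormedModType R[i]) (d : nat).
Variables (A B : 'I_d -> set (X * X)) (U V : 'I_d -> R -> {linear X -> X}).
Hypothesis HW : weyl_pair A B U V.
Local Notation L0 := (oscillator0 A B).
Local Notation L := (oscillator A B).
Local Notation leb := (@lebesgue_measure R).
Variables (nu M : R).
Hypothesis nu0 : 0 < nu.
Hypothesis nup : nu < pi.
Hypothesis M0 : 0 <= M.
Hypothesis hM : forall r t, 0 < r -> nu <= `|t| -> `|t| <= pi -> eigen_bound L0 (r%:C * expi t) (M / r).
Implicit Types (phi : R[i] -> R[i]) (f : X).

Lemma real_cvgP (u : nat -> R) (x : R) : u k @[k --> \oo] --> x ->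
  forall e, 0 < e -> exists N, forall k, (N <= k)%N -> `|u k - x| <= e.
Proof.
move=> h e e0; have hc : ((u k)%:C : cplx R) @[k --> \oo] --> (x%:C : cplx R).
  by apply: cvg_complex => //; exact: cvg_cst.
have [N hN] := (proj1 (cvg_nrmP _ _) hc) _ e0; exists N => k /hN.
by rewrite -[nrm _]/(nrm ((u k)%:C - x%:C)) -rmorphB nrm_real.
Qed.

Lemma pcont_resolvent t f : nu <= `|t| -> `|t| <= pi -> pcont (fun r => resolvent L (r%:C * expi t) f).
Proof.
move=> h1 h2 u x x0 ux; apply/cvg_nrmP => e e0.
have x20 : 0 < x / 2 by rewrite divr_gt0.
pose C := M / (x / 2) * (M / x) * nrm f + 1.
have C0 : 0 < C by rewrite ltr_wpDl // !mulr_ge0 ?nrm_ge0 ?invr_ge0 // ltW.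
have m0 : 0 < Num.min (x / 2) (e / C) by rewrite lt_min x20 divr_gt0.
have [N hN] := real_cvgP ux m0; exists N => k /hN; rewrite le_min => /andP[k1 k2].
have uk : x / 2 <= u k by move: k1; rewrite ler_distl => /andP[h _]; move: h; lra.
have uk0 : 0 < u k := lt_le_trans x20 uk.
have uM : 0 <= M / u k by rewrite divr_ge0 // ltW.
apply: le_trans (resolvent_diff HW f (hM uk0 h1 h2) (hM x0 h1 h2) uM) _.
rewrite -mulrBl nrmM nrm_expi mulr1 -rmorphB nrm_real distrC.
apply: (@le_trans _ _ (C * `|u k - x|)); last by rewrite mulrC -ler_pdivlMr.
rewrite mulrAC ler_wpM2r //; apply: (@le_trans _ _ (M / (x / 2) * (M / x) * nrm f)); last by rewrite /C lerDl.
by rewrite ler_wpM2r ?nrm_ge0 // ler_wpM2r ?divr_ge0 ?(ltW x0) // ler_wpM2l // lef_pV2 ?posrE.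
Qed.

Let absnu : nu <= `|nu|. Proof. exact: ler_norm. Qed.
Let absnup : `|nu| <= pi. Proof. by rewrite ger0_norm ltW. Qed.
Let absN : nu <= `|- nu|. Proof. by rewrite normrN. Qed.
Let absNp : `|- nu| <= pi. Proof. by rewrite normrN. Qed.

Definition ray_cont phi t := pcont (fun r => phi (r%:C * expi t) : cplx R).

Lemma pcont_contour phi f : ray_cont phi nu -> ray_cont phi (- nu) -> pcont (contour_integrand L nu phi f).
Proof.
move=> cp cm u x x0 ux; apply: cvgB; apply: cvgZ.
- by apply: cvg_cplxM; [exact: cm|exact: cvg_cst].
- exact: pcont_resolvent.
- by apply: cvg_cplxM; [exact: cp|exact: cvg_cst].
- exact: pcont_resolvent.
Qed.

(** The density of the H^1 norm on the contour of angle nu, up to 1/(2 pi). As the resolvent is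
    O(1/r), it dominates the contour integrand. *)
Definition hmaj phi r : R := if 0 < r then (nrm (phi (r%:C * expi nu)) + nrm (phi (r%:C * expi (- nu)))) / r else 0.

Lemma contour_le phi f r : nrm (on (@pos R) (contour_integrand L nu phi f) r) <= M * nrm f * hmaj phi r.
Proof.
rewrite /on /hmaj /pos; case: ifP => r0; last by rewrite nrm0 mulr0.
rewrite /contour_integrand; apply: le_trans (nrmB _ _) _; rewrite !nrmZ !nrmM !nrm_expi !mulr1.
have [_ b1] := resolventP HW (hM r0 absnu absnup) f; have [_ b2] := resolventP HW (hM r0 absN absNp) f.
apply: le_trans (lerD (ler_wpM2l (nrm_ge0 _) b2) (ler_wpM2l (nrm_ge0 _) b1)) _.
by apply: le_of_eq; rewrite -mulrDl addrC; move: (nrm _ + nrm _) => q; field; rewrite gt_eqF.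
Qed.

Lemma measurable_hmaj phi : ray_cont phi nu -> ray_cont phi (- nu) -> measurable_fun setT (hmaj phi).
Proof.
move=> cp cm.
have m t : ray_cont phi t -> measurable_fun setT (fun r => nrm (on (@pos R) (fun r => phi (r%:C * expi t) : cplx R) r)).
  by move=> c; exact: (bmeas_nrm (bmeas_pos c)).
have -> : hmaj phi = fun r => if 0 < r then (nrm (on (@pos R) (fun r => phi (r%:C * expi nu) : cplx R) r) + nrm (on (@pos R) (fun r => phi (r%:C * expi (- nu)) : cplx R) r)) / r else 0.
  by apply/funext => r; rewrite /hmaj /on /pos; case: ifP => // ->.
have -> : (fun r => if 0 < r then (nrm (on (@pos R) (fun r => phi (r%:C * expi nu) : cplx R) r) + nrm (on (@pos R) (fun r => phi (r%:C * expi (- nu)) : cplx R) r)) / r else 0) =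
  (fun r => (nrm (on (@pos R) (fun r => phi (r%:C * expi nu) : cplx R) r) + nrm (on (@pos R) (fun r => phi (r%:C * expi (- nu)) : cplx R) r)) * nrm (on (@pos R) (fun r => (r%:C)^-1 : cplx R) r)).
  apply/funext => r; rewrite /on /pos; case: ifP => r0; last by rewrite nrm0 mulr0.
  have e : nrm ((r%:C)^-1 : R[i]) = r^-1 by rewrite nrmV nrm_real gtr0_norm.
  by rewrite r0; congr (_ * _); exact: esym e.
apply: measurable_funM; first by apply: measurable_funD; exact: m.
apply: (bmeas_nrm (bmeas_pos _)) => u x x0 ux; apply: cvg_cplxV.
  by rewrite eq_complex /= eqxx andbT gt_eqF.
by apply: cvg_complex => //; exact: cvg_cst.
Qed.

Section Integrable.
Variables (phi : R[i] -> R[i]) (N : R).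
Hypothesis cp : ray_cont phi nu.
Hypothesis cm : ray_cont phi (- nu).
Hypothesis hN : (\int[leb]_r (hmaj phi r)%:E <= N%:E)%E.

Let hmaj_ge0 r : 0 <= hmaj phi r.
Proof. by rewrite /hmaj; case: ifP => // r0; rewrite divr_ge0 ?addr_ge0 ?nrm_ge0 // ltW. Qed.

Lemma int_hmaj (c : R) : 0 <= c -> (\int[leb]_r (c * hmaj phi r)%:E <= (c * N)%:E)%E.
Proof.
move=> c0; under eq_integral do rewrite EFinM; rewrite ge0_integralZl //.
- by rewrite EFinM lee_wpmul2l // lee_fin.
- by apply: measurableT_comp; [exact: EFin_measurable|exact: measurable_hmaj].
- by move=> r _; rewrite lee_fin.
Qed.

Lemma contour_int f : Bint leb (on (@pos R) (contour_integrand L nu phi f)) /\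
  nrm (PI (contour_integrand L nu phi f)) <= M * N * nrm f.
Proof.
have c0 : 0 <= M * nrm f by rewrite mulr_ge0 ?nrm_ge0.
have mb : bmeas (on (@pos R) (contour_integrand L nu phi f)).
  by apply: bmeas_pos; exact: pcont_contour.
have mG : measurable_fun setT (fun r => M * nrm f * hmaj phi r).
  by apply: measurable_funM => //; exact: measurable_hmaj.
have i1 := int_hmaj c0; have h := contour_le phi f.
split; first by apply: (@le_Bint R _ _ leb X _ _ mb mG h); apply: le_lt_trans i1 _; rewrite ltry.
by rewrite mulrAC; exact: (@BI_leG R _ _ leb X _ _ _ mb mG h i1).
Qed.

Lemma contour_lin f g : PI (contour_integrand L nu phi (f - g)) =
  PI (contour_integrand L nu phi f) - PI (contour_integrand L nu phi g).
Proof.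
have [_ <-] := BintB (contour_int f).1 (contour_int g).1; congr (BI leb _); apply/funext => r.
rewrite /on /pos; case: ifP => r0; last by rewrite subr0.
have e z m : eigen_bound L0 z m -> resolvent L z (f - g) = resolvent L z f - resolvent L z g.
  by move=> hz; have := resolvent_lin HW (-1) g f hz; rewrite !scaleN1r addrC => ->; rewrite addrC.
rewrite /contour_integrand (e _ _ (hM r0 absnu absnup)) (e _ _ (hM r0 absN absNp)) !scalerBr.
by rewrite !opprB addrACA [RHS]addrACA; congr (_ + _); exact: addrC.
Qed.

(** Absolute convergence makes the integral continuous in f with a bound depending on N; this
    suffices to carry the sharper constant C from the dense span of eigenvectors to X. *)
Lemma contour_dense (C : R) : 0 <= C ->
  (forall n y, eigs L0 y -> nrm (PI (contour_integrand L nu phi (\sum_(k < n) y k))) <= C * nrm (\sum_(k < n) y k)) ->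
  forall f, nrm (PI (contour_integrand L nu phi f)) <= C * nrm f.
Proof.
move=> C0 hC f; pose T g := PI (contour_integrand L nu phi g).
have N0 : 0 <= N.
  rewrite -lee_fin; apply: le_trans hN; apply: integral_ge0 => r _; rewrite lee_fin; exact: hmaj_ge0.
have MN : 0 <= M * N by exact: mulr_ge0.
suff /boolp.choice[s hs] : forall n, exists x, sp L0 x /\ nrm (f - x) <= step R n.
  have cs : s n @[n --> \oo] --> f by apply: (cvg_step ler01) => n; rewrite mul1r nrmC; exact: (hs n).2.
  have ct : T (s n) @[n --> \oo] --> T f.
    apply: (cvg_step MN) => n; rewrite nrmC /T -contour_lin; apply: le_trans (contour_int _).2 _.
    exact: ler_wpM2l (hs n).2.
  by apply: (le_limP ct cs C0) => n; have [[k [y [hy ->]]] _] := hs n; exact: hC.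
by move=> n; have [x h1 h2] := oscillator_dense HW f (step_gt0 R n); exists x.
Qed.

End Integrable.

(** On an eigenvector the resolvent is the scalar 1/(z - k), and the decay of phi lets the two rays
    be integrated separately. *)
Lemma contour_eigen (theta D : R) phi n y : nu < theta -> theta < pi -> 0 <= D ->
  (forall r s, 0 < r -> `|s| < theta -> hol phi (r%:C * expi s)) ->
  (forall r s, 0 < r -> `|s| < theta -> nrm (phi (r%:C * expi s)) / r <= D * (1 + r ^+ 2)^-1) ->
  eigs L0 y ->
  PI (contour_integrand L nu phi (\sum_(k < n) y k)) =
  \sum_(k < n) (mval phi k (- nu) - mval phi k nu) *: y k.
Proof.
move=> nt tp D0 hphi phiD hy.
pose g (k : nat) (z : R[i]) := phi z / (z - k%:R).
have k0 : 0 < kap nu by exact: kap_gt0.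
have Dk : 0 <= D / kap nu by rewrite divr_ge0 // ltW.
have bi t k : `|t| = nu -> Bint leb (on (@pos R) (ray (g k) t)).
  move=> ht; have h r s : 0 < r -> t <= s -> s <= t -> hol (g k) (r%:C * expi s) /\ nrm (g k (r%:C * expi s)) <= D / kap nu * (1 + r ^+ 2)^-1.
    move=> r0 a b; have -> : s = t by apply/le_anti; rewrite a b.
    by apply: (hol_ray_fun tp hphi phiD) => //; rewrite ht.
  have cr : pcont (ray (g k) t) by apply: (@pcont_ray R (g k) t t) => // r s r0 a b; case: (h r s r0 a b).
  have [|//] := @PI_le R (cplx R) (ray (g k) t) cr _ Dk.
  by move=> r r0; apply: (@ray_maj R (g k) t t) => // r' s r0' a b; case: (h r' s r0' a b).
pose F (k : 'I_n) (r : R) : X := (on (@pos R) (ray (g k) (- nu)) r - on (@pos R) (ray (g k) nu) r : R[i]) *: y k.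
have hF k : Bint leb (F k) /\ BI leb (F k) = (mval phi k (- nu) - mval phi k nu) *: y k.
  have [||b1 b2] := BintB (bi (- nu) k _) (bi nu k _); rewrite ?normrN ?ger0_norm ?(ltW nu0) //.
  by have [c1 c2] := BI_scalar (y k) b1; split=> //; rewrite c2 b2.
have [_ hs] := BI_sum (index_enum 'I_n) (fun k => (hF k).1).
rewrite -(eq_bigr _ (fun k _ => (hF k).2)) -hs; congr (BI leb _); apply/funext => r.
rewrite /on /F /on /pos; case: ifP => r0; last by rewrite big1 // => k _; rewrite subrr scale0r.
rewrite /contour_integrand (resolvent_eigen HW (hM r0 absnu absnup) n hy) (resolvent_eigen HW (hM r0 absN absNp) n hy).
rewrite !scaler_sumr -sumrB; apply: eq_bigr => k _; rewrite !scalerA -scalerBl; congr (_ *: _).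
by rewrite /ray /g; congr (_ - _); rewrite mulrAC.
Qed.

End ContourIntegrals.

(** * Damping of bounded functions on a sector *)

Section Regularisation.
Context (R : realType).
Variable theta : R.
Hypothesis th0 : 0 < theta.
Hypothesis thp : theta < pi.
Let c := cos (theta / 2).

Let c0 : 0 < c.
Proof. by apply: cos_gt0_pihalf; apply/andP; split; move: th0 thp; lra. Qed.

(** After rotation by -s/2 both summands make the angle |s|/2 with the positive axis. *)
Lemma sector_add (a b s : R) : 0 <= a -> 0 <= b -> `|s| < theta -> c * (a + b) <= nrm (a%:C + b%:C * expi s).
Proof.
move=> a0 b0 hs; rewrite -[leRHS]mul1r -(nrm_expi (- (s / 2))) -nrmM; apply: le_trans (Re_le_nrm _).
have -> : expi (- (s / 2)) * (a%:C + b%:C * expi s) = a%:C * expi (- (s / 2)) + b%:C * expi (s / 2).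
  rewrite mulrDr mulrC mulrCA -expiD; congr (_ + _ * expi _); by field.
rewrite raddfD /= !mul0r !subr0 cosN.
have h : c <= cos (s / 2).
  have hn : `|s / 2| = `|s| / 2 by rewrite normrM [`|2^-1|]gtr0_norm // invr_gt0.
  have h1 : theta / 2 \in `[0, pi] by rewrite in_itv /=; apply/andP; split; move: th0 thp; lra.
  have h2 : `|s| / 2 \in `[0, pi].
    by rewrite in_itv /=; apply/andP; split; move: thp hs (normr_ge0 s); move: `|s| => x; lra.
  by rewrite -(cos_norm (s / 2)) hn; apply: ltW; rewrite ltr_cos //; move: hs; move: `|s| => x; lra.
by rewrite mulrDr [c * a]mulrC [c * b]mulrC lerD // ler_wpM2l.
Qed.

(** This is z / ((z + e)(1 + e z)): it decays at 0 and at infinity, is bounded uniformly in e, and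
    tends to 1 as e tends to 0. The denominators are written as z - c, the form in [hol_inv]. *)
Definition damp (e : R) (z : R[i]) : R[i] := z * ((z - - e%:C)^-1 * (e^-1%:C * (z - - e^-1%:C)^-1)).

Section Point.
Variables (e r s : R).
Hypothesis e0 : 0 < e.
Hypothesis r0 : 0 < r.
Hypothesis hs : `|s| < theta.
Let z := r%:C * expi s.

Let ei0 : 0 < e^-1. Proof. by rewrite invr_gt0. Qed.

Let n1 : c * (e + r) <= nrm (z - - e%:C).
Proof. by rewrite opprK [z + _]addrC; apply: sector_add hs; exact: ltW. Qed.

Let n2 : c * (e^-1 + r) <= nrm (z - - e^-1%:C).
Proof. by rewrite opprK [z + _]addrC; apply: sector_add hs; exact: ltW. Qed.

Let p1 : 0 < c * (e + r). Proof. by rewrite mulr_gt0 // addr_gt0. Qed.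
Let p2 : 0 < c * (e^-1 + r). Proof. by rewrite mulr_gt0 // addr_gt0. Qed.

Let z1 : z - - e%:C != 0.
Proof. by apply/eqP => h; move: n1; rewrite h nrm0 leNgt p1. Qed.
Let z2 : z - - e^-1%:C != 0.
Proof. by apply/eqP => h; move: n2; rewrite h nrm0 leNgt p2. Qed.

Let nz : nrm z = r. Proof. by rewrite nrmM nrm_expi mulr1 nrm_real gtr0_norm. Qed.

Lemma hol_damp : hol (damp e) z.
Proof.
have hid : hol (fun z : R[i] => z) z.
  by have := hol_affine 0 1 z; congr hol; apply/funext => u; rewrite add0r mul1r.
have hcst : hol (fun=> e^-1%:C) z.
  by have := hol_affine e^-1%:C 0 z; congr hol; apply/funext => u; rewrite mul0r addr0.
apply: holM; first exact: hid.
apply: holM; first by apply: hol_inv; rewrite -subr_eq0.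
by apply: holM; [exact: hcst|apply: hol_inv; rewrite -subr_eq0].
Qed.

Let dampE : nrm (damp e z) <= r / (c ^+ 2 * ((e + r) * (1 + e * r))).
Proof.
rewrite /damp nrmM nz ler_wpM2l ?(ltW r0) // nrmM nrmV nrmM nrmV nrm_real gtr0_norm //.
have -> : (c ^+ 2 * ((e + r) * (1 + e * r)))^-1 = (c * (e + r))^-1 * (e^-1 * (c * (e^-1 + r))^-1).
  have h : 0 < 1 + e * r by rewrite addr_gt0 // mulr_gt0.
  have -> : e^-1 + r = (1 + e * r) / e by field; rewrite gt_eqF.
  by move: (1 + e * r) h => u h; field; rewrite !gt_eqF // addr_gt0.
apply: ler_pM; rewrite ?invr_ge0 ?nrm_ge0 //.
- by rewrite mulr_ge0 ?invr_ge0 ?nrm_ge0 // ltW.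
- by rewrite lef_pV2 ?posrE // (lt_le_trans p1).
by rewrite ler_wpM2l ?(ltW ei0) // lef_pV2 ?posrE // (lt_le_trans p2).
Qed.

Let c2 : 0 < c ^+ 2. Proof. by rewrite exprn_gt0. Qed.
Let q0 : 0 < (e + r) * (1 + e * r). Proof. by rewrite mulr_gt0 ?addr_gt0 ?mulr_gt0. Qed.

Let cq : 0 < c ^+ 2 * ((e + r) * (1 + e * r)). Proof. exact: mulr_gt0. Qed.

Lemma damp_le : nrm (damp e z) <= (c ^+ 2)^-1.
Proof.
apply: le_trans dampE _; rewrite (ler_pdivrMr _ _ cq) mulKf ?gt_eqF //.
have : 0 <= e * r * r by rewrite !mulr_ge0 // ltW.
have : 0 <= e * r * e by rewrite !mulr_ge0 // ltW.
by move: e0; lra.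
Qed.

Lemma damp_decay : nrm (damp e z) / r <= (c ^+ 2 * e)^-1 * (1 + r ^+ 2)^-1.
Proof.
rewrite ler_pdivrMr //; apply: le_trans dampE _.
rewrite [leRHS]mulrC ler_wpM2l ?(ltW r0) // -invfM.
have h : 0 < 1 + r ^+ 2 by rewrite ltr_wpDr ?sqr_ge0.
rewrite lef_pV2 ?posrE ?mulr_gt0 ?addr_gt0 ?mulr_gt0 // -mulrA ler_wpM2l ?(ltW c2) //.
have : 0 <= e * r * e by rewrite !mulr_ge0 // ltW.
by move: r0; lra.
Qed.

Lemma damp_diff : e <= 1 -> nrm (damp e z - 1) <= (1 + r + r ^+ 2) / (c ^+ 2 * r) * e.
Proof.
move=> e1; have e0' : e%:C != 0 :> R[i] by rewrite eq_complex /= eqxx andbT gt_eqF.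
have -> : damp e z - 1 = - e%:C * (1 + z ^+ 2 + e%:C * z) * ((z - - e%:C)^-1 * (e^-1%:C * (z - - e^-1%:C)^-1)).
  have ee : e^-1%:C * e%:C = 1 :> R[i] by rewrite -rmorphM mulVf // gt_eqF.
  rewrite /damp; move: (e%:C) (e^-1%:C) ee z1 z2 => a b ee h1 h2.
  have h1' : z + a != 0 by rewrite -[a]opprK.
  have h2' : z + b != 0 by rewrite -[b]opprK.
  rewrite !opprK; apply: (mulIf (mulf_neq0 h1' h2')); rewrite mulrBl mul1r.
  have -> : z * ((z + a)^-1 * (b * (z + b)^-1)) * ((z + a) * (z + b)) = z * b by field; rewrite h1' h2'.
  have -> : - a * (1 + z ^+ 2 + a * z) * ((z + a)^-1 * (b / (z + b))) * ((z + a) * (z + b)) = - (b * a) * (1 + z ^+ 2 + a * z).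
    by field; rewrite h1' h2'.
  rewrite ee; have -> : (z + a) * (z + b) = z ^+ 2 + b * z + a * z + b * a by ring.
  by rewrite ee; ring.
rewrite nrmM.
have b1 : nrm (- e%:C * (1 + z ^+ 2 + e%:C * z)) <= e * (1 + r + r ^+ 2).
  rewrite nrmM nrmN nrm_real gtr0_norm // ler_wpM2l ?(ltW e0) //.
  apply: le_trans (nrmD _ _) _; apply: le_trans (lerD (nrmD _ _) (lexx _)) _.
  rewrite nrm1 nrmX nrmM nrm_real gtr0_norm // nz addrAC -!addrA lerD2l lerD2r.
  by rewrite ler_piMl // ltW.
have b2 : nrm ((z - - e%:C)^-1 * (e^-1%:C * (z - - e^-1%:C)^-1)) <= (c ^+ 2 * r)^-1.
  have h := dampE; rewrite /damp nrmM nz ler_pM2l // in h; apply: le_trans h _.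
  have cr : 0 < c ^+ 2 * r by exact: mulr_gt0.
  rewrite lef_pV2 ?posrE // ler_wpM2l ?(ltW c2) //.
  have : 0 <= e * r * r by rewrite !mulr_ge0 // ltW.
  have : 0 <= e * r * e by rewrite !mulr_ge0 // ltW.
  by move: e0; lra.
apply: le_trans (ler_pM (nrm_ge0 _) (nrm_ge0 _) b1 b2) _.
by apply: le_of_eq; field; rewrite !gt_eqF.
Qed.

End Point.

End Regularisation.

(** * The uniform bound for functions in H^1 *)

Section BoundedCalculus.
Context (R : realType) (X : completeNormedModType R[i]) (d : nat).
Variables (A B : 'I_d -> set (X * X)) (U V : 'I_d -> R -> {linear X -> X}).
Hypothesis HW : weyl_pair A B U V.
Hypothesis hb : bounded_weyl_calculus_type0 U V.
Local Notation L0 := (oscillator0 A B).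
Local Notation L := (oscillator A B).
Local Notation leb := (@lebesgue_measure R).
Variable theta : R.
Hypothesis th0 : 0 < theta.
Hypothesis thp : theta < pi.
Let c := cos (theta / 2).

(** For damped functions [contour_eigen] and [mval_bound] give a bound on eigenvector sums that is
    uniform in the damping; dominated convergence, with the H^1 majorant, then removes the damping.
    K depends neither on nu nor on N. *)
Lemma contour_bound : exists2 K : R, 0 <= K & forall (phi : R[i] -> R[i]) (a N nu : R) f,
  0 <= a -> 0 < nu -> nu < theta ->
  (forall r s, 0 < r -> `|s| < theta -> hol phi (r%:C * expi s)) ->
  (forall r s, 0 < r -> `|s| < theta -> nrm (phi (r%:C * expi s)) <= a) ->
  (\int[leb]_r (hmaj nu phi r)%:E <= N%:E)%E ->
  Bint leb (on (@pos R) (contour_integrand L nu phi f)) /\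
  nrm (PI (contour_integrand L nu phi f)) <= K * a * nrm f.
Proof.
have t20 : 0 < theta / 2 by rewrite divr_gt0.
have t2p : theta / 2 < pi by move: th0 thp; lra.
(* The directions are those adapted to the angle theta/2, whatever nu is. *)
have [K K0 hK] := calculus_bound HW (kap_gt0 t20 t2p) hb.
have c20 : 0 <= (c ^+ 2)^-1 by rewrite invr_ge0 sqr_ge0.
have CA0 := CA_ge0 th0 thp.
exists (K * ((c ^+ 2)^-1 * CA theta)); first by rewrite !mulr_ge0.
move=> phi a N nu f a0 n0 nt hphi phiA hN; have np := lt_trans nt thp.
have [M M0 hM] := far_bound HW hb n0 np.
have rc (psi : R[i] -> R[i]) : (forall r s, 0 < r -> `|s| < theta -> hol psi (r%:C * expi s)) ->
    ray_cont psi nu /\ ray_cont psi (- nu).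
  move=> hpsi; have h t : `|t| < theta -> ray_cont psi t.
    move=> tt u x x0 ux; apply: (hol_cont (hpsi x t x0 tt)); apply: cvg_cplxM; last exact: cvg_cst.
    by apply: cvg_complex => //; exact: cvg_cst.
  by split; apply: h; rewrite ?normrN ger0_norm // ltW.
have [cp cm] := rc phi hphi.
have [bi _] := contour_int HW n0 np M0 hM cp cm hN f; split=> //.
apply: (contour_dense HW n0 np M0 hM cp cm hN); first by rewrite !mulr_ge0.
move=> n y hy; pose psi m z := phi z * damp (step R m) z.
have hpsi m r s : 0 < r -> `|s| < theta -> hol (psi m) (r%:C * expi s).
  by move=> r0 hs; apply: holM; [exact: hphi|exact: (hol_damp th0 thp (step_gt0 R m) r0 hs)].
have psiA m r s : 0 < r -> `|s| < theta -> nrm (psi m (r%:C * expi s)) <= a / c ^+ 2.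
  move=> r0 hs; rewrite nrmM; apply: ler_pM; rewrite ?nrm_ge0 //; first exact: phiA.
  exact: (damp_le th0 thp (step_gt0 R m) r0 hs).
have psiD m r s : 0 < r -> `|s| < theta -> nrm (psi m (r%:C * expi s)) / r <= a * (c ^+ 2 * step R m)^-1 * (1 + r ^+ 2)^-1.
  move=> r0 hs; rewrite nrmM -mulrA -[leRHS]mulrA; apply: ler_pM; rewrite ?nrm_ge0 //.
  - by rewrite divr_ge0 ?nrm_ge0 // ltW.
  - exact: phiA.
  exact: (damp_decay th0 thp (step_gt0 R m) r0 hs).
have D0 m : 0 <= a * (c ^+ 2 * step R m)^-1.
  by rewrite mulr_ge0 // invr_ge0 mulr_ge0 ?sqr_ge0 // ltW // step_gt0.
have ac0 : 0 <= a / c ^+ 2 by rewrite mulr_ge0.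
pose x := \sum_(k < n) y k.
have b m : nrm (PI (contour_integrand L nu (psi m) x)) <= K * ((c ^+ 2)^-1 * CA theta) * a * nrm x.
  rewrite (contour_eigen HW n0 np hM n nt thp (D0 m) (hpsi m) (psiD m) hy).
  (* The contour moves from nu to theta/2, where the constants no longer involve nu. *)
  have sh k : mval (psi m) k (- nu) - mval (psi m) k nu = mval (psi m) k (- (theta / 2)) - mval (psi m) k (theta / 2).
    have tt : theta / 2 < theta by move: th0; lra.
    by have [-> ->] := mval_shift thp (D0 m) (hpsi m) (psiD m) k n0 nt t20 tt.
  have gen (p q : nat -> R[i]) : (forall k, p k = q k) -> \sum_(k < n) p k *: y k = \sum_(k < n) q k *: y k.
    by move=> h; apply: eq_bigr => k _; rewrite h.
  rewrite (gen _ _ sh).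
  apply: le_trans (mval_bound th0 thp ac0 (D0 m) (hpsi m) (psiA m) (psiD m) hK n hy) _.
  by apply: le_of_eq; ring.
apply: (nrm_lim_le _ b).
have [bp bm] := (fun m => (rc (psi m) (hpsi m)).1, fun m => (rc (psi m) (hpsi m)).2).
have pcont_on (psi' : R[i] -> R[i]) : ray_cont psi' nu -> ray_cont psi' (- nu) ->
    bmeas (on (@pos R) (contour_integrand L nu psi' x)).
  by move=> h1 h2; apply: bmeas_pos; exact: (pcont_contour HW n0 np M0 hM).
have mh := measurable_hmaj cp cm.
have G0 : 0 <= M * nrm x * (c ^+ 2)^-1 by rewrite !mulr_ge0 ?nrm_ge0.
apply: (@BI_cvg R _ _ leb X (fun m => on (@pos R) (contour_integrand L nu (psi m) x)) _
  (fun r => M * nrm x * (c ^+ 2)^-1 * hmaj nu phi r)).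
- by move=> m; exact: (pcont_on (psi m) (bp m) (bm m)).
- exact: (pcont_on phi cp cm).
- move=> r; rewrite /on /pos; case: ifP => r0; last exact: cvg_cst.
  have hc t : `|t| < theta -> (psi m (r%:C * expi t) : cplx R) @[m --> \oo] --> (phi (r%:C * expi t) : cplx R).
    move=> tt; rewrite -[X in _ --> (X : cplx R)]mulr1; apply: cvg_cplxM; first exact: cvg_cst.
    apply: (@cvg_step R (cplx R) _ _ ((1 + r + r ^+ 2) / (c ^+ 2 * r))).
      by apply: divr_ge0; [rewrite !addr_ge0 ?sqr_ge0 // ltW|rewrite mulr_ge0 ?sqr_ge0 // ltW].
    by move=> m; exact: (damp_diff th0 thp (step_gt0 R m) r0 tt (step_le1 R m)).
  apply: cvgB; apply: cvgZ; rewrite ?[_ @ _]/(_ @ _); try exact: cvg_cst.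
    by apply: cvg_cplxM; [apply: hc; rewrite normrN ger0_norm // ltW|exact: cvg_cst].
  by apply: cvg_cplxM; [apply: hc; rewrite ger0_norm // ltW|exact: cvg_cst].
- by apply: measurable_funM.
- move=> m r; apply: le_trans (contour_le HW n0 np hM (psi m) x r) _.
  rewrite -[leRHS]mulrA ler_wpM2l ?mulr_ge0 ?nrm_ge0 // /hmaj; case: ifP => r0; last by rewrite mulr0.
  rewrite mulrA ler_wpM2r ?invr_ge0 ?(ltW r0) // mulrDr.
  by apply: lerD; rewrite nrmM mulrC ler_wpM2r ?nrm_ge0 //; apply: (damp_le th0 thp (step_gt0 R m) r0); rewrite ?normrN ger0_norm // ltW.
- by apply: le_lt_trans (int_hmaj cp cm hN G0) _; rewrite ltry.
Qed.

End BoundedCalculus.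

Theorem theorem8p1 (R : realType) (X : completeNormedModType R[i]) (d : nat)
    (A B : 'I_d -> set (X * X)) (U V : 'I_d -> R -> {linear X -> X}) :
  (0 < d)%N ->
  complex_Banach_lattice X ->
  UMD X ->
  weyl_pair A B U V ->
  bounded_weyl_calculus_type0 U V ->
  forall theta : R, 0 < theta -> theta < pi ->
    bounded_Hoo_calculus (oscillator A B) theta.
Proof.
move=> _ _ _ HW hb theta th0 thp.
have t2 : 0 < theta / 2 by rewrite divr_gt0.
have t2t : theta / 2 < theta by move: th0; lra.
have t2p := lt_trans t2t thp.
split; first by exists (theta / 2); exact: (oscillator_angle HW hb t2 t2p).
split; first exact: le_lt_trans (omega_le HW hb t2 t2p) t2t.
split=> //; have [K K0 hK] := contour_bound HW hb th0 thp.
exists ((2 * pi)^-1 * K) => phi [_ [M hM]] [hd [m hm]] nu nu1 nut f.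
have nu0 : 0 < nu by exact: le_lt_trans (omega_ge0 HW hb) nu1.
have sec r s : 0 < r -> `|s| < theta -> sector theta (r%:C * expi s) by move=> r0 hs; exists r, s.
have hphi r s : 0 < r -> `|s| < theta -> hol phi (r%:C * expi s).
  by move=> r0 hs; apply: derivable_hol; apply: hd; exact: sec.
have le z : sector theta z -> nrm (phi z) <= Hoo_norm theta phi.
  by move=> hz; apply: ub_le_sup; [exists m => _ [w hw <-]; exact: hm|exists z].
have a0 : 0 <= Hoo_norm theta phi.
  by apply: le_trans (le _ (sec 1 0 ltr01 _)); rewrite ?nrm_ge0 // normr0.
have pi2 : 0 < 2 * pi :> R by rewrite mulr_gt0 // pi_gt0.
(* The H^1 condition at the angle nu provides the integrability of the contour integrand. *)
have hN : (\int[lebesgue_measure]_r (hmaj nu phi r)%:E <= (2 * pi * M)%:E)%E.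
  have h := hM nu nu0 nut; rewrite EFinM -lee_pdivrMl //.
  rewrite -[X in (X * _)%E]/((2 * pi)^-1%:E); apply: le_trans h.
  rewrite lee_wpmul2l ?lee_fin ?invr_ge0 ?(ltW pi2) // [leRHS]integral_mkcond.
  apply: le_of_eq; apply: eq_integral => r _.
  rewrite patchE /hmaj; case: (ltP 0 r) => r0; first by rewrite mem_set.
  by rewrite memNset //= => h'; move: r0; rewrite leNgt h'.
have [bi bb] := hK phi (Hoo_norm theta phi) (2 * pi * M) nu f a0 nu0 nut hphi (fun r s r0 hs => le _ (sec r s r0 hs)) hN.
have eon : patch (fun=> 0) [set r : R | 0 < r] (contour_integrand (oscillator A B) nu phi f) =
    on (@pos R) (contour_integrand (oscillator A B) nu phi f).
  apply/funext => r; rewrite /patch /on /pos; case: (ltP 0 r) => r0; first by rewrite mem_set.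
  by rewrite memNset //= => h'; move: r0; rewrite leNgt h'.
split.
  by exists (PI (contour_integrand (oscillator A B) nu phi f)); rewrite eon; exact: BIP.
have -> : functional_calculus (oscillator A B) nu phi f =
    (2 * pi%:C * (0 +i* 1))^-1 *: PI (contour_integrand (oscillator A B) nu phi f).
  by rewrite /functional_calculus /bochner eon /PI /BI /bochner patch_setT.
rewrite nrmZ nrmV !nrmM nrm_i mulr1 nrm_nat nrm_real gtr0_norm ?pi_gt0 // -!mulrA ler_wpM2l ?invr_ge0 ?(ltW pi2) //.
by rewrite mulrA.
Qed.
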